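(* Let $\mathcal C$ be a stable $\infty$-category equipped with a semiorthogonal decomposition $(\mathcal A,\mathcal B)$, so that $\mathcal A$ is left admissible and $\mathcal B$ is right admissible. Let $i_{\mathcal A}:\mathcal A\hookrightarrow\mathcal C$ and $i_{\mathcal B}:\mathcal B\hookrightarrow\mathcal C$ be the embeddings. Then: (a) $(\mathcal A,\mathcal B)$ is Cartesian if and only if the subcategory $\mathcal A\subset\mathcal C$ is also right admissible. If these equivalent conditions hold, then the restriction to $\mathcal B$ of any right adjoint $i_{\mathcal A}^*:\mathcal C\to\mathcal A$ of $i_{\mathcal A}$ is a Cartesian gluing functor. (b) $(\mathcal A,\mathcal B)$ is coCartesian if and only if the subcategory $\mathcal B\subset\mathcal C$ is also left admissible. If these equivalent conditions hold, then the restriction to $\mathcal A$ of any left adjoint ${}^*i_{\mathcal B}:\mathcal C\to\mathcal B$ of $i_{\mathcal B}$ is a coCartesian gluing functor.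
   Context: A full subcategory of a stable $\infty$-category $\mathcal C$ is stable if it contains a zero object and is closed under fibers and cofibers. A full stable subcategory is left (resp. right) admissible if its embedding into $\mathcal C$ has a left (resp. right) adjoint. For full stable subcategories $\mathcal A,\mathcal B$, $\{\mathcal A,\mathcal B\}\subset\mathrm{Fun}(\Delta^1,\mathcal C)$ is the full subcategory of edges $a\to b$ with $a\in\mathcal A$, $b\in\mathcal B$. The ordered pair $(\mathcal A,\mathcal B)$ is a semiorthogonal decomposition (SOD) of $\mathcal C$ if the functor $\mathrm{Fib}:\{\mathcal A,\mathcal B\}\to\mathcal C$ sending a morphism to its fiber is an equivalence. $\chi(\mathcal A,\mathcal B)$ is the simplicial set whose $n$-simplices are pairs $(j,\sigma)$ with $j:[n]\to[1]$ an $n$-simplex of $\Delta^1$ and $\sigma:\Delta^n\to\mathcal C$ with $\sigma|\Delta^{j^{-1}(0)}\subset\mathcal A$, $\sigma|\Delta^{j^{-1}(1)}\subset\mathcal B$; $p:\chi(\mathcal A,\mathcal B)\to\Delta^1$ forgets $\sigma$. The SOD is Cartesian (resp. coCartesian) if $p$ is a Cartesian (resp. coCartesian) fibration. In the Cartesian case the functor $G:\mathcal B\to\mathcal A$ classified by $p$ (well defined up to a contractible choice) is called a Cartesian gluing functor; in the coCartesian case the functor $F:\mathcal A\to\mathcal B$ classified by $p$ is called a coCartesian gluing functor. *)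

(* Defs.v *)
(* Infinity-categories are quasi-categories.  Statements that come in dual
   pairs (limit/colimit, Cartesian/coCartesian, ...) are written once, with a
   vertex b : 'I_2 of Delta^1 as parameter: b = v0 is the "over" version
   (slices X_{/s}, limits, Cartesian edges) and b = v1 the "under" version
   (slices X_{s/}, colimits, coCartesian edges).  The opposite vertex is
   vop b. *)
From mathcomp Require Import all_boot.
From mathcomp Require Import boolp.

Set Implicit Arguments.
Unset Strict Implicit.
Unset Printing Implicit Defensive.

Lemma sig_ext (T : Type) (P : T -> Prop) (x y : {z : T | P z}) :
  sval x = sval y -> x = y.
Proof. by case: x y => [x xP] [y yP] /= E; exact: eq_exist. Qed.

Record mor (m n : nat) := Mor {
  mfun :> 'I_m.+1 -> 'I_n.+1;
  mor_mono : forall i j : 'I_m.+1, i <= j -> mfun i <= mfun j }.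

Lemma mor_ext m n (f g : mor m n) : (forall i, f i = g i) -> f = g.
Proof.
case: f g => [f fP] [g gP] /= /funext E; subst g.
by congr Mor; exact: Prop_irrelevance.
Qed.

Definition mor_id n : mor n n := @Mor n n id (fun _ _ => id).

Definition mor_comp l m n (g : mor m n) (f : mor l m) : mor l n :=
  @Mor l n (g \o f) (fun i j ij => mor_mono g (mor_mono f ij)).

Definition mor_cst m n (i : 'I_n.+1) : mor m n :=
  @Mor m n (fun=> i) (fun _ _ _ => leqnn i).

Lemma coface_mono n (i : 'I_n.+2) (j k : 'I_n.+1) :
  j <= k -> lift i j <= lift i k.
Proof. by move=> jk; rewrite /= leq_bump2. Qed.

Definition coface n (i : 'I_n.+2) : mor n n.+1 :=
  @Mor n n.+1 (lift i) (@coface_mono n i).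

Record sset := SSet {
  sk :> nat -> Type;
  act : forall m n, mor m n -> sk n -> sk m;
  act_id : forall n (x : sk n), act (mor_id n) x = x;
  act_comp : forall l m n (f : mor l m) (g : mor m n) (x : sk n),
    act f (act g x) = act (mor_comp g f) x }.

Definition vert (X : sset) n (x : X n) (i : 'I_n.+1) : X 0 :=
  act (mor_cst 0 i) x.
Definition degen (X : sset) n (x : X 0) : X n := act (mor_cst n ord0) x.
Definition face (X : sset) n (i : 'I_n.+2) (x : X n.+1) : X n :=
  act (coface i) x.

Record smap (X Y : sset) := SMap {
  sfun :> forall n, X n -> Y n;
  smap_nat : forall m n (f : mor m n) (x : X n),
    sfun (act f x) = act f (sfun x) }.

Lemma smap_ext (X Y : sset) (F G : smap X Y) :
  (forall n (x : X n), F n x = G n x) -> F = G.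
Proof.
case: F G => [F FP] [G GP] /= E.
have {}E : F = G by apply: functional_extensionality_dep => n; exact/funext/E.
by subst G; congr SMap; exact: Prop_irrelevance.
Qed.

Definition sid (X : sset) : smap X X :=
  @SMap X X (fun _ x => x) (fun _ _ _ _ => erefl).

Lemma scomp_nat (X Y Z : sset) (G : smap Y Z) (F : smap X Y) m n
  (f : mor m n) (x : X n) : G m (F m (act f x)) = act f (G n (F n x)).
Proof. by rewrite !smap_nat. Qed.

Definition scomp (X Y Z : sset) (G : smap Y Z) (F : smap X Y) : smap X Z :=
  @SMap X Z (fun n x => G n (F n x)) (@scomp_nat X Y Z G F).

Notation "G \os F" := (scomp G F) (at level 50, left associativity).

Lemma mor_compA k l m n (f : mor k l) (g : mor l m) (h : mor m n) :
  mor_comp (mor_comp h g) f = mor_comp h (mor_comp g f).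
Proof. exact: mor_ext. Qed.

Lemma mor_comp_id m n (g : mor m n) : mor_comp g (mor_id m) = g.
Proof. exact: mor_ext. Qed.

Definition Delta (n : nat) : sset :=
  @SSet (fun m => mor m n) (fun _ _ f g => mor_comp g f)
    (fun _ g => mor_comp_id g) (fun _ _ _ f g h => mor_compA f g h).

Definition yoneda (X : sset) n (x : X n) : smap (Delta n) X :=
  @SMap (Delta n) X (fun _ g => act g x)
    (fun _ _ f g => esym (act_comp f g x)).

Definition Delta_map m n (f : mor m n) : smap (Delta m) (Delta n) :=
  @yoneda (Delta n) m f.

Definition v0 : 'I_2 := ord0.
Definition v1 : 'I_2 := ord_max.
Definition vop (b : 'I_2) : 'I_2 := if val b is 0 then v1 else v0.

Definition pt : sset :=
  @SSet (fun=> unit) (fun _ _ _ x => x) (fun _ _ => erefl)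
    (fun _ _ _ _ _ _ => erefl).

Definition to_pt (X : sset) : smap X pt :=
  @SMap X pt (fun _ _ => tt) (fun _ _ _ _ => erefl).

Lemma to_Delta0_nat m n (f : mor m n) :
  mor_cst m (ord0 : 'I_1) = mor_comp (mor_cst n ord0) f.
Proof. exact: mor_ext. Qed.

Definition to_Delta0 (X : sset) : smap X (Delta 0) :=
  @SMap X (Delta 0) (fun n _ => mor_cst n ord0)
    (fun _ _ f _ => to_Delta0_nat f).

Definition point (X : sset) (x : X 0) n : smap (Delta n) X :=
  yoneda (degen n x).

Lemma prod_act_id (X Y : sset) n (z : X n * Y n) :
  (act (mor_id n) z.1, act (mor_id n) z.2) = z.
Proof. by case: z => x y; rewrite !act_id. Qed.

Lemma prod_act_comp (X Y : sset) l m n (f : mor l m) (g : mor m n)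
    (z : X n * Y n) :
  (act f (act g z.1), act f (act g z.2))
  = (act (mor_comp g f) z.1, act (mor_comp g f) z.2).
Proof. by rewrite !act_comp. Qed.

Definition sprod (X Y : sset) : sset :=
  @SSet (fun n => X n * Y n)%type
    (fun _ _ f z => (act f z.1, act f z.2))
    (@prod_act_id X Y) (@prod_act_comp X Y).

Definition sfst (X Y : sset) : smap (sprod X Y) X :=
  @SMap (sprod X Y) X (fun _ z => z.1) (fun _ _ _ _ => erefl).
Definition ssnd (X Y : sset) : smap (sprod X Y) Y :=
  @SMap (sprod X Y) Y (fun _ z => z.2) (fun _ _ _ _ => erefl).

Lemma spair_nat (X Y Z : sset) (F : smap Z X) (G : smap Z Y) m n
    (f : mor m n) (z : Z n) :
  (F m (act f z), G m (act f z)) = @act (sprod X Y) m n f (F n z, G n z).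
Proof. by rewrite !smap_nat. Qed.

Definition spair (X Y Z : sset) (F : smap Z X) (G : smap Z Y) :
    smap Z (sprod X Y) :=
  @SMap Z (sprod X Y) (fun n z => (F n z, G n z)) (@spair_nat X Y Z F G).

Definition sprod_map (X X' Y Y' : sset) (F : smap X X') (G : smap Y Y') :
    smap (sprod X Y) (sprod X' Y') :=
  spair (F \os sfst X Y) (G \os ssnd X Y).

Record ssub (X : sset) := SSub {
  smem : forall n, X n -> Prop;
  smem_act : forall m n (f : mor m n) (x : X n), smem x -> smem (act f x) }.

Section SubObject.
Variables (X : sset) (U : ssub X).

Definition sub_act m n (f : mor m n) (x : {x : X n | smem U x}) :
    {x : X m | smem U x} :=
  exist _ (act f (sval x)) (smem_act f (svalP x)).

Lemma sub_act_id n (x : {x : X n | smem U x}) : sub_act (mor_id n) x = x.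
Proof. by apply: sig_ext; exact: act_id. Qed.

Lemma sub_act_comp l m n (f : mor l m) (g : mor m n)
    (x : {x : X n | smem U x}) :
  sub_act f (sub_act g x) = sub_act (mor_comp g f) x.
Proof. by apply: sig_ext; exact: act_comp. Qed.

Definition sub_sset : sset :=
  @SSet (fun n => {x : X n | smem U x}) sub_act sub_act_id sub_act_comp.

Definition incl : smap sub_sset X :=
  @SMap sub_sset X (fun _ x => sval x) (fun _ _ _ _ => erefl).

End SubObject.
Coercion sub_sset : ssub >-> sset.

Section SubMap.
Variables (X Y : sset) (U : ssub Y) (F : smap X Y).
Hypothesis FU : forall n (x : X n), smem U (F n x).

Lemma sub_corestr_nat m n (f : mor m n) (x : X n) :
  exist (@smem Y U m) (F m (act f x)) (FU (act f x))
  = sub_act f (exist (@smem Y U n) (F n x) (FU x)).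
Proof. by apply: sig_ext; exact: smap_nat. Qed.

Definition sub_corestr : smap X U :=
  @SMap X U (fun _ x => exist _ (F _ x) (FU x)) sub_corestr_nat.

End SubMap.

(** [full P]: the simplices all of whose vertices satisfy P. *)
Lemma full_act (X : sset) (P : X 0 -> Prop) m n (f : mor m n) (x : X n) :
  (forall i, P (vert x i)) -> forall i, P (vert (act f x) i).
Proof.
move=> xP i; rewrite /vert act_comp.
suff -> : mor_comp f (mor_cst 0 i) = mor_cst 0 (f i) by exact: xP.
exact: mor_ext.
Qed.

Definition full (X : sset) (P : X 0 -> Prop) : ssub X :=
  @SSub X (fun n x => forall i, P (vert x i)) (@full_act X P).

Lemma boundary_act n l m (f : mor l m) (g : Delta n m) :
  (exists i, forall k, g k <> i) -> exists i, forall k, mor_comp g f k <> i.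
Proof. by case=> i gi; exists i => k; exact: gi. Qed.

Definition boundary n : ssub (Delta n) :=
  @SSub (Delta n) (fun m g => exists i, forall k, mfun g k <> i)
    (@boundary_act n).

Lemma horn_act n (j : 'I_n.+1) l m (f : mor l m) (g : Delta n m) :
  (exists i, i <> j /\ forall k, g k <> i) ->
  exists i, i <> j /\ forall k, mor_comp g f k <> i.
Proof. by case=> i [ij gi]; exists i; split=> // k; exact: gi. Qed.

Definition horn n (j : 'I_n.+1) : ssub (Delta n) :=
  @SSub (Delta n) (fun m g => exists i, i <> j /\ forall k, mfun g k <> i)
    (@horn_act n j).

Lemma fiber_act (X : sset) (p : smap X (Delta 1)) (i : 'I_2) m n
    (f : mor m n) (x : X n) :
  p n x = mor_cst n i -> p m (act f x) = mor_cst m i.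
Proof. by move=> px; rewrite smap_nat px; exact: mor_ext. Qed.

Definition fiber (X : sset) (p : smap X (Delta 1)) (i : 'I_2) : ssub X :=
  @SSub X (fun n x => p n x = mor_cst n i) (@fiber_act X p i).

Definition rlp (K : sset) (U : ssub K) (X S : sset) (p : smap X S) : Prop :=
  forall (u : smap U X) (v : smap K S), p \os u = v \os incl U ->
  exists w : smap K X, w \os incl U = u /\ p \os w = v.

Definition trivial_fibration (X S : sset) (p : smap X S) : Prop :=
  forall n, rlp (boundary n) p.

Definition inner_fibration (X S : sset) (p : smap X S) : Prop :=
  forall n (i : 'I_n.+1), 0 < i < n -> rlp (horn i) p.

Definition infty_category (C : sset) : Prop := inner_fibration (to_pt C).

Section Fun.
Variables K Y : sset.

Definition fun_act m n (f : mor m n) (F : smap (sprod K (Delta n)) Y) :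
    smap (sprod K (Delta m)) Y :=
  F \os sprod_map (sid K) (Delta_map f).

Lemma fun_act_id n (F : smap (sprod K (Delta n)) Y) : fun_act (mor_id n) F = F.
Proof.
apply: smap_ext => m [x g]; rewrite /=.
by congr (F _ (_, _)); exact: mor_ext.
Qed.

Lemma fun_act_comp l m n (f : mor l m) (g : mor m n)
    (F : smap (sprod K (Delta n)) Y) :
  fun_act f (fun_act g F) = fun_act (mor_comp g f) F.
Proof.
apply: smap_ext => k [x h]; rewrite /=.
by congr (F _ (_, _)); exact: mor_ext.
Qed.

Definition Fun : sset :=
  @SSet (fun n => smap (sprod K (Delta n)) Y) fun_act fun_act_id fun_act_comp.

Definition fun_vertex (F : smap K Y) : Fun 0 := F \os sfst K (Delta 0).

Definition vertex_fun (F : Fun 0) : smap K Y :=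
  F \os spair (sid K) (to_Delta0 K).

Lemma fun_ev_nat (v : K 0) m n (f : mor m n) (F : Fun n) :
  (act f F : smap (sprod K (Delta m)) Y) m (degen m v, mor_id m)
  = act f ((F : smap (sprod K (Delta n)) Y) n (degen n v, mor_id n)).
Proof.
rewrite -smap_nat /=; congr (F _ (_, _)).
by rewrite /degen act_comp; congr act; exact: mor_ext.
Qed.

Definition fun_ev (v : K 0) : smap Fun Y :=
  @SMap Fun Y
    (fun n (F : smap (sprod K (Delta n)) Y) => F n (degen n v, mor_id n))
    (@fun_ev_nat v).

End Fun.

Lemma fun_restr_nat (K L Y : sset) (i : smap L K) m n (f : mor m n)
    (F : Fun K Y n) :
  (act f F : smap _ Y) \os sprod_map i (sid (Delta m))
  = act f ((F : smap _ Y) \os sprod_map i (sid (Delta n)) : Fun L Y n).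
Proof. exact: smap_ext. Qed.

Definition fun_restr (K L Y : sset) (i : smap L K) :
    smap (Fun K Y) (Fun L Y) :=
  @SMap (Fun K Y) (Fun L Y)
    (fun n (F : smap (sprod K (Delta n)) Y) =>
       F \os sprod_map i (sid (Delta n)))
    (@fun_restr_nat K L Y i).

Definition src (X : sset) (e : X 1) : X 0 := vert e v0.
Definition tgt (X : sset) (e : X 1) : X 0 := vert e v1.

(** [edge_comp f g h]: the edge h is a composite of f followed by g. *)
Definition edge_comp (X : sset) (f g h : X 1) : Prop :=
  exists s : X 2, [/\ face (inord 2) s = f, face (inord 0) s = g
                    & face (inord 1) s = h].

Definition edge_equiv (X : sset) (e : X 1) : Prop :=
  exists g : X 1, edge_comp e g (degen 1 (src e))
               /\ edge_comp g e (degen 1 (tgt e)).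

Definition functor_equiv (X Y : sset) (F G : smap X Y) : Prop :=
  exists e : Fun X Y 1,
    [/\ edge_equiv e, src e = fun_vertex F & tgt e = fun_vertex G].

(** Equivalence of quasi-categories: invertibility up to natural
    equivalence. *)
Definition cat_equiv (X Y : sset) (F : smap X Y) : Prop :=
  exists G : smap Y X,
    functor_equiv (G \os F) (sid X) /\ functor_equiv (F \os G) (sid Y).

Section FiberMap.
Variables (m n : nat) (f : mor m n) (j : Delta 1 n) (i : 'I_2).

Lemma fiber_map_mem k (a : fiber (yoneda (act f j)) i k) :
  smem (fiber (yoneda j) i) (mor_comp f (sval a)).
Proof. by apply: etrans (svalP a); exact: mor_ext. Qed.

Definition fiber_map :
    smap (fiber (yoneda (act f j)) i) (fiber (yoneda j) i) :=
  @sub_corestr _ _ (fiber (yoneda j) i)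
    (Delta_map f \os incl (fiber (yoneda (act f j)) i)) fiber_map_mem.

End FiberMap.

(** [ojoin v0 X Y] is the join X * Y and [ojoin v1 X Y] is Y * X.  An
    n-simplex is a map j : Delta^n -> Delta^1, a simplex of X on the part of
    Delta^n over b and a simplex of Y on the part over the other vertex; as
    these parts may be empty, the simplices are given as maps. *)
Record join_simplex (b : 'I_2) (X Y : sset) (n : nat) := JoinSimplex {
  jlab : Delta 1 n;
  jfst : smap (fiber (yoneda jlab) b) X;
  jsnd : smap (fiber (yoneda jlab) (vop b)) Y }.

Section Join.
Variable b : 'I_2.

Lemma join_ext X Y n (s t : join_simplex b X Y n) :
  jlab s = jlab t ->
  (forall k a P Q, jfst s k (exist _ a P) = jfst t k (exist _ a Q)) ->
  (forall k a P Q, jsnd s k (exist _ a P) = jsnd t k (exist _ a Q)) ->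
  s = t.
Proof.
case: s t => [j x y] [j' x' y'] /= E; subst j' => Ex Ey.
by congr JoinSimplex; apply: smap_ext => k [a P]; [exact: Ex|exact: Ey].
Qed.

Definition join_act X Y m n (f : mor m n) (s : join_simplex b X Y n) :
    join_simplex b X Y m :=
  @JoinSimplex b X Y m (act f (jlab s))
    (jfst s \os fiber_map f (jlab s) b)
    (jsnd s \os fiber_map f (jlab s) (vop b)).

Lemma join_act_id X Y n (s : join_simplex b X Y n) :
  join_act (mor_id n) s = s.
Proof.
apply: join_ext => [|k a P Q|k a P Q] /=; first exact: mor_ext.
- by congr (jfst s _); apply: sig_ext; exact: mor_ext.
- by congr (jsnd s _); apply: sig_ext; exact: mor_ext.
Qed.

Lemma join_act_comp X Y l m n (f : mor l m) (g : mor m n)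
    (s : join_simplex b X Y n) :
  join_act f (join_act g s) = join_act (mor_comp g f) s.
Proof.
apply: join_ext => [|k a P Q|k a P Q] /=; first exact: mor_ext.
- by congr (jfst s _); apply: sig_ext; exact: mor_ext.
- by congr (jsnd s _); apply: sig_ext; exact: mor_ext.
Qed.

Definition ojoin (X Y : sset) : sset :=
  @SSet (join_simplex b X Y) (@join_act X Y) (@join_act_id X Y)
    (@join_act_comp X Y).

Lemma ojoin_map_nat X X' Y Y' (F : smap X X') (G : smap Y Y') m n
    (f : mor m n) (s : ojoin X Y n) :
  @JoinSimplex b X' Y' m (jlab (act f s)) (F \os jfst (act f s))
    (G \os jsnd (act f s))
  = join_act f (@JoinSimplex b X' Y' n (jlab s) (F \os jfst s)
                  (G \os jsnd s)).
Proof. by congr JoinSimplex; exact: smap_ext. Qed.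

Definition ojoin_map X X' Y Y' (F : smap X X') (G : smap Y Y') :
    smap (ojoin X Y) (ojoin X' Y') :=
  @SMap (ojoin X Y) (ojoin X' Y')
    (fun n s => @JoinSimplex b X' Y' n (jlab s) (F \os jfst s) (G \os jsnd s))
    (@ojoin_map_nat X X' Y Y' F G).

Lemma fiber_cst_empty n k :
  fiber (@yoneda (Delta 1) n (mor_cst n (vop b))) b k -> False.
Proof.
case=> a /(congr1 (fun g : mor k 1 => val (g ord0))) /= E.
by move: E; case: b => [[|[|//]] ?].
Qed.

Definition from_fiber_cst (X : sset) n :
    smap (fiber (@yoneda (Delta 1) n (mor_cst n (vop b))) b) X :=
  SMap (sfun := fun k a => False_rect (X k) (fiber_cst_empty a))
    (fun m k f a => False_ind _ (fiber_cst_empty a)).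

Lemma ojoin_in_nat (X Y : sset) m n (f : mor m n) (y : Y n) :
  @JoinSimplex b X Y m (mor_cst m (vop b)) (from_fiber_cst X m)
    (yoneda (act f y) \os incl _)
  = join_act f (@JoinSimplex b X Y n (mor_cst n (vop b))
      (from_fiber_cst X n) (yoneda y \os incl _)).
Proof.
apply: join_ext => [|k a P Q|k a P Q] /=; first exact: mor_ext.
- by case: (fiber_cst_empty (exist _ a P)).
- exact: act_comp.
Qed.

Definition ojoin_in (X Y : sset) : smap Y (ojoin X Y) :=
  @SMap Y (ojoin X Y)
    (fun n y => @JoinSimplex b X Y n (mor_cst n (vop b))
       (from_fiber_cst X n) (yoneda y \os incl _))
    (@ojoin_in_nat X Y).

Lemma ojoin_map_id X Y (s : smap X X) (t : smap Y Y) :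
  s = sid X -> t = sid Y -> ojoin_map s t = sid (ojoin X Y).
Proof.
move=> -> ->; apply: smap_ext => n z; apply: join_ext => //= k a P Q.
- by congr (jfst z _); exact: sig_ext.
- by congr (jsnd z _); exact: sig_ext.
Qed.

Lemma ojoin_map_comp X X' X'' Y Y' Y'' (F : smap X X') (F' : smap X' X'')
    (G : smap Y Y') (G' : smap Y' Y'') :
  ojoin_map F' G' \os ojoin_map F G = ojoin_map (F' \os F) (G' \os G).
Proof.
by apply: smap_ext => n z; congr JoinSimplex; exact: smap_ext.
Qed.

Lemma ojoin_map_in X X' Y Y' (F : smap X X') (G : smap Y Y') :
  ojoin_map F G \os ojoin_in X Y = ojoin_in X' Y' \os G.
Proof.
apply: smap_ext => n y; apply: join_ext => //= k a P Q.
- by case: (fiber_cst_empty (exist _ a P)).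
- by rewrite smap_nat.
Qed.

End Join.

Lemma scompA (W X Y Z : sset) (H : smap Y Z) (G : smap X Y) (F : smap W X) :
  (H \os G) \os F = H \os (G \os F).
Proof. exact: smap_ext. Qed.

Lemma scomp1s (X Y : sset) (F : smap X Y) : sid Y \os F = F.
Proof. exact: smap_ext. Qed.

Lemma scomps1 (X Y : sset) (F : smap X Y) : F \os sid X = F.
Proof. exact: smap_ext. Qed.

Lemma Delta_map_id n : Delta_map (mor_id n) = sid (Delta n).
Proof. by apply: smap_ext => m g; exact: mor_ext. Qed.

Lemma Delta_map_comp l m n (f : mor l m) (g : mor m n) :
  Delta_map g \os Delta_map f = Delta_map (mor_comp g f).
Proof. by apply: smap_ext => k h; exact: mor_ext. Qed.

Definition cone_act (b : 'I_2) (K : sset) m n (f : mor m n) :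
    smap (ojoin b (Delta m) K) (ojoin b (Delta n) K) :=
  ojoin_map b (Delta_map f) (sid K).

Lemma cone_act_id b K n : cone_act b K (mor_id n) = sid _.
Proof. exact: ojoin_map_id (Delta_map_id n) erefl. Qed.

Lemma cone_act_comp b K l m n (f : mor l m) (g : mor m n) :
  cone_act b K g \os cone_act b K f = cone_act b K (mor_comp g f).
Proof. by rewrite /cone_act ojoin_map_comp Delta_map_comp scomp1s. Qed.

Lemma cone_act_in b K m n (f : mor m n) :
  cone_act b K f \os ojoin_in b (Delta m) K = ojoin_in b (Delta n) K.
Proof. by rewrite /cone_act ojoin_map_in scomps1. Qed.

(** [slice v0 s] is X_{/s}, [slice v1 s] is X_{s/}. *)
Section Slice.
Variables (b : 'I_2) (K X : sset) (s : smap K X).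

Definition slice_simplex n :=
  {F : smap (ojoin b (Delta n) K) X | F \os ojoin_in b (Delta n) K = s}.

Lemma slice_act_subproof m n (f : mor m n) (F : slice_simplex n) :
  (sval F \os cone_act b K f) \os ojoin_in b (Delta m) K = s.
Proof. by rewrite scompA cone_act_in; exact: (svalP F). Qed.

Definition slice_act m n (f : mor m n) (F : slice_simplex n) :
    slice_simplex m := exist _ _ (slice_act_subproof f F).

Lemma slice_act_id n (F : slice_simplex n) : slice_act (mor_id n) F = F.
Proof. by apply: sig_ext; rewrite /= cone_act_id scomps1. Qed.

Lemma slice_act_comp l m n (f : mor l m) (g : mor m n) (F : slice_simplex n) :
  slice_act f (slice_act g F) = slice_act (mor_comp g f) F.
Proof. by apply: sig_ext; rewrite /= scompA cone_act_comp. Qed.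

Definition slice : sset :=
  @SSet slice_simplex slice_act slice_act_id slice_act_comp.

End Slice.

(** For p : X -> S, s : K -> X and L a simplicial subset of K:
    X_{/s|L} x_{S_{/p s|L}} S_{/p s} if b = v0, dually if b = v1.
    The equation in S expresses that both components have the same image in
    the slice over p s|L. *)
Section RelativeSlice.
Variables (b : 'I_2) (X S K : sset) (p : smap X S) (s : smap K X).
Variable L : ssub K.

Definition rel_slice_simplex n :=
  {FG : slice b (s \os incl L) n * slice b (p \os s) n |
    p \os sval FG.1 = sval FG.2 \os ojoin_map b (sid (Delta n)) (incl L)}.

Lemma rel_slice_act_subproof m n (f : mor m n) (FG : rel_slice_simplex n) :
  p \os sval (act f (sval FG).1)
  = sval (act f (sval FG).2) \os ojoin_map b (sid (Delta m)) (incl L).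
Proof.
rewrite /= -scompA (svalP FG) !scompA; congr scomp.
by rewrite !ojoin_map_comp !scomp1s !scomps1.
Qed.

Definition rel_slice_act m n (f : mor m n) (FG : rel_slice_simplex n) :
    rel_slice_simplex m :=
  exist _ (act f (sval FG).1, act f (sval FG).2)
    (rel_slice_act_subproof f FG).

Lemma rel_slice_act_id n (FG : rel_slice_simplex n) :
  rel_slice_act (mor_id n) FG = FG.
Proof. by apply: sig_ext; exact: prod_act_id. Qed.

Lemma rel_slice_act_comp k m n (f : mor k m) (g : mor m n)
    (FG : rel_slice_simplex n) :
  rel_slice_act f (rel_slice_act g FG) = rel_slice_act (mor_comp g f) FG.
Proof. by apply: sig_ext; exact: prod_act_comp. Qed.

Definition rel_slice : sset :=
  @SSet rel_slice_simplex rel_slice_act rel_slice_act_id rel_slice_act_comp.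

Definition cone_incl n :
    smap (ojoin b (Delta n) L) (ojoin b (Delta n) K) :=
  ojoin_map b (sid (Delta n)) (incl L).

Lemma slice_restr_subproof n (F : slice b s n) :
  (sval F \os cone_incl n) \os ojoin_in b (Delta n) L = s \os incl L.
Proof. by rewrite scompA ojoin_map_in -scompA (svalP F). Qed.

Lemma slice_push_subproof n (F : slice b s n) :
  (p \os sval F) \os ojoin_in b (Delta n) K = p \os s.
Proof. by rewrite scompA (svalP F). Qed.

Definition slice_cmp_fun n (F : slice b s n) : rel_slice n :=
  exist _ (exist _ _ (slice_restr_subproof F),
           exist _ _ (slice_push_subproof F))
    (esym (scompA p (sval F) (cone_incl n))).

Lemma slice_cmp_nat m n (f : mor m n) (F : slice b s n) :
  slice_cmp_fun (act f F) = act f (slice_cmp_fun F).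
Proof.
apply: sig_ext; congr pair; apply: sig_ext => /=; last by rewrite scompA.
by rewrite !scompA !ojoin_map_comp !scomp1s !scomps1.
Qed.

Definition slice_cmp : smap (slice b s) rel_slice :=
  @SMap (slice b s) rel_slice slice_cmp_fun slice_cmp_nat.

(** Used when K is the cone on L on the side b: s is then a p-limit cone
    (b = v0) or a p-colimit cone (b = v1) on its restriction to L.  For b = v0,
    X_{/s} -> X_{/s|L} x_{S_{/p s|L}} S_{/p s} is required to be a trivial
    fibration. *)
Definition relative_limit : Prop := trivial_fibration slice_cmp.

End RelativeSlice.

(** The absolute case S = pt: X_{/s} -> X_{/s|L} is a trivial fibration. *)
Definition limit_cone (b : 'I_2) (X K : sset) (L : ssub K) (s : smap K X) :=
  relative_limit b (to_pt X) s L.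

Definition endpoint (i : 'I_2) : ssub (Delta 1) :=
  full (fun x : Delta 1 0 => x = mor_cst 0 i).

(** For e : x -> y and b = v0 this is the trivial fibration
    X_{/e} -> X_{/y} x_{S_{/p y}} S_{/p e} defining p-Cartesian edges. *)
Definition ocartesian_edge (b : 'I_2) (X S : sset) (p : smap X S) (e : X 1) :=
  relative_limit b p (yoneda e) (endpoint (vop b)).

Definition ocartesian_fibration (b : 'I_2) (X S : sset) (p : smap X S) :=
  inner_fibration p /\
  forall (e : S 1) (y : X 0), p 0 y = vert e (vop b) ->
  exists e' : X 1,
    [/\ ocartesian_edge b p e', p 1 e' = e & vert e' (vop b) = y].

Definition cartesian_fibration := ocartesian_fibration v0.
Definition cocartesian_fibration := ocartesian_fibration v1.

(** For q : M -> Delta^1 with identifications [hb], [hc] of X and Y with the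
    fibers over b and over the other vertex, g : Y -> X is the functor
    associated to q: contravariantly for b = v0, with q Cartesian, and
    covariantly for b = v1, with q coCartesian. *)
Definition oassociated (b : 'I_2) (M X Y : sset) (q : smap M (Delta 1))
    (hb : smap X (fiber q b)) (hc : smap Y (fiber q (vop b)))
    (g : smap Y X) : Prop :=
  exists s : smap (sprod Y (Delta 1)) M,
  [/\ q \os s = ssnd Y (Delta 1),
      (forall n (y : Y n), s n (y, mor_cst n (vop b)) = incl _ n (hc n y)),
      (forall n (y : Y n), s n (y, mor_cst n b) = incl _ n (hb n (g n y)))
    & forall y : Y 0, ocartesian_edge b q (s 1 (degen 1 y, mor_id 1))].

(** [associated_contra q h0 h1 g] for q Cartesian, [associated_co q h0 h1 f]
    for q coCartesian. *)
Definition associated_contra (M X Y : sset) (q : smap M (Delta 1))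
    (h0 : smap X (fiber q v0)) (h1 : smap Y (fiber q v1)) (g : smap Y X) :=
  oassociated (b := v0) h0 h1 g.

Definition associated_co (M X Y : sset) (q : smap M (Delta 1))
    (h0 : smap X (fiber q v0)) (h1 : smap Y (fiber q v1)) (f : smap X Y) :=
  oassociated (b := v1) h1 h0 f.

(** f is left adjoint to g: both are associated to one map M -> Delta^1 that is
    a Cartesian and a coCartesian fibration. *)
Definition adjoint (X Y : sset) (f : smap X Y) (g : smap Y X) : Prop :=
  exists (M : sset) (q : smap M (Delta 1))
         (h0 : smap X (fiber q v0)) (h1 : smap Y (fiber q v1)),
    [/\ cartesian_fibration q, cocartesian_fibration q,
        cat_equiv h0 & cat_equiv h1] /\
    associated_co h0 h1 f /\ associated_contra h0 h1 g.

Lemma empty_act (X : sset) m n (f : mor m n) (x : X n) : False -> False.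
Proof. by []. Qed.

Definition empty (X : sset) : ssub X :=
  @SSub X (fun _ _ => False) (@empty_act X).

(** x is final if C_{/x} -> C is a trivial fibration, C being the slice over
    the empty diagram. *)
Definition final_object (C : sset) (x : C 0) : Prop :=
  limit_cone v0 (empty (Delta 0)) (yoneda x).

Definition initial_object (C : sset) (x : C 0) : Prop :=
  limit_cone v1 (empty (Delta 0)) (yoneda x).

Definition zero_object (C : sset) (x : C 0) : Prop :=
  initial_object x /\ final_object x.

(** A square s : Delta^1 x Delta^1 -> C is pictured as

      s00 --> s01
       |       |
       v       v
      s10 --> s11                                                          *)
Definition Sq : sset := sprod (Delta 1) (Delta 1).

Definition corner (i j : 'I_2) : Sq 0 := (mor_cst 0 i, mor_cst 0 j).

Definition top_edge : smap (Delta 1) Sq :=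
  spair (point (mor_cst 0 v0 : Delta 1 0) 1) (sid (Delta 1)).

Definition right_edge : smap (Delta 1) Sq :=
  spair (sid (Delta 1)) (point (mor_cst 0 v1 : Delta 1 0) 1).

(** Delta^1 x Delta^1 is the cone on the cospan (resp. span) obtained by
    omitting the corner s00 (resp. s11). *)
Definition pullback_square (C : sset) (s : smap Sq C) : Prop :=
  limit_cone v0 (full (fun x : Sq 0 => x <> corner v0 v0)) s.

Definition pushout_square (C : sset) (s : smap Sq C) : Prop :=
  limit_cone v1 (full (fun x : Sq 0 => x <> corner v1 v1)) s.

Definition triangle (C : sset) (s : smap Sq C) : Prop :=
  zero_object (s 0 (corner v1 v0)).

Definition fiber_sequence (C : sset) (s : smap Sq C) : Prop :=
  triangle s /\ pullback_square s.

Definition cofiber_sequence (C : sset) (s : smap Sq C) : Prop :=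
  triangle s /\ pushout_square s.

Definition stable (C : sset) : Prop :=
  [/\ infty_category C,
      exists z : C 0, zero_object z,
      forall e : C 1,
        (exists s : smap Sq C,
           fiber_sequence s /\ s \os right_edge = yoneda e) /\
        (exists s : smap Sq C,
           cofiber_sequence s /\ s \os top_edge = yoneda e)
    & forall s : smap Sq C, triangle s ->
        (fiber_sequence s <-> cofiber_sequence s)].

(** Full subcategories are given by a predicate on objects.  Closure under
    fibers refers to all fibers, which are only determined up to
    equivalence. *)
Definition stable_subcategory (C : sset) (A : C 0 -> Prop) : Prop :=
  [/\ exists2 z : C 0, zero_object z & A z,
      forall s : smap Sq C, fiber_sequence s ->
        A (s 0 (corner v0 v1)) -> A (s 0 (corner v1 v1)) ->
        A (s 0 (corner v0 v0))
    & forall s : smap Sq C, cofiber_sequence s ->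
        A (s 0 (corner v0 v0)) -> A (s 0 (corner v0 v1)) ->
        A (s 0 (corner v1 v1))].

Definition emb (C : sset) (A : C 0 -> Prop) : smap (full A) C :=
  incl (full A).

Definition left_admissible (C : sset) (A : C 0 -> Prop) : Prop :=
  exists l : smap C (full A), adjoint l (emb A).

Definition right_admissible (C : sset) (A : C 0 -> Prop) : Prop :=
  exists r : smap C (full A), adjoint (emb A) r.

Section SOD.
Variables (C : sset) (A B : C 0 -> Prop).

Definition arrows : ssub (Fun (Delta 1) C) :=
  full (fun e : Fun (Delta 1) C 0 =>
    A (fun_ev C (mor_cst 0 v0 : Delta 1 0) 0 e) /\
    B (fun_ev C (mor_cst 0 v1 : Delta 1 0) 0 e)).

(** Phi sends an arrow to its fiber, functorially: it is the upper left corner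
    of a functor Psi to fiber sequences whose right edge is the given arrow. *)
Definition fiber_functor (Phi : smap arrows C) : Prop :=
  exists Psi : smap arrows (Fun Sq C),
    [/\ forall e : arrows 0, fiber_sequence (vertex_fun (Psi 0 e)),
        fun_restr C right_edge \os Psi = incl arrows
      & fun_ev C (corner v0 v0) \os Psi = Phi].

Definition SOD : Prop :=
  exists2 Phi : smap arrows C, fiber_functor Phi & cat_equiv Phi.

(** js = (j, sigma); a ranges over the faces of Delta^n that j sends to 0,
    resp. to 1. *)
Definition chi_simplex n :=
  {js : Delta 1 n * C n |
    (forall k (a : fiber (yoneda js.1) v0 k),
       smem (full A) (act (sval a : mor k n) js.2)) /\
    (forall k (a : fiber (yoneda js.1) v1 k),
       smem (full B) (act (sval a : mor k n) js.2))}.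

Lemma chi_act_subproof m n (f : mor m n) (x : chi_simplex n) :
  (forall k (a : fiber (yoneda (act f (sval x).1)) v0 k),
     smem (full A) (act (sval a : mor k m) (act f (sval x).2))) /\
  (forall k (a : fiber (yoneda (act f (sval x).1)) v1 k),
     smem (full B) (act (sval a : mor k m) (act f (sval x).2))).
Proof.
case: x => -[j s] /= [xA xB]; split=> k a; rewrite act_comp.
- exact: (xA k (fiber_map f j v0 k a)).
- exact: (xB k (fiber_map f j v1 k a)).
Qed.

Definition chi_act m n (f : mor m n) (x : chi_simplex n) : chi_simplex m :=
  exist _ (act f (sval x).1, act f (sval x).2) (chi_act_subproof f x).

Lemma chi_act_id n (x : chi_simplex n) : chi_act (mor_id n) x = x.
Proof. by apply: sig_ext; exact: prod_act_id. Qed.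

Lemma chi_act_comp l m n (f : mor l m) (g : mor m n) (x : chi_simplex n) :
  chi_act f (chi_act g x) = chi_act (mor_comp g f) x.
Proof. by apply: sig_ext; exact: prod_act_comp. Qed.

Definition chi : sset := @SSet chi_simplex chi_act chi_act_id chi_act_comp.

Definition chi_proj : smap chi (Delta 1) :=
  @SMap chi (Delta 1) (fun _ x => (sval x).1) (fun _ _ _ _ => erefl).

Definition cartesian_SOD : Prop := SOD /\ cartesian_fibration chi_proj.
Definition cocartesian_SOD : Prop := SOD /\ cocartesian_fibration chi_proj.

Lemma chi_in0_subproof n (x : full A n) :
  (forall k (a : fiber (@yoneda (Delta 1) n (mor_cst n v0)) v0 k),
     smem (full A) (act (sval a : mor k n) (sval x))) /\
  (forall k (a : fiber (@yoneda (Delta 1) n (mor_cst n v0)) v1 k),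
     smem (full B) (act (sval a : mor k n) (sval x))).
Proof.
split=> k a; first exact/smem_act/svalP.
by case: (@fiber_cst_empty v1 n k a).
Qed.

Lemma chi_in1_subproof n (x : full B n) :
  (forall k (a : fiber (@yoneda (Delta 1) n (mor_cst n v1)) v0 k),
     smem (full A) (act (sval a : mor k n) (sval x))) /\
  (forall k (a : fiber (@yoneda (Delta 1) n (mor_cst n v1)) v1 k),
     smem (full B) (act (sval a : mor k n) (sval x))).
Proof.
split=> k a; last exact/smem_act/svalP.
by case: (@fiber_cst_empty v0 n k a).
Qed.

Lemma chi_in0_nat m n (f : mor m n) (x : full A n) :
  exist _ (mor_cst m v0 : Delta 1 m, sval (act f x))
    (chi_in0_subproof (act f x))
  = chi_act f (exist _ (mor_cst n v0 : Delta 1 n, sval x)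
                 (chi_in0_subproof x)).
Proof. by apply: sig_ext; congr pair; exact: mor_ext. Qed.

Lemma chi_in1_nat m n (f : mor m n) (x : full B n) :
  exist _ (mor_cst m v1 : Delta 1 m, sval (act f x))
    (chi_in1_subproof (act f x))
  = chi_act f (exist _ (mor_cst n v1 : Delta 1 n, sval x)
                 (chi_in1_subproof x)).
Proof. by apply: sig_ext; congr pair; exact: mor_ext. Qed.

Definition chi_in0 : smap (full A) (fiber chi_proj v0) :=
  @sub_corestr _ _ (fiber chi_proj v0)
    (@SMap (full A) chi
       (fun n x => exist _ (mor_cst n v0 : Delta 1 n, sval x)
                     (chi_in0_subproof x))
       chi_in0_nat)
    (fun _ _ => erefl).

Definition chi_in1 : smap (full B) (fiber chi_proj v1) :=
  @sub_corestr _ _ (fiber chi_proj v1)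
    (@SMap (full B) chi
       (fun n x => exist _ (mor_cst n v1 : Delta 1 n, sval x)
                     (chi_in1_subproof x))
       chi_in1_nat)
    (fun _ _ => erefl).

Definition cartesian_gluing_functor (G : smap (full B) (full A)) : Prop :=
  cartesian_SOD /\ associated_contra chi_in0 chi_in1 G.

Definition cocartesian_gluing_functor (F : smap (full A) (full B)) : Prop :=
  cocartesian_SOD /\ associated_co chi_in0 chi_in1 F.

End SOD.

(* Main.v *)
Require Import Defs.
From mathcomp Require Import all_boot zify.
From mathcomp Require Import boolp classical_sets.

Set Implicit Arguments.
Unset Strict Implicit.
Unset Printing Implicit Defensive.

(** For A, call an edge a -> c with a in A a coreflection of c if outer horns with this last edge and all
    other vertices in A can be filled; equivalently, it is final in A x_C C_{/c}. The statements (a) and (b)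
    are the cases b = v0 and b = v1 of arguments about the simplicial set [osset b C], which is C or its opposite.

    Over Delta^1, coreflections of the objects of B are the Cartesian edges of chi(A, B), and a coherent family
    of coreflections of all c is the same as a right adjoint of the inclusion of A. If an adjoint is given by
    some correspondence M, its Cartesian edges are factored through the coCartesian ones and the factor is
    transported to C along the equivalence of C with a fiber of M.

    It remains to see that coreflections of the objects of B suffice. In case (a), c is the fiber of an edge
    a -> b with b in B. Replacing b by its coreflection b', and the zero object in the cospan by one in A,
    changes A x_C C_{/(a -> b <- 0)} only by trivial fibrations, and the fiber of a -> b' lies in A. In case (b)
    one applies the decomposition to a loop object of c and rotates the resulting fiber sequence. *)

(** * Monotone maps *)

(** Every construction extends a map one simplex at a time, and each step fills a horn: an inner
    one, or an outer one whose last edge is special. This is why Cartesian edges, slices and limits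
    are first restated as filling conditions for families indexed by joins of simplices.
    Equivalences enter in the same way, an invertible edge being special for every predicate.

    The asymmetry between (a) and (b) comes from [Fib]: it presents c as a fiber, the shape needed
    for a right adjoint, whereas a left adjoint of the inclusion of B needs c as a cofiber of an
    edge a -> b. Writing c as the suspension of its loop object turns one shape into the other by a
    single rotation.

    A coreflection b' -> b only lifts edges that start in A; hence the zero object of the cospan
    must be moved into A before b is replaced. Coreflections are handled as final objects because
    having a final object passes both ways along trivial fibrations, without choosing inverses. *)

Definition mk_mor m n (f : nat -> nat) (Hf : forall i, i <= m -> f i < n.+1)
    (Hm : forall i j, i <= j <= m -> f i <= f j) : mor m n :=
  @Mor m n (fun i => Ordinal (Hf i (ltn_ord i)))
    (fun i j ij => Hm i j (introT andP (conj ij (ltn_ord j)))).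

Lemma mor_eqP m n (f g : mor m n) : (forall i, f i = g i :> nat) -> f = g.
Proof. by move=> E; apply: mor_ext => i; exact/val_inj/E. Qed.

Lemma mor_eqE m n (f g : mor m n) i : f = g -> f i = g i.
Proof. by move->. Qed.

Lemma mor_ltP m n (f : mor m n) i j : f i < f j -> i < j.
Proof. by rewrite !ltnNge; apply: contra => /(mor_mono f). Qed.

Lemma act_eq (X : sset) m n (f g : mor m n) (x : X n) :
  f = g -> act f x = act g x.
Proof. by move->. Qed.

Lemma mor_id_comp m n (g : mor m n) : mor_comp (mor_id n) g = g.
Proof. exact: mor_ext. Qed.

Lemma I2P (b : 'I_2) : b = v0 \/ b = v1.
Proof.
case: b => [[|[|//]] ?]; [left|right]; exact: val_inj.
Qed.

Lemma vopK b : vop (vop b) = b.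
Proof. by case: (I2P b) => ->. Qed.

Lemma vop_neq b : b <> vop b.
Proof. by case: (I2P b) => -> /(congr1 val). Qed.

Lemma I2_neq (b c : 'I_2) : b <> c -> b = vop c.
Proof. by case: (I2P b) => ->; case: (I2P c) => -> H //; exact: val_inj. Qed.

Lemma I1E (i j : 'I_1) : i = j.
Proof. by rewrite (ord1 i) (ord1 j). Qed.

(** The codegeneracy repeating the value p, used as a retraction of [coface p]. The minimum covers p
    = n+1, which has no successor; there the value n is repeated. *)
Definition cod n (p : 'I_n.+2) : mor n.+1 n.
refine (@mk_mor n.+1 n (fun i => if p < i then i.-1 else minn i n) _ _).
- by move=> i; case: ifP; lia.
- by move=> i j; case: ifP; case: ifP; lia.
Defined.

Lemma cod_coface n (p : 'I_n.+2) : mor_comp (cod p) (coface p) = mor_id n.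
Proof.
apply: mor_eqP => i; rewrite /= /bump; have := ltn_ord i; have := ltn_ord p.
by case: leqP; case: ifP; lia.
Qed.

Lemma coface_cod l n (p : 'I_n.+2) (c : mor l n.+1) :
  (forall k, c k <> p) -> mor_comp (coface p) (mor_comp (cod p) c) = c.
Proof.
move=> cp; apply: mor_eqP => i; rewrite /= /bump.
have := ltn_ord p; have := ltn_ord (c i).
have : nat_of_ord (c i) <> p by move=> /val_inj; exact: cp.
by case: ifP; case: leqP; lia.
Qed.

(** A monotone map reflects strict inequalities, so any choice of preimages is monotone, and the
    preimage of [h i] may be chosen to be i. *)
Lemma mor_section l n (h : mor l n) (i : 'I_l.+1) :
  (forall v, exists k, h k = v) ->
  exists d : mor n l, mor_comp h d = mor_id n /\ d (h i) = i.
Proof.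
move=> hs.
pose d v := if v == h i then i else sval (cid (hs v)).
have hd v : h (d v) = v.
  by rewrite /d; case: eqP => [->//|_]; exact: (svalP (cid (hs v))).
have dm (v w : 'I_n.+1) : v <= w -> d v <= d w.
  case: (ltngtP v w) => // [vw|/val_inj ->] // _.
  by apply/ltnW/(@mor_ltP _ _ h); rewrite !hd.
exists (Mor dm); split; first by apply: mor_ext => v /=; exact: hd.
by rewrite /= /d eqxx.
Qed.

Lemma mor_inj_inc n (g : mor n n) : injective g -> forall i : 'I_n.+1, i <= g i.
Proof.
move=> gi [i Hi]; elim: i Hi => [//|i IH] Hi.
apply: (leq_ltn_trans (IH (ltnW Hi))).
rewrite ltn_neqAle (mor_mono g) //= andbT; apply/eqP => /val_inj/gi/(congr1 val) /=.
by lia.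
Qed.

(** Counting makes f injective. Then f and a section of f both send each vertex to one at least as
    large, which forces equality. *)
Lemma mor_surj_id n (f : mor n n) : (forall v, exists k, f k = v) -> f = mor_id n.
Proof.
move=> fs.
have fi : injective f.
  apply/injectiveP/card_uniqP; rewrite -[LHS]/(#|codom f|).
  have E : codom f =i predT by move=> v; have [k <-] := fs v; rewrite codom_f.
  by rewrite (eq_card E) size_map -cardE.
have [d [fd _]] := mor_section ord0 fs.
have di : injective d by move=> v w E; rewrite -[v](mor_eqE v fd) /= E -[RHS](mor_eqE w fd).
apply: mor_eqP => i; apply/eqP; rewrite eqn_leq (mor_inj_inc fi) andbT.
by have := mor_mono f (mor_inj_inc di i); rewrite (mor_eqE i fd : f (d i) = i).
Qed.

Lemma sub_eq (X Y : sset) (V : ssub X) (a : smap V Y) n (x y : X n)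
    (Hx : smem V x) (Hy : smem V y) :
  x = y -> a n (exist _ x Hx) = a n (exist _ y Hy).
Proof. by move=> E; congr (a n _); exact: sig_ext. Qed.

Lemma sub_nat (X Y : sset) (V : ssub X) (a : smap V Y) m n (f : mor m n)
    (x : X n) (Hx : smem V x) (Hy : smem V (act f x)) :
  a m (exist _ (act f x) Hy) = act f (a n (exist _ x Hx)).
Proof. by rewrite -smap_nat; exact: sub_eq. Qed.

(** * Extension of partial maps *)

Definition natrel (K X : sset) (R : forall n, K n -> X n -> Prop) :=
  forall m n (f : mor m n) x y, R n x y -> R m (act f x) (act f y).

(** Off V the new values are described by a relation F that is single-valued there, so that values
    picked by choice are automatically natural. *)
Lemma glue_def (K X : sset) (V V' : ssub K) (a : smap V X) (F : forall n, K n -> X n -> Prop) :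
  (forall n x, smem V' x -> ~ smem V x -> exists y, F n x y) ->
  (forall n x y z, ~ smem V x -> F n x y -> F n x z -> y = z) ->
  (forall m n (f : mor m n) x y, smem V' x -> ~ smem V x -> F n x y ->
     (forall H : smem V (act f x), a m (exist _ _ H) = act f y) /\
     (~ smem V (act f x) -> F m (act f x) (act f y))) ->
  exists a' : smap V' X,
    (forall n x (H : smem V x) (H' : smem V' x),
       a' n (exist _ x H') = a n (exist _ x H)) /\
    (forall n x (H' : smem V' x), ~ smem V x -> F n x (a' n (exist _ x H'))).
Proof.
move=> Fe Fu Fn.
pose v n (x : V' n) : X n := match pselect (smem V (sval x)) with
  | left H => a n (exist _ _ H)
  | right H => sval (cid (Fe n (sval x) (svalP x) H)) end.
have vin n x (H : smem V x) H' : v n (exist _ x H') = a n (exist _ x H).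
  by rewrite /v; case: pselect => //= H2; exact: sub_eq.
have vout n x H' : ~ smem V x -> F n x (v n (exist _ x H')).
  by move=> nH; rewrite /v; case: pselect => //= H2; case: (cid _).
have vnat m n (f : mor m n) (x : V' n) : v m (act f x) = act f (v n x).
  case: x => x H'; have H2' := smem_act f H'.
  have -> : act f (exist _ x H' : V' n) = exist _ (act f x) H2' by exact: sig_ext.
  case: (pselect (smem V x)) => [H|nH].
    by rewrite (vin _ _ (smem_act f H)) (vin _ _ H) (sub_nat a H).
  have [E1 E2] := Fn m n f _ _ H' nH (vout n x H' nH).
  case: (pselect (smem V (act f x))) => [H2|nH2]; first by rewrite (vin _ _ H2).
  exact: (Fu _ _ _ _ nH2 (vout _ _ _ nH2) (E2 nH2)).
by exists (@SMap V' X v vnat).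
Qed.

(** Attaches one nondegenerate cell: each new simplex is [act h s] for exactly one h, and h
    determines its image [act h y]. *)
Lemma attach (K X : sset) (R : forall n, K n -> X n -> Prop) (V V' : ssub K)
    N (s : K N) (a : smap V X) (y : X N) :
  natrel R ->
  (forall l (x : K l), smem V' x -> ~ smem V x -> exists h, x = act h s) ->
  (forall l (h h' : mor l N), act h s = act h' s -> ~ smem V (act h s) ->
     h = h') ->
  (forall n x, R n (sval x) (a n x)) -> R N s y ->
  (forall l (h : mor l N) (H : smem V (act h s)), act h y = a l (exist _ _ H)) ->
  exists a' : smap V' X,
    (forall n x (H : smem V x) (H' : smem V' x),
       a' n (exist _ x H') = a n (exist _ x H)) /\
    (forall n x, R n (sval x) (a' n x)).
Proof.
move=> Rn s2 s3 aR yR ya.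
have [||m n f x _ H' nH [h [-> ->]]|a' [a1 a2]] := @glue_def K X V V' a
  (fun n x z => exists h, x = act h s /\ z = act h y).
- by move=> n x H nH; have [h ->] := s2 n x H nH; exists (act h y), h.
- by move=> n x _ _ nH [h [E ->]] [h' [E' ->]]; rewrite (s3 _ h h') -?E.
- split=> [H|_]; last by exists (mor_comp h f); rewrite !act_comp.
  have H2 : smem V (act (mor_comp h f) s) by rewrite -act_comp.
  by rewrite (act_comp f h y) (ya _ _ H2); apply: sub_eq; exact: act_comp.
exists a'; split=> // n [x H']; case: (pselect (smem V x)) => [H|nH].
  by rewrite (a1 _ _ H); exact: (aR n (exist _ x H)).
by have [h [E ->]] := a2 _ _ H' nH; rewrite [sval _]E; exact: Rn.
Qed.

Lemma boundary_factor l n (g : mor l n.+1) (i : 'I_n.+2) :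
  (forall k, g k <> i) -> exists g', g = mor_comp (coface i) g'.
Proof. by move=> gi; exists (mor_comp (cod i) g); rewrite coface_cod. Qed.

Lemma boundary0 l (g : mor l 0) : ~ smem (boundary 0) (g : Delta 0 l).
Proof. by case=> i /(_ ord0); apply; exact: I1E. Qed.

Lemma not_boundary l n (g : mor l n) :
  ~ smem (boundary n) (g : Delta n l) -> forall v, exists k, g k = v.
Proof.
by move=> H v; apply: contrapT => nk; apply: H; exists v => k E; apply: nk; exists k.
Qed.

(** Zorn's lemma for extensions of u to larger simplicial subsets of K: in a maximal one, a missing
    simplex of least dimension has its boundary in the domain, so a filler would extend the map
    further. The relation R carries side conditions, such as lying over a given map. *)
Lemma cell_ext (K X : sset) (R : forall n, K n -> X n -> Prop) (U : ssub K)
    (u : smap U X) :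
  natrel R -> (forall n x, R n (sval x) (u n x)) ->
  (forall n (x : K n), ~ smem U x -> forall a : smap (boundary n) X,
     (forall l (g : boundary n l), R l (act (sval g : mor l n) x) (a l g)) ->
     (forall l (g : boundary n l) (H : smem U (act (sval g : mor l n) x)),
        a l g = u l (exist _ _ H)) ->
     exists y : X n, R n x y /\
       forall l (g : boundary n l), a l g = act (sval g : mor l n) y) ->
  exists w : smap K X, (forall n x, w n (sval x) = u n x) /\
    forall n x, R n x (w n x).
Proof.
move=> Rn uR fill.
pose good (V : ssub K) (w : smap V X) :=
  (forall n (x : K n), smem U x -> smem V x) /\
  (forall n (x : U n) H, w n (exist _ (sval x) H) = u n x) /\
  (forall n x, R n (sval x) (w n x)).
pose T := {V : ssub K & {w : smap V X | @good V w}}.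
pose le (s t : T) := (forall n (x : K n), smem (tag s) x -> smem (tag t) x) /\
  (forall n x (H : smem (tag s) x) (H' : smem (tag t) x),
     sval (tagged t) n (exist _ x H') = sval (tagged s) n (exist _ x H)).
have gU : @good U u.
  split=> //; split=> // n [x H] H'; exact: sub_eq.
pose tU : T := existT _ U (exist _ u gU).
have := @ZL_preorder T tU (fun s t => `[< le s t >]).
case.
- by move=> t; apply/asboolP; split=> // n x H H'; exact: sub_eq.
- move=> r s t /asboolP[slice_res rs'] /asboolP[st st']; apply/asboolP; split=> [n x H|n x H H'].
    exact/st/slice_res.
  by rewrite (st' _ _ (slice_res _ _ H)) (rs' _ _ H).
- move=> A tot.
  (* The empty chain needs its own bound, as the union of no domains does not contain U. *)
  case: (pselect (exists t, A t)) => [[t0 At0]|nA]; last first.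
    by exists tU => s As; case: nA; exists s.
  have Wa m n (f : mor m n) (x : K n) : (exists2 t, A t & smem (tag t) x) ->
      exists2 t, A t & smem (tag t) (act f x).
    by case=> t At H; exists t => //; exact: smem_act.
  pose W := @SSub K _ Wa.
  have tot' s t n x (Hs : smem (tag s) x) (Ht : smem (tag t) x) : A s -> A t ->
      sval (tagged s) n (exist _ x Hs) = sval (tagged t) n (exist _ x Ht).
    move=> As At; case: (tot s t As At) => /asboolP[_ E].
      by rewrite (E _ _ Hs Ht).
    by rewrite (E _ _ Ht Hs).
  have emp n (x : K n) : False -> False by [].
  pose E := empty K.
  have eN m n (f : mor m n) (x : E n) : False_rect (X m) (svalP (act f x)) = act f (False_rect (X n) (svalP x)).
    by case: x.
  pose e := @SMap E X (fun n x => False_rect (X n) (svalP x)) eN.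
  (* The union is glued onto the empty subobject; the relation is the common value of the members of
     the chain. *)
  have [|||w [_ w2]] := @glue_def K X E W e (fun n x y => exists t (H : smem (tag t) x), A t /\ y = sval (tagged t) n (exist _ x H)).
  + by move=> n x [t At H] _; exists (sval (tagged t) n (exist _ x H)), t, H.
  + by move=> n x _ _ _ [s [Hs [As ->]]] [t [Ht [At ->]]]; exact: tot'.
  + move=> m n f x y _ _ [t [H [At ->]]]; split=> // _; exists t, (smem_act f H); split=> //.
    by rewrite (sub_nat _ H).
  have gw : @good W w.
    split=> [n x H|]; first by exists t0 => //; exact: (svalP (tagged t0)).1.
    split=> [n x H|n [x H]].
      have [t [Ht [At ->]]] := w2 n (sval x) H id.
      exact: (svalP (tagged t)).2.1.
    have [t [Ht [At ->]]] := w2 n x H id.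
    exact: ((svalP (tagged t)).2.2 n (exist _ x Ht)).
  exists (existT _ W (exist _ w gw) : T) => s As; apply/asboolP; split=> [n x H|n x H H'].
    by exists s.
  have [t [Ht [At /= ->]]] := w2 n x H' id.
  exact: tot'.
case=> V [w [UV [wu wR]]] max.
suff VK n (x : K n) : smem V x.
  have wN m n (f : mor m n) (x : K n) : w m (exist _ (act f x) (VK m (act f x))) = act f (w n (exist _ x (VK n x))).
    exact: sub_nat.
  exists (@SMap K X (fun n x => w n (exist _ x (VK n x))) wN).
  by split=> n x /=; [exact: wu|exact: (wR n (exist _ x (VK n x)))].
elim/ltn_ind: n x => n IH x; apply: contrapT => nx.
(* The part of x already in the domain is exactly its boundary: if h is onto and [act h x] is in the
   domain, a section of h gives x back. *)
have bV l (h : mor l n) : smem V (act h x) <-> smem (boundary n) (h : Delta n l).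
  split=> [H|].
    apply: contrapT => /not_boundary hs.
    have [d [E _]] := mor_section ord0 hs.
    by apply: nx; rewrite -(act_id x) -E -act_comp; exact: smem_act.
  case: n x nx h IH => [|n] x nx h IH; first by move/boundary0.
  by case=> i /boundary_factor [h' ->]; rewrite -act_comp; apply/smem_act/IH.
have bV' l (g : boundary n l) : smem V (act (sval g : mor l n) x).
  by apply/bV; exact: (svalP g).
have aN l m (f : mor l m) (g : boundary n m) : w l (exist _ _ (bV' l (act f g))) = act f (w m (exist _ _ (bV' m g))).
  by rewrite -smap_nat; apply: sub_eq; rewrite /= act_comp.
have [||l g H|y [yR yb]] := fill n x _ (@SMap (boundary n) X (fun l g => w l (exist _ _ (bV' l g))) aN).
- by move=> H; exact/nx/UV.
- by move=> l g; exact: (wR l (exist _ _ (bV' l g))).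
- by rewrite /= -(wu l (exist _ _ H) (bV' l g)).
have Va m k (f : mor m k) (z : K k) : smem V z \/ (exists h, z = act h x) ->
   smem V (act f z) \/ (exists h, act f z = act h x).
  by case=> [H|[h ->]]; [left; exact: smem_act|right; exists (mor_comp h f); rewrite act_comp].
pose V' := @SSub K _ Va.
(* As in the Eilenberg-Zilber lemma: for a section d of h through i, the map h' d must be onto,
   hence the identity, so h and h' agree at i. *)
have s3 l (h h' : mor l n) : act h x = act h' x -> ~ smem V (act h x) -> h = h'.
  move=> E nH; have hs := not_boundary (fun B => nH ((bV _ _).2 B)).
  apply: mor_ext => i; have [d [D di]] := mor_section i hs.
  have : mor_comp h' d = mor_id n.
    apply/mor_surj_id/not_boundary => B; apply: nx; have /bV := B.
    by rewrite -act_comp -E act_comp D act_id.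
  by move/(mor_eqE (h i)) => /= ; rewrite di.
have yw l (h : mor l n) (H : smem V (act h x)) : act h y = w l (exist _ _ H).
  by have B := (bV _ _).1 H; have /= <- := yb l (exist _ _ B); exact: sub_eq.
have [|w' [w1 w2]] := @attach K X R V V' n x w y Rn _ s3 wR yR yw.
  by move=> l z [H //|//].
have VV' n0 (x0 : K n0) : smem V x0 -> smem V' x0 by left.
have gw' : @good V' w'.
  split=> [k z /UV H|]; first by left.
  split=> // k z H; rewrite (w1 _ _ (UV _ _ (svalP z))); exact: wu.
have /asboolP[H _] := max (existT _ V' (exist _ w' gw') : T) (introT (asboolP _) (conj VV' w1)).
by apply: nx; apply: H; right; exists (mor_id n); rewrite act_id.
Qed.

Lemma qfill (X : sset) : infty_category X -> forall n (i : 'I_n.+1), 0 < i < n ->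
  forall h : smap (horn i) X, exists y : X n,
    forall l (g : horn i l), h l g = act (sval g : mor l n) y.
Proof.
move=> qX n i Hi h.
have [|w [wh _]] := qX n i Hi h (to_pt _); first exact: smap_ext.
exists (w n (mor_id n)) => l g; rewrite -wh /= -smap_nat; congr (w _ _).
exact/esym/mor_id_comp.
Qed.

Lemma qcat_of_fill (X : sset) : (forall n (i : 'I_n.+1), 0 < i < n ->
  forall h : smap (horn i) X, exists y : X n,
    forall l (g : horn i l), h l g = act (sval g : mor l n) y) -> infty_category X.
Proof.
move=> H n i Hi h v _; have [y hy] := H n i Hi h.
exists (yoneda y); split; last by apply: smap_ext => l x; rewrite /=; case: (v l x).
by apply: smap_ext => l g; rewrite hy.
Qed.

(** * Special edges *)

Definition ledge_mor n : mor 1 n.+1.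
refine (@mk_mor 1 n.+1 (fun i => i + n) _ _); lia.
Defined.

(** Over Delta^1 a simplex of the base is determined by its vertices, so that an edge over 0 -> 1 is
    Cartesian iff it is special for the predicate [lies over 0]. *)
Definition special (X : sset) (P : X 0 -> Prop) (e : X 1) : Prop :=
  forall n (h : smap (horn (ord_max : 'I_n.+3)) X),
  (forall H, h 1 (exist _ (ledge_mor n.+1 : Delta n.+2 1) H) = e) ->
  (forall (i : 'I_n.+3) H, i < n.+2 ->
     P (h 0 (exist _ (mor_cst 0 i : Delta n.+2 0) H))) ->
  exists y : X n.+2, forall l g, h l g = act (sval g : mor l n.+2) y.

Lemma special_sub (X : sset) (P P' : X 0 -> Prop) e :
  (forall x, P' x -> P x) -> special P e -> special P' e.
Proof. by move=> PP' eP n h h1 h0; apply: (eP n h) => // i H Hi; exact/PP'/h0. Qed.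

(** * Extension of homotopies along special edges *)

Definition path_act (X : sset) m n (f : mor m n)
    (F : smap (sprod (Delta n) (Delta 1)) X) : smap (sprod (Delta m) (Delta 1)) X :=
  F \os sprod_map (Delta_map f) (sid (Delta 1)).

Lemma path_act_id (X : sset) n (F : smap (sprod (Delta n) (Delta 1)) X) :
  path_act (mor_id n) F = F.
Proof.
apply: smap_ext => m [x g] /=; congr (F _ (_, _)); exact: mor_id_comp.
Qed.

Lemma path_act_comp (X : sset) l m n (f : mor l m) (g : mor m n)
    (F : smap (sprod (Delta n) (Delta 1)) X) :
  path_act f (path_act g F) = path_act (mor_comp g f) F.
Proof. by apply: smap_ext => k [x h] /=; congr (F _ (_, _)); exact: mor_ext. Qed.

(** [Fun (Delta 1) X] with the factors exchanged, so that a map K -> [pathset X] is directly a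
    homotopy on K x Delta^1. *)
Definition pathset (X : sset) : sset :=
  @SSet (fun n => smap (sprod (Delta n) (Delta 1)) X) (@path_act X)
    (@path_act_id X) (@path_act_comp X).

Definition pfun (X : sset) n (F : pathset X n) : smap (sprod (Delta n) (Delta 1)) X := F.

Lemma path_actE (X : sset) m n (f : mor m n) (F : pathset X n) k (c : mor k m) (j : mor k 1) :
  pfun (act f F) k (c, j) = pfun F k (mor_comp f c, j).
Proof. by []. Qed.

Lemma path_nat (X : sset) n (F : pathset X n) k l (f : mor l k) (c : mor k n) (j : mor k 1) :
  pfun F l (mor_comp c f, mor_comp j f) = act f (pfun F k (c, j)).
Proof. by rewrite -smap_nat. Qed.

Lemma mor_cst_comp l m n (f : mor l m) (i : 'I_n.+1) : mor_comp (mor_cst m i) f = mor_cst l i.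
Proof. exact: mor_ext. Qed.

Lemma mor_comp_cst l m n (f : mor m n) (i : 'I_m.+1) : mor_comp f (mor_cst l i) = mor_cst l (f i).
Proof. exact: mor_ext. Qed.

Section Prism.
Variables (X : sset) (qX : infty_category X) (n : nat) (y : X n.+1).
Variables (a : smap (boundary n.+1) (pathset X)) (P : X 0 -> Prop).
Hypothesis ay : forall l (g : boundary n.+1 l) k (c : mor k l),
  pfun (a l g) k (c, mor_cst k v1) = act (mor_comp (sval g) c) y.
Hypothesis aS : forall H, special P
  (pfun (a 0 (exist _ (mor_cst 0 ord_max : Delta n.+1 0) H)) 1 (mor_cst 1 ord0, mor_id 1)).
Hypothesis aP : forall i H,
  P (pfun (a 0 (exist _ (mor_cst 0 i : Delta n.+1 0) H)) 0 (mor_id 0, mor_cst 0 v0)).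

Let K := sprod (Delta n.+1) (Delta 1).

Lemma prism_sub_act i l k (f : mor l k) (x : K k) :
  smem (boundary n.+1) x.1 \/ (forall t, mfun x.2 t = v0 -> mfun x.1 t < i) ->
  smem (boundary n.+1) (act f x).1 \/ (forall t, mfun (act f x).2 t = v0 -> mfun (act f x).1 t < i).
Proof. by case=> [H|H]; [left; exact: smem_act|right=> t; exact: H]. Qed.

(** A filtration of Delta^{n+1} x Delta^1. Stage 0 is the boundary times Delta^1 together with the
    end over 1; stage i also admits simplices whose vertices over 0 are (k, 0) with k < i. *)
Definition prism_sub (i : nat) : ssub K := @SSub K _ (@prism_sub_act i).

Definition prism_bd : ssub K :=
  @SSub K (fun k x => smem (boundary n.+1) x.1) (fun _ _ f x H => smem_act f H).

Definition prism_bd1 k (x : prism_bd k) : boundary n.+1 k :=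
  exist _ (sval x).1 (svalP x).

Lemma prism_bd_nat l k (f : mor l k) (x : prism_bd k) :
  pfun (a l (prism_bd1 (act f x))) l (mor_id l, (sval (act f x)).2) =
  act f (pfun (a k (prism_bd1 x)) k (mor_id k, (sval x).2)).
Proof.
rewrite -path_nat mor_id_comp.
have -> : prism_bd1 (act f x) = act f (prism_bd1 x) by exact: sig_ext.
by rewrite smap_nat path_actE mor_comp_id.
Qed.

Definition prism_bd_map : smap prism_bd X :=
  @SMap prism_bd X (fun k x => pfun (a k (prism_bd1 x)) k (mor_id k, (sval x).2)) prism_bd_nat.

Lemma prism0 : exists b : smap (prism_sub 0) X,
  (forall k (x : K k) (H : smem prism_bd x) H', b k (exist _ x H') = prism_bd_map k (exist _ x H)) /\
  (forall k (x : K k) H', mfun x.2 =1 (fun=> v1) -> b k (exist _ x H') = act (x.1 : mor k n.+1) y).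
Proof.
have j1 k (x : K k) : smem (prism_sub 0) x -> ~ smem prism_bd x -> x.2 = mor_cst k v1.
  case=> // H _; apply: mor_ext => t; apply: contrapT => E.
  by have := H t (I2_neq E).
have [|||b [b1 b2]] := @glue_def K X prism_bd (prism_sub 0) prism_bd_map
  (fun k x z => z = act (x.1 : mor k n.+1) y).
- by move=> k x _ _; exists (act (x.1 : mor k n.+1) y).
- by move=> k x z z' _ -> ->.
- move=> l k f x z H' nH ->; split=> [H|_]; rewrite act_comp //.
  by rewrite /= (j1 _ _ H' nH) mor_cst_comp ay /= mor_comp_id.
exists b; split=> // k x H' E; case: (pselect (smem prism_bd x)) => H; last exact: b2.
have {}E : x.2 = mor_cst k v1 by exact: mor_ext.
by rewrite (b1 _ _ H) /= E ay /= mor_comp_id.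
Qed.

Definition sig1 (i : 'I_n.+2) : mor n.+2 n.+1.
refine (@mk_mor n.+2 n.+1 (fun h => if h <= i then h else h.-1) _ _).
- by move=> h; have := ltn_ord i; case: ifP; lia.
- by move=> h h'; case: ifP; case: ifP; lia.
Defined.

Definition sig2 (i : 'I_n.+2) : mor n.+2 1.
refine (@mk_mor n.+2 1 (fun h => if h <= i then 0 else 1) _ _).
- by move=> h _; case: ifP.
- by move=> h h'; case: ifP; case: ifP; lia.
Defined.

(** The maximal simplex (0,0), ..., (i,0), (i,1), ..., (n+1,1) of the prism. *)
Definition sigK (i : 'I_n.+2) : K n.+2 := (sig1 i, sig2 i).

(** The face opposite (i,0) belongs to stage i, the face opposite (i,1) does not, and every other
    face projects to the boundary. So the cell is attached along the horn at the vertex i+1. *)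
Lemma sig_mem (i : 'I_n.+2) (j : 'I_n.+3) l (h : mor l n.+2) : val j = i.+1 ->
  smem (prism_sub i) (act h (sigK i)) <-> smem (horn j) (h : Delta n.+2 l).
Proof.
move=> ji; split.
  case=> [[v Hv]|Hi].
    case: (ltngtP v i) => vi.
    - exists (widen_ord (leqnSn _) v); split.
        by move=> /(congr1 val) /=; rewrite ji; lia.
      move=> k E; apply: (Hv k); apply: val_inj => /=.
      by rewrite E /=; case: ifP; lia.
    - exists (lift ord0 v); split.
        by move=> /(congr1 val) /=; rewrite ji /bump /=; lia.
      move=> k E; apply: (Hv k); apply: val_inj => /=.
      by rewrite E /= /bump /=; case: ifP; lia.
    - exists (widen_ord (leqnSn _) i); split.
        by move=> /(congr1 val) /=; rewrite ji; lia.
      move=> k E; apply: (Hv k); apply: val_inj => /=.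
      by rewrite E /= leqnn; lia.
  exists (widen_ord (leqnSn _) i); split.
    by move=> /(congr1 val) /=; rewrite ji; lia.
  move=> k E; have := Hi k; rewrite /= E /= leqnn ltnn => H.
  have // : false by apply: H; exact: val_inj.
case=> v [vj Hv]; have vj' : nat_of_ord v <> i.+1 by rewrite -ji => /val_inj.
case: (ltngtP v i) => vi.
- left; have Hv' : v < n.+2 by move: (ltn_ord i); lia.
  exists (Ordinal Hv') => k /(congr1 val) /= E; apply: (Hv k); apply: val_inj => /=.
  by move: E; case: ifP; lia.
- left; have Hv' : v.-1 < n.+2 by move: (ltn_ord v); lia.
  exists (Ordinal Hv') => k /(congr1 val) /= E; apply: (Hv k); apply: val_inj => /=.
  by move: E; case: ifP; lia.
- right=> t /(congr1 val) /=; have : nat_of_ord (h t) <> i by rewrite -vi => /val_inj; exact: Hv.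
  by case: ifP; lia.
Qed.

(** A new simplex has (i,0) among its vertices, so those over 1 have first coordinate at least i;
    shifting the latter by one gives the operator h. *)
Lemma sig_sur (i : 'I_n.+2) l (x : K l) : smem (prism_sub i.+1) x ->
  ~ smem (prism_sub i) x -> exists h, x = act h (sigK i).
Proof.
move=> H1 H2.
have x1 : ~ smem (boundary n.+1) x.1 by move=> H; apply: H2; left.
case: H1 => // H1.
have [t0 [t0v t0i]] : exists t, mfun x.2 t = v0 /\ nat_of_ord (mfun x.1 t) = i.
  apply: contrapT => nt; apply: H2; right=> t Ht; have := H1 t Ht.
  rewrite ltnS leq_eqVlt => /orP[/eqP E|//]; case: nt; by exists t.
have up t : mfun x.2 t = v1 -> i <= mfun x.1 t.
  move=> Ht; rewrite -t0i; apply: mor_mono; apply/ltnW/(@mor_ltP _ _ x.2).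
  by rewrite t0v Ht.
pose h (t : 'I_l.+1) := if mfun x.2 t == v0 then nat_of_ord (mfun x.1 t) else (mfun x.1 t).+1.
have hb t : h t < n.+3 by rewrite /h; have := ltn_ord (mfun x.1 t); case: ifP; lia.
have x2 t : mfun x.2 t = v0 \/ mfun x.2 t = v1 by exact: I2P.
have hm (t t' : 'I_l.+1) : t <= t' -> h t <= h t'.
  move=> tt; have := mor_mono x.1 tt; have := mor_mono x.2 tt; rewrite /h.
  by case: (x2 t) => ->; case: (x2 t') => -> //=; lia.
exists (@Mor l n.+2 (fun t => Ordinal (hb t)) hm).
apply: injective_projections; apply: mor_eqP => t /=; rewrite /h.
  have := H1 t; have := up t; case: (x2 t) => E; rewrite E /=.
    by move=> _ /(_ erefl); case: ifP => //; lia.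
  by move=> /(_ erefl) + _; case: ifP => //; lia.
have := H1 t; have := up t; case: (x2 t) => E; rewrite E /=.
  by move=> _ /(_ erefl); case: ifP => //; lia.
by move=> /(_ erefl) + _; case: ifP => //; lia.
Qed.

Lemma sig_inj (i : 'I_n.+2) l (h h' : mor l n.+2) :
  act h (sigK i) = act h' (sigK i) -> h = h'.
Proof.
move=> /pair_equal_spec [/mor_eqE E1 /mor_eqE E2]; apply: mor_eqP => t.
have /(congr1 val) /= := E1 t; have /(congr1 val) /= := E2 t.
by case: ifP; case: ifP; lia.
Qed.

(** The horn is inner for i <= n. For i = n+1 it is the last horn, and its last edge is the path at
    the last vertex, special by [aS]. *)
Lemma sig_fill (b0 : smap (prism_sub 0) X) (i : 'I_n.+2) (b : smap (prism_sub i) X) :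
  (forall k (x : K k) (H : smem prism_bd x) H', b0 k (exist _ x H') = prism_bd_map k (exist _ x H)) ->
  (forall k (x : K k) H H', b k (exist _ x H') = b0 k (exist _ x H)) ->
  exists z : X n.+2, forall l (h : mor l n.+2) (H : smem (prism_sub i) (act h (sigK i))),
    act h z = b l (exist _ _ H).
Proof.
move=> b0E bE; pose j : 'I_n.+3 := lift ord0 i.
have ji : val j = i.+1 by [].
have hH l (g : horn j l) : smem (prism_sub i) (act (sval g : mor l n.+2) (sigK i)).
  by apply/(sig_mem _ ji); exact: (svalP g).
have hN l m (f : mor l m) (g : horn j m) :
   b l (exist _ _ (hH l (act f g))) = act f (b m (exist _ _ (hH m g))).
  by rewrite -smap_nat; apply: sub_eq; rewrite /= !mor_compA.
pose h := @SMap (horn j) X (fun l g => b l (exist _ _ (hH l g))) hN.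
suff [z hz] : exists z : X n.+2, forall l g, h l g = act (sval g : mor l n.+2) z.
  exists z => l f H; have F := (sig_mem f ji).1 H.
  by rewrite -(hz l (exist _ _ F)) /=; exact: sub_eq.
case: (ltnP i n.+1) => Hi.
  by apply: qfill => //; rewrite ji; lia.
have hval l (g : horn j l) (H0 : smem (prism_sub 0) (act (sval g : mor l n.+2) (sigK i))) : h l g = b0 l (exist _ _ H0).
  by rewrite /= (bE _ _ H0).
have ii : i = ord_max by apply: val_inj => /=; move: (ltn_ord i); lia.
have E : j = ord_max by apply: val_inj; rewrite ji ii.
rewrite /sigK in hval; clearbody h; clear hN hH ji; clearbody j; subst j.
have bd k (c : mor k n.+1) (t : 'I_n.+2) : c = mor_cst k t -> smem (boundary n.+1) (c : Delta n.+1 k).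
  move=> ->; exists (if t == ord0 then ord_max else ord0) => t' /(congr1 val) /=.
  by case: (t =P ord0) => [->//|tn /= E]; apply: tn; exact: val_inj.
have sp := @aS (bd _ _ _ erefl).
apply: sp => [H|v H Hv].
  have B : mor_comp (sig1 i) (ledge_mor n.+1) = mor_cst 1 ord_max.
    by apply: mor_eqP => t /=; rewrite ii /=; case: t => [[|[|//]] ?] /=; case: ifP; lia.
  have B' : smem prism_bd (act (ledge_mor n.+1) ((sig1 i, sig2 i) : K n.+2)) := bd _ _ _ B.
  have H0 : smem (prism_sub 0) (act (ledge_mor n.+1) ((sig1 i, sig2 i) : K n.+2)) by left.
  rewrite (hval _ (exist _ _ H) H0) (b0E _ _ B').
  rewrite -[LHS]/(pfun (a 1 (prism_bd1 (exist _ _ B'))) 1 (mor_id 1, mor_comp (sig2 i) (ledge_mor n.+1))).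
  have -> : mor_comp (sig2 i) (ledge_mor n.+1) = mor_id 1.
    by apply: mor_eqP => t /=; rewrite ii /=; case: t => [[|[|//]] ?] /=; case: ifP; lia.
  have -> : prism_bd1 (exist _ _ B') = act (mor_cst 1 ord0) (exist _ _ (bd 0 (mor_cst 0 ord_max) _ erefl) : boundary n.+1 0).
    by apply: sig_ext; rewrite /= B; exact: mor_ext.
  by rewrite smap_nat path_actE mor_comp_id.
have Hv' : v < n.+2 by [].
have B : mor_comp (sig1 i) (mor_cst 0 v) = mor_cst 0 (Ordinal Hv').
  by apply: mor_eqP => t /=; rewrite ii /=; case: ifP; lia.
have B' : smem prism_bd (act (mor_cst 0 v) ((sig1 i, sig2 i) : K n.+2)) := bd _ _ _ B.
have H0 : smem (prism_sub 0) (act (mor_cst 0 v) ((sig1 i, sig2 i) : K n.+2)) by left.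
rewrite (hval _ (exist _ _ H) H0) (b0E _ _ B').
rewrite -[X in P X]/(pfun (a 0 (prism_bd1 (exist _ _ B'))) 0 (mor_id 0, mor_comp (sig2 i) (mor_cst 0 v))).
have -> : mor_comp (sig2 i) (mor_cst 0 v) = mor_cst 0 v0.
  by apply: mor_eqP => t /=; rewrite ii /=; case: ifP; lia.
have -> : prism_bd1 (exist _ _ B') = exist _ _ (bd 0 (mor_cst 0 (Ordinal Hv')) _ erefl) by exact: sig_ext.
exact: (@aP (Ordinal Hv')).
Qed.

Lemma prism : exists w : pathset X n.+1,
  (forall l (g : boundary n.+1 l), a l g = act (sval g : mor l n.+1) w) /\
  (forall k (c : mor k n.+1), pfun w k (c, mor_cst k v1) = act c y).
Proof.
have [b0 [b0E b01]] := prism0.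
have step i : i <= n.+2 -> exists b : smap (prism_sub i) X,
    forall k (x : K k) H H', b k (exist _ x H') = b0 k (exist _ x H).
  elim: i => [_|i IH Hi]; first by exists b0 => k x H H'; exact: sub_eq.
  have [b bE] := IH (ltnW Hi).
  have [z zb] := @sig_fill b0 (Ordinal Hi) b b0E bE.
  have [//||||||b' [b1 _]] := @attach K X (fun _ _ _ => True) (prism_sub i) (prism_sub i.+1)
    n.+2 (sigK (Ordinal Hi)) b z.
  - exact: (@sig_sur (Ordinal Hi)).
  - by move=> l h h' E _; exact: (@sig_inj (Ordinal Hi)).
  - by [].
  - by [].
  - exact: zb.
  exists b' => k x H H'.
  have Hx : smem (prism_sub i) x.
    by case: H => H; [left|right=> t Ht; have := H t Ht].
  by rewrite (b1 _ _ Hx) (bE _ _ H).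
have [b bE] := step n.+2 (leqnn _).
(* At stage n+2 the condition on vertices is void, so the whole prism is reached. *)
have bH k (x : K k) : smem (prism_sub n.+2) x by right=> t _; exact: ltn_ord.
have wN l m (f : mor l m) (x : K m) : b l (exist _ _ (bH l (act f x))) = act f (b m (exist _ _ (bH m x))).
  by rewrite -smap_nat; exact: sub_eq.
exists (@SMap K X (fun k x => b k (exist _ x (bH k x))) wN); split=> [l g|k c]; last first.
  have H0 : smem (prism_sub 0) ((c, mor_cst k v1) : K k) by right.
  by rewrite /= (bE _ _ H0) b01.
apply: smap_ext => k [c j].
have B : smem prism_bd ((mor_comp (sval g) c, j) : K k).
  by have := svalP (act c g).
have H0 : smem (prism_sub 0) ((mor_comp (sval g) c, j) : K k) by left.
rewrite [RHS]/= (bE _ _ H0) (b0E _ _ B).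
rewrite -[RHS]/(pfun (a k (prism_bd1 (exist _ _ B))) k (mor_id k, j)).
have -> : prism_bd1 (exist _ _ B) = act (c : mor k l) g by exact: sig_ext.
by rewrite smap_nat path_actE mor_comp_id.
Qed.

End Prism.

Definition smap_path (K X : sset) (w : smap (sprod K (Delta 1)) X) n (x : K n) : pathset X n :=
  w \os sprod_map (yoneda x) (sid (Delta 1)).

Lemma smap_path_nat (K X : sset) (w : smap (sprod K (Delta 1)) X) m n (f : mor m n) (x : K n) :
  smap_path w (act f x) = act f (smap_path w x).
Proof. by apply: smap_ext => k [c j] /=; rewrite act_comp. Qed.

Definition curry_path (K X : sset) (w : smap (sprod K (Delta 1)) X) : smap K (pathset X) :=
  @SMap K (pathset X) (@smap_path K X w) (@smap_path_nat K X w).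

Lemma uncurry_path_nat (K X : sset) (w : smap K (pathset X)) m n (f : mor m n) (x : sprod K (Delta 1) n) :
  pfun (w m (act f x).1) m (mor_id m, (act f x).2) = act f (pfun (w n x.1) n (mor_id n, x.2)).
Proof. by rewrite smap_nat -path_nat path_actE mor_comp_id mor_id_comp. Qed.

Definition uncurry_path (K X : sset) (w : smap K (pathset X)) : smap (sprod K (Delta 1)) X :=
  @SMap (sprod K (Delta 1)) X (fun n x => pfun (w n x.1) n (mor_id n, x.2)) (@uncurry_path_nat K X w).

Lemma edge_path_nat (X : sset) (e : X 1) n l m (f : mor l m) (x : sprod (Delta n) (Delta 1) m) :
  act ((act f x).2 : mor l 1) e = act f (act (x.2 : mor m 1) e).
Proof. by rewrite act_comp. Qed.

Definition edge_path (X : sset) (e : X 1) n : pathset X n :=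
  @SMap (sprod (Delta n) (Delta 1)) X (fun m x => act (x.2 : mor m 1) e) (@edge_path_nat X e n).

Lemma vert_act (X : sset) m n (f : mor m n) (x : X n) i : vert (act f x) i = vert x (f i).
Proof. by rewrite /vert act_comp mor_comp_cst. Qed.

Lemma act_degen (X : sset) m n (f : mor m n) (x : X 0) : act f (degen n x) = degen m x.
Proof. by rewrite /degen act_comp mor_cst_comp. Qed.

Lemma vert0 (X : sset) (x : X 0) i : vert x i = x.
Proof. by rewrite -[RHS]act_id; apply: act_eq; apply: mor_ext => k; exact: I1E. Qed.

Lemma degen0 (X : sset) (x : X 0) : degen 0 x = x.
Proof. exact: vert0. Qed.

Lemma vert_degen (X : sset) n (x : X 0) i : vert (degen n x) i = x.
Proof. by rewrite /vert act_degen degen0. Qed.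

Section Transport.
Variables (X : sset) (qX : infty_category X) (K : sset) (U : ssub K) (f : smap K X).
Variables (g : smap (sprod U (Delta 1)) X) (eps : K 0 -> X 1).
Hypothesis g1 : forall n (x : U n), g n (x, mor_cst n v1) = f n (sval x).
Hypothesis epsU : forall x : U 0, eps (sval x) = g 1 (degen 1 x, mor_id 1).
Hypothesis eps1 : forall v, vert (eps v) v1 = f 0 v.
Hypothesis H : forall n (x : K n.+1), ~ smem U x ->
  exists P, special P (eps (vert x ord_max)) /\ forall i, P (vert (eps (vert x i)) v0).

Lemma tr_sub_act m n (h : mor m n) (x : K n) : smem U x \/ x = degen n (vert x ord0) ->
  smem U (act h x) \/ act h x = degen m (vert (act h x) ord0).
Proof.
case=> [Ux|E]; [left; exact: smem_act|right].
by rewrite E act_degen vert_degen.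
Qed.

(** U together with the 0-skeleton of K, where the homotopy has to be the chosen edge [eps]. *)
Definition tr_sub : ssub K := @SSub K _ tr_sub_act.

(** Pulls f back along the edges [eps], one prism for each simplex outside U. With dimension 0
    settled by [eps], every other simplex asks for a special edge only at its last vertex, for a
    predicate that may vary with the simplex. *)
Lemma transport : exists w : smap (sprod K (Delta 1)) X,
  (forall n x, w n (x, mor_cst n v1) = f n x) /\
  (forall n (x : U n) j, w n (sval x, j) = g n (x, j)) /\
  forall v, w 1 (degen 1 v, mor_id 1) = eps v.
Proof.
have [|||u [u1 u2]] := @glue_def K (pathset X) U tr_sub (curry_path g)
  (fun n x z => z = edge_path (eps (vert x ord0)) n).
- by move=> n x _ _; exists (edge_path (eps (vert x ord0)) n).
- by move=> n x z z' _ -> ->.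
- move=> m n h x z [//|E] nU ->; split=> [Ux|_]; last first.
    have -> : vert (act h x) ord0 = vert x ord0 by rewrite vert_act E !vert_degen.
    exact: smap_ext.
  case: nU; rewrite E act_degen in Ux *; have := smem_act (mor_cst 0 ord0) Ux.
  by move/(smem_act (mor_cst n ord0)); rewrite -[act _ (degen m _)]/(vert _ _) vert_degen.
have uE v (Hv : smem tr_sub v) k (c : mor k 0) (j : mor k 1) :
    pfun (u 0 (exist _ v Hv)) k (c, j) = act j (eps v).
  case: (pselect (smem U v)) => Uv; last by rewrite (u2 _ _ Hv Uv) vert0.
  rewrite (u1 _ _ Uv) /= (epsU (exist _ v Uv)) -smap_nat /=; congr (g _ (_, _)).
    by apply: sig_ext; rewrite /= /degen act_comp; apply: act_eq; apply: mor_ext => t; exact: I1E.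
  exact: esym (mor_id_comp _).
have [|n [x Hx] k c|n x nU a aR aU|w [wu wR]] := @cell_ext K (pathset X)
  (fun n x z => forall k (c : mor k n), pfun z k (c, mor_cst k v1) = act c (f n x)) tr_sub u.
- by move=> m n h x z E k c; rewrite path_actE E smap_nat act_comp.
- case: (pselect (smem U x)) => Ux.
    by rewrite (u1 _ _ Ux) /= g1 -smap_nat.
  have [//|E] := Hx; rewrite (u2 _ _ Hx Ux).
  rewrite -[LHS]/(act (mor_cst k v1) (eps (vert x ord0))).
  have -> : mor_cst k v1 = mor_comp (mor_cst 0 v1) (mor_cst k ord0) by exact: mor_ext.
  have -> : f n x = degen n (f 0 (vert x ord0)) by rewrite [in LHS]E; exact: smap_nat.
  by rewrite -act_comp [act (mor_cst 0 v1) _]eps1 act_degen.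
- case: n x nU a aR aU => [|n] x nU a aR aU; first by case: nU; right; rewrite vert0 degen0.
  have nU' : ~ smem U x by move=> ?; apply: nU; left.
  have [P [spP PP]] := H nU'.
  have vU v : smem tr_sub (v : K 0) by right; rewrite vert0 degen0.
  have aE i H0 k (c : mor k 0) (j : mor k 1) :
      pfun (a 0 (exist _ (mor_cst 0 i : Delta n.+1 0) H0)) k (c, j) = act j (eps (vert x i)).
    by rewrite (aU _ _ (vU _)) uE.
  have [l b k c|H0|i H0|z [z1 z2]] := @prism X qX n (f n.+1 x) a P.
  + by rewrite aR smap_nat act_comp.
  + by rewrite aE act_id.
  + by rewrite aE; exact: PP.
  by exists z.
exists (uncurry_path w); split=> [n x|]; first by rewrite /= wR act_id.
split=> [n [x Ux] j|v].
  have Hx : smem tr_sub x by left.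
  by rewrite /= (wu n (exist _ x Hx)) (u1 _ _ Ux) /=; congr (g _ (_, _)); apply: sig_ext; exact: act_id.
have vU : smem tr_sub v by right; rewrite vert0 degen0.
by rewrite /= smap_nat path_actE (wu 0 (exist _ v vU)) uE act_id.
Qed.

End Transport.

(** * Opposites *)

Definition rvo (b : 'I_2) n (i : 'I_n.+1) : 'I_n.+1 := if val b is 0 then i else rev_ord i.

Lemma rvoK b n : involutive (@rvo b n).
Proof. by case: (I2P b) => -> i //; exact: rev_ordK. Qed.

Lemma rvo1 n (i : 'I_n.+1) : rvo v1 i = rev_ord i.
Proof. by []. Qed.

Lemma rv_mono b m n (f : mor m n) (i j : 'I_m.+1) : i <= j -> rvo b (f (rvo b i)) <= rvo b (f (rvo b j)).
Proof.
case: (I2P b) => -> ij; first exact: mor_mono.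
rewrite !rvo1 /= leq_sub2l // ltnS; apply: mor_mono => /=; exact: leq_sub2l.
Qed.

Definition rv b m n (f : mor m n) : mor m n :=
  @Mor m n (fun i => rvo b (f (rvo b i))) (@rv_mono b m n f).

Lemma rv_id b n : rv b (mor_id n) = mor_id n.
Proof. by apply: mor_ext => i /=; rewrite rvoK. Qed.

Lemma rv_comp b l m n (f : mor l m) (g : mor m n) : rv b (mor_comp g f) = mor_comp (rv b g) (rv b f).
Proof. by apply: mor_ext => i /=; rewrite rvoK. Qed.

Lemma rvK b m n (f : mor m n) : rv b (rv b f) = f.
Proof. by apply: mor_ext => i /=; rewrite !rvoK. Qed.

Lemma rv_cst b m n (i : 'I_n.+1) : rv b (mor_cst m i) = mor_cst m (rvo b i).
Proof. exact: mor_ext. Qed.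

Lemma osset_id b (X : sset) n (x : X n) : act (rv b (mor_id n)) x = x.
Proof. by rewrite rv_id act_id. Qed.

Lemma osset_comp b (X : sset) l m n (f : mor l m) (g : mor m n) (x : X n) :
  act (rv b f) (act (rv b g) x) = act (rv b (mor_comp g f)) x.
Proof. by rewrite rv_comp act_comp. Qed.

(** X itself for b = v0 and its opposite for b = v1, with the same simplices. *)
Definition osset b (X : sset) : sset :=
  @SSet (fun n => X n) (fun m n f x => act (rv b f) x) (@osset_id b X) (@osset_comp b X).

Definition osmap b (X Y : sset) (F : smap X Y) : smap (osset b X) (osset b Y) :=
  @SMap (osset b X) (osset b Y) (fun n x => F n x) (fun m n f x => smap_nat F (rv b f) x).

Definition osub b (X : sset) (U : ssub X) : ssub (osset b X) :=
  @SSub (osset b X) (fun n x => @smem X U n x) (fun m n f x H => smem_act (rv b f) H).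

Lemma overt b (X : sset) n (x : X n) i : vert (x : osset b X n) i = vert x (rvo b i).
Proof. by rewrite /vert /= rv_cst. Qed.

Lemma odegen b (X : sset) n (x : X 0) : degen n (x : osset b X 0) = degen n x.
Proof. by rewrite /degen /= rv_cst; apply: act_eq; apply: mor_ext => t; exact: I1E. Qed.

Lemma rvo_max b n (i : 'I_n.+1) : nat_of_ord (rvo b i) = if val b is 0 then nat_of_ord i else n - i.
Proof. by case: (I2P b) => -> /=; rewrite ?subSS. Qed.

Lemma rv_horn b n (j : 'I_n.+1) l (g : mor l n) :
  smem (horn (rvo b j)) (rv b g : Delta n l) <-> smem (horn j) (g : Delta n l).
Proof.
have aux c (i : 'I_n.+1) (h : mor l n) : smem (horn i) (h : Delta n l) -> smem (horn (rvo c i)) (rv c h : Delta n l).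
  case=> v [vi hv]; exists (rvo c v); split=> [/(can_inj (@rvoK c _))//|k].
  by move=> /(can_inj (@rvoK c _)); exact: hv.
split=> [/(aux b)|]; last exact: aux.
by rewrite rvoK rvK.
Qed.

Lemma rv_boundary b n l (g : mor l n) :
  smem (boundary n) (rv b g : Delta n l) <-> smem (boundary n) (g : Delta n l).
Proof.
have aux c (h : mor l n) : smem (boundary n) (h : Delta n l) -> smem (boundary n) (rv c h : Delta n l).
  by case=> v hv; exists (rvo c v) => k /(can_inj (@rvoK c _)); exact: hv.
split=> [/(aux b)|]; last exact: aux.
by rewrite rvK.
Qed.

Section OpMap.
Variables (b : 'I_2) (X : sset) (n : nat) (U V : ssub (Delta n)).
Hypothesis UV : forall l (g : mor l n), smem U (rv b g : Delta n l) <-> smem V (g : Delta n l).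
Variable h : smap V (osset b X).

Lemma op_mem l (g : U l) : smem V (rv b (sval g : mor l n) : Delta n l).
Proof. by apply/UV; rewrite rvK; exact: (svalP g). Qed.

Definition op_fun l (g : U l) : X l := h l (exist _ _ (op_mem g)).

Lemma op_sub_nat l m (f : mor l m) (g : U m) : op_fun (act f g) = act f (op_fun g).
Proof.
rewrite /op_fun; set x := exist _ _ _; set y := exist _ _ (op_mem g).
have -> : x = act (rv b f) (y : V m) by apply: sig_ext; exact: rv_comp.
by rewrite smap_nat; exact: (@act_eq X _ _ _ _ (h m y) (rvK b f)).
Qed.

Definition op_sub : smap U X := @SMap U X op_fun op_sub_nat.

Lemma op_subE l (g : mor l n) H : op_sub l (exist _ (rv b g : Delta n l) H) = h l (exist _ (g : Delta n l) ((UV g).1 H)).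
Proof. by apply: (@sub_eq _ (osset b X) V h); exact: rvK. Qed.

End OpMap.

Lemma osset_fill b (X : sset) n (U V : ssub (Delta n))
   (UV : forall l (g : mor l n), smem U (rv b g : Delta n l) <-> smem V (g : Delta n l))
   (h : smap V (osset b X)) :
   (exists y : X n, forall l (g : U l), op_sub UV h l g = act (sval g : mor l n) y) ->
   exists y : osset b X n, forall l (g : V l), h l g = act (sval g : mor l n) y.
Proof.
case=> y yh; exists y => l [g Vg]; have Ug := (UV l g).2 Vg.
rewrite -[RHS](yh l (exist _ _ Ug)) op_subE; exact: (@sub_eq _ (osset b X) V h).
Qed.

Lemma osset_qcat b (X : sset) : infty_category X -> infty_category (osset b X).
Proof.
move=> qX; apply: qcat_of_fill => n i Hi h.
apply: (osset_fill (UV := fun l g => rv_horn b i g)).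
by apply: qfill => //; rewrite rvo_max; case: (I2P b) => -> //=; lia.
Qed.

Section TransportOp.
Variables (X : sset) (qX : infty_category X) (K : sset) (U : ssub K) (f : smap K X).
Variables (g : smap (sprod U (Delta 1)) X) (eps : K 0 -> X 1).
Hypothesis g0 : forall n (x : U n), g n (x, mor_cst n v0) = f n (sval x).
Hypothesis epsU : forall x : U 0, eps (sval x) = g 1 (degen 1 x, mor_id 1).
Hypothesis eps0 : forall v, vert (eps v) v0 = f 0 v.
Hypothesis H : forall n (x : K n.+1), ~ smem U x ->
  exists P : X 0 -> Prop, @special (osset v1 X) P (eps (vert x ord0)) /\ forall i, P (vert (eps (vert x i)) v1).

Lemma rvo_v0 : rvo v1 v0 = v1. Proof. exact: val_inj. Qed.
Lemma rvo_v1 : rvo v1 v1 = v0. Proof. exact: val_inj. Qed.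

Let K' := osset v1 K.
Let U' := osub v1 U.

Lemma oprod_nat m n (h : mor m n) (x : sprod U' (Delta 1) n) :
  g m (exist (@smem _ U m) (sval (act h x).1) (svalP (act h x).1), rv v1 (act h x).2) =
  act (rv v1 h) (g n (exist (@smem _ U n) (sval x.1) (svalP x.1), rv v1 x.2)).
Proof.
rewrite -smap_nat; congr (g _ (_, _)); first exact: sig_ext.
by rewrite /= rv_comp.
Qed.

(** The preceding statement in the opposite of X, with Delta^1 reversed as well; the special edge is
    now needed at the first vertex. *)
Lemma transport_op : exists w : smap (sprod K (Delta 1)) X,
  (forall n x, w n (x, mor_cst n v0) = f n x) /\
  (forall n (x : U n) j, w n (sval x, j) = g n (x, j)) /\
  forall v, w 1 (degen 1 v, mor_id 1) = eps v.
Proof.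
have [n [x Hx]|[x Hx]|v|n x nU|w [w1 [w2 w3]]] := @transport (osset v1 X) (@osset_qcat v1 _ qX) K' U' (osmap v1 f)
  (@SMap (sprod U' (Delta 1)) (osset v1 X) _ oprod_nat) eps.
- by rewrite /= rv_cst rvo_v1 g0.
- rewrite /= rv_id (epsU (exist _ x Hx)); congr (g _ (_, _)).
  by apply: sig_ext; rewrite /= rv_cst; apply: act_eq; apply: mor_ext => t; exact: I1E.
- by rewrite overt rvo_v1 eps0.
- have [P [P1 P2]] := H nU; exists P; split.
    rewrite overt; suff -> : rvo v1 ord_max = ord0 :> 'I_n.+2 by [].
    by apply: val_inj; rewrite /= subnn.
  by move=> i; rewrite overt rvo_v0 overt; exact: P2.
have wN m n (h : mor m n) (x : sprod K (Delta 1) n) :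
    w m ((act h x).1, rv v1 (act h x).2) = @act X _ _ h (w n (x.1, rv v1 x.2)).
  have := smap_nat w (rv v1 h) ((x.1, rv v1 x.2) : sprod K' (Delta 1) n).
  move=> E; apply: etrans (etrans E _).
    congr (w m _); congr pair; last exact: rv_comp.
    exact/esym/(@act_eq K _ _ _ _ x.1 (rvK v1 h)).
  exact: (@act_eq X _ _ _ _ (w n _) (rvK v1 h)).
exists (@SMap (sprod K (Delta 1)) X (fun n x => w n (x.1, rv v1 x.2)) wN).
split=> [n x|]; first by rewrite /= rv_cst rvo_v0 w1.
split=> [n x j|v] /=.
  by rewrite (w2 n (exist _ (sval x) (svalP x))) /= rvK; congr (g _ (_, _)); exact: sig_ext.
by rewrite rv_id -(odegen v1) w3.
Qed.

End TransportOp.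

(** * Horns from faces and composition of edges *)

Ltac mor_ord := apply: mor_eqP; move=> [[|[|[|[|//]]]] ?]; rewrite /= /bump ?inordK //.

(** A simplex of the horn may lie on several faces. Two such faces meet in codimension 2, where the
    simplicial identities give equal values; so any of them may be used to define the map. *)
Lemma horn_faces (X : sset) n (j : 'I_n.+3) (x : 'I_n.+3 -> X n.+1) :
  (forall i k : 'I_n.+3, i < k -> i <> j -> k <> j ->
     face (inord i) (x k) = face (inord k.-1) (x i)) ->
  exists h : smap (horn j) X, forall l (g : horn j l) i, i <> j ->
    (forall k, (sval g : mor l n.+2) k <> i) -> h l g = act (mor_comp (cod i) (sval g)) (x i).
Proof.
move=> xc.
have comp l (g : mor l n.+2) (i k : 'I_n.+3) : i <> j -> k <> j -> (forall t, g t <> i) -> (forall t, g t <> k) ->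
    act (mor_comp (cod i) g) (x i) = act (mor_comp (cod k) g) (x k).
  wlog ik : i k / i < k.
    move=> W ij kj gi gk; case: (ltngtP i k) => [ik|ki|/val_inj ->] //; first exact: W.
    by apply/esym; exact: W.
  move=> ij kj gi gk; have Hi := ltn_ord i; have Hk := ltn_ord k.
  have E : face (inord i) (x k) = face (inord k.-1) (x i) by exact: xc.
  have [g' [-> ->]] : exists g', mor_comp (cod k) g = mor_comp (coface (inord i)) g' /\
      mor_comp (cod i) g = mor_comp (coface (inord k.-1)) g'.
    exists (mor_comp (cod (inord i)) (mor_comp (cod k) g)); split.
      rewrite coface_cod // => t /(congr1 val); rewrite /= inordK; last by lia.
      have := ltn_ord (g t); have : nat_of_ord (g t) <> i by move=> /val_inj; exact: gi.
      have : nat_of_ord (g t) <> k by move=> /val_inj; exact: gk.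
      by case: ifP; lia.
    apply: mor_eqP => t /=; rewrite /bump !inordK; [|lia..].
    have := ltn_ord (g t); have : nat_of_ord (g t) <> i by move=> /val_inj; exact: gi.
    have : nat_of_ord (g t) <> k by move=> /val_inj; exact: gk.
    by case: (ltnP k (g t)); case: (ltnP i (g t)); repeat case: ifP; lia.
  by rewrite -!act_comp -[act (coface _) (x i)]/(face _ _) -E.
have pick l (g : horn j l) : exists i, i <> j /\ forall k, (sval g : mor l n.+2) k <> i by exact: (svalP g).
pose h l (g : horn j l) := act (mor_comp (cod (sval (cid (pick l g)))) (sval g)) (x (sval (cid (pick l g)))).
have hE l (g : horn j l) i : i <> j -> (forall k, (sval g : mor l n.+2) k <> i) -> h l g = act (mor_comp (cod i) (sval g)) (x i).
  by move=> ij gi; rewrite /h; case: (cid _) => k [kj gk] /=; exact: comp.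
have hN l m (f : mor l m) (g : horn j m) : h l (act f g) = act f (h m g).
  have [i [ij gi]] := pick m g; rewrite (hE _ _ _ ij gi) (hE _ (act f g) i ij) => [|k]; last exact: gi.
  by rewrite act_comp mor_compA.
by exists (@SMap (horn j) X h hN).
Qed.

Lemma coface_horn n (i j : 'I_n.+2) : i <> j -> smem (horn j) (coface i : Delta n.+1 n).
Proof. by move=> ij; exists i; split=> // k /esym/eqP; rewrite /= (negbTE (neq_lift _ _)). Qed.

Lemma qfill_faces (X : sset) (qX : infty_category X) n (j : 'I_n.+3) (x : 'I_n.+3 -> X n.+1) :
  0 < j < n.+2 ->
  (forall i k : 'I_n.+3, i < k -> i <> j -> k <> j ->
     face (inord i) (x k) = face (inord k.-1) (x i)) ->
  exists y : X n.+2, forall i, i <> j -> face i y = x i.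
Proof.
move=> Hj /horn_faces [h hE]; have [y yE] := qfill qX Hj h.
exists y => i ij; rewrite /face -(yE _ (exist _ _ (coface_horn ij))) (hE _ _ i ij) /=.
  by rewrite cod_coface act_id.
by move=> k /esym/eqP; rewrite (negbTE (neq_lift _ _)).
Qed.

Lemma src_face (X : sset) (e : X 1) : src e = face (inord 1) e.
Proof. by apply: act_eq; apply: mor_eqP => i /=; rewrite inordK // (ord1 i). Qed.

Lemma tgt_face (X : sset) (e : X 1) : tgt e = face (inord 0) e.
Proof. by apply: act_eq; apply: mor_eqP => i /=; rewrite inordK // (ord1 i). Qed.

Lemma face_face (X : sset) n (x : X n.+2) (i : 'I_n.+2) (j : 'I_n.+3) (i' : 'I_n.+2) (j' : 'I_n.+3) :
  mor_comp (coface j) (coface i) = mor_comp (coface j') (coface i') -> face i (face j x) = face i' (face j' x).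
Proof. by move=> E; rewrite /face !act_comp E. Qed.

Section Triangles.
Variables (X : sset) (qX : infty_category X).
Notation T := (@edge_comp X).
Notation one x := (degen 1 x).

Lemma T_ends (f g h : X 1) : T f g h -> [/\ src h = src f, tgt f = src g & tgt h = tgt g].
Proof.
by case=> s [<- <- <-]; split; rewrite ?src_face ?tgt_face; apply: face_face;
  mor_ord.
Qed.

(** Inner horns of dimension 3 given by their faces. The entry at the missing index j is arbitrary,
    every condition on it being void. *)
Lemma T_assoc (j : 'I_4) (s0 s1 s2 s3 : X 2) : 0 < j < 3 ->
  (j <> 0 :> nat -> j <> 1 :> nat -> face (inord 0) s1 = face (inord 0) s0) ->
  (j <> 0 :> nat -> j <> 2 :> nat -> face (inord 0) s2 = face (inord 1) s0) ->
  (j <> 0 :> nat -> j <> 3 :> nat -> face (inord 0) s3 = face (inord 2) s0) ->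
  (j <> 1 :> nat -> j <> 2 :> nat -> face (inord 1) s2 = face (inord 1) s1) ->
  (j <> 1 :> nat -> j <> 3 :> nat -> face (inord 1) s3 = face (inord 2) s1) ->
  (j <> 2 :> nat -> j <> 3 :> nat -> face (inord 2) s3 = face (inord 2) s2) ->
  exists y : X 3, [/\ j <> 0 :> nat -> face (inord 0) y = s0, j <> 1 :> nat -> face (inord 1) y = s1,
     j <> 2 :> nat -> face (inord 2) y = s2 & j <> 3 :> nat -> face (inord 3) y = s3].
Proof.
move=> Hj E01 E02 E03 E12 E13 E23.
pose x (i : 'I_4) := match nat_of_ord i with 0 => s0 | 1 => s1 | 2 => s2 | _ => s3 end.
have [//||y yx] := @qfill_faces X qX 1 j x.
  move=> i k ik ij kj.
  have {}ij : nat_of_ord j <> i by move=> /val_inj/esym.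
  have {}kj : nat_of_ord j <> k by move=> /val_inj/esym.
  move: i k ik ij kj => [[|[|[|[|//]]]] Hi] [[|[|[|[|//]]]] Hk] //= _ ij kj; rewrite /x /=.
exists y; split=> nj; rewrite yx /x ?inordK // => E; apply: nj; rewrite -E inordK //.
Qed.

(** Fills the horn at the vertex 2 of the 3-simplex with consecutive edges f, g, h and takes the
    missing face. In the call, the repeated triangle is a placeholder for that face. *)
Lemma T_assocl (f g h p q k : X 1) : T f g p -> T g h q -> T p h k -> T f q k.
Proof.
move=> [s3 [a3 b3 c3]] [s0 [a0 b0 c0]] [s1 [a1 b1 c1]].
have [//|||||||y [y0 y1 _ y3]] := @T_assoc (inord 2) s0 s1 s1 s3;
  rewrite ?inordK // ?(a3, b3, c3, a0, b0, c0, a1, b1, c1) //.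
rewrite !inordK // in y0 y1 y3; exists (face (inord 2) y); split.
- rewrite -a3 -y3 //; apply: face_face; mor_ord.
- rewrite -c0 -y0 //; apply: face_face; mor_ord.
- rewrite -c1 -y1 //; apply: face_face; mor_ord.
Qed.

Lemma T_assocr (f g h p q k : X 1) : T f g p -> T g h q -> T f q k -> T p h k.
Proof.
move=> [s3 [a3 b3 c3]] [s0 [a0 b0 c0]] [s2 [a2 b2 c2]].
have [//|||||||y [y0 _ y2 y3]] := @T_assoc (inord 1) s0 s2 s2 s3;
  rewrite ?inordK // ?(a3, b3, c3, a0, b0, c0, a2, b2, c2) //.
rewrite !inordK // in y0 y2 y3; exists (face (inord 1) y); split.
- rewrite -c3 -y3 //; apply: face_face; mor_ord.
- rewrite -b0 -y0 //; apply: face_face; mor_ord.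
- rewrite -c2 -y2 //; apply: face_face; mor_ord.
Qed.

Lemma face_cod (Y : sset) (e : Y 1) i j : face i (act (cod j) e) = act (mor_comp (cod j) (coface i)) e.
Proof. by rewrite /face act_comp. Qed.

Lemma T_idl (f : X 1) : T (one (src f)) f f.
Proof.
exists (act (cod ord0) f); rewrite !face_cod; split.
- rewrite /degen /src /vert act_comp; apply: act_eq; mor_ord.
- by rewrite -[RHS]act_id; apply: act_eq; mor_ord.
- by rewrite -[RHS]act_id; apply: act_eq; mor_ord.
Qed.

Lemma T_idr (f : X 1) : T f (one (tgt f)) f.
Proof.
exists (act (cod ord_max) f); rewrite !face_cod; split.
- by rewrite -[RHS]act_id; apply: act_eq; mor_ord.
- rewrite /degen /tgt /vert act_comp; apply: act_eq; mor_ord.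
- by rewrite -[RHS]act_id; apply: act_eq; mor_ord.
Qed.

Definition homotopic (f g : X 1) := T f (one (tgt f)) g.

Lemma T_uniq f g p p' : T f g p -> T f g p' -> homotopic p p'.
Proof.
move=> H H'; have [_ _ E] := T_ends H; rewrite /homotopic E.
exact: T_assocr H (T_idr g) H'.
Qed.

Lemma homotopic_sym f g : homotopic f g -> homotopic g f.
Proof. move=> H; exact: T_uniq H (T_idr f). Qed.

Lemma homotopic_comp f g p p' : T f g p -> homotopic p p' -> T f g p'.
Proof.
move=> H H'; have [_ _ E] := T_ends H; rewrite /homotopic E in H'.
exact: T_assocl H (T_idr g) H'.
Qed.

Lemma homotopic_l f g h k : homotopic f g -> T f h k -> T g h k.
Proof.
move=> H H'; have [_ E _] := T_ends H'; rewrite /homotopic E in H.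
exact: T_assocr H (T_idl h) H'.
Qed.

Lemma homotopic_r e f g p : homotopic f g -> T e f p -> T e g p.
Proof.
move=> H H'; have [_ _ E] := T_ends H'.
apply: T_assocl H' H _; rewrite -E; exact: T_idr.
Qed.

(** For an inverse g of f, both h and h' are composites of g followed by k. *)
Lemma T_lcancel f h h' k : edge_equiv f -> T f h k -> T f h' k -> homotopic h h'.
Proof.
case=> g [fg gf] H H'; have [_ E _] := T_ends H.
have aux x : T f x k -> T g k x.
  move=> Hx; have [_ E' _] := T_ends Hx.
  by apply: T_assocl gf Hx _; rewrite E'; exact: T_idl.
exact: T_uniq (aux _ H) (aux _ H').
Qed.

(** [lo] has the values 0, 0, 1 and [hi] the values 0, 1, 1. *)
Definition lo : mor 2 1 := cod (ord0 : 'I_3).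
Definition hi : mor 2 1 := cod (ord_max : 'I_3).

Lemma lohi_face : [/\ mor_comp lo (coface (inord 2)) = mor_cst 1 v0, mor_comp lo (coface (inord 0)) = mor_id 1,
  mor_comp lo (coface (inord 1)) = mor_id 1 &
  [/\ mor_comp hi (coface (inord 2)) = mor_id 1, mor_comp hi (coface (inord 0)) = mor_cst 1 v1 &
  mor_comp hi (coface (inord 1)) = mor_id 1]].
Proof. by split; [..|split]; apply: mor_eqP => i; case: i => [[|[|//]] ?] /=; rewrite /bump !inordK. Qed.

Lemma square_T (s : smap Sq X) :
  T (s 1 (mor_id 1, mor_cst 1 v0)) (s 1 (mor_cst 1 v1, mor_id 1)) (s 1 (mor_id 1, mor_id 1)) /\
  T (s 1 (mor_cst 1 v0, mor_id 1)) (s 1 (mor_id 1, mor_cst 1 v1)) (s 1 (mor_id 1, mor_id 1)).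
Proof.
have [l2 l0 l1 [h2 h0 h1]] := lohi_face.
split; [exists (s 2 (hi, lo))|exists (s 2 (lo, hi))]; rewrite /face -!smap_nat /=.
  by rewrite l0 l1 l2 h0 h1 h2.
by rewrite l0 l1 l2 h0 h1 h2.
Qed.

(** Vertex values of the map Sq -> Delta^2 that collapses the bottom edge: (0,0) and (0,1) go to 0
    and 1, while (1,0) and (1,1) both go to 2. *)
Definition tri_val n (x : Sq n) (i : 'I_n.+1) : nat :=
  if mfun x.1 i == v1 then 2 else mfun x.2 i.

Lemma tri_val_lt n (x : Sq n) i : tri_val x i < 3.
Proof. by rewrite /tri_val; have := ltn_ord (mfun x.2 i); case: ifP; lia. Qed.

Lemma tri_val_mono n (x : Sq n) (i j : 'I_n.+1) : i <= j -> tri_val x i <= tri_val x j.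
Proof.
move=> ij; have := mor_mono x.1 ij; have := mor_mono x.2 ij; rewrite /tri_val.
have := ltn_ord (mfun x.2 i); have := ltn_ord (mfun x.2 j).
by case: (I2P (mfun x.1 i)) => ->; case: (I2P (mfun x.1 j)) => -> /=; lia.
Qed.

Lemma tri_nat m n (f : mor m n) (x : Sq n) :
  @Mor m 2 (fun i => Ordinal (tri_val_lt (act f x) i)) (@tri_val_mono m (act f x)) =
  mor_comp (@Mor n 2 (fun i => Ordinal (tri_val_lt x i)) (@tri_val_mono n x)) f.
Proof. exact: mor_eqP. Qed.

Definition tri_mor : smap Sq (Delta 2) :=
  @SMap Sq (Delta 2) (fun n x => @Mor n 2 (fun i => Ordinal (tri_val_lt x i)) (@tri_val_mono n x)) tri_nat.

Lemma tri_morE n (x : Sq n) (i : 'I_n.+1) :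
  (tri_mor n x : mor n 2) i = (if mfun x.1 i == v1 then 2 else mfun x.2 i) :> nat.
Proof. by []. Qed.

Lemma T_square f g h : T f g h -> exists s : smap Sq X,
  [/\ forall n (j : mor n 1), s n (mor_cst n v0, j) = act j f, forall n (j : mor n 1), s n (j, mor_cst n v1) = act j g,
      forall n (j : mor n 1), s n (mor_cst n v1, j) = degen n (tgt g) & s 1 (mor_id 1, mor_cst 1 v0) = h].
Proof.
case=> s [<- <- <-]; exists (yoneda s \os tri_mor); split.
- move=> n j; rewrite /face act_comp; apply: act_eq; apply: mor_eqP => i.
  by rewrite tri_morE /= inordK //; case: (I2P (j i)) => ->.
- move=> n j; rewrite /face act_comp; apply: act_eq; apply: mor_eqP => i.
  by rewrite tri_morE /= inordK //; case: (I2P (j i)) => ->.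
- move=> n j; rewrite tgt_face /degen /face !act_comp; apply: act_eq; apply: mor_eqP => i.
  by rewrite tri_morE /= !inordK.
- rewrite /face; apply: act_eq; apply: mor_eqP => i.
  by rewrite tri_morE /= inordK //; case: (I2P i) => ->.
Qed.

Lemma edge_equiv_degen (x : X 0) : edge_equiv (degen 1 x).
Proof.
have E i : vert (degen 1 x) i = x by exact: vert_degen.
exists (degen 1 x); rewrite /src /tgt !E; have := T_idl (degen 1 x); rewrite /src E; by split.
Qed.

End Triangles.

Lemma edge_comp_map (X Y : sset) (F : smap X Y) f g h :
  edge_comp f g h -> edge_comp (F 1 f) (F 1 g) (F 1 h).
Proof. by case=> s [<- <- <-]; exists (F 2 s); rewrite /face -!smap_nat. Qed.

Lemma edge_equiv_map (X Y : sset) (F : smap X Y) e : edge_equiv e -> edge_equiv (F 1 e).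
Proof.
case=> g [fg gf]; exists (F 1 g).
have E v : degen 1 (vert (F 1 e) v) = F 1 (degen 1 (vert e v)) by rewrite /vert /degen -!smap_nat.
by rewrite /src /tgt !E; split; exact: edge_comp_map.
Qed.

Lemma homotopic_map (X Y : sset) (F : smap X Y) f g :
  homotopic f g -> homotopic (F 1 f) (F 1 g).
Proof.
by move/(edge_comp_map F); rewrite /homotopic /tgt /vert /degen -!smap_nat.
Qed.

Lemma edge_comp_op (X : sset) (f g h : X 1) : edge_comp f g h -> @edge_comp (osset v1 X) g f h.
Proof.
case=> s [<- <- <-]; exists s; split; apply: (@act_eq X); apply: mor_eqP => i;
  case: i => [[|[|//]] ?]; rewrite /= /bump !inordK //.
Qed.

Lemma edge_comp_o0 (X : sset) (f g h : X 1) : edge_comp f g h -> @edge_comp (osset v0 X) f g h.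
Proof. by case=> s [<- <- <-]; exists s; split; apply: (@act_eq X); exact: mor_ext. Qed.

Lemma edge_equiv_o b (X : sset) (e : X 1) : edge_equiv e -> @edge_equiv (osset b X) e.
Proof.
case: (I2P b) => -> [g [fg gf]]; exists g; rewrite /src /tgt !overt !odegen.
  by split; exact: edge_comp_o0.
by rewrite (rvo_v0 : rvo v1 v0 = v1) (rvo_v1 : rvo v1 v1 = v0); split; exact: edge_comp_op.
Qed.

(** * Joins of simplices *)

Section JoinMaps.
Variable b : 'I_2.

(** The join of Delta^m and Delta^k is Delta^{k+m+1}, with Delta^m in front for b = v0 and behind
    for b = v1. The dimension is written [(k + m).+1] so that it reduces when k is a numeral. *)
Definition jinl m k : mor m (k + m).+1.
refine (@mk_mor m (k + m).+1 (fun i => if val b is 0 then i else k.+1 + i) _ _);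
  by case: (I2P b) => -> /=; lia.
Defined.

Definition jinr m k : mor k (k + m).+1.
refine (@mk_mor k (k + m).+1 (fun i => if val b is 0 then m.+1 + i else i) _ _);
  by case: (I2P b) => -> /=; lia.
Defined.

Definition jlb m k : mor (k + m).+1 1.
refine (@mk_mor (k + m).+1 1 (fun i => if val b is 0 then m < i : nat else k < i : nat) _ _);
  by case: (I2P b) => -> /=; lia.
Defined.

(** A retraction of [jinl]; on the vertices of the other side its values are clamped and
    arbitrary. *)
Definition jpl m k : mor (k + m).+1 m.
refine (@mk_mor (k + m).+1 m (fun i => if val b is 0 then minn i m else i - k.+1) _ _);
  by case: (I2P b) => -> /=; lia.
Defined.

Definition jpr m k : mor (k + m).+1 k.
refine (@mk_mor (k + m).+1 k (fun i => if val b is 0 then i - m.+1 else minn i k) _ _);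
  by case: (I2P b) => -> /=; lia.
Defined.

Lemma jlb_inl m k : mor_comp (jlb m k) (jinl m k) = mor_cst m b.
Proof. by apply: mor_eqP => i /=; have := ltn_ord i; case: (I2P b) => -> /=; lia. Qed.

Lemma jlb_inr m k : mor_comp (jlb m k) (jinr m k) = mor_cst k (vop b).
Proof. by apply: mor_eqP => i /=; have := ltn_ord i; case: (I2P b) => -> /=; lia. Qed.

Lemma jpl_inl m k : mor_comp (jpl m k) (jinl m k) = mor_id m.
Proof. by apply: mor_eqP => i /=; have := ltn_ord i; case: (I2P b) => -> /=; lia. Qed.

Lemma jpr_inr m k : mor_comp (jpr m k) (jinr m k) = mor_id k.
Proof. by apply: mor_eqP => i /=; have := ltn_ord i; case: (I2P b) => -> /=; lia. Qed.

Lemma jinl_pl m k t : jlb m k t = b -> jinl m k (jpl m k t) = t.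
Proof.
move=> /(congr1 val) E; apply: val_inj; move: E => /=; have := ltn_ord t.
by case: (I2P b) => -> /=; lia.
Qed.

Lemma jinr_pr m k t : jlb m k t = vop b -> jinr m k (jpr m k t) = t.
Proof.
move=> /(congr1 val) E; apply: val_inj; move: E => /=; have := ltn_ord t.
by case: (I2P b) => -> /=; lia.
Qed.

Lemma jinl_inr_lt m k i j : if val b is 0 then jinl m k i < jinr m k j else jinr m k j < jinl m k i.
Proof. by have := ltn_ord i; have := ltn_ord j; move=> /=; case: (I2P b) => -> /=; lia. Qed.

Arguments jinl : simpl never.
Arguments jinr : simpl never.
Arguments jlb : simpl never.
Arguments jpl : simpl never.
Arguments jpr : simpl never.

Lemma I2vP (c : 'I_2) : c = b \/ c = vop b.
Proof. by case: (I2P b) => ->; case: (I2P c) => ->; [left|right|right|left]; exact: val_inj. Qed.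

Definition jsel l p q (j : mor l 1) (F : 'I_l.+1 -> 'I_p.+1) (G : 'I_l.+1 -> 'I_q.+1)
  (i : 'I_l.+1) : 'I_(q + p).+2 := if j i == b then jinl p q (F i) else jinr p q (G i).

Lemma jmerge_mono l p q (j : mor l 1) (F : 'I_l.+1 -> 'I_p.+1) (G : 'I_l.+1 -> 'I_q.+1) :
  (forall i i' : 'I_l.+1, i <= i' -> j i = b -> j i' = b -> F i <= F i') ->
  (forall i i' : 'I_l.+1, i <= i' -> j i = vop b -> j i' = vop b -> G i <= G i') ->
  forall i i' : 'I_l.+1, i <= i' ->
    jsel j F G i <= jsel j F G i'.
Proof.
move=> HF HG i i' ii; have jj := mor_mono j ii; have nb := @vop_neq b.
have nb' : (vop b == b) = false by apply/eqP => /esym.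
case: (I2vP (j i)) => E; case: (I2vP (j i')) => E'; rewrite /jsel E E' ?eqxx ?nb'.
- by apply: mor_mono; exact: HF.
- move: jj (jinl_inr_lt (F i) (G i')); rewrite E E'.
  by case: (I2P b) => -> //= _; exact: ltnW.
- move: jj (jinl_inr_lt (F i') (G i)); rewrite E E'.
  by case: (I2P b) => -> //= _; exact: ltnW.
- by apply: mor_mono; exact: HG.
Qed.

Definition jm m k m' k' (f : mor m' m) (g : mor k' k) : mor (k' + m').+1 (k + m).+1 :=
  @Mor _ _ (jsel (jlb m' k') (fun t => f (jpl m' k' t)) (fun t => g (jpr m' k' t)))
   (@jmerge_mono (k' + m').+1 m k (jlb m' k') (fun t => f (jpl m' k' t)) (fun t => g (jpr m' k' t))
    (fun i i' ii _ _ => mor_mono f (mor_mono (jpl m' k') ii))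
    (fun i i' ii _ _ => mor_mono g (mor_mono (jpr m' k') ii))).

(** Sends i to its copy on the side named by j. Every simplex of a join with label j factors through
    this map, so that it is described by two simplices of the same dimension l. *)
Definition jgr l (j : mor l 1) : mor l (l + l).+1 :=
  @Mor _ _ (jsel j id id) (@jmerge_mono l l l j id id (fun i i' ii _ _ => ii) (fun i i' ii _ _ => ii)).

Lemma vopE : (vop b == b) = false.
Proof. by apply/eqP => /esym; exact: vop_neq. Qed.

Lemma jmL m k m' k' (f : mor m' m) (g : mor k' k) t : jlb m' k' t = b -> jm f g t = jinl m k (f (jpl m' k' t)).
Proof. by move=> E; rewrite [LHS]/(jsel _ _ _ _) /jsel E eqxx. Qed.

Lemma jmR m k m' k' (f : mor m' m) (g : mor k' k) t : jlb m' k' t = vop b -> jm f g t = jinr m k (g (jpr m' k' t)).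
Proof. by move=> E; rewrite [LHS]/(jsel _ _ _ _) /jsel E vopE. Qed.

Lemma jgrL l (j : mor l 1) t : j t = b -> jgr j t = jinl l l t.
Proof. by move=> E; rewrite [LHS]/(jsel _ _ _ _) /jsel E eqxx. Qed.

Lemma jgrR l (j : mor l 1) t : j t = vop b -> jgr j t = jinr l l t.
Proof. by move=> E; rewrite [LHS]/(jsel _ _ _ _) /jsel E vopE. Qed.

Lemma jlbl m k i : jlb m k (jinl m k i) = b.
Proof. exact: (mor_eqE i (jlb_inl m k)). Qed.
Lemma jlbr m k i : jlb m k (jinr m k i) = vop b.
Proof. exact: (mor_eqE i (jlb_inr m k)). Qed.
Lemma jpll m k i : jpl m k (jinl m k i) = i.
Proof. exact: (mor_eqE i (jpl_inl m k)). Qed.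
Lemma jprr m k i : jpr m k (jinr m k i) = i.
Proof. exact: (mor_eqE i (jpr_inr m k)). Qed.

Lemma jm_inl m k m' k' (f : mor m' m) (g : mor k' k) : mor_comp (jm f g) (jinl m' k') = mor_comp (jinl m k) f.
Proof. by apply: mor_ext => i; rewrite [LHS](jmL f g (jlbl _ i)) jpll. Qed.

Lemma jm_inr m k m' k' (f : mor m' m) (g : mor k' k) : mor_comp (jm f g) (jinr m' k') = mor_comp (jinr m k) g.
Proof. by apply: mor_ext => i; rewrite [LHS](jmR f g (jlbr _ i)) jprr. Qed.

Lemma jm_split m k (t : 'I_(k + m).+2) :
  (jlb m k t = b /\ jinl m k (jpl m k t) = t) \/ (jlb m k t = vop b /\ jinr m k (jpr m k t) = t).
Proof.
by case: (I2vP (jlb m k t)) => E; [left|right]; split=> //; [exact: jinl_pl|exact: jinr_pr].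
Qed.

Lemma jm_ext m k n (f g : mor (k + m).+1 n) :
  mor_comp f (jinl m k) = mor_comp g (jinl m k) -> mor_comp f (jinr m k) = mor_comp g (jinr m k) -> f = g.
Proof.
move=> El dres; apply: mor_ext => t; case: (jm_split t) => -[_ <-].
  exact: (mor_eqE _ El).
exact: (mor_eqE _ dres).
Qed.

Lemma jm_id m k : jm (mor_id m) (mor_id k) = mor_id (k + m).+1.
Proof. by apply: jm_ext; rewrite ?jm_inl ?jm_inr mor_comp_id mor_id_comp. Qed.

Lemma jm_comp m k m' k' m2 k2 (f : mor m' m) (g : mor k' k) (f' : mor m2 m') (g' : mor k2 k') :
  mor_comp (jm f g) (jm f' g') = jm (mor_comp f f') (mor_comp g g').
Proof.
by apply: jm_ext; rewrite mor_compA ?jm_inl ?jm_inr -mor_compA ?jm_inl ?jm_inr mor_compA.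
Qed.

Lemma jlb_jm m k m' k' (f : mor m' m) (g : mor k' k) : mor_comp (jlb m k) (jm f g) = jlb m' k'.
Proof.
by apply: jm_ext; rewrite mor_compA ?jm_inl ?jm_inr -mor_compA ?jlb_inl ?jlb_inr mor_cst_comp.
Qed.

Lemma jpl_jm m k m' k' (f : mor m' m) (g : mor k' k) t : jlb m' k' t = b ->
  jpl m k (jm f g t) = f (jpl m' k' t).
Proof. by move=> E; rewrite jmL // jpll. Qed.

Lemma jpr_jm m k m' k' (f : mor m' m) (g : mor k' k) t : jlb m' k' t = vop b ->
  jpr m k (jm f g t) = g (jpr m' k' t).
Proof. by move=> E; rewrite jmR // jprr. Qed.

Lemma jm_gr_comp l l' (j : mor l 1) (f : mor l' l) : mor_comp (jgr j) f = mor_comp (jm f f) (jgr (mor_comp j f)).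
Proof.
apply: mor_ext => i; case: (I2vP (j (f i))) => E.
  by rewrite [LHS](jgrL E) -[RHS]/(jm f f (jgr (mor_comp j f) i)) (jgrL (E : mor_comp j f i = b)) (jmL _ _ (jlbl _ _)) jpll.
by rewrite [LHS](jgrR E) -[RHS]/(jm f f (jgr (mor_comp j f) i)) (jgrR (E : mor_comp j f i = vop b)) (jmR _ _ (jlbr _ _)) jprr.
Qed.

Lemma jm_gr l m k (j : mor l 1) (f : mor l m) (g : mor l k) (h : mor l (k + m).+1) :
  (forall i, j i = b -> h i = jinl m k (f i)) -> (forall i, j i = vop b -> h i = jinr m k (g i)) ->
  mor_comp (jm f g) (jgr j) = h.
Proof.
move=> Hl Hr; apply: mor_ext => i; case: (I2vP (j i)) => E; rewrite -[LHS]/(jm f g (jgr j i)).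
  by rewrite (jgrL E) (jmL _ _ (jlbl _ _)) jpll Hl.
by rewrite (jgrR E) (jmR _ _ (jlbr _ _)) jprr Hr.
Qed.

End JoinMaps.

Arguments jinl : simpl never.
Arguments jinr : simpl never.
Arguments jlb : simpl never.
Arguments jpl : simpl never.
Arguments jpr : simpl never.
Arguments jm : simpl never.
Arguments jgr : simpl never.

(** Vertices outside the fiber go to the nearest vertex of the fiber: the last one for c = 0, the
    first one for c = 1. A map on a nonempty fiber thus amounts to a single l-simplex, and the size
    of the fiber never has to be computed. *)
Lemma clamp_ex (c : 'I_2) l (j : mor l 1) : (exists i, j i = c) ->
  exists r : mor l l, mor_comp j r = mor_cst l c /\ forall i, j i = c -> r i = i.
Proof.
case=> i0 E0; case: (I2P c) E0 => -> E0.
  pose q := [arg max_(i > i0 | j i == v0) (i : nat)].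
  have [qE qM] : j q = v0 /\ forall i, j i = v0 -> i <= q.
    by rewrite /q; case: arg_maxnP => [|i /eqP Hi HM]; [rewrite E0|split=> // k /eqP; exact: HM].
  have rm (i i' : 'I_l.+1) : i <= i' -> (if j i == v0 then i else q) <= (if j i' == v0 then i' else q).
    move=> ii; case: eqP => E; case: eqP => E' //; first exact: qM.
    have := mor_mono j ii; rewrite E'; case: (I2P (j i)) => E2; rewrite E2 //.
  exists (Mor rm); split; first by apply: mor_ext => i /=; case: eqP.
  by move=> i /= ->.
pose q := [arg min_(i < i0 | j i == v1) (i : nat)].
have [qE qM] : j q = v1 /\ forall i, j i = v1 -> q <= i.
  by rewrite /q; case: arg_minnP => [|i /eqP Hi HM]; [rewrite E0|split=> // k /eqP; exact: HM].
have rm (i i' : 'I_l.+1) : i <= i' -> (if j i == v1 then i else q) <= (if j i' == v1 then i' else q).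
  move=> ii; case: eqP => E; case: eqP => E' //; last exact: qM.
  have := mor_mono j ii; rewrite E; case: (I2P (j i')) => E2; rewrite E2 //.
exists (Mor rm); split; first by apply: mor_ext => i /=; case: eqP.
by move=> i /= ->.
Qed.

(** * Maps out of a join *)

Section Build.
Variables (b : 'I_2) (G K X : sset).

Notation J := (ojoin b G K).

Lemma fiber_val c n (j : Delta 1 n) k (a : fiber (yoneda j) c k) : mor_comp (j : mor n 1) (sval a : mor k n) = mor_cst k c.
Proof. exact: (svalP a). Qed.

Lemma fiber_valE c n (j : Delta 1 n) k (a : fiber (yoneda j) c k) i : mfun j ((sval a : mor k n) i) = c.
Proof. exact: (mor_eqE i (fiber_val a)). Qed.

Definition clamp c l (j : Delta 1 l) (H : exists i, mfun j i = c) : fiber (yoneda j) c l :=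
  exist _ (sval (cid (clamp_ex H))) (proj1 (svalP (cid (clamp_ex H)))).

Lemma clampP c l (j : Delta 1 l) (H : exists i, mfun j i = c) i : mfun j i = c -> (sval (clamp H) : mor l l) i = i.
Proof. exact: (proj2 (svalP (cid (clamp_ex H)))). Qed.

Lemma clampE c l (j : Delta 1 l) (H : exists i, mfun j i = c) Y (F : smap (fiber (yoneda j) c) Y) k (a : fiber (yoneda j) c k) :
  F k a = act (sval a : mor k l) (F l (clamp H)).
Proof.
rewrite -smap_nat; congr (F k _); apply: sig_ext; apply: mor_ext => i /=.
by rewrite clampP // fiber_valE.
Qed.

(** The simplex of the join spanned by g and x. *)
Definition jiota m k (g : G m) (x : K k) : J (k + m).+1 :=
  @JoinSimplex b G K (k + m).+1 (jlb b m k : Delta 1 _)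
    (yoneda (act (jpl b m k) g) \os incl _) (yoneda (act (jpr b m k) x) \os incl _).

Lemma jiota_act m k m' k' (f : mor m' m) (f' : mor k' k) (g : G m) (x : K k) :
  act (jm b f f') (jiota g x) = jiota (act f g) (act f' x).
Proof.
apply: join_ext => [|l a P Q|l a P Q] /=; first exact: jlb_jm.
- rewrite !act_comp; apply: act_eq; apply: mor_ext => i.
  by rewrite -[LHS]/(jpl b m k (jm b f f' (mfun a i))) jpl_jm //; exact: (mor_eqE i Q).
- rewrite !act_comp; apply: act_eq; apply: mor_ext => i.
  by rewrite -[LHS]/(jpr b m k (jm b f f' (mfun a i))) jpr_jm //; exact: (mor_eqE i Q).
Qed.

Lemma fiber_opp_empty n k : fiber (@yoneda (Delta 1) n (mor_cst n b)) (vop b) k -> False.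
Proof.
case=> a /(congr1 (fun g : mor k 1 => g ord0)) /= E.
exact: (vop_neq E).
Qed.

Definition from_fiber_opp (Y : sset) n : smap (fiber (@yoneda (Delta 1) n (mor_cst n b)) (vop b)) Y :=
  SMap (sfun := fun k a => False_rect (Y k) (fiber_opp_empty a))
    (fun m k f a => False_ind _ (fiber_opp_empty a)).

Definition jleft_fun n (g : G n) : J n :=
  @JoinSimplex b G K n (mor_cst n b : Delta 1 n) (yoneda g \os incl _) (from_fiber_opp K n).

Lemma jleft_nat m n (f : mor m n) (g : G n) : jleft_fun (act f g) = act f (jleft_fun g).
Proof.
apply: join_ext => [|k a P Q|k a P Q] /=; first exact: mor_ext.
- exact: act_comp.
- by case: (fiber_opp_empty (exist _ a P)).
Qed.

Definition jleft : smap G J := @SMap G J jleft_fun jleft_nat.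

(** One of the two sides may be empty. If both occur, the simplex is the restriction along [jgr] of
    the one spanned by its two clamped parts. *)
Lemma join_cases l (z : J l) :
  [\/ exists Hl : exists i, mfun (jlab z) i = b, exists Hr : exists i, mfun (jlab z) i = vop b,
        z = act (jgr b (jlab z)) (jiota (jfst z l (clamp Hl)) (jsnd z l (clamp Hr))),
      exists Hl : exists i, mfun (jlab z) i = b, jlab z = mor_cst l b /\ z = jleft l (jfst z l (clamp Hl)) |
      exists Hr : exists i, mfun (jlab z) i = vop b, jlab z = mor_cst l (vop b) /\ z = ojoin_in b G K l (jsnd z l (clamp Hr))].
Proof.
case: (pselect (exists i, mfun (jlab z) i = b)) => [Hl|nl]; last first.
  have Ej : jlab z = mor_cst l (vop b).
    by apply: mor_ext => i; case: (I2vP b (mfun (jlab z) i)) => // E; case: nl; exists i.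
  have Hr : exists i, mfun (jlab z) i = vop b by exists ord0; rewrite Ej.
  apply: Or33; exists Hr; split=> //; apply: join_ext => //= k a P Q.
    by case: (fiber_cst_empty (exist _ a Q)).
  exact: clampE.
case: (pselect (exists i, mfun (jlab z) i = vop b)) => [Hr|nr]; last first.
  have Ej : jlab z = mor_cst l b.
    by apply: mor_ext => i; case: (I2vP b (mfun (jlab z) i)) => // E; case: nr; exists i.
  apply: Or32; exists Hl; split=> //; apply: join_ext => //= k a P Q.
    exact: clampE.
  by case: (fiber_opp_empty (exist _ a Q)).
apply: Or31; exists Hl, Hr; apply: join_ext => [|k a P Q|k a P Q] /=.
- apply: mor_ext => i; rewrite -[RHS]/(jlb b l l (jgr b (jlab z) i)).
  by case: (I2vP b (mfun (jlab z) i)) => E; rewrite ?(jgrL E) ?(jgrR E) ?jlbl ?jlbr.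
- rewrite (clampE Hl) act_comp; apply: act_eq; apply: mor_ext => i.
  rewrite -[RHS]/(jpl b l l (jgr b (jlab z) (mfun a i))) jgrL ?jpll //.
  exact: (mor_eqE i P).
- rewrite (clampE Hr) act_comp; apply: act_eq; apply: mor_ext => i.
  rewrite -[RHS]/(jpr b l l (jgr b (jlab z) (mfun a i))) jgrR ?jprr //.
  exact: (mor_eqE i P).
Qed.

Lemma join_smap_ext (F F' : smap J X) :
  (forall n g, F n (jleft n g) = F' n (jleft n g)) ->
  F \os ojoin_in b G K = F' \os ojoin_in b G K ->
  (forall m k (g : G m) (x : K k), F _ (jiota g x) = F' _ (jiota g x)) -> F = F'.
Proof.
move=> El dres Ei; apply: smap_ext => l z; case: (join_cases z) => [[Hl [Hr ->]]|[Hl [_ ->]]|[Hr [_ ->]]].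
- by rewrite !smap_nat Ei.
- exact: El.
- by have := congr1 (fun H : smap K X => H l (jsnd z l (clamp Hr))) dres.
Qed.

Variables (al : smap G X) (s : smap K X).
Variable R : forall m k, G m -> K k -> Prop.
Hypothesis Ract : forall m k m' k' (f : mor m' m) (f' : mor k' k) (g : G m) (x : K k),
  R g x -> R (act f g) (act f' x).
Variable y : forall m k (g : G m) (x : K k), R g x -> X (k + m).+1.
Hypothesis ynat : forall m k m' k' (f : mor m' m) (f' : mor k' k) (g : G m) (x : K k) r r',
  @y m' k' (act f g) (act f' x) r' = act (jm b f f') (@y m k g x r).
Hypothesis yl : forall m k (g : G m) (x : K k) r, act (jinl b m k) (@y m k g x r) = al m g.
Hypothesis yr : forall m k (g : G m) (x : K k) r, act (jinr b m k) (@y m k g x r) = s k x.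

Lemma join_sub_act m n (f : mor m n) (z : J n) :
  (forall k a a', R (jfst z k a) (jsnd z k a')) ->
  forall k a a', R (jfst (act f z) k a) (jsnd (act f z) k a').
Proof. by move=> H k a a'; exact: H. Qed.

(** The condition is void on simplices of G or of K alone. Taking for R membership of one part in a
    subobject, one obtains unions such as (boundary * K) u (G * L). *)
Definition join_sub : ssub J := @SSub J _ join_sub_act.

Definition build_fun l (z : join_sub l) : X l :=
  match pselect (exists i, mfun (jlab (sval z)) i = b), pselect (exists i, mfun (jlab (sval z)) i = vop b) with
  | left Hl, left Hr => act (jgr b (jlab (sval z))) (y (svalP z l (clamp Hl) (clamp Hr)))
  | left Hl, right _ => al l (jfst (sval z) l (clamp Hl))
  | right _, left Hr => s l (jsnd (sval z) l (clamp Hr))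
  | right nl, right nr => False_rect _ (match I2vP b (mfun (jlab (sval z)) ord0) with
       | or_introl E => nl (ex_intro _ ord0 E) | or_intror E => nr (ex_intro _ ord0 E) end)
  end.

Lemma yE m k (g g' : G m) (x x' : K k) r r' : g = g' -> x = x' -> @y m k g x r = @y m k g' x' r'.
Proof. by move=> Eg Ex; subst; congr y; exact: Prop_irrelevance. Qed.

(** Restriction along f can empty one side, and then [yl] or [yr] identifies what remains; a side
    cannot become nonempty, which excludes the other combinations. *)
Lemma build_nat m n (f : mor m n) (z : join_sub n) : build_fun (act f z) = act f (build_fun z).
Proof.
case: z => z Hz; rewrite /build_fun /=.
have R2 (p : G n) (q : K n) (r : R p q) : R (act f p) (act f q) by exact: Ract.
case: pselect => Hl'; case: pselect => Hr'; case: pselect => Hl; case: pselect => Hr //.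
- set r := (X in act (jgr b (jlab z)) (y X)).
  rewrite act_comp jm_gr_comp -act_comp -(ynat r (R2 _ _ r)).
  set r2 := R2 _ _ r; set r1 := (X in y X).
  have r3 : R (act (sval (@clamp b m (act f (jlab z)) Hl') : mor m m) (act f (jfst z n (clamp Hl))))
              (act (sval (@clamp (vop b) m (act f (jlab z)) Hr') : mor m m) (act f (jsnd z n (clamp Hr)))) by exact: Ract.
  transitivity (act (jgr b (mor_comp (jlab z : mor n 1) f)) (y r3)).
    congr act; apply: yE; rewrite act_comp; exact: clampE.
  rewrite (ynat r2 r3) act_comp; congr (act _ _); apply: jm_gr => i E.
    by rewrite (jgrL E) clampP.
  by rewrite (jgrR E) clampP.
- by case: Hr; case: Hr' => i E; exists (f i).
- by case: Hl; case: Hl' => i E; exists (f i).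
- by case: Hl; case: Hl' => i E; exists (f i).
- have E : mor_comp (jlab z : mor n 1) f = mor_cst m b.
    by apply: mor_ext => i; case: (I2vP b (mfun (jlab z) (f i))) => // E; case: Hr'; exists i.
  set r := (X in act (jgr b (jlab z)) (y X)).
  rewrite act_comp jm_gr_comp -act_comp -(ynat r (R2 _ _ r)).
  have -> : jgr b (mor_comp (jlab z : mor n 1) f) = jinl b m m.
    by apply: mor_ext => i; rewrite jgrL // E.
  rewrite yl (clampE Hl) /=; congr (al m _); apply: act_eq; apply: mor_ext => i /=.
  by rewrite clampP // (mor_eqE i E).
- rewrite -smap_nat (clampE Hl) /=; congr (al m _); apply: act_eq; apply: mor_ext => i /=.
  by rewrite clampP //; case: (I2vP b (mfun (jlab z) (f i))) => // E; case: Hr'; exists i.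
- by case: Hl; case: Hl' => i E; exists (f i).
- by case: Hl; case: Hl' => i E; exists (f i).
- have E : mor_comp (jlab z : mor n 1) f = mor_cst m (vop b).
    by apply: mor_ext => i; case: (I2vP b (mfun (jlab z) (f i))) => // E; case: Hl'; exists i.
  set r := (X in act (jgr b (jlab z)) (y X)).
  rewrite act_comp jm_gr_comp -act_comp -(ynat r (R2 _ _ r)).
  have -> : jgr b (mor_comp (jlab z : mor n 1) f) = jinr b m m.
    by apply: mor_ext => i; rewrite jgrR // E.
  rewrite yr (clampE Hr) /=; congr (s m _); apply: act_eq; apply: mor_ext => i /=.
  by rewrite clampP // (mor_eqE i E).
- by case: Hr; case: Hr' => i E; exists (f i).
- rewrite -smap_nat (clampE Hr) /=; congr (s m _); apply: act_eq; apply: mor_ext => i /=.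
  by rewrite clampP //; case: (I2vP b (mfun (jlab z) (f i))) => // E; case: Hl'; exists i.
- by case: Hr; case: Hr' => i E; exists (f i).
- by case: (I2vP b (mfun (jlab z) (f ord0))) => E; [case: Hl'|case: Hr']; exists ord0.
- by case: (I2vP b (mfun (jlab z) (f ord0))) => E; [case: Hl'|case: Hr']; exists ord0.
- by case: (I2vP b (mfun (jlab z) (f ord0))) => E; [case: Hl'|case: Hr']; exists ord0.
- by case: (I2vP b (mfun (jlab z) (f ord0))) => E; [case: Hl'|case: Hr']; exists ord0.
Qed.

Definition build : smap join_sub X := SMap build_nat.

Lemma build_iota m k (g : G m) (x : K k) r H : build _ (exist _ (jiota g x) H) = @y m k g x r.
Proof.
rewrite /build [LHS]/= /build_fun [sval _]/=; case: pselect => Hl; last first.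
  by case: Hl; exists (jinl b m k ord0); exact: jlbl.
case: pselect => Hr; last by case: Hr; exists (jinr b m k ord0); exact: jlbr.
set r' := (X in y X).
have r3 : R (act (mor_comp (jpl b m k) (sval (clamp Hl) : mor (k+m).+1 _)) g) (act (mor_comp (jpr b m k) (sval (clamp Hr) : mor (k+m).+1 _)) x).
  exact: Ract.
have -> : y r' = y r3 by apply: yE; exact: act_comp.
rewrite (ynat r r3) act_comp -[RHS]act_id.
congr (act _ _); apply: jm_gr => i E.
  rewrite -[RHS]/(jinl b m k (jpl b m k ((sval (clamp Hl) : mor (k + m).+1 _) i))).
  by rewrite clampP // jinl_pl.
rewrite -[RHS]/(jinr b m k (jpr b m k ((sval (clamp Hr) : mor (k + m).+1 _) i))).
by rewrite clampP // jinr_pr.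
Qed.

Lemma build_left n (g : G n) H : build _ (exist _ (jleft n g) H) = al n g.
Proof.
rewrite /build [LHS]/= /build_fun [sval _]/=; case: pselect => Hl; last by case: Hl; exists ord0.
case: pselect => Hr; first by case: Hr => i /= E; case: (@vop_neq b).
by congr (al n _); rewrite -[RHS]act_id; apply: act_eq; apply: mor_ext => i; exact: clampP.
Qed.

Lemma build_right n (x : K n) H : build _ (exist _ (ojoin_in b G K n x) H) = s n x.
Proof.
rewrite /build [LHS]/= /build_fun [sval _]/=; case: pselect => Hl.
  by case: Hl => i /= E; case: (@vop_neq b).
case: pselect => Hr; last by case: Hr; exists ord0.
by congr (s n _); rewrite -[RHS]act_id; apply: act_eq; apply: mor_ext => i; exact: clampP.
Qed.

End Build.

Section BuildAll.
Variables (b : 'I_2) (G K X : sset) (al : smap G X) (s : smap K X).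
Variable y : forall m k, G m -> K k -> X (k + m).+1.
Hypothesis ynat : forall m k m' k' (f : mor m' m) (f' : mor k' k) (g : G m) (x : K k),
  y (act f g) (act f' x) = act (jm b f f') (y g x).
Hypothesis yl : forall m k (g : G m) (x : K k), act (jinl b m k) (y g x) = al m g.
Hypothesis yr : forall m k (g : G m) (x : K k), act (jinr b m k) (y g x) = s k x.

Lemma build_all_ex : exists F : smap (ojoin b G K) X,
  [/\ forall m k (g : G m) (x : K k), F _ (jiota b g x) = y g x,
      forall m (g : G m), F _ (jleft b G K _ g) = al m g &
      F \os ojoin_in b G K = s].
Proof.
pose R m k (g : G m) (x : K k) := True.
pose B := @build b G K X al s R (fun _ _ _ _ _ _ _ _ _ => I) (fun m k g x _ => y g x)
    (fun m k m' k' f f' g x _ _ => ynat f f' g x) (fun m k g x _ => yl g x) (fun m k g x _ => yr g x).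
exists (B \os @sub_corestr _ _ (@join_sub b G K R) (sid _) (fun _ _ _ _ _ => I)); split.
- move=> m k g x; exact: (@build_iota b G K X al s R _ (fun m k g x _ => y g x) _ _ _ m k g x I).
- move=> m g; exact: (@build_left b G K X al s R).
- apply: smap_ext => n x; exact: (@build_right b G K X al s R).
Qed.

Definition build_all : smap (ojoin b G K) X := sval (cid build_all_ex).

Lemma build_all_iota m k (g : G m) (x : K k) : build_all _ (jiota b g x) = y g x.
Proof. by rewrite /build_all; case: cid => F [Fi Fl Fr] /=; exact: Fi. Qed.

Lemma build_all_left m (g : G m) : build_all _ (jleft b G K _ g) = al m g.
Proof. by rewrite /build_all; case: cid => F [Fi Fl Fr] /=; exact: Fl. Qed.

Lemma build_all_in : build_all \os ojoin_in b G K = s.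
Proof. by rewrite /build_all; case: cid => F [Fi Fl Fr] /=; exact: Fr. Qed.

End BuildAll.

Lemma ojoin_map_iota b (G G' K K' : sset) (F : smap G G') (H : smap K K') m k (g : G m) (x : K k) :
  ojoin_map b F H _ (jiota b g x) = jiota b (F m g) (H k x).
Proof. by apply: join_ext => //= l a P Q; rewrite !smap_nat. Qed.

Lemma ojoin_map_left b (G G' K K' : sset) (F : smap G G') (H : smap K K') m (g : G m) :
  ojoin_map b F H _ (jleft b G K m g) = jleft b G' K' m (F m g).
Proof.
apply: join_ext => //= l a P Q; first by rewrite smap_nat.
by case: (fiber_opp_empty (exist _ a P)).
Qed.

Lemma iota_inl b (G K : sset) m k (g : G m) (x : K k) : act (jinl b m k) (jiota b g x) = jleft b G K m g.
Proof.
apply: join_ext => [|l a P Q|l a P Q] /=; first exact: jlb_inl.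
  by rewrite -act_comp (act_comp (jinl b m k)) jpl_inl act_id.
by case: (fiber_opp_empty (exist _ a Q)).
Qed.

Lemma iota_inr b (G K : sset) m k (g : G m) (x : K k) : act (jinr b m k) (jiota b g x) = ojoin_in b G K k x.
Proof.
apply: join_ext => [|l a P Q|l a P Q] /=; first exact: jlb_inr.
  by case: (fiber_cst_empty (exist _ a Q)).
by rewrite -act_comp (act_comp (jinr b m k)) jpr_inr act_id.
Qed.

Lemma scompE (X Y Z : sset) (F : smap Y Z) (H : smap X Y) n x : (F \os H) n x = F n (H n x).
Proof. by []. Qed.

Lemma cone_act_iota b (K : sset) m n (f : mor m n) l k (a : Delta m l) (x : K k) :
  cone_act b K f _ (jiota b a x) = jiota b (mor_comp f a : Delta n l) x.
Proof. exact: ojoin_map_iota. Qed.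

Lemma cone_act_left b (K : sset) m n (f : mor m n) l (a : Delta m l) :
  cone_act b K f _ (jleft b (Delta m) K l a) = jleft b (Delta n) K l (mor_comp f a : Delta n l).
Proof. exact: ojoin_map_left. Qed.

Lemma cone_incl_iota b (K : sset) (L : ssub K) n l k (a : Delta n l) (x : L k) :
  cone_incl b L n _ (jiota b a x) = jiota b a (sval x).
Proof. exact: ojoin_map_iota. Qed.

Lemma cone_incl_left b (K : sset) (L : ssub K) n l (a : Delta n l) :
  cone_incl b L n _ (jleft b (Delta n) L l a) = jleft b (Delta n) K l a.
Proof. exact: ojoin_map_left. Qed.

Definition joinE := (scompE, cone_act_iota, cone_act_left, cone_incl_iota, cone_incl_left, ojoin_map_iota, ojoin_map_left).

(** * Relative limits as lifting properties *)

Section FamLift.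
Variables (b : 'I_2) (X S K : sset) (p : smap X S) (s : smap K X) (L : ssub K).

(** The lifting problem of (boundary * K) u (Delta^n * L) in Delta^n * K against p, with maps out of
    joins written as families on pairs of simplices. The solution W is recorded for the top simplex
    of Delta^n only, its other values being restrictions. *)
Definition fam_lift : Prop := forall n (al : X n)
  (y : forall m k (g : mor m n) (x : K k), smem (boundary n) (g : Delta n m) \/ smem L x -> X (k + m).+1)
  (T : forall k, K k -> S (k + n).+1),
  (forall m k m' k' (f : mor m' m) (f' : mor k' k) (g : mor m n) (x : K k) r r',
     y m' k' (mor_comp g f) (act f' x) r' = act (jm b f f') (y m k g x r)) ->
  (forall m k g x r, act (jinl b m k) (y m k g x r) = act g al) ->
  (forall m k g x r, act (jinr b m k) (y m k g x r) = s k x) ->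
  (forall k k' (f : mor k' k) x, T k' (act f x) = act (jm b (mor_id n) f) (T k x)) ->
  (forall k x, act (jinl b n k) (T k x) = p n al) ->
  (forall k x, act (jinr b n k) (T k x) = p k (s k x)) ->
  (forall m k g x r, p _ (y m k g x r) = act (jm b g (mor_id k)) (T k x)) ->
  exists W : forall k, K k -> X (k + n).+1,
    [/\ forall k k' (f : mor k' k) x, W k' (act f x) = act (jm b (mor_id n) f) (W k x),
        forall m k g x r, y m k g x r = act (jm b g (mor_id k)) (W k x),
        forall k x, p _ (W k x) = T k x,
        forall k x, act (jinl b n k) (W k x) = al & forall k x, act (jinr b n k) (W k x) = s k x].

Lemma fam_nat Y n (W : forall k, K k -> sk Y (k + n).+1) :
  (forall k k' (f : mor k' k) x, W k' (act f x) = act (jm b (mor_id n) f) (W k x)) ->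
  forall m k m' k' (f : mor m' m) (f' : mor k' k) (g : Delta n m) (x : K k),
    act (jm b (act f g : mor m' n) (mor_id k')) (W k' (act f' x)) = act (jm b f f') (act (jm b (g : mor m n) (mor_id k)) (W k x)).
Proof.
move=> WN m k m' k' f f' g x; rewrite WN !act_comp !jm_comp; apply: act_eq.
by rewrite !mor_id_comp mor_comp_id.
Qed.

Lemma fam_l Y n (W : forall k, K k -> sk Y (k + n).+1) al :
  (forall k x, act (jinl b n k) (W k x) = al) ->
  forall m k (g : Delta n m) (x : K k), act (jinl b m k) (act (jm b (g : mor m n) (mor_id k)) (W k x)) = yoneda al m g.
Proof. by move=> Wl m k g x; rewrite act_comp jm_inl -act_comp Wl. Qed.

Lemma fam_r Y n (W : forall k, K k -> sk Y (k + n).+1) (t : smap K Y) :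
  (forall k x, act (jinr b n k) (W k x) = t k x) ->
  forall m k (g : Delta n m) (x : K k), act (jinr b m k) (act (jm b (g : mor m n) (mor_id k)) (W k x)) = t k x.
Proof. by move=> Wr m k g x; rewrite act_comp jm_inr mor_comp_id Wr. Qed.

Lemma sval_act n m (f : mor m n) (F : slice b s n) : sval (act f F) = sval F \os cone_act b K f.
Proof. by []. Qed.

Lemma slice_iota n (F : slice b s n) m k (g : mor m n) (x : K k) :
  sval F _ (jiota b (g : Delta n m) x) = act (jm b g (mor_id k)) (sval F _ (jiota b (mor_id n : Delta n n) x)).
Proof.
rewrite -smap_nat jiota_act act_id; by congr (sval F _ (jiota _ _ _)).
Qed.

(** Adjunction between join and slice: y over the boundary is a map from the boundary to the slice,
    y over L together with T is a simplex of the fiber product, and W is read off from the lift of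
    that simplex. *)
Lemma rl_use : relative_limit b p s L -> fam_lift.
Proof.
move=> rl n al y T ynat yl yr Tnat Tl Tr pT.
have yirr m k (g g' : mor m n) (x x' : K k) r r' : g = g' -> x = x' -> y m k g x r = y m k g' x' r'.
  by move=> Eg Ex; subst; congr y; exact: Prop_irrelevance.
have yb m (g : boundary n m) m' (a : mor m' m) : smem (boundary n) (mor_comp (sval g) a : Delta n m').
  exact: (svalP (act a g)).
pose Y1 m (g : boundary n m) m' k (a : Delta m m') (x : K k) := y m' k (mor_comp (sval g) a) x (or_introl (yb m g m' a)).
have Y1n m g m1 k1 m2 k2 (f : mor m2 m1) (f' : mor k2 k1) (a : Delta m m1) (x : K k1) :
    @Y1 m g _ _ (act f a) (act f' x) = act (jm b f f') (Y1 m g _ _ a x).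
  have r2 : smem (boundary n) (mor_comp (mor_comp (sval g) a) f : Delta n m2) \/ smem L (act f' x).
    by left; rewrite mor_compA; exact: yb.
  by rewrite -(ynat _ _ _ _ f f' _ _ _ r2); apply: yirr => //; exact/esym/mor_compA.
have Y1l m (g : boundary n m) m1 k1 (a : Delta m m1) (x : K k1) :
   act (jinl b m1 k1) (@Y1 m g _ _ a x) = yoneda (act (sval g : mor m n) al) m1 a.
  by rewrite yl /= act_comp.
have Y1r m (g : boundary n m) m1 k1 (a : Delta m m1) (x : K k1) :
   act (jinr b m1 k1) (@Y1 m g _ _ a x) = s k1 x.
  by rewrite yr.
pose u0 m (g : boundary n m) : slice b s m := exist _ (build_all (Y1n m g) (Y1l m g) (Y1r m g)) (build_all_in _ _ _).
have u0i m (g : boundary n m) m1 k1 (a : Delta m m1) (x : K k1) : sval (u0 m g) _ (jiota b a x) = Y1 m g _ _ a x.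
  exact: build_all_iota.
have u0l m (g : boundary n m) m1 (a : Delta m m1) : sval (u0 m g) _ (jleft b (Delta m) K m1 a) = act (mor_comp (sval g) a) al.
  by rewrite -act_comp; exact: build_all_left.
have u0in m (g : boundary n m) : sval (u0 m g) \os ojoin_in b _ K = s by exact: build_all_in.
have u0nat m m' (f : mor m' m) (g : boundary n m) : u0 m' (act f g) = act f (u0 m g).
  apply: sig_ext; rewrite sval_act; apply: join_smap_ext => [l a||l k a x].
  - by rewrite !joinE !u0l; apply: act_eq; exact: mor_compA.
  - by rewrite scompA cone_act_in !u0in.
  - by rewrite !joinE !u0i; apply: yirr; rewrite //= mor_compA.
pose u := @SMap (boundary n) (slice b s) u0 (fun m' m f g => u0nat m m' f g).
pose Y2 m k (g : Delta n m) (x : L k) := y m k g (sval x) (or_intror (svalP x)).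
have Y2n m1 k1 m2 k2 (f : mor m2 m1) (f' : mor k2 k1) (a : Delta n m1) (x : L k1) :
    Y2 _ _ (act f a) (act f' x) = act (jm b f f') (Y2 _ _ a x).
  exact: (ynat _ _ _ _ f f' a (sval x)).
have Y2l m k (g : Delta n m) (x : L k) : act (jinl b m k) (Y2 _ _ g x) = yoneda al m g by rewrite yl.
have Y2r m k (g : Delta n m) (x : L k) : act (jinr b m k) (Y2 _ _ g x) = (s \os incl L) k x by rewrite yr.
pose B1 := build_all Y2n Y2l Y2r.
pose V1 : slice b (s \os incl L) n := exist _ B1 (build_all_in _ _ _).
have B1i m k (a : Delta n m) (x : L k) : sval V1 _ (jiota b a x) = Y2 m k a x by exact: build_all_iota.
have B1l m (a : Delta n m) : sval V1 _ (jleft b (Delta n) L m a) = act (a : mor m n) al by exact: build_all_left.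
have B1in : sval V1 \os ojoin_in b _ L = s \os incl L by exact: build_all_in.
have Tl' k x : act (jinl b n k) (T k x) = p n al := Tl k x.
pose B2 := @build_all b (Delta n) K S (yoneda (p n al)) (p \os s) _ (fam_nat Tnat) (fam_l Tl) (@fam_r S n T (p \os s) Tr).
pose V2 : slice b (p \os s) n := exist _ B2 (build_all_in _ _ _).
have B2i m k (a : Delta n m) (x : K k) : sval V2 _ (jiota b a x) = act (jm b (a : mor m n) (mor_id k)) (T k x) by exact: build_all_iota.
have B2l m (a : Delta n m) : sval V2 _ (jleft b (Delta n) K m a) = act (a : mor m n) (p n al) by exact: build_all_left.
have B2in : sval V2 \os ojoin_in b _ K = p \os s by exact: build_all_in.
clearbody V1 V2 u0.
have VE : p \os sval V1 = sval V2 \os ojoin_map b (sid (Delta n)) (incl L).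
  apply: join_smap_ext => [l a||l k a x].
  - by rewrite !joinE B1l B2l smap_nat.
  - by rewrite !scompA ojoin_map_in B1in -(scompA (sval V2)) B2in scompA.
  - by rewrite !joinE B1i B2i pT.
pose v : rel_slice b p s L n := exist _ (V1, V2) VE.
have [|w [wu wv]] := rl n u (yoneda v).
  apply: smap_ext => m g; apply: sig_ext; congr pair; apply: sig_ext.
  - rewrite -[LHS]/(sval (u0 m g) \os cone_incl b L m) -[RHS]/(sval V1 \os cone_act b L (sval g : mor m n)).
    apply: join_smap_ext => [l a||l k a x].
    + by rewrite !joinE u0l B1l.
    + by rewrite !scompA cone_act_in ojoin_map_in -scompA u0in B1in.
    + by rewrite !joinE u0i B1i; exact: yirr.
  - rewrite -[LHS]/(p \os sval (u0 m g)) -[RHS]/(sval V2 \os cone_act b K (sval g : mor m n)).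
    apply: join_smap_ext => [l a||l k a x].
    + by rewrite !joinE u0l B2l smap_nat.
    + by rewrite !scompA cone_act_in u0in B2in.
    + by rewrite !joinE u0i B2i pT.
pose F := w n (mor_id n).
have wE m (g : mor m n) : w m g = act g F.
  by rewrite /F -smap_nat; congr (w m _); exact/esym/mor_id_comp.
have Fv : slice_cmp b p s L n F = v.
  have := congr1 (fun H : smap (Delta n) _ => H n (mor_id n)) wv; rewrite /= => ->.
  exact: (@act_id (rel_slice b p s L)).
have F1 : sval F \os cone_incl b L n = sval V1 by rewrite -[V1]/(sval v).1 -Fv.
have F2 : p \os sval F = sval V2 by rewrite -[V2]/(sval v).2 -Fv.
exists (fun k x => sval F _ (jiota b (mor_id n : Delta n n) x)); split.
- by move=> k k' f x; rewrite -smap_nat jiota_act act_id.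
- move=> m k g x r; rewrite -slice_iota; case: r => r.
    have E : w m (g : Delta n m) = u m (exist _ (g : Delta n m) r) by rewrite -wu.
    have := congr1 (fun H : slice b s m => sval H _ (jiota b (mor_id m : Delta m m) x)) E.
    rewrite wE sval_act !joinE [RHS]u0i => EE.
    rewrite -[g in RHS]mor_comp_id EE; apply: yirr => //; exact/esym/mor_comp_id.
  have := congr1 (fun H : smap _ X => H _ (jiota b (g : Delta n m) (exist _ x r : L k))) F1.
  by rewrite B1i !joinE => ->; exact: yirr.
- move=> k x; have := congr1 (fun H : smap _ S => H _ (jiota b (mor_id n : Delta n n) x)) F2.
  by rewrite B2i scompE => ->; rewrite jm_id act_id.
- move=> k x; rewrite -smap_nat iota_inl.
  have := congr1 (fun H : smap _ X => H _ (jleft b (Delta n) L n (mor_id n))) F1.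
  by rewrite B1l !joinE act_id.
- move=> k x; rewrite -smap_nat iota_inr.
  by have := congr1 (fun H : smap K X => H k x) (svalP F).
Qed.

(** The same adjunction backwards: the two maps of a lifting square are evaluated on the simplices
    spanned by pairs, and the family W is assembled into a simplex of the slice. *)
Lemma rl_make : fam_lift -> relative_limit b p s L.
Proof.
move=> FL n u v uv.
have uvE m (g : boundary n m) : slice_cmp b p s L m (u m g) = act (sval g : mor m n) (v n (mor_id n)).
  rewrite -smap_nat; have := congr1 (fun H : smap (boundary n) _ => H m g) uv; rewrite /= => ->.
  by congr (v m _); exact/esym/mor_id_comp.
set V := v n (mor_id n) in uvE *.
have u1 m (g : boundary n m) : sval (u m g) \os cone_incl b L m = sval (sval V).1 \os cone_act b L (sval g : mor m n).
  by have := congr1 (fun H : rel_slice b p s L m => sval (sval H).1) (uvE m g).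
have u2 m (g : boundary n m) : p \os sval (u m g) = sval (sval V).2 \os cone_act b K (sval g : mor m n).
  by have := congr1 (fun H : rel_slice b p s L m => sval (sval H).2) (uvE m g).
pose al := sval (sval V).1 n (jleft b (Delta n) L n (mor_id n)).
pose T k (x : K k) := sval (sval V).2 _ (jiota b (mor_id n : Delta n n) x).
have TE m k (g : mor m n) (x : K k) : sval (sval V).2 _ (jiota b (g : Delta n m) x) = act (jm b g (mor_id k)) (T k x).
  by rewrite /T -smap_nat jiota_act act_id [act g _]mor_id_comp.
have ub m k (g : boundary n m) (x : L k) :
    sval (u m g) _ (jiota b (mor_id m : Delta m m) (sval x)) = sval (sval V).1 _ (jiota b (sval g) x).
  have := congr1 (fun H : smap _ X => H _ (jiota b (mor_id m : Delta m m) x)) (u1 m g).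
  by rewrite !joinE => ->; rewrite mor_comp_id.
(* Both sources apply when g is in the boundary and x in L; by [ub] they agree. *)
pose y m k (g : mor m n) (x : K k) (r : smem (boundary n) (g : Delta n m) \/ smem L x) : X (k + m).+1 :=
  match pselect (smem (boundary n) (g : Delta n m)) with
  | left H => sval (u m (exist _ (g : Delta n m) H)) _ (jiota b (mor_id m : Delta m m) x)
  | right H => sval (sval V).1 _ (jiota b (g : Delta n m) (exist _ x (match r with or_introl H' => False_ind _ (H H') | or_intror H' => H' end) : L k)) end.
have yb : forall m k (g : boundary n m) (x : K k) (r : smem (boundary n) (sval g) \/ smem L x), y m k (sval g) x r = sval (u m g) _ (jiota b (mor_id m : Delta m m) x).
  move=> m k g x r.
  rewrite /y; case: pselect => [H|]; last by case; exact: (svalP g).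
  by rewrite (_ : exist _ _ H = g) //; exact: sig_ext.
have yL : forall m k (g : mor m n) (x : L k) (r : smem (boundary n) (g : Delta n m) \/ smem L (sval x)), y m k g (sval x) r = sval (sval V).1 _ (jiota b (g : Delta n m) x).
  move=> m k g x r.
  rewrite /y; case: pselect => [H|H]; first by rewrite ub.
  by congr (sval (sval V).1 _ (jiota _ _ _)); exact: sig_ext.
have uN m (g : boundary n m) k m' k' (f : mor m' m) (f' : mor k' k) (x : K k) :
    sval (u m' (act f g)) _ (jiota b (mor_id m' : Delta m' m') (act f' x)) =
    act (jm b f f') (sval (u m g) _ (jiota b (mor_id m : Delta m m) x)).
  by rewrite smap_nat sval_act !joinE -smap_nat jiota_act mor_comp_id [act f _]mor_id_comp.
have uL m (g : boundary n m) : sval (u m g) m (jleft b (Delta m) K m (mor_id m)) = act (sval g : mor m n) al.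
  have := congr1 (fun H : smap _ X => H _ (jleft b (Delta m) L m (mor_id m))) (u1 m g).
  rewrite !joinE => ->; by rewrite /al -smap_nat -smap_nat mor_comp_id [act (sval g) _]mor_id_comp.
have [|||||||W [WN Wy Wp Wl Wr]] := FL n al y T.
- move=> m k m' k' f f' g x r r'; case: (pselect (smem (boundary n) (g : Delta n m))) => H.
    by rewrite (yb _ _ (exist _ (g : Delta n m) H)) (yb _ _ (act f (exist _ (g : Delta n m) H : boundary n m))) uN.
  case: (r) => // Lx; rewrite (yL _ _ _ (exist _ x Lx)) (yL _ _ _ (act f' (exist _ x Lx : L k))) -smap_nat jiota_act //.
- move=> m k g x r; case: (pselect (smem (boundary n) (g : Delta n m))) => H.
    by rewrite (yb _ _ (exist _ (g : Delta n m) H)) -smap_nat iota_inl uL.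
  case: (r) => // Lx; rewrite (yL _ _ _ (exist _ x Lx)) -smap_nat iota_inl /al -smap_nat -smap_nat.
  by rewrite [act g _]mor_id_comp.
- move=> m k g x r; case: (pselect (smem (boundary n) (g : Delta n m))) => H.
    rewrite (yb _ _ (exist _ (g : Delta n m) H)) -smap_nat iota_inr.
    by have := congr1 (fun H : smap K X => H k x) (svalP (u m (exist _ (g : Delta n m) H))).
  case: (r) => // Lx; rewrite (yL _ _ _ (exist _ x Lx)) -smap_nat iota_inr.
  by have := congr1 (fun H : smap L X => H k (exist _ x Lx)) (svalP (sval V).1).
- by move=> k k' f x; rewrite /T -smap_nat jiota_act act_id.
- move=> k x; rewrite /T -smap_nat iota_inl.
  have := congr1 (fun H : smap _ S => H _ (jleft b (Delta n) L n (mor_id n))) (svalP V).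
  by rewrite !joinE.
- move=> k x; rewrite /T -smap_nat iota_inr.
  by have := congr1 (fun H : smap K S => H k x) (svalP (sval V).2).
- move=> m k g x r; rewrite -TE; case: (pselect (smem (boundary n) (g : Delta n m))) => H.
    rewrite (yb _ _ (exist _ (g : Delta n m) H)).
    have := congr1 (fun H : smap _ S => H _ (jiota b (mor_id m : Delta m m) x)) (u2 m (exist _ (g : Delta n m) H)).
    by rewrite !joinE => ->; rewrite mor_comp_id.
  case: (r) => // Lx; rewrite (yL _ _ _ (exist _ x Lx)).
  have := congr1 (fun H : smap _ S => H _ (jiota b (g : Delta n m) (exist _ x Lx : L k))) (svalP V).
  by rewrite !joinE.
pose F : slice b s n :=
  exist _ (@build_all b (Delta n) K X (yoneda al) s _ (fam_nat WN) (fam_l Wl) (fam_r Wr)) (build_all_in _ _ _).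
have sE m k (g : mor m n) (x : K k) : sval F _ (jiota b (g : Delta n m) x) = act (jm b g (mor_id k)) (W k x).
  exact: build_all_iota.
have sL m (g : mor m n) : sval F _ (jleft b (Delta n) K m g) = act g al.
  exact: build_all_left.
exists (yoneda F); split; apply: smap_ext => m g.
  apply: sig_ext; rewrite [LHS]/=; apply: join_smap_ext => [l a||l k a x].
  - rewrite !joinE build_all_left.
    have -> : jleft b (Delta m) K l a = act (a : mor l m) (jleft b (Delta m) K m (mor_id m)).
      by rewrite -smap_nat [act _ _]mor_id_comp.
    by rewrite smap_nat uL act_comp.
  - by rewrite scompA cone_act_in build_all_in; exact/esym/(svalP (u m g)).
  - rewrite !joinE build_all_iota.
    have r : smem (boundary n) (sval g) \/ smem L x by left; exact: (svalP g).
    have := uN m g k l k a (mor_id k) x; rewrite act_id.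
    rewrite -(yb _ _ g x r) Wy act_comp jm_comp mor_id_comp => <-.
    by rewrite smap_nat sval_act !joinE; rewrite mor_comp_id.
have -> : v m g = act (g : mor m n) V.
  by rewrite /V -smap_nat; congr (v m _); exact/esym/mor_id_comp.
rewrite [LHS](smap_nat (slice_cmp b p s L) g F); congr act.
apply: sig_ext; rewrite [RHS]surjective_pairing; congr pair; apply: sig_ext.
  rewrite -[LHS]/(sval F \os cone_incl b L n); apply: join_smap_ext => [l a||l k a x].
  - by rewrite !joinE sL /al -smap_nat -smap_nat [act a _]mor_id_comp.
  - rewrite [LHS](slice_restr_subproof L F); exact/esym/(svalP (sval V).1).
  - rewrite !joinE sE.
    have r : smem (boundary n) a \/ smem L (sval x) by right; exact: (svalP x).
    by rewrite -(yL _ _ _ x r) Wy.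
rewrite -[LHS]/(p \os sval F); apply: join_smap_ext => [l a||l k a x].
- rewrite !joinE sL.
  have := congr1 (fun H : smap _ S => H _ (jleft b (Delta n) L n (mor_id n))) (svalP V).
  rewrite !joinE -/al => E.
  by rewrite smap_nat [p n al]E -smap_nat -smap_nat [act a _]mor_id_comp.
- rewrite [LHS](slice_push_subproof p F); exact/esym/(svalP (sval V).2).
- by rewrite !joinE sE smap_nat Wp -TE.
Qed.

End FamLift.

(** * Horns of a join of simplices *)

Lemma mor_compE l m n (g : mor m n) (f : mor l m) i : mor_comp g f i = g (f i).
Proof. by []. Qed.

Definition misses l n (g : mor l n) v := forall k, g k <> v.

Lemma jinl_inr b m k i j : jinl b m k i <> jinr b m k j.
Proof. by move=> /(congr1 (jlb b m k)); rewrite jlbl jlbr; exact: vop_neq. Qed.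

Lemma jm_missl b m k m' k' (f : mor m' m) (g : mor k' k) v : misses f v -> misses (jm b f g) (jinl b m k v).
Proof.
move=> fv t; case: (jm_split b t) => -[E _]; last by rewrite jmR // => /esym; exact: jinl_inr.
by rewrite jmL // => /(congr1 (jpl b m k)); rewrite !jpll; exact: fv.
Qed.

Lemma jm_missr b m k m' k' (f : mor m' m) (g : mor k' k) v : misses g v -> misses (jm b f g) (jinr b m k v).
Proof.
move=> fv t; case: (jm_split b t) => -[E _]; first by rewrite jmL //; exact: jinl_inr.
by rewrite jmR // => /(congr1 (jpr b m k)); rewrite !jprr; exact: fv.
Qed.

(** The parts a and c are the clamped coordinates of g; clamping adds no vertices, so each part
    misses what g misses on its side. *)
Lemma mor_cases b l m k (g : mor l (k + m).+1) :
  [\/ exists a c j, [/\ g = mor_comp (jm b a c) (jgr b j), forall v, misses g (jinl b m k v) -> misses (a : mor l m) v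
                      & forall v, misses g (jinr b m k v) -> misses (c : mor l k) v],
      exists a, g = mor_comp (jinl b m k) a | exists c, g = mor_comp (jinr b m k) c].
Proof.
pose j := mor_comp (jlb b m k) g.
case: (pselect (exists i, j i = b)) => [Hl|nl]; last first.
  apply: Or33; exists (mor_comp (jpr b m k) g); apply: mor_ext => i.
  by rewrite !mor_compE jinr_pr //; case: (I2vP b (j i)) => // E; case: nl; exists i.
case: (pselect (exists i, j i = vop b)) => [Hr|nr]; last first.
  apply: Or32; exists (mor_comp (jpl b m k) g); apply: mor_ext => i.
  by rewrite !mor_compE jinl_pl //; case: (I2vP b (j i)) => // E; case: nr; exists i.
have [r [jr rE]] := clamp_ex Hl; have [r' [jr' rE']] := clamp_ex Hr.
apply: Or31; exists (mor_comp (jpl b m k) (mor_comp g r)), (mor_comp (jpr b m k) (mor_comp g r')), j; split.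
- apply/esym/jm_gr => i E; first by rewrite !mor_compE rE // jinl_pl.
  by rewrite !mor_compE rE' // jinr_pr.
- by move=> v gv t E; apply: (gv (r t)); rewrite -E !mor_compE jinl_pl //; exact: (mor_eqE t jr).
- by move=> v gv t E; apply: (gv (r' t)); rewrite -E !mor_compE jinr_pr //; exact: (mor_eqE t jr').
Qed.

(** One half of the fact that the horn of Delta^n * Delta^d at a vertex i of Delta^d is the union of
    (boundary * Delta^d) and (Delta^n * horn at i); the other half is [horn_cases]. *)
Lemma jm_horn b n d (i : 'I_d.+1) m k (g : mor m n) (c : mor k d) :
  smem (boundary n) (g : Delta n m) \/ smem (horn i) (c : Delta d k) ->
  smem (horn (jinr b n d i)) (jm b g c : Delta (d + n).+1 _).
Proof.
case=> [[v gv]|[v [vi cv]]].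
  by exists (jinl b n d v); split; [exact: jinl_inr|exact: jm_missl].
exists (jinr b n d v); split; last exact: jm_missr.
by move=> /(congr1 (jpr b n d)); rewrite !jprr.
Qed.

Lemma inl_horn b n d (i : 'I_d.+2) l (a : mor l n) :
  smem (horn (jinr b n d.+1 i)) (mor_comp (jinl b n d.+1) a : Delta (d.+1 + n).+1 l).
Proof.
have [v vi] : exists v : 'I_d.+2, v <> i.
  by exists (if i == ord0 then ord_max else ord0); case: eqP => [->|ni /esym].
exists (jinr b n d.+1 v); split; first by move=> /(congr1 (jpr b n d.+1)); rewrite !jprr.
by move=> k; exact: jinl_inr.
Qed.

Lemma inr_horn b n d (i : 'I_d.+1) l (c : mor l d) :
  smem (horn (jinr b n d i)) (mor_comp (jinr b n d) c : Delta (d + n).+1 l).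
Proof.
by exists (jinl b n d ord0); split; [exact: jinl_inr|move=> k /esym; exact: jinl_inr].
Qed.

Lemma horn_cases b n d (i : 'I_d.+1) l (g : mor l (d + n).+1) : smem (horn (jinr b n d i)) (g : Delta _ l) ->
  [\/ exists a c j, g = mor_comp (jm b a c) (jgr b j) /\ (smem (boundary n) (a : Delta n l) \/ smem (horn i) (c : Delta d l)),
      exists a, g = mor_comp (jinl b n d) a | exists c, g = mor_comp (jinr b n d) c].
Proof.
case=> v [vi gv]; case: (mor_cases b g) => [[a [c [j [E Ha Hc]]]]|[a ->]|[c ->]]; last 2 first.
- by apply: Or32; exists a.
- by apply: Or33; exists c.
apply: Or31; exists a, c, j; split=> //; case: (jm_split b v) => -[_ Ev].
  by left; exists (jpl b n d v); apply: Ha; rewrite Ev.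
right; exists (jpr b n d v); split; last by apply: Hc; rewrite Ev.
by move=> E2; apply: vi; rewrite -Ev E2.
Qed.

Section HornFam.
Variables (b : 'I_2) (X : sset) (n d : nat) (i : 'I_d.+2) (al : X n) (om : X d.+1).
Variable y : forall m k (g : mor m n) (c : mor k d.+1),
  smem (boundary n) (g : Delta n m) \/ smem (horn i) (c : Delta d.+1 k) -> X (k + m).+1.
Hypothesis ynat : forall m k m' k' (f : mor m' m) (f' : mor k' k) (g : mor m n) (c : mor k d.+1) r r',
  y (g := mor_comp g f) (c := mor_comp c f') r' = act (jm b f f') (y (g := g) (c := c) r).
Hypothesis yl : forall m k g c r, act (jinl b m k) (y (g := g) (c := c) r) = act g al.
Hypothesis yr : forall m k g c r, act (jinr b m k) (y (g := g) (c := c) r) = act c om.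

(** The top simplex [z0] of the join carries the horn into the subobject on which the family defines
    a map. *)
Lemma horn_of_fam : exists h : smap (horn (jinr b n d.+1 i)) X,
  [/\ forall m k (g : mor m n) (c : mor k d.+1) r H, h _ (exist _ (jm b g c : Delta _ _) H) = y (g := g) (c := c) r,
      forall m (a : mor m n) H, h _ (exist _ (mor_comp (jinl b n d.+1) a : Delta _ _) H) = act a al &
      forall m (c : mor m d.+1) H, h _ (exist _ (mor_comp (jinr b n d.+1) c : Delta _ _) H) = act c om].
Proof.
pose R m k (g : Delta n m) (c : Delta d.+1 k) := smem (boundary n) g \/ smem (horn i) c.
have Ract m k m' k' (f : mor m' m) (f' : mor k' k) (g : Delta n m) (c : Delta d.+1 k) : R _ _ g c -> R _ _ (act f g) (act f' c).
  by case=> [H|H]; [left; exact: smem_act|right; exact: smem_act].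
pose B := @build b (Delta n) (Delta d.+1) X (yoneda al) (yoneda om) R Ract (fun m k g c r => @y m k g c r)
   (fun m k m' k' f f' g c r r' => ynat r r') (fun m k g c r => yl r) (fun m k g c r => yr r).
pose z0 : ojoin b (Delta n) (Delta d.+1) (d.+1 + n).+1 := jiota b (mor_id n : Delta n n) (mor_id d.+1 : Delta d.+1 d.+1).
pose JS := @join_sub b (Delta n) (Delta d.+1) R.
have mem l (g : horn (jinr b n d.+1 i) l) : smem JS (act (sval g : mor l _) z0).
  have [v [vi gv]] := svalP g => k a a'.
  case: (jm_split b v) => -[_ Ev].
    left; exists (jpl b n d.+1 v) => t E; apply: (gv ((sval a : mor k l) t)).
    have E' : jpl b n d.+1 ((sval g : mor l _) ((sval a : mor k l) t)) = jpl b n d.+1 v := E.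
    by rewrite -Ev -E' jinl_pl //; exact: (mor_eqE t (svalP a)).
  right; exists (jpr b n d.+1 v); split=> [E|t E]; first by apply: vi; rewrite -Ev E.
  apply: (gv ((sval a' : mor k l) t)).
  have E' : jpr b n d.+1 ((sval g : mor l _) ((sval a' : mor k l) t)) = jpr b n d.+1 v := E.
  by rewrite -Ev -E' jinr_pr //; exact: (mor_eqE t (svalP a')).
have hN l m (f : mor l m) (g : horn (jinr b n d.+1 i) m) : B l (exist _ _ (mem l (act f g))) = act f (B m (exist _ _ (mem m g))).
  by rewrite -smap_nat; apply: sub_eq; rewrite act_comp.
exists (@SMap (horn (jinr b n d.+1 i)) X (fun l g => B l (exist _ _ (mem l g))) hN); split.
- move=> m k g c r H; rewrite -[LHS]/(B _ (exist _ _ (mem _ (exist _ _ H)))).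
  have E : act (jm b g c) z0 = jiota b (g : Delta n m) (c : Delta d.+1 k).
    by rewrite /z0 jiota_act; congr (jiota b _ _); exact: mor_id_comp.
  have H2 : smem JS (jiota b (g : Delta n m) (c : Delta d.+1 k)) by rewrite -E; exact: (mem _ (exist _ _ H)).
  rewrite (sub_eq B _ H2 E); exact: build_iota.
- move=> m a H; rewrite -[LHS]/(B _ (exist _ _ (mem _ (exist _ _ H)))).
  have E : act (mor_comp (jinl b n d.+1) a) z0 = jleft b (Delta n) (Delta d.+1) m a.
    by rewrite -act_comp iota_inl -smap_nat; congr (jleft _ _ _ _ _); exact: mor_id_comp.
  have H2 : smem JS (jleft b (Delta n) (Delta d.+1) m a) by rewrite -E; exact: (mem _ (exist _ _ H)).
  by rewrite (sub_eq B _ H2 E) build_left.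
- move=> m c H; rewrite -[LHS]/(B _ (exist _ _ (mem _ (exist _ _ H)))).
  have E : act (mor_comp (jinr b n d.+1) c) z0 = ojoin_in b (Delta n) (Delta d.+1) m c.
    by rewrite -act_comp iota_inr -smap_nat; congr (ojoin_in _ _ _ _ _); exact: mor_id_comp.
  have H2 : smem JS (ojoin_in b (Delta n) (Delta d.+1) m c) by rewrite -E; exact: (mem _ (exist _ _ H)).
  by rewrite (sub_eq B _ H2 E) build_right.
Qed.

End HornFam.

(** * Cartesian edges as fillers of outer horns *)

Section OpMap'.
Variables (b : 'I_2) (X : sset) (n : nat) (U V : ssub (Delta n)).
Hypothesis UV : forall l (g : mor l n), smem U (rv b g : Delta n l) <-> smem V (g : Delta n l).

Lemma op_unsub (h : smap U X) : exists h' : smap V (osset b X),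
  forall l (g : mor l n) H H', h' l (exist _ (g : Delta n l) H') = h l (exist _ (rv b g : Delta n l) H).
Proof.
pose m l (g : V l) : smem U (rv b (sval g : mor l n) : Delta n l) := (UV (sval g : mor l n)).2 (svalP g).
have hN k l (f : mor k l) (g : V l) : h k (exist _ _ (m k (act f g))) = @act X _ _ (rv b f) (h l (exist _ _ (m l g))).
  by rewrite -smap_nat; apply: sub_eq; exact: rv_comp.
exists (@SMap V (osset b X) (fun l g => h l (exist _ _ (m l g))) hN).
by move=> l g H H'; apply: (@sub_eq _ X U h).
Qed.

End OpMap'.

(** The classical form of a Cartesian edge. Only the last horn occurs, because the variance is moved
    into [osset]. *)
Definition hcart (X S : sset) (p : smap X S) (e : X 1) : Prop :=
  forall n (h : smap (horn (ord_max : 'I_n.+3)) X) (t : S n.+2),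
  (forall H, h 1 (exist _ (ledge_mor n.+1 : Delta n.+2 1) H) = e) ->
  (forall l g, p l (h l g) = act (sval g : mor l n.+2) t) ->
  exists y : X n.+2, p _ y = t /\ forall l g, h l g = act (sval g : mor l n.+2) y.

Lemma endpoint_horn (j : 'I_2) k (c : mor k 1) : smem (endpoint j) (c : Delta 1 k) <-> smem (horn j) (c : Delta 1 k).
Proof.
split=> [H|[v [vj cv]] i].
  exists (vop j); split; first by move/esym; exact: vop_neq.
  move=> i E; have E2 : c i = j := mor_eqE ord0 (H i).
  exact: (@vop_neq j (etrans (esym E2) E)).
apply: mor_ext => t; apply: contrapT => E.
by apply: (cv i); rewrite (I2_neq vj); exact: I2_neq E.
Qed.

Lemma jinr_outer b n : jinr b n 1 (vop b) = rvo b (ord_max : 'I_n.+3).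
Proof. by apply: ord_inj; rewrite rvo_max /=; case: (I2P b) => -> /=; lia. Qed.

Lemma rv_ledge b n : rv b (ledge_mor n.+1) = jinr b n 1.
Proof.
apply: mor_eqP => i; rewrite [LHS]rvo_max /=; have := ltn_ord i.
by case: (I2P b) => -> /=; rewrite ?rvo_max /=; lia.
Qed.

Lemma outer_horn b n l (g : mor l n.+2) :
  smem (horn (jinr b n 1 (vop b))) (rv b g : Delta (1 + n).+1 l) <-> smem (horn (ord_max : 'I_n.+3)) (g : Delta n.+2 l).
Proof. by rewrite jinr_outer; exact: rv_horn. Qed.

(** The case K = Delta^1 of [fam_lift] with L an endpoint. That endpoint is a horn of Delta^1, so
    the subobject of Delta^n * Delta^1 is an outer horn of Delta^{n+2}, the last one after
    reorientation. *)
Lemma ocart_hcart b (X S : sset) (p : smap X S) (e : X 1) :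
  ocartesian_edge b p e <-> hcart (osmap b p) e.
Proof.
split.
  move=> /rl_use FL n h t he ht.
  pose hX : smap (horn (jinr b n 1 (vop b))) X := op_sub (@outer_horn b n) h.
  have hXE l (g : mor l n.+2) H H' : hX l (exist _ (g : Delta n.+2 l) H) = h l (exist _ (rv b g : Delta n.+2 l) H').
    by apply: (@sub_eq _ (osset b X) _ h).
  pose tS : S n.+2 := t.
  have hXp l (g : horn (jinr b n 1 (vop b)) l) : p l (hX l g) = act (sval g : mor l n.+2) tS.
    have E : p l (hX l g) = act (rv b (rv b (sval g : mor l n.+2))) tS.
      exact: (ht l (exist _ _ (op_mem (@outer_horn b n) g))).
    by rewrite E rvK.
  have rE m k (g : mor m n) (c : Delta 1 k) : smem (boundary n) (g : Delta n m) \/ smem (endpoint (vop b)) c ->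
      smem (horn (jinr b n 1 (vop b))) (jm b g (c : mor k 1) : Delta _ _).
    by move=> r; apply: jm_horn; case: r => [|/endpoint_horn]; [left|right].
  pose y m k (g : mor m n) (c : Delta 1 k) r := hX _ (exist _ _ (rE m k g c r)).
  have inlH := inl_horn b (vop b) (mor_id n); rewrite mor_comp_id in inlH.
  have inrH := inr_horn b n (vop b) (mor_id 1); rewrite mor_comp_id in inrH.
  have inrE : hX _ (exist _ _ inrH) = e.
    have H' : smem (horn (ord_max : 'I_n.+3)) (rv b (jinr b n 1) : Delta n.+2 1) by apply/(@outer_horn b); rewrite rvK.
    rewrite (hXE _ _ _ H'); have H2 : smem (horn (ord_max : 'I_n.+3)) (ledge_mor n.+1 : Delta n.+2 1).
      by rewrite -(rvK b (ledge_mor n.+1)) rv_ledge.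
    rewrite -(he H2); apply: (@sub_eq _ (osset b X) _ h).
    by rewrite -rv_ledge rvK.
  have [|||||||W [WN Wy Wp Wl Wr]] := FL n (hX _ (exist _ _ inlH)) y (fun k (c : Delta 1 k) => act (jm b (mor_id n) (c : mor k 1)) (tS : S (1 + n).+1)).
  - move=> m k m' k' f f' g c r r'; rewrite /y -smap_nat; apply: sub_eq.
    by rewrite /= jm_comp.
  - move=> m k g c r; rewrite /y -!smap_nat; apply: sub_eq; exact: jm_inl.
  - move=> m k g c r; rewrite [RHS]/= -inrE /y -!smap_nat; apply: sub_eq; exact: jm_inr.
  - by move=> k k' f c; rewrite act_comp jm_comp mor_id_comp.
  - by move=> k c; rewrite hXp act_comp jm_inl mor_comp_id.
  - by move=> k c; rewrite act_comp jm_inr /= smap_nat -[in RHS]inrE hXp act_comp.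
  - by move=> m k g c r; rewrite hXp act_comp jm_comp mor_id_comp mor_comp_id.
  pose y0 := W 1 (mor_id 1).
  have WE k (c : mor k 1) : W k c = act (jm b (mor_id n) c) y0.
    by rewrite -WN; congr (W k _); exact/esym/mor_id_comp.
  exists (y0 : X n.+2); split.
    by apply: etrans (Wp 1 (mor_id 1)) _; rewrite jm_id act_id.
  move=> l g; set g0 := rv b (sval g : mor l n.+2).
  have H : smem (horn (jinr b n 1 (vop b))) (g0 : Delta n.+2 l) by apply/(@outer_horn b); exact: (svalP g).
  have -> : h l g = hX l (exist _ _ H).
    have H' : smem (horn (ord_max : 'I_n.+3)) (rv b g0 : Delta n.+2 l) by rewrite rvK; exact: (svalP g).
    rewrite (hXE _ _ _ H'); case: g @g0 H H' => g Hg g0 H H'.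
    by apply: (@sub_eq _ (osset b X) _ h); rewrite /g0 rvK.
  rewrite -[RHS]/(@act X _ _ g0 y0).
  case: (horn_cases H) => [[a [c [j [E r]]]]|[a E]|[c E]]; move: H; rewrite E => H.
  - have r' : smem (boundary n) (a : Delta n l) \/ smem (endpoint (vop b)) (c : Delta 1 l).
      by case: r => [|/endpoint_horn]; [left|right].
    have -> : hX l (exist _ _ H) = act (jgr b j) (y _ _ a c r').
      by rewrite /y -smap_nat; exact: sub_eq.
    by rewrite Wy WE (act_comp (jm b a _)) jm_comp mor_id_comp mor_comp_id act_comp.
  - have -> : hX l (exist _ _ H) = act a (hX _ (exist _ _ inlH)) by rewrite -smap_nat; exact: sub_eq.
    by rewrite -(Wl 1 (mor_id 1)) act_comp.
  - have -> : hX l (exist _ _ H) = act c (hX _ (exist _ _ inrH)) by rewrite -smap_nat; exact: sub_eq.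
    by rewrite inrE -act_comp -[y0]/(W 1 (mor_id 1)) Wr /= act_id.
move=> hc; apply: rl_make => n al y T ynat yl yr Tnat Tl Tr pT.
pose y' m k (g : mor m n) (c : mor k 1) (r : smem (boundary n) (g : Delta n m) \/ smem (horn (vop b)) (c : Delta 1 k)) :=
  y m k g c (match r with or_introl H => or_introl H | or_intror H => or_intror ((@endpoint_horn (vop b) k c).2 H) end).
have [|||hX [hXy hXl hXr]] := @horn_of_fam b X n 0 (vop b) al e y'.
- move=> m k m' k' f f' g c r r'; exact: ynat.
- by move=> m k g c r; exact: yl.
- by move=> m k g c r; exact: yr.
have [h hE] := op_unsub (@outer_horn b n) hX.
pose t0 : S n.+2 := T 1 (mor_id 1).
have TE k (c : mor k 1) : T k c = act (jm b (mor_id n) c) t0.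
  by rewrite -Tnat; congr (T k _); exact/esym/mor_id_comp.
have pE m k (g : mor m n) (c : mor k 1) r : p _ (y m k g c r) = act (jm b g c) t0.
  by rewrite pT TE act_comp jm_comp mor_id_comp mor_comp_id.
have [|l g|y0 [y0p y0h]] := hc n h (t0 : osset b S n.+2).
- move=> H; have H' : smem (horn (jinr b n 1 (vop b))) (rv b (ledge_mor n.+1) : Delta n.+2 1) by apply/(@outer_horn b).
  rewrite (hE _ _ H'); have E : rv b (ledge_mor n.+1) = mor_comp (jinr b n 1) (mor_id 1) by rewrite rv_ledge mor_comp_id.
  by move: H'; rewrite E => H'; rewrite hXr act_id.
- have H : smem (horn (jinr b n 1 (vop b))) (rv b (sval g : mor l n.+2) : Delta n.+2 l).
    by apply/(@outer_horn b); exact: (svalP g).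
  case: g H => g Hg H; rewrite -[LHS]/(p l (h l (exist _ g Hg))) (hE _ _ H) -[RHS]/(@act S _ _ (rv b g) t0).
  move: H; rewrite [sval _]/=; set g0 := rv b g => H.
  case: (horn_cases H) => [[a [c [j [E r]]]]|[a E]|[c E]]; move: H; rewrite E => H.
  + have H2 := jm_horn b r.
    have -> : hX l (exist _ _ H) = act (jgr b j) (hX _ (exist _ _ H2)) by rewrite -smap_nat; exact: sub_eq.
    by rewrite (hXy _ _ _ _ r) smap_nat pE act_comp.
  + by rewrite hXl smap_nat -(Tl 1 (mor_id 1)) act_comp.
  + by rewrite hXr -act_comp -[t0]/(T 1 (mor_id 1)) Tr /= act_id smap_nat.
pose yX : X n.+2 := y0.
have hXE l (g : mor l n.+2) (H : smem (horn (jinr b n 1 (vop b))) (g : Delta n.+2 l)) : hX l (exist _ _ H) = act g yX.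
  have H' : smem (horn (ord_max : 'I_n.+3)) (rv b g : Delta n.+2 l) by apply/(@outer_horn b); rewrite rvK.
  have H2 : smem (horn (jinr b n 1 (vop b))) (rv b (rv b g) : Delta n.+2 l) by rewrite rvK.
  have E : hX l (exist _ _ H2) = @act X _ _ (rv b (rv b g)) yX.
    by rewrite -(hE _ _ _ H') (y0h l (exist _ _ H')).
  have -> : hX l (exist _ _ H) = hX l (exist _ _ H2) by apply: sub_eq; rewrite rvK.
  by rewrite E rvK.
exists (fun k (c : Delta 1 k) => act (jm b (mor_id n) (c : mor k 1)) yX); split.
- by move=> k k' f c; rewrite act_comp jm_comp mor_id_comp.
- move=> m k g c r; rewrite act_comp jm_comp mor_id_comp mor_comp_id.
  have r' : smem (boundary n) (g : Delta n m) \/ smem (horn (vop b)) (c : Delta 1 k).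
    by case: r => [|/endpoint_horn]; [left|right].
  rewrite -(hXE _ _ (jm_horn b r')) (hXy _ _ _ _ r') /y'; congr (y _ _ _ _ _); exact: Prop_irrelevance.
- by move=> k c; rewrite smap_nat TE; congr act.
- move=> k c; rewrite act_comp jm_inl mor_comp_id.
  have H := inl_horn b (vop b) (mor_id n); have := hXl _ _ H; rewrite act_id => <-.
  by rewrite hXE mor_comp_id.
- move=> k c; rewrite act_comp jm_inr.
  by rewrite -(hXE _ _ (inr_horn b n (vop b) (c : mor k 1))) hXr.
Qed.

Lemma cod_factor l n (c : mor l n.+2) (i k : 'I_n.+3) : i < k -> misses c i -> misses c k ->
  exists c', mor_comp (cod k) c = mor_comp (coface (inord i)) c' /\
      mor_comp (cod i) c = mor_comp (coface (inord k.-1)) c'.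
Proof.
move=> ik gi gk; have Hi := ltn_ord i; have Hk := ltn_ord k.
exists (mor_comp (cod (inord i)) (mor_comp (cod k) c)); split.
  rewrite coface_cod // => t /(congr1 val); rewrite /= inordK; last by lia.
  have := ltn_ord (c t); have : nat_of_ord (c t) <> i by move=> /val_inj; exact: gi.
  have : nat_of_ord (c t) <> k by move=> /val_inj; exact: gk.
  by case: ifP; lia.
apply: mor_eqP => t /=; rewrite /bump !inordK; [|lia..].
have := ltn_ord (c t); have : nat_of_ord (c t) <> i by move=> /val_inj; exact: gi.
have : nat_of_ord (c t) <> k by move=> /val_inj; exact: gk.
by case: (ltnP k (c t)); case: (ltnP i (c t)); repeat case: ifP; lia.
Qed.

Lemma Delta_actE n m l (f : mor l m) (g : Delta n m) : act f g = mor_comp g f.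
Proof. by []. Qed.

Definition jmE := (jm_comp, mor_id_comp, mor_comp_id, mor_compA).

(** * Slices over a simplex *)

Definition dec_act (d : nat) (X : sset) m n (f : mor m n) (y : X (d + n).+1) : X (d + m).+1 :=
  act (jm v0 f (mor_id d)) y.

Lemma dec_act_id d (X : sset) n (y : X (d + n).+1) : dec_act (mor_id n) y = y.
Proof. by rewrite /dec_act jm_id act_id. Qed.

Lemma dec_act_comp d (X : sset) l m n (f : mor l m) (g : mor m n) (y : X (d + n).+1) :
  dec_act f (dec_act g y) = dec_act (mor_comp g f) y.
Proof. by rewrite /dec_act act_comp jm_comp mor_comp_id. Qed.

(** Its m-simplices with given back face [s : X d] are those of X_{/s}. *)
Definition dec (d : nat) (X : sset) : sset :=
  @SSet (fun m => X (d + m).+1) (@dec_act d X) (@dec_act_id d X) (@dec_act_comp d X).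

Definition dback d (X : sset) m (y : dec d X m) : X d := @act X _ _ (jinr v0 m d) y.
Definition dfront d (X : sset) m (y : dec d X m) : X m := @act X _ _ (jinl v0 m d) y.

Lemma Er_nat d d' (f : mor d' d) (X : sset) m n (g : mor m n) (y : dec d X n) :
  @act X _ _ (jm v0 (mor_id m) f) (act g y : X (d + m).+1) = @act (dec d' X) _ _ g (@act X _ _ (jm v0 (mor_id n) f) y).
Proof. by rewrite [in LHS]/= [in RHS]/= /dec_act !act_comp !jm_comp !mor_id_comp !mor_comp_id. Qed.

(** On simplices with back face s this is the projection X_{/s} -> X_{/f^* s}. *)
Definition dres d d' (f : mor d' d) (X : sset) : smap (dec d X) (dec d' X) :=
  @SMap (dec d X) (dec d' X) (fun m y => @act X _ _ (jm v0 (mor_id m) f) y) (@Er_nat d d' f X).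

Lemma Er_comp d d' d2 (f : mor d' d) (g : mor d2 d') X m (y : dec d X m) :
  dres g X m (dres f X m y) = dres (mor_comp f g) X m y.
Proof. by rewrite [LHS]act_comp jm_comp mor_id_comp. Qed.

Lemma Er_id d X m (y : dec d X m) : dres (mor_id d) X m y = y.
Proof. exact: (@dec_act_id d X m y). Qed.

Lemma dback_Er d d' (f : mor d' d) X m (y : dec d X m) : dback (dres f X m y) = act f (dback y).
Proof. by rewrite /dback [LHS]act_comp act_comp jm_inr. Qed.

Lemma dfront_Er d d' (f : mor d' d) X m (y : dec d X m) : dfront (dres f X m y) = dfront y.
Proof. by rewrite /dfront [LHS]act_comp jm_inl mor_comp_id. Qed.

Lemma dback_act d (X : sset) m n (f : mor m n) (y : dec d X n) : dback (act f y) = dback y.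
Proof. by rewrite /dback [LHS]act_comp jm_inr mor_comp_id. Qed.

Lemma dfront_act d (X : sset) m n (f : mor m n) (y : dec d X n) : dfront (act f y) = act f (dfront y).
Proof. by rewrite /dfront [LHS]act_comp act_comp jm_inl. Qed.

Definition Afront (X : sset) (A : X 0 -> Prop) d m (y : dec d X m) := forall t, A (vert (dfront y) t).

Lemma Afront_act (X : sset) (A : X 0 -> Prop) d m n (f : mor m n) (y : dec d X n) : Afront A y -> Afront A (act f y).
Proof. by move=> Ay t; rewrite dfront_act vert_act. Qed.

Lemma Afront_Er (X : sset) (A : X 0 -> Prop) d d' (f : mor d' d) m (y : dec d X m) : Afront A (dres f X m y) <-> Afront A y.
Proof. by split=> H t; have := H t; rewrite dfront_Er. Qed.

(** The single property needed to extend cones. It holds at every vertex of the back part but the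
    last, because the front is nonempty and the horn is therefore inner; at the last vertex it holds
    when the last edge of [om] is special. *)
Definition efill (X : sset) (A : X 0 -> Prop) d (om : X d.+1) (i : 'I_d.+2) : Prop :=
  forall m (h : smap (horn (jinr v0 m d.+1 i)) X),
  (forall k (c : mor k d.+1) H, h k (exist _ (mor_comp (jinr v0 m d.+1) c : Delta (d.+1 + m).+1 k) H) = act c om) ->
  (forall t H, A (h 0 (exist _ (mor_cst 0 (jinl v0 m d.+1 t) : Delta (d.+1 + m).+1 0) H))) ->
  exists y : X (d.+1 + m).+1, forall l g, h l g = act (sval g : mor l _) y.

Lemma efill_inner (X : sset) (qX : infty_category X) A d (om : X d.+1) (i : 'I_d.+2) : i < d.+1 -> efill A om i.
Proof. by move=> Hi m h _ _; apply: qfill => //=; lia. Qed.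

Lemma efill_special (X : sset) (A P : X 0 -> Prop) d (om : X d.+1) (i : 'I_d.+2) : val i = d.+1 ->
  special P (act (ledge_mor d) om) -> (forall x, A x -> P x) ->
  (forall t : 'I_d.+2, t < d.+1 -> P (vert om t)) -> efill A om i.
Proof.
move=> id sp AP Pom m.
have : jinr v0 m d.+1 i = ord_max :> 'I_(d + m).+3 by apply: val_inj => /=; rewrite [nat_of_ord i]id; lia.
move: (jinr v0 m d.+1 i) => j -> h hr hl; apply: (sp (d + m) h) => [H|t H Ht].
  have E : ledge_mor (d + m).+1 = mor_comp (jinr v0 m d.+1) (ledge_mor d).
    by apply: mor_eqP => t /=; lia.
  by move: H; rewrite E => H; rewrite hr.
case: (@jm_split v0 m d.+1 t) => -[_ Et]; move: H Ht; rewrite -Et => H Ht.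
  exact/AP/hl.
move: H; rewrite -(mor_comp_cst 0 (jinr v0 m d.+1)) => H; rewrite hr.
by apply: Pom; move: Ht => /=; lia.
Qed.

Section Efill.
Variables (X : sset) (A : X 0 -> Prop) (d : nat) (om : X d.+1) (i : 'I_d.+2) (m : nat).
Variables (u : smap (boundary m) (dec d.+1 X)) (z : 'I_d.+2 -> dec d X m) (al : X m).
Hypothesis fillable : efill A om i.
Hypothesis ub : forall l g, dback (u l g) = om.
Hypothesis zb : forall p, p <> i -> dback (z p) = face p om.
Hypothesis zf : forall p, p <> i -> dfront (z p) = al.
Hypothesis Aal : forall t, A (vert al t).
Hypothesis zz : forall p q, p <> i -> q <> i -> forall k (c : mor k d.+1), misses c p -> misses c q ->
  dres (mor_comp (cod p) c) X m (z p) = dres (mor_comp (cod q) c) X m (z q).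
Hypothesis uz : forall l (g : boundary m l) p, p <> i -> dres (coface p) X l (u l g) = act (sval g : mor l m) (z p).

Lemma Efill_horn k (c : mor k d.+1) : smem (horn i) (c : Delta d.+1 k) -> exists p, p <> i /\ misses c p.
Proof. by []. Qed.

Definition Efill_y n k (g : mor n m) (c : mor k d.+1)
    (r : smem (boundary m) (g : Delta m n) \/ smem (horn i) (c : Delta d.+1 k)) : X (k + n).+1 :=
  match pselect (smem (boundary m) (g : Delta m n)) with
  | left H => dres c X n (u n (exist _ (g : Delta m n) H))
  | right H => let p := sval (cid (Efill_horn (match r with or_introl H' => False_ind _ (H H') | or_intror H' => H' end))) in
     dres (mor_comp (cod p) c) X n (act g (z p))
  end.

Lemma Efill_yu n k (g : boundary m n) (c : mor k d.+1) (r : smem (boundary m) (sval g) \/ smem (horn i) (c : Delta d.+1 k)) :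
  Efill_y r = dres c X n (u n g).
Proof.
rewrite /Efill_y; case: pselect => [H|]; last by case; exact: (svalP g).
by congr (dres _ _ _ (u _ _)); exact: sig_ext.
Qed.

Lemma Efill_yz n k (g : mor n m) (c : mor k d.+1) p (r : smem (boundary m) (g : Delta m n) \/ smem (horn i) (c : Delta d.+1 k)) :
  p <> i -> misses c p -> Efill_y r = dres (mor_comp (cod p) c) X n (act g (z p)).
Proof.
move=> pi cp; rewrite /Efill_y; case: pselect => [H|H].
  rewrite -[act g (z p)](uz (exist _ (g : Delta m n) H) pi) Er_comp.
  by rewrite coface_cod.
by case: cid => q [qi cq]; rewrite -[LHS]/(dres (mor_comp (cod q) c) X n (act g (z q))) !smap_nat; congr act; exact: zz.
Qed.

(** The data form a horn of Delta^m * Delta^{d+1} at the vertex i of the back part: u covers the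
    boundary of Delta^m, and z p covers the face p. *)
Lemma Efill : exists w : dec d.+1 X m,
  [/\ dback w = om, forall l g, u l g = act (sval g : mor l m) w & forall p, p <> i -> dres (coface p) X m w = z p].
Proof.
have [|||h [hy hl hr]] := @horn_of_fam v0 X m d i al om (fun n k g c r => Efill_y r).
- move=> n k n' k' f f' g c r r'; case: (pselect (smem (boundary m) (g : Delta m n))) => H.
    rewrite (Efill_yu (g := exist _ (g : Delta m n) H)) (Efill_yu (g := act f (exist _ (g : Delta m n) H : boundary m n))).
    by rewrite smap_nat [LHS]/= /dec_act [in RHS]/= !act_comp; apply: act_eq; rewrite !jmE.
  case: (r) => // -[p [pi cp]]; rewrite (Efill_yz _ pi cp) (@Efill_yz _ _ _ _ p) //; last by move=> t; exact: cp.
  by rewrite [LHS]/= /dec_act [in RHS]/= /dec_act !act_comp; apply: act_eq; rewrite !jmE.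
- move=> n k g c r; rewrite -[LHS]/(dfront (d := k) (Efill_y r)).
  case: (pselect (smem (boundary m) (g : Delta m n))) => H.
    rewrite (Efill_yu (g := exist _ (g : Delta m n) H)) dfront_Er.
    have [p pi] : exists p : 'I_d.+2, p <> i.
      by exists (if i == ord0 then ord_max else ord0); case: eqP => [->|ni /esym].
    by rewrite -(dfront_Er (coface p)) uz // dfront_act zf.
  by case: (r) => // -[p [pi cp]]; rewrite (Efill_yz _ pi cp) dfront_Er dfront_act zf.
- move=> n k g c r; rewrite -[LHS]/(dback (d := k) (Efill_y r)).
  case: (pselect (smem (boundary m) (g : Delta m n))) => H.
    by rewrite (Efill_yu (g := exist _ (g : Delta m n) H)) dback_Er ub.
  case: (r) => // -[p [pi cp]]; rewrite (Efill_yz _ pi cp) dback_Er dback_act zb //.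
  by rewrite /face act_comp coface_cod.
have [||w wh] := fillable (h := h).
- by move=> k c H; exact: hr.
- move=> t; rewrite -(mor_comp_cst 0 (jinl v0 m d.+1)) => H; rewrite hl; exact: Aal.
have wy n k (g : mor n m) (c : mor k d.+1) (r : smem (boundary m) (g : Delta m n) \/ smem (horn i) (c : Delta d.+1 k)) :
    act (jm v0 g c) w = Efill_y r.
  by rewrite -(hy _ _ _ _ r (jm_horn v0 r)) wh.
exists w; split.
- have H := inr_horn v0 m i (mor_id d.+1); have := wh _ (exist _ _ H).
  by rewrite hr act_id [sval _]/= mor_comp_id.
- move=> l g; have r : smem (boundary m) (sval g) \/ smem (horn i) (mor_id d.+1 : Delta d.+1 d.+1) by left; exact: (svalP g).
  by rewrite [RHS](wy _ _ _ _ r) Efill_yu Er_id.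
- move=> p pi; have cp : misses (coface p) p by move=> k /esym/eqP; rewrite (negbTE (neq_lift _ _)).
  have r : smem (boundary m) (mor_id m : Delta m m) \/ smem (horn i) (coface p : Delta d.+1 d) by right; exists p.
  by rewrite [LHS](wy _ _ _ _ r) (Efill_yz r pi cp) cod_coface Er_id act_id.
Qed.

End Efill.

(** Lifting against the slice projections: a map K -> X_{/om} is determined up to choice by its
    faces other than the i-th. *)
Lemma Efill_ext (X : sset) (A : X 0 -> Prop) d (om : X d.+1) (i : 'I_d.+2) (K : sset) (U : ssub K)
    (u : smap U (dec d.+1 X)) (z : 'I_d.+2 -> smap K (dec d X)) :
  efill A om i ->
  (forall n x, dback (u n x) = om) ->
  (forall p n x, p <> i -> dback (z p n x) = face p om) ->
  (forall p q n x, p <> i -> q <> i -> dfront (z p n x) = dfront (z q n x)) ->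
  (forall p n x, p <> i -> Afront A (z p n x)) ->
  (forall p q n x, p <> i -> q <> i -> forall k (c : mor k d.+1), misses c p -> misses c q ->
     dres (mor_comp (cod p) c) X n (z p n x) = dres (mor_comp (cod q) c) X n (z q n x)) ->
  (forall p n x, p <> i -> dres (coface p) X n (u n x) = z p n (sval x)) ->
  exists w : smap K (dec d.+1 X), [/\ forall n x, w n (sval x) = u n x, forall n x, dback (w n x) = om &
    forall p n x, p <> i -> dres (coface p) X n (w n x) = z p n x].
Proof.
move=> fl ub zb zf zA zz uz.
have [p0 p0i] : exists p : 'I_d.+2, p <> i.
  by exists (if i == ord0 then ord_max else ord0); case: eqP => [->|ni /esym].
have [|||w [wu wR]] := @cell_ext K (dec d.+1 X)
  (fun n x y => dback y = om /\ forall p, p <> i -> dres (coface p) X n y = z p n x) U u.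
- by move=> m n f x y [yb yz]; split=> [|p pi]; rewrite ?dback_act // smap_nat yz // smap_nat.
- by move=> n x; split=> // p pi; exact: uz.
- move=> n x nU a aR aU.
  have [||||||w [wb wa wz]] := @Efill X A d om i n a (fun p => z p n x) (dfront (z p0 n x)) fl.
  + by move=> l g; have [] := aR l g.
  + by move=> p pi; exact: zb.
  + by move=> p pi; exact: zf.
  + exact: zA.
  + by move=> p q pi qi; exact: zz.
  + by move=> l g p pi; have [_ ->] := aR l g; rewrite // smap_nat.
  by exists w.
by exists w; split=> // [n x|p n x pi]; have [H1 H2] := wR n x; rewrite ?H2.
Qed.

Lemma Efill_compat (X : sset) d (i : 'I_d.+3) m (z : 'I_d.+3 -> dec d.+1 X m) :
  (forall p q : 'I_d.+3, p < q -> p <> i -> q <> i -> dres (coface (inord p)) X m (z q) = dres (coface (inord q.-1)) X m (z p)) ->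
  forall p q, p <> i -> q <> i -> forall k (c : mor k d.+2), misses c p -> misses c q ->
     dres (mor_comp (cod p) c) X m (z p) = dres (mor_comp (cod q) c) X m (z q).
Proof.
move=> H p q pi qi k c; wlog pq : p q pi qi / p < q.
  move=> W cp cq; case: (ltngtP p q) => [pq|qp|/val_inj ->] //; first exact: W.
  by apply/esym; exact: W.
move=> cp cq; have [c' [-> ->]] := cod_factor pq cp cq.
by rewrite -!Er_comp H.
Qed.

(** The last horn of Delta^{m+2} = Delta^m * Delta^1 is the union of (boundary * Delta^1) and
    (Delta^m * {1}). It amounts to a boundary in X_{/e} whose image in X_{/tgt e} is filled. *)
Lemma special_of_slice (X : sset) (P : X 0 -> Prop) (e : X 1) :
  (forall m (u : smap (boundary m) (dec 1 X)) (Y : dec 0 X m), (forall l g, dback (u l g) = e) -> Afront P Y -> dback Y = vert e v1 ->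
     (forall l (g : boundary m l), dres (coface ord0) X l (u l g) = act (sval g : mor l m) Y) ->
     exists w : dec 1 X m, [/\ dback w = e, forall l g, u l g = act (sval g : mor l m) w & dres (coface ord0) X m w = Y]) ->
  special P e.
Proof.
move=> H m h he hP.
have jE : jinr v0 m 1 v1 = ord_max :> 'I_m.+3 by apply: val_inj => /=; lia.
move: h he hP; rewrite -jE => h he hP.
have rE k (g : mor k m) j (c : mor j 1) r := @jm_horn v0 m 1 v1 k j g c r.
have gm k (g : boundary m k) : smem (boundary m) (sval g) \/ smem (horn v1) (mor_id 1 : Delta 1 1) by left; exact: (svalP g).
have uN k l (f : mor k l) (g : boundary m l) :
    h _ (exist _ _ (rE _ _ _ _ (gm k (act f g)))) = act f (h _ (exist _ _ (rE _ _ _ _ (gm l g))) : dec 1 X l).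
  rewrite [RHS]/= /dec_act -smap_nat; apply: sub_eq.
  by rewrite -[RHS]/(mor_comp (jm v0 (sval g : mor l m) (mor_id 1)) (jm v0 f (mor_id 1))) jm_comp mor_comp_id.
pose u := @SMap (boundary m) (dec 1 X) _ uN.
have Yr : smem (boundary m) (mor_id m : Delta m m) \/ smem (horn v1) (coface ord0 : Delta 1 0).
  by right; exists v0; split=> [/(congr1 val)//|k /(congr1 val)].
pose Y : dec 0 X m := h _ (exist _ _ (rE _ _ _ _ Yr)).
have inrH := inr_horn v0 m v1 (mor_id 1); rewrite mor_comp_id in inrH.
have inrE : h _ (exist _ _ inrH) = e.
  have E : ledge_mor m.+1 = jinr v0 m 1 by apply: mor_eqP => i /=; lia.
  have H2 : smem (horn (jinr v0 m 1 v1)) (ledge_mor m.+1 : Delta (1 + m).+1 1) by rewrite E.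
  by rewrite -(he H2); apply: sub_eq.
have inlH := inl_horn v0 v1 (mor_id m); rewrite mor_comp_id in inlH.
have Yf : dfront Y = h _ (exist _ _ inlH).
  rewrite /dfront /Y -smap_nat; apply: sub_eq.
  exact: etrans (@jm_inl v0 m 1 m 0 (mor_id m) (coface (ord0 : 'I_2))) (mor_comp_id _).
have [||||w [wb wu wY]] := H m u Y.
- move=> l g; rewrite /dback -inrE -smap_nat; apply: sub_eq.
  exact: etrans (@jm_inr v0 m 1 l 1 (sval g : mor l m) (mor_id 1)) (mor_comp_id _).
- move=> t; rewrite Yf /vert -smap_nat.
  have E : mor_comp (jinl v0 m 1) (mor_cst 0 t) = mor_cst 0 (jinl v0 m 1 t) by exact: mor_ext.
  have H2 : smem (horn (jinr v0 m 1 v1)) (mor_cst 0 (jinl v0 m 1 t) : Delta (1 + m).+1 0).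
    by rewrite -E; exact: inl_horn.
  rewrite (_ : h 0 _ = h 0 (exist _ _ H2)); last exact: sub_eq.
  by apply: hP => /=; have := ltn_ord t; lia.
- rewrite /dback /Y -inrE /vert -!smap_nat; apply: sub_eq.
  apply: etrans (@jm_inr v0 m 1 m 0 (mor_id m) (coface (ord0 : 'I_2))) _; rewrite [RHS]/=; congr mor_comp.
  by apply: mor_eqP => t; rewrite (ord1 t).
- move=> l g; apply: etrans (etrans (esym (smap_nat h _ _)) _) (smap_nat h _ _); apply: sub_eq.
  apply: etrans (@jm_comp v0 m 1 l 1 l 0 (sval g : mor l m) (mor_id 1) (mor_id l) (coface (ord0 : 'I_2))) _.
  by apply/esym/(etrans (@jm_comp v0 m 1 m 0 l 0 (mor_id m) (coface (ord0 : 'I_2)) (sval g : mor l m) (mor_id 0))); rewrite !mor_id_comp !mor_comp_id.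
exists (w : X m.+2) => l [g Hg]; rewrite [sval _]/=.
case: (@horn_cases v0 m 1 v1 l g Hg) => [[a [c [j [E r]]]]|[a E]|[c E]]; move: Hg; rewrite E => Hg.
- have H2 := rE _ a _ c r.
  have -> : h l (exist _ _ Hg) = act (jgr v0 j) (h _ (exist _ _ H2)) by rewrite -smap_nat; exact: sub_eq.
  rewrite -act_comp; congr act; case: r => [r|[v [vi cv]]].
    have E2 : h _ (exist _ _ H2) = dres c X _ (u _ (exist _ (a : Delta m l) r)).
      apply: etrans (smap_nat h _ _); apply: sub_eq.
      by apply/esym/(etrans (@jm_comp v0 m 1 l 1 l l a (mor_id 1) (mor_id l) c)); rewrite mor_id_comp mor_comp_id.
    rewrite E2 wu; apply: etrans (act_comp _ _ _) _; apply: act_eq.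
    by apply: etrans (@jm_comp v0 m 1 l 1 l l a (mor_id 1) (mor_id l) c) _; rewrite mor_comp_id mor_id_comp.
  have Ec : c = mor_comp (coface ord0) (mor_cst l ord0).
    apply: mor_ext => t; have := cv t; case: (I2P v) vi => -> //; case: (I2P (c t)) => -> // _ _; exact: val_inj.
  have E2 : h _ (exist _ _ H2) = dres (mor_cst l ord0) X _ (act a Y).
    apply: etrans (etrans _ (smap_nat h _ _)) (congr1 _ (smap_nat h _ _)); apply: sub_eq.
    apply/esym; apply: etrans (congr1 (fun z => mor_comp z _) (@jm_comp v0 m 1 m 0 l 0 (mor_id m) (coface (ord0 : 'I_2)) a (mor_id 0))) _.
    apply: etrans (@jm_comp v0 m 1 l 0 l l _ _ (mor_id l) (mor_cst l ord0)) _.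
    by rewrite mor_id_comp ?mor_comp_id -Ec.
  rewrite E2 -wY -smap_nat Er_comp -Ec; apply: etrans (act_comp _ _ _) _; apply: act_eq.
  by apply: etrans (@jm_comp v0 m 1 l 1 l l a (mor_id 1) (mor_id l) c) _; rewrite mor_comp_id mor_id_comp.
- have -> : h l (exist _ _ Hg) = act a (h _ (exist _ _ inlH)) by rewrite -smap_nat; exact: sub_eq.
  by rewrite -Yf -wY dfront_Er /dfront act_comp.
- have -> : h l (exist _ _ Hg) = act c (h _ (exist _ _ inrH)) by rewrite -smap_nat; exact: sub_eq.
  by rewrite inrE -wb /dback act_comp.
Qed.

(** * Equivalences are special *)

Lemma Er_eq d d' (f g : mor d' d) X m (y : dec d X m) : f = g -> dres f X m y = dres g X m y.
Proof. by move->. Qed.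

Definition from_empty (K X : sset) : smap (empty K) X :=
  @SMap (empty K) X (fun n x => False_rect (X n) (svalP x)) (fun _ _ _ x => False_ind _ (svalP x)).

Section Joyal.
Variables (X : sset) (qX : infty_category X).

Lemma dfill1 (om : X 1) (K : sset) (U : ssub K) (u : smap U (dec 1 X)) (z : smap K (dec 0 X)) :
  (forall n x, dback (u n x) = om) -> (forall n x, dback (z n x) = vert om v0) ->
  (forall n x, dres (coface (inord 1)) X n (u n x) = z n (sval x)) ->
  exists w : smap K (dec 1 X), [/\ forall n x, w n (sval x) = u n x, forall n x, dback (w n x) = om &
    forall n x, dres (coface (inord 1)) X n (w n x) = z n x].
Proof.
move=> ub zb uz; have p1 (p : 'I_2) : p <> v0 -> p = inord 1.
  by move=> np; apply: val_inj; case: (I2P p) np => -> //= _; rewrite inordK.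
have [|||||||w [wu wb wz]] := @Efill_ext X (fun=> True) 0 om v0 K U u (fun=> z).
- exact: efill_inner.
- exact: ub.
- by move=> p n x /p1 ->; rewrite zb -/(src om) src_face.
- by [].
- by [].
- by move=> p q n x /p1 -> /p1 ->.
- by move=> p n x /p1 ->.
exists w; split=> // n x; apply: wz => /(congr1 val); by rewrite /= inordK.
Qed.

(** Extension of cones in X without condition on the front vertices. Faces are indexed by numbers,
    and the entry of z at the missing index j is arbitrary. *)
Lemma dfill d j (om : X d.+2) (K : sset) (U : ssub K) (u : smap U (dec d.+2 X)) (z : nat -> smap K (dec d.+1 X)) :
  j < d.+2 -> (forall n x, dback (u n x) = om) ->
  (forall p, p < d.+3 -> p <> j -> forall n x, dback (z p n x) = face (inord p) om) ->
  (forall p q, p < q -> q < d.+3 -> p <> j -> q <> j -> forall n x,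
     dres (coface (inord p)) X n (z q n x) = dres (coface (inord q.-1)) X n (z p n x)) ->
  (forall p, p < d.+3 -> p <> j -> forall n x, dres (coface (inord p)) X n (u n x) = z p n (sval x)) ->
  exists w : smap K (dec d.+2 X), [/\ forall n x, w n (sval x) = u n x, forall n x, dback (w n x) = om &
    forall p, p < d.+3 -> p <> j -> forall n x, dres (coface (inord p)) X n (w n x) = z p n x].
Proof.
move=> jd ub zb zz uz.
have ne (p : 'I_d.+3) : p <> inord j -> nat_of_ord p <> j by move=> pj E; apply: pj; apply: val_inj; rewrite /= inordK //; lia.
have c (p q : 'I_d.+3) n (x : K n) : p < q -> p <> inord j -> q <> inord j ->
    dres (coface (inord p)) X n (z q n x) = dres (coface (inord q.-1)) X n (z p n x).
  by move=> pq /ne pj /ne qj; apply: zz => //; exact: ltn_ord.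
have [|||||||w [wu wb wz]] := @Efill_ext X (fun=> True) d.+1 om (inord j) K U u (fun p : 'I_d.+3 => z p).
- by apply: efill_inner => //; rewrite inordK //; lia.
- exact: ub.
- by move=> p n x /ne pj; rewrite zb ?ltn_ord // inord_val.
- move=> p q n x; wlog pq : p q / p < q.
    move=> W pj qj; case: (ltngtP p q) => [pq|qp|/val_inj ->] //; first exact: W.
    by apply/esym; exact: W.
  by move=> pj qj; rewrite -(dfront_Er (coface (inord q.-1))) -(c p q) // dfront_Er.
- by [].
- move=> p q n x pj qj; apply: (@Efill_compat X d (inord j) n (fun p : 'I_d.+3 => z p n x)) => // p' q' pq pj' qj'.
  exact: c.
- by move=> p n x /ne pj; rewrite -uz ?ltn_ord // inord_val.
exists w; split=> // p pd pj n x; rewrite (wz (inord p)) ?inordK // => /(congr1 val) /=.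
by rewrite !inordK //; lia.
Qed.

End Joyal.

Ltac er_ord := rewrite ?scompE ?Er_comp; apply: Er_eq; mor_ord.

Lemma inord0 n : inord 0 = ord0 :> 'I_n.+1.
Proof. by apply: val_inj; rewrite /= inordK. Qed.

(** Joyal's extension of outer horns. With an inverse g of e and a 3-simplex x, y, x, y whose edges are
    e, g, e and identities, all missing faces are filled by inner horns. *)
Lemma joyal (X : sset) (qX : infty_category X) (e : X 1) : edge_equiv e -> special (fun=> True) e.
Proof.
case=> g [[T2 [t22 t20 t21]] [T1 [t12 t10 t11]]]; apply: special_of_slice => m u Y ub _ Yb uY.
have [h0 h1 h2 [h3 h4 h5]] := lohi_face.
have fs2 : face (inord 2) (act hi e) = e by rewrite /face act_comp h3 act_id.
have fs0 : face (inord 0) (act hi e) = degen 1 (tgt e).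
  by rewrite /face act_comp h4 /degen /tgt /vert act_comp; apply: act_eq; exact: mor_ext.
have fs1 : face (inord 1) (act hi e) = e by rewrite /face act_comp h5 act_id.
have [|||||||y [y0 _ y2 y3]] := @T_assoc X qX (inord 1) T1 T1 (act hi e) T2;
  rewrite ?inordK // ?(t22, t20, t21, t12, t10, t11, fs0, fs1, fs2) //.
have {y0}y0 : face (inord 0) y = T1 by apply: y0; rewrite inordK.
have {y2}y2 : face (inord 2) y = act hi e by apply: y2; rewrite inordK.
have {y3}y3 : face (inord 3) y = T2 by apply: y3; rewrite inordK.
(* The face opposite the vertex 1: a triangle on x, x, y whose edges are an identity and twice e.
   The final extension takes place over it. *)
pose D1 := face (inord 1) y.
have d0 : face (inord 0) D1 = e by rewrite -t10 -y0; apply: face_face; mor_ord.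
have d2 : face (inord 2) D1 = degen 1 (src e) by rewrite -t21 -y3; apply: face_face; mor_ord.
have d1 : face (inord 1) D1 = e by rewrite -[RHS]fs1 -y2; apply: face_face; mor_ord.
have tg : tgt g = src e.
  have := @face_face X 0 T2 (inord 0) (inord 0) (inord 0) (inord 1).
  rewrite t20 t21 tgt_face => ->; last by mor_ord.
  by rewrite -tgt_face; exact: vert_degen.
have sg : src g = tgt e.
  by rewrite src_face tgt_face -{1}t20 -{1}t22; apply: face_face; mor_ord.
pose s := dres (mor_cst 1 ord0 : mor 1 0) X.
have uY' l (x : boundary m l) : dres (coface (inord 0)) X l (u l x) = act (sval x : mor l m) Y by rewrite inord0 uY.
(* Over the boundary of Delta^m, u is prolonged to cones on the triangle of e and g. The face found
   by filling is [psi], a boundary in X_{/g}. *)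
pose z2 (p : nat) : smap (boundary m) (dec 1 X) := if p is 1 then s \os (dres (coface (inord 1)) X \os u) else u.
have [//|||||ze2 [_ zb2 ze2f]] := @dfill X qX 0 0 T2 (boundary m) (empty _) (from_empty _ _) z2.
- by move=> n x; case: (svalP x).
- move=> [|[|[|//]]] // _ _ n x /=; last by rewrite ub t22.
  by rewrite -[dback _]/(dback (s n (dres (coface (inord 1)) X n (u n x)))) !dback_Er ub t21 /degen src_face.
- by move=> p q pq qd pj qj n x; move: p q pq qd pj qj => -[|[|[|p]]] [|[|[|q]]] // _ _ _ _; er_ord.
- by move=> p _ _ n x; case: (svalP x).
have {ze2f} [ze21 ze22] : (forall n x, dres (coface (inord 1)) X n (ze2 n x) = s n (dres (coface (inord 1)) X n (u n x))) /\
    (forall n x, dres (coface (inord 2)) X n (ze2 n x) = u n x).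
  by split=> n x; [exact: (ze2f 1)|exact: (ze2f 2)].
have ze2v n (x : boundary m n) : dres (coface (inord 0)) X n (dres (coface (inord 0)) X n (ze2 n x)) = dres (coface (inord 1)) X n (u n x).
  have := congr1 (dres (coface (inord 0)) X n) (ze21 n x); rewrite !Er_comp => E.
  transitivity (dres (mor_comp (coface (inord 1)) (coface (inord 0))) X n (ze2 n x)); first by er_ord.
  by rewrite E; er_ord.
pose psi := dres (coface (inord 0)) X \os ze2.
(* The prolongation continues from [psi] over the triangle of g and e. *)
pose z1 (p : nat) : smap (boundary m) (dec 1 X) := if p is 1 then s \os (dres (coface (inord 0)) X \os u) else psi.
have [//|||||ze1 [_ zb1 ze1f]] := @dfill X qX 0 0 T1 (boundary m) (empty _) (from_empty _ _) z1.
- by move=> n x; case: (svalP x).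
- move=> [|[|[|//]]] // _ _ n x.
    by rewrite -[dback _]/(dback (s n (dres (coface (inord 0)) X n (u n x)))) !dback_Er ub t11 /degen tgt_face.
  by rewrite -[dback _]/(dback (dres (coface (inord 0)) X n (ze2 n x))) !dback_Er zb2 -/(face _ _) t20 t12.
- move=> p q pq qd pj qj n x; move: p q pq qd pj qj => -[|[|[|p]]] [|[|[|q]]] // _ _ _ _; rewrite !scompE -(ze22 n x); er_ord.
- by move=> p _ _ n x; case: (svalP x).
have {ze1f} [ze11 ze12] : (forall n x, dres (coface (inord 1)) X n (ze1 n x) = s n (dres (coface (inord 0)) X n (u n x))) /\
    (forall n x, dres (coface (inord 2)) X n (ze1 n x) = psi n x).
  by split=> n x; [exact: (ze1f 1)|exact: (ze1f 2)].
(* Three faces are now known over the 3-simplex; the fourth prescribes the boundary over [D1]. *)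
pose zo (p : nat) : smap (boundary m) (dec 2 X) := match p with 0 => ze1 | 2 => dres hi X \os u | _ => ze2 end.
have [//|||||om [_ omb omf]] := @dfill X qX 1 1 y (boundary m) (empty _) (from_empty _ _) zo.
- by move=> n x; case: (svalP x).
- move=> [|[|[|[|//]]]] // _ _ n x; first by rewrite zb1 y0.
    by rewrite -[dback _]/(dback (dres hi X n (u n x))) dback_Er ub y2.
  by rewrite zb2 y3.
- move=> p q pq qd pj qj n x; move: p q pq qd pj qj => -[|[|[|[|p]]]] [|[|[|[|q]]]] // _ _ _ _.
    apply: etrans (esym (ze11 n x)); er_ord.
  apply: etrans (ze22 n x) _; rewrite scompE Er_comp -[LHS]Er_id; apply: Er_eq; rewrite -h3; mor_ord.
- by move=> p _ _ n x; case: (svalP x).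
have om0 n x : dres (coface (inord 0)) X n (om n x) = ze1 n x by exact: (omf 0).
have om2 n x : dres (coface (inord 2)) X n (om n x) = dres hi X n (u n x) by exact: (omf 2).
have om3 n x : dres (coface (inord 3)) X n (om n x) = ze2 n x by exact: (omf 3).
pose zY := @yoneda (dec 0 X) m Y.
have zYb n x : dback (zY n x) = tgt e by rewrite dback_act.
(* From here on over all of Delta^m. Since Y sits at the source of g, extending it along g is an
   inner filling. *)
have [|||G [Gu Gb G1]] := @dfill1 X qX g (Delta m) (boundary m) psi zY.
- by move=> n x; rewrite -[dback _]/(dback (dres (coface (inord 0)) X n (ze2 n x))) dback_Er zb2.
- by move=> n x; rewrite zYb -sg.
- move=> n x; rewrite -[RHS]uY' -(ze22 n x); er_ord.
(* Continues along e and returns to Y: the face omitting the middle vertex is degenerate on Y. *)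
pose zf (p : nat) : smap (Delta m) (dec 1 X) := if p is 1 then s \os zY else G.
have [//|||||F [Fu Fb Ff]] := @dfill X qX 0 0 T1 (Delta m) (boundary m) ze1 zf.
- exact: zb1.
- move=> [|[|[|//]]] // _ _ n x; last by rewrite Gb t12.
  by rewrite -[dback _]/(dback (s n (zY n x))) dback_Er zYb t11.
- move=> p q pq qd pj qj n x; move: p q pq qd pj qj => -[|[|[|p]]] [|[|[|q]]] // _ _ _ _; apply: etrans (G1 n x) _; rewrite scompE Er_comp.
  by rewrite -[LHS]Er_id; apply: Er_eq; mor_ord.
- move=> [|[|[|//]]] // _ _ n x; last by rewrite [RHS]Gu ze12.
  by rewrite ze11 uY'.
have F1 n x : dres (coface (inord 1)) X n (F n x) = s n (zY n x) by exact: (Ff 1).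
have F2 n x : dres (coface (inord 2)) X n (F n x) = G n x by exact: (Ff 2).
(* Over [D1] the known faces are the copy of e found in F and a degenerate one; the face obtained by
   filling is the desired cone on e. *)
pose zw (p : nat) : smap (Delta m) (dec 1 X) := if p is 0 then dres (coface (inord 0)) X \os F
  else s \os (dres (coface (inord 0)) X \os G).
have [//|||||W [Wu Wb Wf]] := @dfill X qX 0 1 D1 (Delta m) (boundary m) (dres (coface (inord 1)) X \os om) zw.
- by move=> n x; rewrite scompE dback_Er omb.
- move=> [|[|[|//]]] // _ _ n x; rewrite !scompE !dback_Er.
    by rewrite Fb -/(face _ _) t10 d0.
  by rewrite Gb d2 -tg tgt_face.
- move=> p q pq qd pj qj n x; move: p q pq qd pj qj => -[|[|[|p]]] [|[|[|q]]] // _ _ _ _; rewrite !scompE -F2; er_ord.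
- move=> [|[|[|//]]] // _ _ n x; rewrite !scompE.
    by rewrite Fu -om0; er_ord.
  rewrite Gu !scompE ze2v -[RHS]ze21 -om3; er_ord.
have W0 n x : dres (coface (inord 0)) X n (W n x) = dres (coface (inord 0)) X n (F n x) by exact: (Wf 0).
exists (dres (coface (inord 1)) X m (W m (mor_id m))); split.
- by rewrite dback_Er Wb.
- move=> l x; rewrite -!smap_nat Delta_actE mor_id_comp Wu scompE.
  transitivity (dres (coface (inord 1)) X l (dres (coface (inord 2)) X l (om l x))); last by er_ord.
  by rewrite om2 Er_comp h5 Er_id.
- rewrite -inord0; transitivity (dres (coface (inord 0)) X m (dres (coface (inord 0)) X m (W m (mor_id m)))); first by er_ord.
  rewrite W0; transitivity (dres (coface (inord 0)) X m (dres (coface (inord 1)) X m (F m (mor_id m)))); first by er_ord.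
  rewrite F1 Er_comp; transitivity (dres (mor_id 0) X m (zY m (mor_id m))); first by apply: Er_eq; mor_ord.
  by rewrite Er_id [zY _ _]act_id.
Qed.

(** * Limits in the chosen orientation *)

Lemma rv_jinl b m k : rv b (jinl v0 m k) = jinl b m k.
Proof. by apply: mor_eqP => i; rewrite [LHS]rvo_max /=; have := ltn_ord i; case: (I2P b) => -> /=; rewrite ?rvo_max /=; lia. Qed.

Lemma rv_jinr b m k : rv b (jinr v0 m k) = jinr b m k.
Proof. by apply: mor_eqP => i; rewrite [LHS]rvo_max /=; have := ltn_ord i; case: (I2P b) => -> /=; rewrite ?rvo_max /=; lia. Qed.

Lemma rv_jm b m k m' k' (f : mor m' m) (g : mor k' k) : rv b (jm v0 f g) = jm b (rv b f) (rv b g).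
Proof.
apply: (@jm_ext b).
  by rewrite jm_inl -(rv_jinl b m' k') -(rv_jinl b m k) -rv_comp jm_inl rv_comp.
by rewrite jm_inr -(rv_jinr b m' k') -(rv_jinr b m k) -rv_comp jm_inr rv_comp.
Qed.

Lemma oactE b (X : sset) m n (f : mor m n) (x : X n) : @act (osset b X) m n f x = @act X m n (rv b f) x.
Proof. by []. Qed.

Section OLim.
Variables (b : 'I_2) (C K : sset) (L : ssub K) (s : smap K C).
Hypothesis lim : limit_cone b L s.
Let X := osset b C.

(** Simplices are read in [osset b C], where the new vertices come in front of K for both values of
    b; only joins oriented by v0 remain. *)
Lemma limit_fill n (al : X n)
  (y : forall m k (g : mor m n) (x : K k), smem (boundary n) (g : Delta n m) \/ smem L x -> X (k + m).+1) :
  (forall m k m' k' (f : mor m' m) (f' : mor k' k) (g : mor m n) (x : K k) r r',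
     y m' k' (mor_comp g f) (@act (osset b K) _ _ f' x) r' = @act X _ _ (jm v0 f f') (y m k g x r)) ->
  (forall m k g x r, @act X _ _ (jinl v0 m k) (y m k g x r) = act g al) ->
  (forall m k g x r, @act X _ _ (jinr v0 m k) (y m k g x r) = s k x) ->
  exists W : forall k, K k -> X (k + n).+1,
    [/\ forall k k' (f : mor k' k) x, W k' (@act (osset b K) _ _ f x) = @act X _ _ (jm v0 (mor_id n) f) (W k x),
        forall m k g x r, y m k g x r = @act X _ _ (jm v0 g (mor_id k)) (W k x),
        forall k x, @act X _ _ (jinl v0 n k) (W k x) = al & forall k x, @act X _ _ (jinr v0 n k) (W k x) = s k x].
Proof.
move=> ynat yl yr.
have rr m k (g : mor m n) (x : K k) : smem (boundary n) (g : Delta n m) \/ smem L x ->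
    smem (boundary n) (rv b g : Delta n m) \/ smem L x.
  by case=> H; [left; apply/rv_boundary|right].
have yirr m k (g g' : mor m n) (x x' : K k) r r' : g = g' -> x = x' -> y m k g x r = y m k g' x' r'.
  by move=> Eg Ex; subst; congr y; exact: Prop_irrelevance.
pose alC : C n := al.
pose y' m k g x r : C (k + m).+1 := y m k (rv b g) x (rr m k g x r).
have y'nat m k m' k' (f : mor m' m) (f' : mor k' k) (g : mor m n) (x : K k) r r' :
     y' m' k' (mor_comp g f) (act f' x) r' = act (jm b f f') (y' m k g x r).
  have E1 : @act (osset b K) _ _ (rv b f') x = act f' x by rewrite oactE rvK.
  have E2 : rv b (mor_comp g f) = mor_comp (rv b g) (rv b f) by exact: rv_comp.
  have r2 : smem (boundary n) (mor_comp (rv b g) (rv b f) : Delta n m') \/ smem L (@act (osset b K) _ _ (rv b f') x).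
    by rewrite E1 -E2; exact: (rr _ _ _ _ r').
  apply: etrans (@yirr _ _ _ _ _ _ _ r2 E2 (esym E1)) _; apply: etrans (ynat _ _ _ _ _ _ _ _ (rr _ _ _ _ r) _) _.
  by rewrite oactE rv_jm !rvK.
have y'l m k g x r : act (jinl b m k) (y' m k g x r) = act g alC.
  by rewrite -rv_jinl -oactE (yl _ _ _ _ _) oactE rvK.
have y'r m k g x r : act (jinr b m k) (y' m k g x r) = s k x.
  by rewrite -rv_jinr -oactE (yr _ _ _ _ _).
have [|||||||W [W1 W2 _ W3 W4]] := rl_use lim (al := alC) (y := y') (T := fun _ _ => tt) => //.
exists W; split.
- by move=> k k' f x; rewrite !oactE rv_jm rv_id -W1.
- move=> m k g x r; have r2 : smem (boundary n) (rv b g : Delta n m) \/ smem L x by exact/rr.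
  by rewrite oactE rv_jm rv_id -(W2 _ _ _ _ r2); apply: yirr => //; rewrite rvK.
- by move=> k x; rewrite oactE rv_jinl W3.
- by move=> k x; rewrite oactE rv_jinr W4.
Qed.

End OLim.

Lemma final_fill b (C : sset) (z : C 0) : limit_cone b (empty (Delta 0)) (yoneda z) ->
  forall m (u : smap (boundary m) (dec 0 (osset b C))) (al : osset b C m),
  (forall l g, dback (u l g) = z) -> (forall l (g : boundary m l), dfront (u l g) = act (sval g : mor l m) al) ->
  exists w : dec 0 (osset b C) m, [/\ dback w = z, dfront w = al & forall l g, u l g = act (sval g : mor l m) w].
Proof.
move=> lim m u al ub uf.
have bd l k (g : mor l m) (x : Delta 0 k) : smem (boundary m) (g : Delta m l) \/ smem (empty (Delta 0)) x -> smem (boundary m) (g : Delta m l).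
  by case.
have [|||W [W1 W2 W3 W4]] := limit_fill lim (al := al) (y := fun l k g x r => dres (x : mor k 0) (osset b C) l (u l (exist _ _ (bd l k g x r)))).
- move=> l k l' k' f f' g x r r'.
  have -> : exist _ _ (bd l' k' (mor_comp g f) (@act (osset b (Delta 0)) _ _ f' x) r') = act f (exist _ _ (bd l k g x r) : boundary m l).
    exact: sig_ext.
  rewrite smap_nat; apply: etrans (act_comp _ _ _) (etrans _ (esym (act_comp _ _ _))); congr act.
  rewrite !jm_comp mor_id_comp mor_comp_id mor_id_comp; congr jm.
  by apply: mor_ext => t; exact: I1E.
- by move=> l k g x r; rewrite -[LHS]/(dfront (d := k) (dres (x : mor k 0) (osset b C) l _)) dfront_Er uf.
- move=> l k g x r; rewrite -[LHS]/(dback (dres (x : mor k 0) (osset b C) l _)) dback_Er ub.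
  rewrite -[LHS]/(@act C _ _ (rv b (x : mor k 0)) z) -[RHS]/(@act C _ _ (x : mor k 0) z).
  have -> : rv b (x : mor k 0) = (x : mor k 0); last by [].
  by apply: mor_ext => t; exact: I1E.
exists (W 0 (mor_id 0)); split.
- by rewrite /dback W4 /= act_id.
- exact: W3.
- move=> l g; have r : smem (boundary m) (sval g) \/ smem (empty (Delta 0)) (mor_id 0 : Delta 0 0) by left; exact: (svalP g).
  rewrite -[RHS](W2 _ _ _ _ r) Er_id; congr (u _ _); exact: sig_ext.
Qed.

(** * Pullback squares *)

Lemma sq_lt m (x : Sq m) (i : 'I_m.+1) : mfun x.1 i + mfun x.2 i < 3.
Proof. by have := ltn_ord (mfun x.1 i); have := ltn_ord (mfun x.2 i); lia. Qed.

Lemma sq_mono m (x : Sq m) (i j : 'I_m.+1) : i <= j -> mfun x.1 i + mfun x.2 i <= mfun x.1 j + mfun x.2 j.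
Proof. by move=> ij; apply: leq_add; exact: mor_mono. Qed.

(** The sum of the coordinates. On either of the two triangles of the square it inverts the
    inclusion [tri]. *)
Definition sq_tau m (x : Sq m) : mor m 2 := @Mor m 2 (fun i => Ordinal (sq_lt x i)) (@sq_mono m x).

Lemma sq_tau_act m k (f : mor m k) (x : Sq k) : sq_tau (act f x) = mor_comp (sq_tau x) f.
Proof. exact: mor_eqP. Qed.

Definition tri (j : bool) : Sq 2 := if j then (lo, hi) else (hi, lo).

Definition in_tri (j : bool) m (x : Sq m) := forall i, if j then mfun x.1 i <= mfun x.2 i else mfun x.2 i <= mfun x.1 i.

Lemma in_tri_act j m k (f : mor m k) (x : Sq k) : in_tri j x -> in_tri j (act f x).
Proof. by move=> H i; exact: H. Qed.

(** The only incomparable vertices of the square are (0,1) and (1,0), and a simplex cannot contain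
    both. *)
Lemma in_tri_or m (x : Sq m) : in_tri true x \/ in_tri false x.
Proof.
case: (pselect (in_tri true x)) => [|/existsNP [i Hi]]; [by left|right => k].
have := ltn_ord (mfun x.1 i); have := ltn_ord (mfun x.2 i); have := ltn_ord (mfun x.1 k); have := ltn_ord (mfun x.2 k).
case: (leqP i k) => [ik|/ltnW ki].
  by have := mor_mono x.1 ik; move: Hi => /negP /=; lia.
by have := mor_mono x.2 ki; move: Hi => /negP /=; lia.
Qed.

Lemma tri_tau j m (x : Sq m) : in_tri j x -> act (sq_tau x) (tri j) = x.
Proof.
case: x => p q H; case: j H => H; congr pair; apply: mor_eqP => i; have /= := H i;
  have := ltn_ord (mfun p i); have := ltn_ord (mfun q i); rewrite /= /bump;
  move: (nat_of_ord _) (nat_of_ord _) => a c; repeat case: ifP; lia.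
Qed.

Lemma tau_tri j : sq_tau (tri j) = mor_id 2.
Proof. by case: j; mor_ord. Qed.

Lemma tri_in j : in_tri j (tri j).
Proof. by case: j => -[[|[|[|//]]] ?]. Qed.

Section Pullback.
Variables (b : 'I_2) (C : sset) (s : smap Sq C).
Hypothesis lim : limit_cone b (full (fun x : Sq 0 => x <> corner b b)) s.
Let X := osset b C.
Let th j : X 2 := s 2 (tri j).
Let tau m (x : Sq m) : mor m 2 := rv b (sq_tau x).

Lemma th_tau j m (x : Sq m) : in_tri j x -> @act X _ _ (tau x) (th j) = s m x.
Proof. by move=> H; rewrite oactE rvK -smap_nat (tri_tau H). Qed.

Lemma tau_misses m (x : Sq m) : smem (full (fun x : Sq 0 => x <> corner b b)) x -> misses (tau x) ord0.
Proof.
move=> H i E; apply: (H (rvo b i)); rewrite /vert /corner.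
have E1 : rvo b (sq_tau x (rvo b i)) = ord0 by [].
have {E1} : sq_tau x (rvo b i) = rvo b ord0 by rewrite -E1 rvoK.
move=> /(congr1 (@nat_of_ord _)); rewrite [nat_of_ord (sq_tau _ _)]/= rvo_max.
have := ltn_ord (mfun x.1 (rvo b i)); have := ltn_ord (mfun x.2 (rvo b i)) => H1 H2 H3.
congr pair; apply: mor_eqP => t; rewrite /=; move: H3; case: (I2P b) (H1) (H2) => -> /=; lia.
Qed.

Lemma tau_misses_full m (x : Sq m) : misses (tau x) ord0 -> smem (full (fun x : Sq 0 => x <> corner b b)) x.
Proof.
move=> H i E; have /mor_eqE E1 := congr1 fst E; have /mor_eqE E2 := congr1 snd E; apply: (H (rvo b i)); apply: ord_inj; rewrite [LHS]rvo_max /= rvoK.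
have /(congr1 val) := E1 ord0; have /(congr1 val) := E2 ord0; rewrite /=; case: (I2P b) => -> /=; lia.
Qed.

Lemma tau_diag m (x : Sq m) : in_tri true x -> in_tri false x -> misses (tau x) (inord 1).
Proof.
move=> H1 H2 i E; have := H1 (rvo b i); have := H2 (rvo b i).
have E1 : rvo b (sq_tau x (rvo b i)) = inord 1 by [].
have {E1} : sq_tau x (rvo b i) = rvo b (inord 1) by rewrite -E1 rvoK.
move=> /(congr1 (@nat_of_ord _)); rewrite [nat_of_ord (sq_tau _ _)]/= rvo_max inordK //.
by case: (I2P b) => -> /=; lia.
Qed.

(** A cone on the square is a pair of cones on its two triangles that agree on the diagonal. The
    omitted corner is the vertex 0 of both triangles, so the given cone on the rest lives over the
    faces 0. *)
Lemma pullback_lift m (u : bool -> smap (boundary m) (dec 2 X)) (y : bool -> dec 1 X m) :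
  (forall j l g, dback (u j l g) = th j) -> (forall j, dback (y j) = face ord0 (th j)) ->
  (forall l g, dres (coface (inord 1)) X l (u true l g) = dres (coface (inord 1)) X l (u false l g)) ->
  dres (coface ord0) X m (y true) = dres (coface ord0) X m (y false) ->
  (forall j l (g : boundary m l), dres (coface ord0) X l (u j l g) = act (sval g : mor l m) (y j)) ->
  exists w : bool -> dec 2 X m, [/\ forall j, dback (w j) = th j,
    forall j l g, u j l g = act (sval g : mor l m) (w j), forall j, dres (coface ord0) X m (w j) = y j
    & dres (coface (inord 1)) X m (w true) = dres (coface (inord 1)) X m (w false)].
Proof.
move=> ub yb uu yy uy.
pose z j l k (g : mor l m) (x : Sq k) : dec k X l :=
  match pselect (smem (boundary m) (g : Delta m l)) with
  | left H => dres (tau x) X l (u j l (exist _ (g : Delta m l) H))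
  | right _ => dres (mor_comp (cod ord0) (tau x)) X l (act g (y j))
  end.
have zu j l k (g : boundary m l) (x : Sq k) : z j l k (sval g) x = dres (tau x) X l (u j l g).
  rewrite /z; case: pselect => [H|]; last by case; exact: (svalP g).
  by congr (dres _ _ _ (u _ _ _)); exact: sig_ext.
have zy j l k (g : mor l m) (x : Sq k) : misses (tau x) ord0 ->
    z j l k g x = dres (mor_comp (cod ord0) (tau x)) X l (act g (y j)).
  move=> xm; rewrite /z; case: pselect => [H|//].
  by rewrite -[act g (y j)](uy j l (exist _ _ H)) Er_comp coface_cod.
have zz l k (g : mor l m) (x : Sq k) : in_tri true x -> in_tri false x ->
    smem (boundary m) (g : Delta m l) \/ misses (tau x) ord0 -> z true l k g x = z false l k g x.
  move=> x1 x2 [H|H].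
    rewrite -[g]/(sval (exist _ (g : Delta m l) H : boundary m l)) !zu.
    have E : mor_comp (coface (inord 1)) (mor_comp (cod (inord 1)) (tau x)) = tau x := coface_cod (tau_diag x1 x2).
    transitivity (dres (mor_comp (cod (inord 1)) (tau x)) X l (dres (coface (inord 1)) X l (u true l (exist _ (g : Delta m l) H)))).
      by rewrite Er_comp E.
    by rewrite uu Er_comp E.
  (* A simplex of the diagonal that avoids the corner is constant at the end vertex, where [yy]
     applies. *)
  rewrite !zy //; have -> : mor_comp (cod ord0) (tau x) = mor_comp (coface ord0) (mor_cst k ord0).
    have td : misses (tau x) (inord 1) := tau_diag x1 x2.
    apply: mor_eqP => i; rewrite !mor_compE; move: (tau x i) (td i) (H i) => t n1 n0.
    have : nat_of_ord t <> 0 by move=> E; apply: n0; exact: val_inj.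
    have : nat_of_ord t <> 1 by move=> E; apply: n1; apply: val_inj; rewrite /= inordK.
    by have := ltn_ord t; rewrite /= /bump /=; case: ifP; lia.
  by rewrite -!Er_comp !smap_nat yy.
have znat j l k l' k' (f : mor l' l) (f' : mor k' k) (g : mor l m) (x : Sq k) :
    smem (boundary m) (g : Delta m l) \/ misses (tau x) ord0 ->
    z j l' k' (mor_comp g f) (@act (osset b Sq) _ _ f' x) = @act X _ _ (jm v0 f f') (z j l k g x).
  have tE : tau (@act (osset b Sq) _ _ f' x) = mor_comp (tau x) f'.
    by rewrite /tau oactE sq_tau_act rv_comp rvK.
  move=> r; case: (pselect (smem (boundary m) (g : Delta m l))) => H.
    have gE : mor_comp g f = sval (act f (exist _ (g : Delta m l) H : boundary m l)) by [].
    rewrite {1}gE -[g in RHS]/(sval (exist _ (g : Delta m l) H : boundary m l)) !zu tE smap_nat.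
    apply: etrans (@act_comp X _ _ _ _ _ _) (etrans _ (esym (@act_comp X _ _ _ _ _ _))); congr act.
    by rewrite !jm_comp !mor_id_comp !mor_comp_id.
  case: r => // r; rewrite !zy //; last by rewrite tE => i; exact: r.
  rewrite tE -mor_compA -[act (mor_comp g f) (y j)]act_comp.
  apply: etrans (@act_comp X _ _ _ _ _ _) (etrans _ (esym (@act_comp X _ _ _ _ _ _))); congr act.
  by rewrite !jm_comp !mor_id_comp !mor_comp_id.
have zf l k j (g : mor l m) (x : Sq k) : dfront (z j l k g x) = act g (dfront (y true)).
  have yf j' : dfront (y j') = dfront (y true).
    by rewrite -(dfront_Er (coface ord0)) -[in RHS](dfront_Er (coface ord0)); case: j' => //; rewrite yy.
  rewrite /z; case: pselect => [H|H]; rewrite dfront_Er; last by rewrite dfront_act yf.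
  by rewrite -(dfront_Er (coface ord0)) uy dfront_act yf.
have zb l k j (g : mor l m) (x : Sq k) : in_tri j x -> smem (boundary m) (g : Delta m l) \/ misses (tau x) ord0 ->
    dback (z j l k g x) = s k x.
  move=> xj r; rewrite -(th_tau xj) /z; case: pselect => [H|H]; rewrite dback_Er; first by rewrite ub.
  by case: r => // r; rewrite dback_act yb /face act_comp coface_cod.
(* On the diagonal both triangles give the same value, so a fixed choice is harmless. *)
pose jj k (x : Sq k) : bool := `[< in_tri true x >].
have jjP k (x : Sq k) : in_tri (jj k x) x.
  by rewrite /jj; case: asboolP => // H; case: (in_tri_or x).
have rm l k (g : mor l m) (x : Sq k) : smem (boundary m) (g : Delta m l) \/ smem (full (fun x : Sq 0 => x <> corner b b)) x ->
    smem (boundary m) (g : Delta m l) \/ misses (tau x) ord0.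
  by case=> H; [left|right; exact: tau_misses].
have zj l k (g : mor l m) (x : Sq k) j : in_tri j x ->
    smem (boundary m) (g : Delta m l) \/ misses (tau x) ord0 -> z (jj k x) l k g x = z j l k g x.
  move=> xj r; have := jjP k x; case: (jj k x) => xx; case: j xj => // xj; first exact: zz.
  by apply/esym; exact: zz.
have [|||W [W1 W2 W3 W4]] := limit_fill lim (al := dfront (y true)) (y := fun l k g x _ => z (jj k x) l k g x).
- move=> l k l' k' f f' g x r r'; rewrite -(znat _ _ _ _ _ _ _ _ _ (rm _ _ _ _ r)).
  apply: zj; last exact: rm.
  by apply: (@in_tri_act _ _ _ (rv b f')); exact: jjP.
- by move=> l k g x r; exact: zf.
- by move=> l k g x r; apply: zb; [exact: jjP|exact: rm].
have tt j : tau (tri j) = mor_id 2 by rewrite /tau tau_tri rv_id.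
exists (fun j => W 2 (tri j)); split.
- by move=> j; exact: W4.
- move=> j l g; have r : smem (boundary m) (sval g) \/ smem (full (fun x : Sq 0 => x <> corner b b)) (tri j) by left; exact: (svalP g).
  have := W2 _ _ _ _ r; rewrite (zj _ _ _ _ _ (tri_in j) (rm _ _ _ _ r)) zu tt Er_id; exact.
- move=> j; pose x := @act (osset b Sq) _ _ (coface ord0) (tri j).
  have xj : in_tri j x by apply: (@in_tri_act _ _ _ (rv b (coface ord0))); exact: tri_in.
  have tx : tau x = coface ord0 by rewrite /tau /x oactE sq_tau_act tau_tri mor_id_comp rvK.
  have xL : smem (full (fun x : Sq 0 => x <> corner b b)) x.
    by apply: tau_misses_full; rewrite tx => i /esym/eqP; rewrite (negbTE (neq_lift _ _)).
  have := W2 _ _ (mor_id m) x (or_intror xL).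
  rewrite (zj _ _ _ _ _ xj (rm _ _ _ _ (or_intror xL))) zy; last by rewrite tx => i /esym/eqP; rewrite (negbTE (neq_lift _ _)).
  rewrite tx cod_coface Er_id act_id jm_id act_id => ->.
  by rewrite /x W1.
- have E j : @act (osset b Sq) _ _ (coface (inord 1)) (tri j) = (mor_id 1, mor_id 1).
    rewrite oactE; case: j; congr pair; apply: mor_eqP; move=> [[|[|//]] ?]; rewrite /= ?rvo_max /=;
    case: (I2P b) => -> /=; rewrite /bump ?inordK //.
  by rewrite -[LHS]/(@act X _ _ (jm v0 (mor_id m) _) (W 2 (tri true))) -W1 E -(E false) W1.
Qed.

End Pullback.

(** * Trivial fibrations and final objects *)

Definition tfib (E E' : sset) (p : smap E E') : Prop :=
  forall m (u : smap (boundary m) E) (y : E' m), (forall l (g : boundary m l), p l (u l g) = act (sval g : mor l m) y) ->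
  exists w : E m, p m w = y /\ forall l (g : boundary m l), u l g = act (sval g : mor l m) w.

(** Finality through fillers of boundaries with last vertex x. This form makes sense in any
    simplicial set and lifts directly along trivial fibrations. *)
Definition has_final (E : sset) : Prop := exists x : E 0, forall n (u : smap (boundary n.+1) E),
  (forall H, u 0 (exist _ (mor_cst 0 ord_max : Delta n.+1 0) H) = x) ->
  exists w : E n.+1, forall l (g : boundary n.+1 l), u l g = act (sval g : mor l n.+1) w.

Lemma tf_lift (E E' : sset) (p : smap E E') : tfib p -> forall (K : sset) (U : ssub K) (u : smap U E) (v : smap K E'),
  (forall n x, p n (u n x) = v n (sval x)) ->
  exists w : smap K E, (forall n x, w n (sval x) = u n x) /\ forall n x, p n (w n x) = v n x.
Proof.
move=> tp K U u v uv.
have [|||w [wu wv]] := @cell_ext K E (fun n x y => p n y = v n x) U u.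
- by move=> m n f x y E0; rewrite !smap_nat E0.
- exact: uv.
- move=> n x nU a aR aU; have [w [w1 w2]] := tp n a (v n x) (fun l g => etrans (aR l g) (smap_nat v _ x)).
  by exists w.
by exists w.
Qed.

Lemma last_act n k l (f : mor l k) (z : boundary n.+1 k) :
  sval z = mor_cst k ord_max :> mor k n.+1 -> sval (act f z) = mor_cst l ord_max :> mor l n.+1.
Proof. by move=> E; rewrite [LHS]/(mor_comp _ _) E; exact: mor_ext. Qed.

Definition last_vertex n : ssub (boundary n.+1) :=
  @SSub (boundary n.+1) (fun k z => sval z = mor_cst k ord_max :> mor k n.+1) (fun k l f z => @last_act n l k f z).

Lemma last_bd n k : smem (boundary n.+1) (mor_cst k ord_max : Delta n.+1 k).
Proof. by exists ord0 => t /(congr1 val). Qed.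

Definition const_map (U E : sset) (x : E 0) : smap U E := yoneda x \os to_Delta0 U.

(** A boundary in E' is lifted to E so that its last vertex becomes x itself; therefore the lift is
    prescribed on the simplices constant at that vertex. *)
Lemma hasfin_push (E E' : sset) (p : smap E E') : tfib p -> has_final E -> has_final E'.
Proof.
move=> tp [x xP]; exists (p 0 x) => n u ux.
have [|v [vx pv]] := @tf_lift E E' p tp (boundary n.+1) (last_vertex n) (const_map _ x) u.
  move=> k [z zE]; apply: etrans (smap_nat p (mor_cst k ord0) x) _; rewrite -(ux (last_bd n 0)) -smap_nat.
  by congr (u k _); apply: sig_ext; rewrite [RHS]zE; exact: mor_ext.
have [|w wE] := xP n v.
  move=> H; have L : smem (last_vertex n) (exist (@smem _ (boundary n.+1) 0) (mor_cst 0 ord_max : Delta n.+1 0) H) by [].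
  rewrite (vx 0 (exist _ _ L)); rewrite [LHS]/(act (mor_cst 0 ord0) x) -[RHS]act_id; apply: act_eq.
  by apply: mor_ext => t; exact: I1E.
by exists (p _ w) => l g; rewrite -pv wE smap_nat.
Qed.

Lemma bd0_empty k : boundary 0 k -> False.
Proof. by case=> g [i gi]; apply: (gi ord0); exact: I1E. Qed.

Definition from_bd0 (E : sset) : smap (boundary 0) E :=
  @SMap (boundary 0) E (fun k g => False_rect _ (bd0_empty g)) (fun _ _ _ g => False_ind _ (bd0_empty g)).

Lemma hasfin_pull (E E' : sset) (p : smap E E') : tfib p -> has_final E' -> has_final E.
Proof.
move=> tp [x' xP]; have [|x [px _]] := tp 0 (from_bd0 E) x'; first by move=> l g; have := bd0_empty g.
exists x => n u ux; have [|w' wE] := xP n (p \os u).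
  by move=> H; rewrite -px -(ux H).
by have [|w [_ w2]] := tp n.+1 u w'; [exact: wE|exists w].
Qed.

Lemma hasfin_tf (E E' : sset) (p : smap E E') : tfib p -> has_final E <-> has_final E'.
Proof. by move=> tp; split; [exact: (hasfin_push tp)|exact: (hasfin_pull tp)]. Qed.

Lemma tf_id (E : sset) : tfib (sid E).
Proof. by move=> m u y H; exists y; split. Qed.

Section fibprod.
Variables (P Q R : sset) (f : smap P R) (g : smap Q R).

Lemma fibprod_act m n (h : mor m n) (x : sprod P Q n) : f n x.1 = g n x.2 -> f m (act h x).1 = g m (act h x).2.
Proof. by move=> E; rewrite [LHS]smap_nat [RHS]smap_nat E. Qed.

Definition fibprod : ssub (sprod P Q) := @SSub (sprod P Q) (fun n x => f n x.1 = g n x.2) fibprod_act.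

Definition fibprod1 : smap fibprod P := sfst P Q \os incl fibprod.
Definition fibprod2 : smap fibprod Q := ssnd P Q \os incl fibprod.

Lemma fibprod_eq n (x : fibprod n) : f n (fibprod1 n x) = g n (fibprod2 n x).
Proof. exact: (svalP x). Qed.

Lemma fibprod_ext n (x y : fibprod n) : fibprod1 n x = fibprod1 n y -> fibprod2 n x = fibprod2 n y -> x = y.
Proof.
by move=> E1 E2; apply: sig_ext; move: E1 E2; rewrite /fibprod1 /fibprod2 /=; case: (sval x) (sval y) => [a c] [a' c'] /= -> ->.
Qed.

Definition fibprodmk n (a : P n) (c : Q n) (E : f n a = g n c) : fibprod n := exist _ (a, c) E.

Lemma fibprodmap_nat (E : sset) (a : smap E P) (c : smap E Q) (H : forall n x, f n (a n x) = g n (c n x)) m n (h : mor m n) (x : E n) :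
  fibprodmk (H m (act h x)) = act h (fibprodmk (H n x)).
Proof. by apply: fibprod_ext; rewrite /fibprod1 /fibprod2 /= smap_nat. Qed.

Definition fibprodmap (E : sset) (a : smap E P) (c : smap E Q) (H : forall n x, f n (a n x) = g n (c n x)) : smap E fibprod :=
  @SMap E fibprod (fun n x => fibprodmk (H n x)) (@fibprodmap_nat E a c H).

Lemma tf_FPmap (E : sset) (a : smap E P) (c : smap E Q) (H : forall n x, f n (a n x) = g n (c n x)) :
  (forall m (u : smap (boundary m) E) (y1 : P m) (y2 : Q m), f m y1 = g m y2 ->
    (forall l (g : boundary m l), a l (u l g) = act (sval g : mor l m) y1) ->
    (forall l (g : boundary m l), c l (u l g) = act (sval g : mor l m) y2) ->
    exists w : E m, [/\ a m w = y1, c m w = y2 & forall l (g : boundary m l), u l g = act (sval g : mor l m) w]) ->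
  tfib (fibprodmap H).
Proof.
move=> HH m u y uy; have [l x|l x|w [w1 w2 w3]] := HH m u (fibprod1 m y) (fibprod2 m y) (fibprod_eq y).
- by rewrite -smap_nat -uy.
- by rewrite -smap_nat -uy.
by exists w; split=> //; apply: fibprod_ext; rewrite /fibprod1 /fibprod2 /= -?w1 -?w2.
Qed.

End fibprod.

(** Lifting is done in each factor separately; p and q are compatible with the maps to R, so the two
    lifts form a point of the fiber product. *)
Lemma hasfin_FP (P Q R P' Q' : sset) (f : smap P R) (g : smap Q R) (f' : smap P' R) (g' : smap Q' R)
    (p : smap P' P) (q : smap Q' Q) : tfib p -> tfib q ->
  (forall n x, f n (p n x) = f' n x) -> (forall n x, g n (q n x) = g' n x) ->
  has_final (fibprod f' g') <-> has_final (fibprod f g).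
Proof.
move=> tp tq fp gq.
have H n (x : fibprod f' g' n) : f n ((p \os fibprod1 f' g') n x) = g n ((q \os fibprod2 f' g') n x).
  by rewrite [LHS]fp [RHS]gq fibprod_eq.
apply: (@hasfin_tf _ _ (fibprodmap H)); apply: tf_FPmap => m u y1 y2 yy uy1 uy2.
have [|w1 [pw1 uw1]] := tp m (fibprod1 f' g' \os u) y1; first exact: uy1.
have [|w2 [pw2 uw2]] := tq m (fibprod2 f' g' \os u) y2; first exact: uy2.
have E : f' m w1 = g' m w2 by rewrite -fp -gq pw1 pw2.
exists (fibprodmk E); split=> // l x; apply: fibprod_ext; rewrite [RHS]smap_nat; [exact: uw1|exact: uw2].
Qed.

(** * Slices with apex in a subcategory *)

Section slice_in.
Variables (X : sset) (A : X 0 -> Prop).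

Definition in_slice d (s : X d) m (y : dec d X m) := dback y = s /\ Afront A y.

Lemma ov_act d (s : X d) m n (f : mor m n) (y : dec d X n) : in_slice s y -> in_slice s (act f y).
Proof. by case=> E H; split; [rewrite dback_act|exact: Afront_act]. Qed.

(** The m-simplices of X_{/s} whose front vertices satisfy A. *)
Definition slice_in d (s : X d) : ssub (dec d X) := @SSub (dec d X) (fun m y => in_slice s y) (fun m n f y => @ov_act d s m n f y).

Definition slice_res d d' (f : mor d' d) (s : X d) : smap (slice_in s) (dec d' X) := dres f X \os incl (slice_in s).

Lemma ov_Er d d' (f : mor d' d) (s : X d) m (y : dec d X m) : in_slice s y -> in_slice (act f s) (dres f X m y).
Proof. by case=> E H; split; [rewrite dback_Er E|exact/Afront_Er]. Qed.

Definition slice_face d d' (f : mor d' d) (s : X d) : smap (slice_in s) (slice_in (act f s)) :=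
  @sub_corestr _ _ (slice_in (act f s)) (slice_res f s) (fun n x => ov_Er f (svalP x)).

Lemma tf_to_Ed (E : sset) d (s : X d) (p : smap E (slice_in s)) :
  (forall m (u : smap (boundary m) E) (y : dec d X m), in_slice s y ->
    (forall l (g : boundary m l), sval (p l (u l g)) = act (sval g : mor l m) y) ->
    exists w : E m, sval (p m w) = y /\ forall l (g : boundary m l), u l g = act (sval g : mor l m) w) ->
  tfib p.
Proof.
move=> H m u y uy; have [l g|w [w1 w2]] := H m u (sval y) (svalP y).
- by rewrite uy.
by exists w; split=> //; exact: sig_ext.
Qed.

End slice_in.

Section Fills.
Variables (X : sset) (qX : infty_category X) (A : X 0 -> Prop).

Lemma edge_efill (e : X 1) (j : 'I_2) m (u : smap (boundary m) (dec 1 X)) (y : dec 0 X m) :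
  efill A e j -> (forall l g, dback (u l g) = e) -> in_slice A (vert e j) y ->
  (forall l (g : boundary m l), dres (mor_cst 0 j) X l (u l g) = act (sval g : mor l m) y) ->
  exists w : dec 1 X m, [/\ in_slice A e w, forall l (g : boundary m l), u l g = act (sval g : mor l m) w & dres (mor_cst 0 j) X m w = y].
Proof.
move=> fl ub [yb yA] uy.
have cf (p : 'I_2) : p <> j -> coface p = mor_cst 0 j :> mor 0 1.
  move=> pj; apply: mor_ext => t; rewrite /= (ord1 t); apply: val_inj; move: pj.
  by case: (I2P p) => ->; case: (I2P j) => -> // [].
have [|p pj|p pj||p q pj qj k c cp|l g p pj|w [wb wu wz]] := @Efill X A 0 e j m u (fun=> y) (dfront y) fl.
- exact: ub.
- by rewrite yb /face cf.
- by [].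
- exact: yA.
- by rewrite (I2_neq pj) (I2_neq qj).
- by rewrite cf.
have wE : dres (mor_cst 0 j) X m w = y by rewrite -(cf (vop j)); [apply: wz|]; move/esym; exact: vop_neq.
exists w; split=> //; split=> // t; rewrite -(dfront_Er (mor_cst 0 j)) wE; exact: yA.
Qed.

(** The missing face is at the vertex 0 of the back part, an inner position: cones extend along any
    edge from its source. From the target, as in [edge_fill1], the edge has to be special. *)
Lemma edge_fill0 (e : X 1) m (u : smap (boundary m) (dec 1 X)) (y : dec 0 X m) :
  (forall l g, dback (u l g) = e) -> in_slice A (src e) y ->
  (forall l (g : boundary m l), dres (mor_cst 0 v0) X l (u l g) = act (sval g : mor l m) y) ->
  exists w : dec 1 X m, [/\ in_slice A e w, forall l (g : boundary m l), u l g = act (sval g : mor l m) w & dres (mor_cst 0 v0) X m w = y].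
Proof. by move=> ub yA uy; apply: edge_efill => //; exact: efill_inner. Qed.

Lemma edge_efill_special (P : X 0 -> Prop) (e : X 1) : special P e -> (forall x, A x -> P x) -> P (src e) -> efill A e v1.
Proof.
move=> sp AP Ps; apply: (efill_special _ (P := P)) => //; last first.
  by move=> t Ht; have -> : t = v0 by apply: val_inj; move: Ht; rewrite /=; lia.
by rewrite (_ : ledge_mor 0 = mor_id 1) ?act_id //; apply: mor_eqP => i /=; lia.
Qed.

Lemma edge_fill1 (P : X 0 -> Prop) (e : X 1) m (u : smap (boundary m) (dec 1 X)) (y : dec 0 X m) :
  special P e -> (forall x, A x -> P x) -> P (src e) ->
  (forall l g, dback (u l g) = e) -> in_slice A (tgt e) y ->
  (forall l (g : boundary m l), dres (mor_cst 0 v1) X l (u l g) = act (sval g : mor l m) y) ->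
  exists w : dec 1 X m, [/\ in_slice A e w, forall l (g : boundary m l), u l g = act (sval g : mor l m) w & dres (mor_cst 0 v1) X m w = y].
Proof. by move=> sp AP Ps ub yA uy; apply: edge_efill => //; exact: edge_efill_special sp AP Ps. Qed.

Lemma tri_fill (s : X 2) (j : nat) m (u : smap (boundary m) (dec 2 X)) (z : nat -> dec 1 X m) : j < 3 ->
  efill A s (inord j) -> (forall l g, dback (u l g) = s) ->
  (forall p, p < 3 -> p <> j -> in_slice A (face (inord p) s) (z p)) ->
  (forall p q, p < q -> q < 3 -> p <> j -> q <> j ->
     dres (coface (inord p)) X m (z q) = dres (coface (inord q.-1)) X m (z p)) ->
  (forall p, p < 3 -> p <> j -> forall l (g : boundary m l), dres (coface (inord p)) X l (u l g) = act (sval g : mor l m) (z p)) ->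
  exists w : dec 2 X m, [/\ in_slice A s w, forall l (g : boundary m l), u l g = act (sval g : mor l m) w &
    forall p, p < 3 -> p <> j -> dres (coface (inord p)) X m w = z p].
Proof.
move=> jd fl ub zb zz uz.
have ne (p : 'I_3) : p <> inord j -> nat_of_ord p <> j by move=> pj E; apply: pj; apply: val_inj; rewrite /= inordK //; lia.
have c (p q : 'I_3) : p < q -> p <> inord j -> q <> inord j ->
    dres (coface (inord p)) X m (z q) = dres (coface (inord q.-1)) X m (z p).
  by move=> pq /ne pj /ne qj; apply: zz => //; exact: ltn_ord.
have [p0 p0d p0j] : exists2 p, p < 3 & p <> j by case: j {jd fl zb zz uz ne c} => [|j]; [exists 1|exists 0].
have zf p : p < 3 -> p <> j -> dfront (z p) = dfront (z p0).
  move=> pd pj; case: (ltngtP p p0) => [pq|pq|-> //].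
    by rewrite -[RHS](dfront_Er (coface (inord p))) zz // dfront_Er.
  by rewrite -[LHS](dfront_Er (coface (inord p0))) zz // dfront_Er.
have [|p /ne pj|p /ne pj||p q pj qj|l g p /ne pj|w [wb wu wz]] := @Efill X A 1 s (inord j) m u (fun p : 'I_3 => z p) (dfront (z p0)) fl.
- exact: ub.
- by have [-> _] := zb p (ltn_ord p) pj; rewrite inord_val.
- exact: zf.
- by have [_] := zb p0 p0d p0j.
- apply: (@Efill_compat X 0 (inord j) m (fun p : 'I_3 => z p)) => // p' q' pq pj' qj'; exact: c.
- by rewrite -uz // inord_val.
have {}wz p : p < 3 -> p <> j -> dres (coface (inord p)) X m w = z p.
  move=> pd pj; rewrite (wz (inord p)) ?inordK // => /(congr1 val) /=; by rewrite !inordK //; lia.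
exists w; split=> //; split=> // t; rewrite -(dfront_Er (coface (inord p0))) wz //; exact: (zb p0 p0d p0j).2.
Qed.

Lemma ov_e d d' (f : mor d' d) (s : X d) m (y : dec d X m) s' : in_slice A s y -> act f s = s' -> in_slice A s' (dres f X m y).
Proof. by move=> H <-; exact: ov_Er. Qed.

Lemma cface0 : coface (inord 0 : 'I_2) = mor_cst 0 v1. Proof. by mor_ord. Qed.
Lemma cface1 : coface (inord 1 : 'I_2) = mor_cst 0 v0. Proof. by mor_ord. Qed.

Lemma er_face (d d' d2 e' : nat) (f : mor d' d) (g : mor d2 d') (f' : mor e' d) (g' : mor d2 e') m (y : dec d X m) :
  mor_comp f g = mor_comp f' g' -> dres g X m (dres f X m y) = dres g' X m (dres f' X m y).
Proof. by move=> E; rewrite !Er_comp E. Qed.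

(** The cone is first extended along the edge 0 -> 1 from the vertex 0. Then only the face 0 is
    missing, at an inner position. *)
Lemma tri_from1 (s : X 2) m (u : smap (boundary m) (dec 2 X)) (y : dec 1 X m) :
  (forall l g, dback (u l g) = s) -> in_slice A (face (inord 1) s) y ->
  (forall l (g : boundary m l), dres (coface (inord 1)) X l (u l g) = act (sval g : mor l m) y) ->
  exists w : dec 2 X m, [/\ in_slice A s w, forall l (g : boundary m l), u l g = act (sval g : mor l m) w & dres (coface (inord 1)) X m w = y].
Proof.
move=> ub yA uy.
have [|||y2 [y2A y2u y2v]] := @edge_fill0 (face (inord 2) s) m (dres (coface (inord 2)) X \os u) (dres (mor_cst 0 v0) X m y).
- by move=> l g; rewrite scompE dback_Er ub.
- by apply: (ov_e yA); rewrite /src /vert /face !act_comp; apply: act_eq; mor_ord.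
- by move=> l g; rewrite -smap_nat -uy scompE; apply: er_face; mor_ord.
have [//||||||w [wA wu wz]] := @tri_fill s 0 m u (fun p => if p is 1 then y else y2).
- by apply: efill_inner => //; rewrite inordK.
- exact: ub.
- by move=> [|[|[|//]]].
- by move=> p q pq qd pj qj; move: p q pq qd pj qj => [|[|[|p]]] [|[|[|q]]] // _ _ _ _; rewrite -[2.-1]/1 cface1 y2v.
- by move=> [|[|[|//]]] // _ _ l g; rewrite -y2u.
by exists w; split=> //; exact: (wz 1).
Qed.

(** The face 0 is obtained by extension from the vertex 1, and the remaining horn at 1 is inner. *)
Lemma tri_from2 (s : X 2) m (u : smap (boundary m) (dec 2 X)) (y : dec 1 X m) :
  (forall l g, dback (u l g) = s) -> in_slice A (face (inord 2) s) y ->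
  (forall l (g : boundary m l), dres (coface (inord 2)) X l (u l g) = act (sval g : mor l m) y) ->
  exists w : dec 2 X m, [/\ in_slice A s w, forall l (g : boundary m l), u l g = act (sval g : mor l m) w & dres (coface (inord 2)) X m w = y].
Proof.
move=> ub yA uy.
have [|||y2 [y2A y2u y2v]] := @edge_fill0 (face (inord 0) s) m (dres (coface (inord 0)) X \os u) (dres (mor_cst 0 v1) X m y).
- by move=> l g; rewrite scompE dback_Er ub.
- by apply: (ov_e yA); rewrite /src /vert /face !act_comp; apply: act_eq; mor_ord.
- by move=> l g; rewrite -smap_nat -uy scompE; apply: er_face; mor_ord.
have [//||||||w [wA wu wz]] := @tri_fill s 1 m u (fun p => if p is 2 then y else y2).
- by apply: efill_inner => //; rewrite inordK.
- exact: ub.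
- by move=> [|[|[|//]]].
- by move=> p q pq qd pj qj; move: p q pq qd pj qj => [|[|[|p]]] [|[|[|q]]] // _ _ _ _; rewrite -[2.-1]/1 cface1 cface0 y2v.
- by move=> [|[|[|//]]] // _ _ l g; rewrite -y2u.
by exists w; split=> //; exact: (wz 2).
Qed.

(** Going back from the vertex 1 to the vertex 0 needs the edge 0 -> 1 to be special; the remaining
    horn at 1 is inner. *)
Lemma tri_from0 (s : X 2) m (u : smap (boundary m) (dec 2 X)) (y : dec 1 X m) :
  special (fun=> True) (face (inord 2) s) ->
  (forall l g, dback (u l g) = s) -> in_slice A (face (inord 0) s) y ->
  (forall l (g : boundary m l), dres (coface (inord 0)) X l (u l g) = act (sval g : mor l m) y) ->
  exists w : dec 2 X m, [/\ in_slice A s w, forall l (g : boundary m l), u l g = act (sval g : mor l m) w & dres (coface (inord 0)) X m w = y].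
Proof.
move=> sp ub yA uy.
have [//|//||||y2 [y2A y2u y2v]] := @edge_fill1 _ (face (inord 2) s) m (dres (coface (inord 2)) X \os u) (dres (mor_cst 0 v0) X m y) sp.
- by move=> l g; rewrite scompE dback_Er ub.
- by apply: (ov_e yA); rewrite /tgt /vert /face !act_comp; apply: act_eq; mor_ord.
- by move=> l g; rewrite -smap_nat -uy scompE; apply: er_face; mor_ord.
have [//||||||w [wA wu wz]] := @tri_fill s 1 m u (fun p => if p is 0 then y else y2).
- by apply: efill_inner => //; rewrite inordK.
- exact: ub.
- by move=> [|[|[|//]]].
- by move=> p q pq qd pj qj; move: p q pq qd pj qj => [|[|[|p]]] [|[|[|q]]] // _ _ _ _; rewrite -[2.-1]/1 cface1 cface0 y2v.
- by move=> [|[|[|//]]] // _ _ l g; rewrite -y2u.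
by exists w; split=> //; exact: (wz 0).
Qed.

End Fills.

(** A square as two triangles with a common edge 0 -> 2 and apex at the vertex 0. Pullbacks, and
    pushouts in the reversed orientation, both provide this form. *)
Definition is_pullback (X : sset) (th : bool -> X 2) : Prop :=
  face (inord 1) (th true) = face (inord 1) (th false) /\
  forall m (u : bool -> smap (boundary m) (dec 2 X)) (y : bool -> dec 1 X m),
  (forall j l g, dback (u j l g) = th j) -> (forall j, dback (y j) = face (inord 0) (th j)) ->
  (forall l g, dres (coface (inord 1)) X l (u true l g) = dres (coface (inord 1)) X l (u false l g)) ->
  dres (mor_cst 0 v1) X m (y true) = dres (mor_cst 0 v1) X m (y false) ->
  (forall j l (g : boundary m l), dres (coface (inord 0)) X l (u j l g) = act (sval g : mor l m) (y j)) ->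
  exists w : bool -> dec 2 X m, [/\ forall j, dback (w j) = th j,
    forall j l (g : boundary m l), u j l g = act (sval g : mor l m) (w j), forall j, dres (coface (inord 0)) X m (w j) = y j
    & dres (coface (inord 1)) X m (w true) = dres (coface (inord 1)) X m (w false)].

(** * Cones on cospans and squares *)

Section Steps.
Variables (X : sset) (qX : infty_category X) (A : X 0 -> Prop).

Lemma Ed_ext d (s : X d) m (x y : slice_in A s m) : sval x = sval y -> x = y.
Proof. exact: sig_ext. Qed.

(** Cones on the cospan f, g with apex in A. The fiber product is formed over [dec 0 X], which
    avoids transport along an equality of targets. *)
Definition cospan_in (f g : X 1) : sset := fibprod (slice_res A (mor_cst 0 v1) f) (slice_res A (mor_cst 0 v1) g).
Definition square_in (th : bool -> X 2) : sset := fibprod (slice_res A (coface (inord 1)) (th true)) (slice_res A (coface (inord 1)) (th false)).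

Definition slice_val (E : sset) d (s : X d) (p : smap E (slice_in A s)) : smap E (dec d X) := incl (slice_in A s) \os p.

Lemma cmp_back (E : sset) d (s : X d) (p : smap E (slice_in A s)) n x : dback (slice_val p n x) = s.
Proof. by case: (svalP (p n x)). Qed.

Lemma tf_src (e : X 1) : tfib (slice_face A (mor_cst 0 v0) e).
Proof.
apply: tf_to_Ed => m u y yA uy.
have [|||w [wA wu wy]] := @edge_fill0 X qX A e m (slice_val u) y.
- by move=> l g; exact: cmp_back.
- exact: yA.
- exact: uy.
by exists (exist _ w wA); split=> // l g; apply: Ed_ext; exact: wu.
Qed.

Lemma tf_tgt (P : X 0 -> Prop) (e : X 1) : special P e -> (forall x, A x -> P x) -> P (src e) -> tfib (slice_face A (mor_cst 0 v1) e).
Proof.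
move=> sp AP Ps; apply: tf_to_Ed => m u y yA uy.
have [|||w [wA wu wy]] := @edge_fill1 X A P e m (slice_val u) y sp AP Ps.
- by move=> l g; exact: cmp_back.
- exact: yA.
- exact: uy.
by exists (exist _ w wA); split=> // l g; apply: Ed_ext; exact: wu.
Qed.

Lemma tf_d1 (s : X 2) : tfib (slice_face A (coface (inord 1)) s).
Proof.
apply: tf_to_Ed => m u y yA uy.
have [|||w [wA wu wy]] := @tri_from1 X qX A s m (slice_val u) y; [by move=> l g; exact: cmp_back|exact: yA|exact: uy|].
by exists (exist _ w wA); split=> // l g; apply: Ed_ext; exact: wu.
Qed.

Lemma tf_d0 (s : X 2) : special (fun=> True) (face (inord 2) s) -> tfib (slice_face A (coface (inord 0)) s).
Proof.
move=> sp; apply: tf_to_Ed => m u y yA uy.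
have [|||w [wA wu wy]] := @tri_from0 X qX A s m (slice_val u) y sp; [by move=> l g; exact: cmp_back|exact: yA|exact: uy|].
by exists (exist _ w wA); split=> // l g; apply: Ed_ext; exact: wu.
Qed.

(** Cones on e map by trivial fibrations to the cones on either end of e. *)
Lemma hasfin_equiv (e : X 1) : special (fun=> True) e -> has_final (slice_in A (src e)) <-> has_final (slice_in A (tgt e)).
Proof.
move=> sp; have [H1 H2] := hasfin_tf (tf_src (e := e)); have [//|//|H3 H4] := hasfin_tf (tf_tgt sp _ _ (e := e)).
by split=> H; [exact/H3/H2|exact/H1/H4].
Qed.

Lemma cosp_sym f g : has_final (cospan_in f g) -> has_final (cospan_in g f).
Proof.
have H n (x : cospan_in f g n) : slice_res A (mor_cst 0 v1) g n (fibprod2 _ _ n x) = slice_res A (mor_cst 0 v1) f n (fibprod1 _ _ n x).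
  by rewrite fibprod_eq.
apply: (@hasfin_push _ _ (fibprodmap H)); apply: tf_FPmap => m u y1 y2 yy uy1 uy2.
by exists (fibprodmk (esym yy)); split=> // l x; apply: fibprod_ext; rewrite [RHS]smap_nat.
Qed.

Lemma ermax (s : X 2) i n (x : slice_in A s n) : (forall k : 'I_1, lift (inord i : 'I_3) (v1 : 'I_2) = ord_max) ->
  slice_res A (mor_cst 0 v1) (face (inord i) s) n (slice_face A (coface (inord i)) s n x) = slice_res A (mor_cst 0 ord_max) s n x.
Proof. by move=> H; rewrite [LHS]Er_comp; apply: Er_eq; apply: mor_ext => k; exact: H. Qed.

(** Cones on f and the triangle k map by trivial fibrations to both sides; on the face 0 this uses
    the special edge. *)
Lemma cosp_swap (k : X 2) f : special (fun=> True) (face (inord 2) k) ->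
  has_final (cospan_in f (face (inord 1) k)) <-> has_final (cospan_in f (face (inord 0) k)).
Proof.
move=> sp; have L i : i < 2 -> lift (inord i : 'I_3) (v1 : 'I_2) = ord_max.
  by move=> Hi; apply: val_inj; rewrite /= /bump inordK; lia.
have H1 := @hasfin_FP (slice_in A f) _ _ _ (slice_in A k) (slice_res A (mor_cst 0 v1) f) (slice_res A (mor_cst 0 v1) (face (inord 1) k)) (slice_res A (mor_cst 0 v1) f)
  (slice_res A (mor_cst 0 ord_max) k) (sid _) _ (@tf_id _) (tf_d1 (s := k)) (fun _ _ => erefl) (fun n x => ermax x (fun=> L 1 isT)).
have H2 := @hasfin_FP (slice_in A f) _ _ _ (slice_in A k) (slice_res A (mor_cst 0 v1) f) (slice_res A (mor_cst 0 v1) (face (inord 0) k)) (slice_res A (mor_cst 0 v1) f)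
  (slice_res A (mor_cst 0 ord_max) k) (sid _) _ (@tf_id _) (tf_d0 sp) (fun _ _ => erefl) (fun n x => ermax x (fun=> L 0 isT)).
exact: iff_trans (iff_sym H1) H2.
Qed.

Section Square.
Variable th : bool -> X 2.

Definition apex_map : smap (square_in th) (slice_in A (vert (th true) ord0)) := slice_face A (mor_cst 0 ord0) (th true) \os fibprod1 _ _.

Lemma sqr_eq n (x : square_in th n) :
  dres (coface (inord 1)) X n (sval (fibprod1 _ _ n x)) = dres (coface (inord 1)) X n (sval (fibprod2 _ _ n x)).
Proof. exact: fibprod_eq x. Qed.

Hypothesis thE : face (inord 1) (th true) = face (inord 1) (th false).

(** From the apex a cone extends along the diagonal, and from the diagonal to each triangle
    separately. *)
Lemma tf_apex : tfib apex_map.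
Proof.
apply: tf_to_Ed => m u y yA uy.
pose u1 := slice_val (fibprod1 _ _ \os u); pose u2 := slice_val (fibprod2 _ _ \os u).
have [|||d [dA du dy]] := @edge_fill0 X qX A (face (inord 1) (th true)) m (dres (coface (inord 1)) X \os u1) y.
- by move=> l g; rewrite scompE dback_Er cmp_back.
- by rewrite (_ : src _ = vert (th true) ord0) // /src /vert /face act_comp; apply: act_eq; mor_ord.
- by move=> l g; rewrite -uy scompE Er_comp; apply: Er_eq; mor_ord.
have [|||w1 [w1A w1u w1d]] := @tri_from1 X qX A (th true) m u1 d; [by move=> l g; exact: cmp_back|exact: dA|exact: du|].
have [|||w2 [w2A w2u w2d]] := @tri_from1 X qX A (th false) m u2 d.
- by move=> l g; exact: cmp_back.
- by rewrite -thE.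
- by move=> l g; rewrite -du scompE; exact: esym (sqr_eq (u l g)).
have E : slice_res A (coface (inord 1)) (th true) m (exist _ w1 w1A) = slice_res A (coface (inord 1)) (th false) m (exist _ w2 w2A).
  by rewrite [LHS]w1d [RHS]w2d.
exists (fibprodmk E); split; last first.
  by move=> l g; apply: fibprod_ext; apply: Ed_ext; [exact: w1u|exact: w2u].
rewrite -dy -w1d Er_comp; apply: Er_eq; mor_ord.
Qed.

Lemma legs_eq n (x : square_in th n) :
  slice_res A (mor_cst 0 v1) (face (inord 0) (th true)) n ((slice_face A (coface (inord 0)) (th true) \os fibprod1 _ _) n x) =
  slice_res A (mor_cst 0 v1) (face (inord 0) (th false)) n ((slice_face A (coface (inord 0)) (th false) \os fibprod2 _ _) n x).
Proof.
have E := congr1 (dres (mor_cst 0 v1) X n) (sqr_eq x); rewrite !Er_comp in E.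
apply: etrans (Er_comp _ _ _) (etrans _ (esym (Er_comp _ _ _))).
by apply: etrans (etrans _ E) _; apply: Er_eq; mor_ord.
Qed.

Definition legs_map : smap (square_in th) (cospan_in (face (inord 0) (th true)) (face (inord 0) (th false))) := fibprodmap legs_eq.

Lemma tf_legs : is_pullback th -> tfib legs_map.
Proof.
case=> _ H; apply: tf_FPmap => m u y1 y2 yy uy1 uy2.
have [|||||w [wb wu wy ww]] := H m (fun j => if j then slice_val (fibprod1 _ _ \os u) else slice_val (fibprod2 _ _ \os u)) (fun j => if j then sval y1 else sval y2).
- by case=> l g; exact: cmp_back.
- by case; [case: (svalP y1)|case: (svalP y2)].
- by move=> l g; exact: sqr_eq (u l g).
- exact: yy.
- by case=> l g; [rewrite -[RHS]/(sval (act _ y1)) -uy1|rewrite -[RHS]/(sval (act _ y2)) -uy2].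
have wA j : in_slice A (th j) (w j).
  split=> // t; rewrite -(dfront_Er (coface (inord 0))) wy.
  by case: j; [case: (svalP y1)|case: (svalP y2)].
have E : slice_res A (coface (inord 1)) (th true) m (exist _ _ (wA true)) = slice_res A (coface (inord 1)) (th false) m (exist _ _ (wA false)) := ww.
exists (fibprodmk E); split.
- by apply: Ed_ext; exact: (wy true).
- by apply: Ed_ext; exact: (wy false).
by move=> l g; apply: fibprod_ext; apply: Ed_ext; [exact: (wu true)|exact: (wu false)].
Qed.

Definition side_map : smap (square_in th) (slice_in A (face (inord 2) (th true))) := slice_face A (coface (inord 2)) (th true) \os fibprod1 _ _.

(** The triangle through the given side is filled first; its diagonal is then the datum from which
    the other triangle is filled. *)
Lemma tf_side : tfib side_map.
Proof.
apply: tf_to_Ed => m u y yA uy.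
pose u1 := slice_val (fibprod1 _ _ \os u); pose u2 := slice_val (fibprod2 _ _ \os u).
have [|||w1 [w1A w1u w1y]] := @tri_from2 X qX A (th true) m u1 y; [by move=> l g; exact: cmp_back|exact: yA|exact: uy|].
have [|||w2 [w2A w2u w2d]] := @tri_from1 X qX A (th false) m u2 (dres (coface (inord 1)) X m w1).
- by move=> l g; exact: cmp_back.
- by rewrite -thE; exact: ov_Er.
- by move=> l g; rewrite -smap_nat -w1u; exact: esym (sqr_eq (u l g)).
have E : slice_res A (coface (inord 1)) (th true) m (exist _ w1 w1A) = slice_res A (coface (inord 1)) (th false) m (exist _ w2 w2A).
  by rewrite [RHS]w2d.
by exists (fibprodmk E); split=> // l g; apply: fibprod_ext; apply: Ed_ext; [exact: w1u|exact: w2u].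
Qed.

Lemma hasfin_apex : is_pullback th ->
  has_final (slice_in A (vert (th true) ord0)) <-> has_final (cospan_in (face (inord 0) (th true)) (face (inord 0) (th false))).
Proof. by move=> H; exact: iff_trans (iff_sym (hasfin_tf tf_apex)) (hasfin_tf (tf_legs H)). Qed.

End Square.

(** Cospans over the two ends of e are compared through cones on two triangles glued along e.
    Passing from the target of e to its source fills outer horns with last edge e, which is possible
    only if the other vertices satisfy P; hence the conditions on the sources of the legs. *)
Lemma cosp_base (P : X 0 -> Prop) (e : X 1) (s t : X 2) : special P e -> (forall x, A x -> P x) -> P (src e) ->
  face (inord 0) s = e -> face (inord 0) t = e -> P (vert s ord0) -> P (vert t ord0) ->
  has_final (cospan_in (face (inord 1) s) (face (inord 1) t)) <-> has_final (cospan_in (face (inord 2) s) (face (inord 2) t)).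
Proof.
move=> sp AP Pe se te Ps Pt.
pose T := fibprod (slice_res A (coface (inord 0)) s) (slice_res A (coface (inord 0)) t).
have TE n (x : T n) : dres (coface (inord 0)) X n (sval (fibprod1 _ _ n x)) = dres (coface (inord 0)) X n (sval (fibprod2 _ _ n x)) := fibprod_eq x.
have face2 i (i3 : i < 3) (i0 : 0 < i) n (x : T n) :
    slice_res A (mor_cst 0 v1) (face (inord i) s) n ((slice_face A (coface (inord i)) s \os fibprod1 _ _) n x) =
    slice_res A (mor_cst 0 v1) (face (inord i) t) n ((slice_face A (coface (inord i)) t \os fibprod2 _ _) n x).
  have E := congr1 (dres (mor_cst 0 (inord (2 - i) : 'I_2)) X n) (TE n x); rewrite !Er_comp in E.
  apply: etrans (Er_comp _ _ _) (etrans _ (esym (Er_comp _ _ _))).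
  by apply: etrans (etrans _ E) _; apply: Er_eq; move: i i3 i0 {E} => [|[|[|//]]] // _ _; mor_ord.
have spill (r : X 2) : face (inord 0) r = e -> P (vert r ord0) -> efill A r (inord 2).
  move=> re Pr; apply: (@efill_special X A P 1 r (inord 2)); first by rewrite /= inordK.
  - have -> : ledge_mor 1 = coface (inord 0) by mor_ord.
    by rewrite -/(face _ _) re.
  - exact: AP.
  move=> [[|[|//]] Hi] _; first by rewrite (_ : Ordinal Hi = ord0) //; exact: val_inj.
  rewrite (_ : vert r _ = src e) // -re /src /vert /face act_comp; apply: act_eq; mor_ord.
(* Over the composite legs: the cone extends backwards along e, then to each triangle at its last
   vertex. *)
have H1 : tfib (fibprodmap (face2 1 isT isT)).
  apply: tf_FPmap => m u y1 y2 yy uy1 uy2.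
  pose u1 := slice_val (fibprod1 _ _ \os u); pose u2 := slice_val (fibprod2 _ _ \os u).
  have [|||d [dA du dy]] := @edge_fill1 X A P e m (dres (coface (inord 0)) X \os u1) (dres (mor_cst 0 v1) X m (sval y1)) sp AP Pe.
  - by move=> l g; rewrite scompE dback_Er cmp_back.
  - by apply: (ov_e (svalP y1)); rewrite -se /tgt /vert /face !act_comp; apply: act_eq; mor_ord.
  - move=> l g; rewrite -smap_nat -[act _ (sval y1)]/(sval (act _ y1)) -uy1; apply: er_face; mor_ord.
  have fill (r : X 2) (Hr : face (inord 0) r = e) (Pr : P (vert r ord0)) (v : smap (boundary m) (dec 2 X)) (z : slice_in A (face (inord 1) r) m) :
      (forall l g, dback (v l g) = r) -> (forall l (g : boundary m l), dres (coface (inord 1)) X l (v l g) = act (sval g : mor l m) (sval z)) ->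
      (forall l (g : boundary m l), dres (coface (inord 0)) X l (v l g) = act (sval g : mor l m) d) ->
      dres (mor_cst 0 v1) X m (sval z) = dres (mor_cst 0 v1) X m d ->
      exists w : dec 2 X m, [/\ in_slice A r w, forall l (g : boundary m l), v l g = act (sval g : mor l m) w,
        dres (coface (inord 0)) X m w = d & dres (coface (inord 1)) X m w = sval z].
    move=> vb vz vd zd; have [//||||||w [wA wu wz]] := @tri_fill X A r 2 m v (fun p => if p is 0 then d else sval z).
    - exact: spill.
    - exact: vb.
    - by move=> [|[|[|//]]] // _ _; [rewrite Hr|exact: (svalP z)].
    - by move=> p q pq qd pj qj; move: p q pq qd pj qj => [|[|[|p]]] [|[|[|q]]] // _ _ _ _; rewrite -[1.-1]/0 cface0.
    - by move=> [|[|[|//]]].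
    by exists w; split=> //; [exact: (wz 0)|exact: (wz 1)].
  have [|||| w1 [w1A w1u w1d w1y]] := fill s se Ps u1 y1; [by move=> l g; exact: cmp_back| | exact: du | by rewrite dy |].
    by move=> l g; rewrite -[RHS]/(sval (act _ y1)) -uy1.
  have [|||| w2 [w2A w2u w2d w2y]] := fill t te Pt u2 y2; [by move=> l g; exact: cmp_back| | | by rewrite dy; exact: esym yy |].
    by move=> l g; rewrite -[RHS]/(sval (act _ y2)) -uy2.
    by move=> l g; rewrite -du; exact: esym (TE l (u l g)).
  have E : slice_res A (coface (inord 0)) s m (exist _ w1 w1A) = slice_res A (coface (inord 0)) t m (exist _ w2 w2A).
    by rewrite [LHS]w1d [RHS]w2d.
  exists (fibprodmk E); split; [exact: Ed_ext|exact: Ed_ext|].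
  by move=> l g; apply: fibprod_ext; apply: Ed_ext; [exact: w1u|exact: w2u].
(* Over the lifted legs all fillings are inner. *)
have H2 : tfib (fibprodmap (face2 2 isT isT)).
  apply: tf_FPmap => m u y1 y2 yy uy1 uy2.
  pose u1 := slice_val (fibprod1 _ _ \os u); pose u2 := slice_val (fibprod2 _ _ \os u).
  have [|||d [dA du dy]] := @edge_fill0 X qX A e m (dres (coface (inord 0)) X \os u1) (dres (mor_cst 0 v1) X m (sval y1)).
  - by move=> l g; rewrite scompE dback_Er cmp_back.
  - by apply: (ov_e (svalP y1)); rewrite -se /src /vert /face !act_comp; apply: act_eq; mor_ord.
  - move=> l g; rewrite -smap_nat -[act _ (sval y1)]/(sval (act _ y1)) -uy1; apply: er_face; mor_ord.
  have fill (r : X 2) (Hr : face (inord 0) r = e) (v : smap (boundary m) (dec 2 X)) (z : slice_in A (face (inord 2) r) m) :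
      (forall l g, dback (v l g) = r) -> (forall l (g : boundary m l), dres (coface (inord 2)) X l (v l g) = act (sval g : mor l m) (sval z)) ->
      (forall l (g : boundary m l), dres (coface (inord 0)) X l (v l g) = act (sval g : mor l m) d) ->
      dres (mor_cst 0 v1) X m (sval z) = dres (mor_cst 0 v0) X m d ->
      exists w : dec 2 X m, [/\ in_slice A r w, forall l (g : boundary m l), v l g = act (sval g : mor l m) w,
        dres (coface (inord 0)) X m w = d & dres (coface (inord 2)) X m w = sval z].
    move=> vb vz vd zd; have [//||||||w [wA wu wz]] := @tri_fill X A r 1 m v (fun p => if p is 0 then d else sval z).
    - by apply: efill_inner => //; rewrite inordK.
    - exact: vb.
    - by move=> [|[|[|//]]] // _ _; [rewrite Hr|exact: (svalP z)].
    - by move=> p q pq qd pj qj; move: p q pq qd pj qj => [|[|[|p]]] [|[|[|q]]] // _ _ _ _; rewrite -[2.-1]/1 cface0 cface1.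
    - by move=> [|[|[|//]]].
    by exists w; split=> //; [exact: (wz 0)|exact: (wz 2)].
  have [|||| w1 [w1A w1u w1d w1y]] := fill s se u1 y1; [by move=> l g; exact: cmp_back| | exact: du | by rewrite dy |].
    by move=> l g; rewrite -[RHS]/(sval (act _ y1)) -uy1.
  have [|||| w2 [w2A w2u w2d w2y]] := fill t te u2 y2; [by move=> l g; exact: cmp_back| | | by rewrite dy; exact: esym yy |].
    by move=> l g; rewrite -[RHS]/(sval (act _ y2)) -uy2.
    by move=> l g; rewrite -du; exact: esym (TE l (u l g)).
  have E : slice_res A (coface (inord 0)) s m (exist _ w1 w1A) = slice_res A (coface (inord 0)) t m (exist _ w2 w2A).
    by rewrite [LHS]w1d [RHS]w2d.
  exists (fibprodmk E); split; [exact: Ed_ext|exact: Ed_ext|].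
  by move=> l g; apply: fibprod_ext; apply: Ed_ext; [exact: w1u|exact: w2u].
exact: iff_trans (iff_sym (hasfin_tf H1)) (hasfin_tf H2).
Qed.

End Steps.

(** * Special edges as final objects *)

Lemma jm_coface n i : i < n.+2 -> jm v0 (coface (inord i : 'I_n.+2)) (mor_id 0) = coface (inord i : 'I_n.+3).
Proof.
move=> Hi; apply: (@jm_ext v0 n 0).
  rewrite (@jm_inl v0 n.+1 0 n 0); apply: mor_eqP => t /=; rewrite /bump !inordK //; lia.
rewrite (@jm_inr v0 n.+1 0 n 0); apply: mor_eqP => t /=; have := ltn_ord t; rewrite /bump !inordK //; lia.
Qed.

Lemma bd_coface n (i : 'I_n.+2) : smem (boundary n.+1) (coface i : Delta n.+1 n).
Proof. by exists i => k /esym/eqP; rewrite (negbTE (neq_lift _ _)). Qed.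

Lemma lt_max n (i : 'I_n.+1) : i <> ord_max -> i < n.
Proof. by move=> im; have := ltn_ord i; case: (ltngtP (nat_of_ord i) n) => // [|E]; [lia|case: im; exact: val_inj]. Qed.

Section Special.
Variables (X : sset) (A : X 0 -> Prop).

(** The edges e and f form a last horn of dimension 2; filling it factors f through e. *)
Lemma special_T (P : X 0 -> Prop) (e f : X 1) : special P e -> P (src f) -> P (src e) -> tgt f = tgt e ->
  exists s : X 2, face (inord 0) s = e /\ face (inord 1) s = f.
Proof.
move=> sp Pf Pe E; have [|h hE] := @horn_faces X 0 ord_max (fun i : 'I_3 => if nat_of_ord i is 0 then e else f).
  move=> [[|[|[|//]]] Hi] [[|[|[|//]]] Hk] //= _ i1 k1; try by case: k1; exact: val_inj.
  by rewrite -!tgt_face E.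
have n0 : (ord0 : 'I_3) <> ord_max by move/(congr1 val).
have n1 : (inord 1 : 'I_3) <> ord_max by move/(congr1 (@nat_of_ord _)); rewrite /= inordK.
have [H|i H Hi|y hy] := sp 0 h.
- rewrite (hE _ _ ord0 n0) /=; last by move=> t /(congr1 val) /=; rewrite addn1.
  by rewrite -[RHS]act_id; apply: act_eq; mor_ord.
- case: i H Hi => [[|[|//]] Hi] H _.
    rewrite (hE _ _ (inord 1) n1) /= ?inordK //; last by move=> t /(congr1 (@nat_of_ord _)); rewrite /= inordK.
    by rewrite (_ : act _ f = src f) //; apply: act_eq; apply: mor_eqP => t; rewrite /= ?inordK.
  rewrite (hE _ _ ord0 n0) /=; last by move=> t /(congr1 val).
  by rewrite (_ : act _ e = src e) //; apply: act_eq; apply: mor_eqP => t.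
exists y; split.
  rewrite inord0 /face; have := hy _ (exist _ _ (coface_horn n0)); rewrite /= => <-.
  by rewrite (hE _ _ ord0 n0) /= ?cod_coface ?act_id // => k /esym/eqP; rewrite (negbTE (neq_lift _ _)).
rewrite /face; have := hy _ (exist _ _ (coface_horn n1)); rewrite /= => <-.
by rewrite (hE _ _ (inord 1) n1) /= ?inordK ?cod_coface ?act_id // => k /esym/eqP; rewrite (negbTE (neq_lift _ _)).
Qed.

(** The last horn of Delta^{n+2} = Delta^{n+1} * Delta^0 is (boundary * Delta^0), hence a boundary
    in A x_X X_{/c}. Its last vertex is e, the final object. *)
Lemma hasfin_special c : has_final (slice_in A c) -> exists e : X 1, [/\ A (src e), tgt e = c & special A e].
Proof.
case=> -[e0 [eb eA]] H; pose e : X 1 := e0; exists e; split.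
- have := eA ord0; rewrite (_ : vert _ _ = src e) // /dfront /vert act_comp; apply: act_eq; exact: mor_eqP.
- by rewrite -eb /dback /tgt /vert; apply: act_eq; apply: mor_eqP => t; rewrite (ord1 t).
have te : tgt e = c.
  by rewrite -eb /dback /tgt /vert; apply: act_eq; apply: mor_eqP => t; rewrite (ord1 t).
move=> n h he hP.
have jE : jinr v0 n.+1 0 ord0 = ord_max :> 'I_n.+3 by apply: val_inj => /=; lia.
have mem l (g : boundary n.+1 l) : smem (horn (ord_max : 'I_n.+3)) (jm v0 (sval g : mor l n.+1) (mor_id 0) : Delta n.+2 l.+1).
  by rewrite -jE; exact: (@jm_horn v0 n.+1 0 ord0 l 0 (sval g) (mor_id 0) (or_introl (svalP g))).
pose V l (g : boundary n.+1 l) : dec 0 X l := h _ (exist _ _ (mem l g)).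
have VN k l (f : mor k l) (g : boundary n.+1 l) : V k (act f g) = act f (V l g).
  apply: etrans (smap_nat h _ _); apply: sub_eq.
  by apply/esym/(etrans (@jm_comp v0 n.+1 0 l 0 k 0 (sval g : mor l n.+1) (mor_id 0) f (mor_id 0))); rewrite mor_comp_id.
have ledgeH : smem (horn (ord_max : 'I_n.+3)) (ledge_mor n.+1 : Delta n.+2 1).
  by exists ord0; split=> [/(congr1 val)//|k /(congr1 val) /=]; lia.
have Vov l (g : boundary n.+1 l) : in_slice A c (V l g).
  split.
    rewrite -te -(he ledgeH) /dback /tgt /vert -[LHS]smap_nat -[RHS]smap_nat; apply: sub_eq.
    by apply: etrans (@jm_inr v0 n.+1 0 l 0 (sval g : mor l n.+1) (mor_id 0)) _; apply: mor_eqP => t; rewrite (ord1 t) /=; lia.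
  move=> t; rewrite /dfront /vert -[X in act _ X]smap_nat -smap_nat.
  have E : mor_comp (mor_comp (jm v0 (sval g : mor l n.+1) (mor_id 0)) (jinl v0 l 0)) (mor_cst 0 t) = mor_cst 0 (jinl v0 n.+1 0 ((sval g : mor l n.+1) t)).
    by rewrite (@jm_inl v0 n.+1 0 l 0); exact: mor_ext.
  have H2 : smem (horn (ord_max : 'I_n.+3)) (mor_cst 0 (jinl v0 n.+1 0 ((sval g : mor l n.+1) t)) : Delta n.+2 0).
    rewrite -E; exact/smem_act/smem_act/mem.
  rewrite (_ : h 0 _ = h 0 (exist _ _ H2)); last exact: sub_eq.
  apply: hP; move: ((sval g : mor l n.+1) t) => k; have := ltn_ord k; rewrite /=; lia.
have VN2 k l (f : mor k l) (g : boundary n.+1 l) :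
    exist (@smem _ (slice_in A c) k) (V k (act f g)) (Vov k (act f g)) = act f (exist (@smem _ (slice_in A c) l) (V l g) (Vov l g) : slice_in A c l).
  by apply: sig_ext; exact: VN.
have [HH|w wE] := H n (@SMap (boundary n.+1) (slice_in A c) _ VN2).
  apply: sig_ext; apply: etrans (he ledgeH); apply: (@sub_eq _ X _ h); apply: mor_eqP => t.
  case: t => [[|[|//]] Ht]; last by rewrite jmR /=; [lia|exact: val_inj].
  by rewrite jmL /=; [lia|exact: val_inj].
exists (sval w : X n.+2) => l [g [i [im gi]]]; rewrite [sval _]/=.
have Hi : i < n.+2 := lt_max im.
have iE : inord i = i by exact: inord_val.
have cm := mem n (exist _ _ (bd_coface (inord i : 'I_n.+2))); rewrite [sval _]/= jm_coface // iE in cm.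
pose ci : boundary n.+1 n := exist _ _ (bd_coface (inord i : 'I_n.+2)).
have E2 : V n ci = @act (dec 0 X) _ _ (coface (inord i)) (sval w) := congr1 sval (wE n ci).
have E3 : h _ (exist _ _ cm) = act (coface i) (sval w : X n.+2).
  apply: etrans (etrans _ E2) _.
    by apply: (@sub_eq _ X _ h); rewrite [sval _]/= jm_coface // iE.
  by apply: (@act_eq X); rewrite jm_coface // iE.
rewrite -[act g _](congr1 (fun t => act t (sval w : X n.+2)) (coface_cod gi)) -act_comp -E3 -smap_nat.
by apply: (@sub_eq _ X _ h); exact: esym (coface_cod gi).
Qed.

Lemma ov_vert n (y : dec 0 X n) c (t : 'I_n.+2) : in_slice A c y -> t < n.+1 -> A (vert (y : X n.+1) t).
Proof.
case=> _ H tn; have := H (Ordinal tn); rewrite (_ : vert _ _ = vert (y : X n.+1) t) // /dfront /vert act_comp.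
by apply: act_eq; exact: mor_eqP.
Qed.

(** The faces of a boundary in the slice obey the simplicial identities in X. For n = 0 this says
    that two edges have the same target c. *)
Lemma bd_faces (c : X 0) n (u : smap (boundary n.+1) (slice_in A c)) i k : i < k -> k < n.+2 ->
  face (inord i) (sval (u n (exist _ _ (bd_coface (inord k : 'I_n.+2)))) : X n.+1) =
  face (inord k.-1) (sval (u n (exist _ _ (bd_coface (inord i : 'I_n.+2)))) : X n.+1).
Proof.
move=> ik Hk; rewrite /face; case: n u Hk => [|n] u Hk.
  have dE (y : dec 0 X 0) : act (coface (inord 0 : 'I_2)) (y : X 1) = dback y.
    by rewrite /dback; apply: act_eq; mor_ord.
  have -> : i = 0 by lia.
  have -> : k = 1 by lia.
  rewrite !dE; case: (svalP (u 0 (exist _ _ (bd_coface (inord 1 : 'I_2))))) => -> _.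
  by case: (svalP (u 0 (exist _ _ (bd_coface (inord 0 : 'I_2))))) => -> _.
have uN a b (f : mor a b) (g : boundary n.+2 b) : sval (u a (act f g)) = @act X _ _ (jm v0 f (mor_id 0)) (sval (u b g)).
  by rewrite smap_nat.
have E j (y : X n.+2) : j < n.+2 -> act (coface (inord j : 'I_n.+3)) y = act (jm v0 (coface (inord j : 'I_n.+2)) (mor_id 0)) y.
  by move=> Hj; rewrite jm_coface.
rewrite !E -?uN; [|lia..]; congr (sval (u _ _)); apply: sig_ext; apply: mor_eqP => t /=.
by rewrite /bump !inordK; lia.
Qed.

(** The faces of a boundary in the slice form a last horn in X with last edge e. The filler stays in
    the slice, since each of its vertices lies on a given face. *)
Lemma special_hasfin (e : X 1) : special A e -> A (src e) -> has_final (slice_in A (tgt e)).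
Proof.
move=> sp Ae; set c := tgt e.
have eov : in_slice A c (e : dec 0 X 0).
  split; first by rewrite /dback; apply: act_eq; apply: mor_eqP => t; rewrite (ord1 t).
  move=> t; rewrite (_ : vert _ _ = src e) // /dfront /vert act_comp; apply: act_eq; apply: mor_eqP => i; by rewrite (ord1 t).
exists (exist _ (e : dec 0 X 0) eov) => n u ue.
pose xs (i : 'I_n.+3) : X n.+1 := sval (u n (exist _ _ (bd_coface (inord i : 'I_n.+2)))).
have xsov i : in_slice A c (xs i : dec 0 X n) by exact: (svalP (u n _)).
have uN k l (f : mor k l) (g : boundary n.+1 l) : sval (u k (act f g)) = @act X _ _ (jm v0 f (mor_id 0)) (sval (u l g)).
  by rewrite smap_nat.
have max_lt (i : 'I_n.+3) : i <> ord_max -> i < n.+2.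
  exact: lt_max.
have [|h hE] := @horn_faces X n ord_max xs.
  by move=> i k ik /max_lt Hi /max_lt Hk; exact: bd_faces.
have n0 : (ord0 : 'I_n.+3) <> ord_max by move/(congr1 val).
have [H|i H Hi|Y hY] := sp n h.
- rewrite (hE _ _ ord0 n0) [sval _]/=; last by move=> t /(congr1 val) /=; lia.
  apply: etrans _ (congr1 sval (ue (last_bd n 0))).
  have E : exist _ _ (last_bd n 0) = act (mor_cst 0 ord_max) (exist _ _ (bd_coface (inord (ord0 : 'I_n.+3) : 'I_n.+2)) : boundary n.+1 n).
    by apply: sig_ext; apply: mor_eqP => t /=; rewrite /bump inordK //; lia.
  rewrite E uN; apply: (@act_eq X); apply: mor_eqP => t.
  case: t => [[|[|//]] Ht]; last by rewrite jmR /=; [lia|exact: val_inj].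
  by rewrite jmL /=; [lia|exact: val_inj].
(* A face of the horn containing the vertex i: the face opposite 1 if i = 0, the face opposite 0
   otherwise. *)
- pose k : 'I_n.+3 := inord (nat_of_ord i == 0).
  have kE : k = (nat_of_ord i == 0) :> nat by rewrite /k inordK //; case: eqP.
  have km : k <> ord_max by move/(congr1 val) => /=; rewrite -[val k]/(nat_of_ord k) kE; case: eqP.
  rewrite (hE _ _ k km) [sval _]/=; last by move=> t /(congr1 val) /=; rewrite -[X in _ = X]/(nat_of_ord k) kE; case: eqP; lia.
  rewrite mor_comp_cst; apply: (ov_vert (xsov k)); rewrite /= kE; case: eqP => Hi0; case: ifP; lia.
have xE (i : 'I_n.+3) : i <> ord_max -> xs i = act (coface i) Y.
  move=> im; have := hY _ (exist _ _ (coface_horn im)); rewrite [sval _]/= => <-.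
  rewrite (hE _ _ i im) /= ?cod_coface ?act_id // => k /esym/eqP; by rewrite (negbTE (neq_lift _ _)).
have Yov : in_slice A c (Y : dec 0 X n.+1).
  split.
    rewrite /dback -(xsov ord0).1 (xE _ n0) /dback act_comp; apply: act_eq; apply: mor_eqP => t /=; rewrite /bump; lia.
  move=> t; rewrite /dfront /vert act_comp.
  pose k : 'I_n.+3 := inord (nat_of_ord t == 0).
  have kE : k = (nat_of_ord t == 0) :> nat by rewrite /k inordK //; case: eqP.
  have km : k <> ord_max by move/(congr1 val) => /=; rewrite -[val k]/(nat_of_ord k) kE; case: eqP.
  have Ht := ltn_ord t.
  have t'P : t - (nat_of_ord t != 0) < n.+1 by case: eqP; lia.
  have := ov_vert (t := Ordinal (leqW t'P)) (xsov k) t'P; rewrite (xE _ km) /vert act_comp.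
  rewrite (_ : mor_comp (jinl v0 n.+1 0) (mor_cst 0 t) = mor_comp (coface k) (mor_cst 0 (Ordinal (leqW t'P)))) //.
  by apply: mor_eqP => i; rewrite /= -[val k]/(nat_of_ord k) /bump kE; case: eqP => E; rewrite ?E /=; lia.
exists (exist _ (Y : dec 0 X n.+1) Yov) => l [g [i gi]]; apply: sig_ext; rewrite [RHS]/= /dec_act.
pose i' : 'I_n.+3 := inord i; have Hi := ltn_ord i.
have i'E : i' = i :> nat by rewrite /i' inordK //; lia.
have im : i' <> ord_max by move/(congr1 (@nat_of_ord _)); rewrite i'E /=; lia.
have bE : exist (@smem _ (boundary n.+1) l) g (ex_intro _ i gi) = act (mor_comp (cod i) (g : mor l n.+1)) (exist _ _ (bd_coface (inord i' : 'I_n.+2)) : boundary n.+1 n).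
  apply: sig_ext; rewrite [RHS]/= i'E inord_val; exact: esym (coface_cod gi).
rewrite bE uN -/(xs i') (xE _ im) act_comp; apply: (@act_eq X).
have cE : coface i' = jm v0 (coface i) (mor_id 0) by rewrite /i' -jm_coface // inord_val.
rewrite cE; apply: etrans (@jm_comp v0 n.+1 0 n 0 l 0 (coface i) (mor_id 0) (mor_comp (cod i) (g : mor l n.+1)) (mor_id 0)) _.
by rewrite mor_id_comp (coface_cod gi).
Qed.

End Special.

(** * Existence of coreflections *)

Section Coreflection.
Variables (X : sset) (qX : infty_category X) (A : X 0 -> Prop).

(** The consequences of being initial in dimensions at most 2, enough to exchange one zero object
    for another. *)
Definition initial_like (z : X 0) : Prop := (forall x, exists e : X 1, src e = z /\ tgt e = x) /\
  (forall f g h : X 1, src f = z -> tgt f = src g -> src h = z -> tgt h = tgt g -> edge_comp f g h).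

Lemma zin_equiv z z' (e : X 1) : initial_like z -> initial_like z' -> src e = z -> tgt e = z' -> edge_equiv e.
Proof.
move=> [z1 z2] [z1' z2'] es et; have [g [gs gt]] := z1' z; exists g.
have D x i : vert (degen 1 x) i = x by exact: vert_degen.
by split; [apply: z2|apply: z2']; rewrite ?et ?gs ?es ?gt // /src /tgt D.
Qed.

Lemma zswap z z' (f g g' : X 1) : initial_like z -> initial_like z' -> src g = z -> src g' = z' -> tgt g = tgt g' ->
  has_final (cospan_in A f g) <-> has_final (cospan_in A f g').
Proof.
move=> Hz Hz' gs gs' gt; have [e [es et]] := Hz.1 z'.
have [k [k2 k0 k1]] : edge_comp e g' g by apply: Hz.2; rewrite ?et ?gs' ?gt.
rewrite -k0 -k1; apply: cosp_swap => //; rewrite k2; apply: joyal => //.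
exact: zin_equiv Hz Hz' es et.
Qed.

Definition coreflected (c : X 0) : Prop := exists e : X 1, [/\ A (src e), tgt e = c & special A e].

Hypothesis A_zero : exists2 z, A z & initial_like z.
Hypothesis A_fib : forall h : X 1, A (src h) -> A (tgt h) ->
  exists th, [/\ is_pullback th, face (inord 0) (th true) = h, initial_like (src (face (inord 0) (th false))) & A (vert (th true) ord0)].

Lemma pb_tgt (th : bool -> X 2) : is_pullback th -> tgt (face (inord 0) (th true)) = tgt (face (inord 0) (th false)).
Proof.
case=> E _; have := congr1 (@tgt X) E.
have F j : tgt (face (inord 1) (th j)) = tgt (face (inord 0) (th j)).
  by rewrite /tgt /vert /face !act_comp; apply: act_eq; mor_ord.
by rewrite !F.
Qed.

(** The coreflection e lifts a leg only if its source lies in A, so the zero object is exchanged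
    first. The lift of f then has both ends in A, its fiber lies in A, and an object of A is its own
    coreflection. *)
Lemma hasfin_cosp (f g : X 1) : A (src f) -> initial_like (src g) -> tgt f = tgt g -> coreflected (tgt f) -> has_final (cospan_in A f g).
Proof.
move=> Af zg fg [e [Ae et sp]]; have [z0 Az0 zz0] := A_zero.
have [g0 [g0s g0t]] := zz0.1 (tgt f).
apply/(@zswap _ _ f g g0 zg zz0) => //; first by rewrite g0t.
(* The faces 2 of s and t are the lifts of the two legs through e. *)
have [s [s0 s1]] := special_T sp Af Ae (esym et).
have [t [t0 t1]] : exists s : X 2, face (inord 0) s = e /\ face (inord 1) s = g0.
  by apply: (special_T sp); rewrite ?g0s ?g0t.
rewrite -s1 -t1.
have sv (r : X 2) : vert r ord0 = src (face (inord 1) r) by rewrite /src /vert /face act_comp; apply: act_eq; mor_ord.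
have s2 (r : X 2) : src (face (inord 2) r) = src (face (inord 1) r) by rewrite /src /vert /face !act_comp; apply: act_eq; mor_ord.
have t2 (r : X 2) : tgt (face (inord 2) r) = src (face (inord 0) r) by rewrite /src /tgt /vert /face !act_comp; apply: act_eq; mor_ord.
apply/(@cosp_base X qX A A e _ _ sp); rewrite ?sv ?s1 ?t1 ?g0s //.
have [||th [pbt th1 thz thA]] := A_fib (h := face (inord 2) s); rewrite ?s2 ?t2 ?s1 ?s0 //.
apply/(@zswap _ _ _ _ (face (inord 0) (th false)) zz0 thz) => //.
- by rewrite s2 t1.
- by rewrite -(pb_tgt pbt) th1 !t2 s0 t0.
(* Cones on the lifted cospan are cones on its fiber, for which the identity edge is final. *)
rewrite -th1; apply/(hasfin_apex qX A pbt.1 pbt).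
have D (x : X 0) i : vert (degen 1 x) i = x by exact: vert_degen.
set r := vert _ _ in thA *; rewrite -(D r v1); apply: (@special_hasfin X A (degen 1 r)); last by rewrite /src D.
have J := joyal qX (edge_equiv_degen r); exact: (@special_sub X (fun=> True) A (degen 1 r) (fun _ _ => I) J).
Qed.

Lemma corefl_fib (th : bool -> X 2) : is_pullback th -> A (src (face (inord 0) (th true))) ->
  initial_like (src (face (inord 0) (th false))) -> coreflected (tgt (face (inord 0) (th true))) -> has_final (slice_in A (vert (th true) ord0)).
Proof. by move=> H Ha Hz Hc; apply/(hasfin_apex qX A H.1 H); apply: hasfin_cosp => //; exact: pb_tgt. Qed.

(** c is the loop object of d, and d is the cofiber of p -> q, so c is also the fiber of p -> q. *)
Lemma corefl_loop (th th' : bool -> X 2) (e : X 1) : is_pullback th -> is_pullback th' ->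
  initial_like (src (face (inord 0) (th true))) -> initial_like (src (face (inord 0) (th false))) ->
  edge_equiv e -> tgt e = tgt (face (inord 0) (th true)) -> src e = tgt (face (inord 0) (th' true)) ->
  A (vert (th' true) ord0) -> initial_like (src (face (inord 0) (th' false))) -> coreflected (src (face (inord 0) (th' true))) ->
  has_final (slice_in A (vert (th true) ord0)).
Proof.
move=> H H' z1 z2 /(joyal qX) sp et es Ap z3 co.
apply/(hasfin_apex qX A H.1 H).
set f := face _ (th true); set g := face _ (th false).
have [s [s0 s1]] : exists s : X 2, face (inord 0) s = e /\ face (inord 1) s = f by exact: (special_T sp).
have [t [t0 t1]] : exists s : X 2, face (inord 0) s = e /\ face (inord 1) s = g.
  by apply: (special_T sp); rewrite // et; exact/esym/pb_tgt.
(* Moves the end of the cospan along the equivalence e, which lifts edges from any object. *)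
rewrite -s1 -t1; apply/(@cosp_base X qX A (fun=> True) e _ _ sp) => //.
have s2 (r : X 2) : src (face (inord 2) r) = src (face (inord 1) r) by rewrite /src /vert /face !act_comp; apply: act_eq; mor_ord.
have t2 (r : X 2) : tgt (face (inord 2) r) = src (face (inord 0) r) by rewrite /src /tgt /vert /face !act_comp; apply: act_eq; mor_ord.
(* One of the two legs becomes the zero leg of th'. *)
apply/(@zswap _ _ _ _ (face (inord 0) (th' false)) z2 z3) => //.
- by rewrite s2 t1.
- by rewrite t2 t0 es; exact: pb_tgt.
(* The other leg 0 -> d is factored as 0 -> q -> d by the triangle r, so that the square th' can be
   pasted to it. *)
have [e1 [e1s e1t]] := z1.1 (src (face (inord 0) (th' true))).
have [r [r2 r0 r1]] : edge_comp e1 (face (inord 0) (th' true)) (face (inord 2) s).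
  by apply: z1.2; rewrite ?e1s ?e1t ?s2 ?s1 ?t2 ?s0 ?es.
have C1 := @hasfin_FP (slice_in A (face (inord 1) r)) _ _ (slice_in A r) _ (slice_res A (mor_cst 0 v1) (face (inord 1) r))
  (slice_res A (mor_cst 0 v1) (face (inord 0) (th' false))) (slice_res A (mor_cst 0 ord_max) r) _ _ (sid _)
  (@tf_d1 X qX A r) (@tf_id _) (fun n x => ermax x (fun=> _)) (fun _ _ => erefl).
rewrite -r1; apply/C1 => {C1}.
  by apply: val_inj; rewrite /= /bump inordK.
pose T := fibprod (slice_res A (mor_cst 0 ord_max) r) (slice_res A (mor_cst 0 v1) (face (inord 0) (th' false))).
pose hc (e0 : X 1) : smap (cospan_in A e0 (face (inord 0) (th' false))) (dec 0 X) := slice_res A (mor_cst 0 v0) e0 \os fibprod1 _ _.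
have T1 n (x : T n) : slice_res A (mor_cst 0 v1) (face (inord 0) r) n ((slice_face A (coface (inord 0)) r \os fibprod1 _ _) n x) =
    slice_res A (mor_cst 0 v1) (face (inord 0) (th' false)) n (fibprod2 _ _ n x).
  by rewrite -fibprod_eq; apply: etrans (Er_comp _ _ _) _; apply: Er_eq; mor_ord.
have T2 n (x : T n) : slice_res A (mor_cst 0 v1) (face (inord 2) r) n ((slice_face A (coface (inord 2)) r \os fibprod1 _ _) n x) =
    hc (face (inord 0) r) n (fibprodmap T1 n x).
  by apply: etrans (Er_comp _ _ _) (etrans _ (esym (Er_comp _ _ _))); apply: Er_eq; mor_ord.
(* A cone on r amounts to cones on its edges 0 -> q and q -> d that agree at q, the missing face
   being inner. *)
have C2 : tfib (fibprodmap T2).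
  apply: tf_FPmap => m u y1 y2 yy uy1 uy2.
  have [//||||||w [wA wu wz]] := @tri_fill X A r 1 m (slice_val (fibprod1 _ _ \os u)) (fun p => if p is 0 then sval (fibprod1 _ _ m y2) else sval y1).
  - by apply: efill_inner => //; rewrite inordK.
  - by move=> l x; exact: cmp_back.
  - by move=> [|[|[|//]]] // _ _; [exact: (svalP (fibprod1 _ _ m y2))|exact: (svalP y1)].
  - by move=> p q pq qd pj qj; move: p q pq qd pj qj => [|[|[|p]]] [|[|[|q]]] // _ _ _ _; rewrite -[2.-1]/1 cface0 cface1.
  - move=> [|[|[|//]]] // _ _ l x; last by rewrite -[RHS]/(sval (act (sval x : mor l m) y1)) -uy1.
    by rewrite -[RHS]/(sval (act (sval x : mor l m) (fibprod1 _ _ m y2))) -smap_nat -uy2.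
  have E : slice_res A (mor_cst 0 ord_max) r m (exist _ w wA) = slice_res A (mor_cst 0 v1) (face (inord 0) (th' false)) m (fibprod2 _ _ m y2).
    rewrite -fibprod_eq; apply: etrans (congr1 (dres (mor_cst 0 v1) X m) (wz 0 isT _)) => //.
    by rewrite Er_comp; apply: Er_eq; mor_ord.
  exists (fibprodmk E); split.
  - by apply: Ed_ext; exact: (wz 2).
  - by apply: fibprod_ext => //; apply: Ed_ext; exact: (wz 0).
  move=> l x; apply: fibprod_ext; first by apply: Ed_ext; exact: wu.
  by rewrite [RHS]smap_nat -[fibprod2 _ _ m (fibprodmk E)]/(fibprod2 _ _ m y2) -smap_nat -uy2.
apply/(hasfin_tf C2); rewrite r0.
pose h' : smap (square_in A th') (dec 0 X) := slice_res A (mor_cst 0 (inord 1)) (th' true) \os fibprod1 _ _.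
(* The cospan of q -> d and the zero leg is replaced by the pullback square th'. *)
have C3 := @hasfin_FP (slice_in A (face (inord 2) r)) _ _ _ (square_in A th') (slice_res A (mor_cst 0 v1) (face (inord 2) r))
  (hc (face (inord 0) (th' true))) (slice_res A (mor_cst 0 v1) (face (inord 2) r)) h' (sid _) (legs_map A th') (@tf_id _) (@tf_legs X A th' H')
  (fun _ _ => erefl).
apply/C3 => [n x|].
  by apply: etrans (Er_comp _ _ _) _; apply: Er_eq; mor_ord.
(* The square is replaced by its side p -> q, which completes the pasting: what remains is the
   cospan of 0 -> q and p -> q. *)
have C4 := @hasfin_FP (slice_in A (face (inord 2) r)) _ _ _ (square_in A th') (slice_res A (mor_cst 0 v1) (face (inord 2) r))
  (slice_res A (mor_cst 0 v1) (face (inord 2) (th' true))) (slice_res A (mor_cst 0 v1) (face (inord 2) r)) h' (sid _) (side_map A th') (@tf_id _)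
  (@tf_side X qX A th' H'.1) (fun _ _ => erefl).
apply/C4 => [n x|].
  by apply: etrans (Er_comp _ _ _) _; apply: Er_eq; mor_ord.
have pv : src (face (inord 2) (th' true)) = vert (th' true) ord0 by rewrite /src /vert /face act_comp; apply: act_eq; mor_ord.
apply: cosp_sym; apply: hasfin_cosp.
- by rewrite pv.
- by rewrite r2 e1s.
- by rewrite r2 e1t t2.
- by rewrite t2.
Qed.

End Coreflection.

(** The edge at x of a natural transformation. *)
Definition comp_at (K Y : sset) (p : smap (sprod K (Delta 1)) Y) (x : K 0) : Y 1 := p 1 (degen 1 x, mor_id 1).

Lemma comp_act (K Y : sset) (p : smap (sprod K (Delta 1)) Y) (x : K 0) n (j : mor n 1) :
  p n (degen n x, j : Delta 1 n) = act j (comp_at p x).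
Proof.
rewrite /comp_at -smap_nat; congr (p _ (_, _)); first by rewrite [RHS]/= act_degen.
exact/esym/mor_id_comp.
Qed.

Lemma comp_vert (K Y : sset) (p : smap (sprod K (Delta 1)) Y) (x : K 0) i :
  vert (comp_at p x) i = p 0 (x, mor_cst 0 i : Delta 1 0).
Proof. by rewrite /vert -comp_act degen0. Qed.

Lemma comp_natural (K Y : sset) (p : smap (sprod K (Delta 1)) Y) (y : K 1) :
  edge_comp (p 1 (y, mor_cst 1 v0 : Delta 1 1)) (comp_at p (tgt y)) (p 1 (y, mor_id 1)) /\
  edge_comp (comp_at p (src y)) (p 1 (y, mor_cst 1 v1 : Delta 1 1)) (p 1 (y, mor_id 1)).
Proof.
have [H1 H2] := square_T (p \os sprod_map (yoneda y) (sid (Delta 1))).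
have E i : act (mor_cst 1 i) y = degen 1 (vert y i).
  by rewrite /degen /vert act_comp; apply: act_eq; exact: mor_ext.
rewrite /= !act_id in H1 H2; rewrite /comp_at /src /tgt -!E; split.
- by apply: H1.
- by apply: H2.
Qed.

(** * Homotopies relative to the ends of a cylinder *)

Section Ends.
Variables (X Y : sset).

Lemma cyl_ends_act m n (f : mor m n) (z : sprod X (Delta 1) n) :
  (exists c, z.2 = mor_cst n c) -> exists c, (act f z).2 = mor_cst m c.
Proof. by case=> c E; exists c; rewrite [LHS]/= E; exact: mor_ext. Qed.

(** X times the boundary of Delta^1. A transformation is moved by transport over X x Delta^1
    relative to this subobject, where both ends are prescribed. *)
Definition cyl_ends : ssub (sprod X (Delta 1)) := @SSub (sprod X (Delta 1)) (fun n z => exists c, z.2 = mor_cst n c) cyl_ends_act.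

Lemma cst_ends n x c : smem cyl_ends ((x, mor_cst n c) : sprod X (Delta 1) n).
Proof. by exists c. Qed.

Lemma cyl_endsP n (z : cyl_ends n) : exists x c, z = exist _ _ (@cst_ends n x c).
Proof. by case: z => -[x j] H; have [c /= jc] := H; exists x, c; apply: sig_ext; rewrite /= jc. Qed.

Variables p0 p1 : smap (sprod X (Delta 1)) Y.

Definition ends_fun n (z : sprod cyl_ends (Delta 1) n) : Y n :=
  if mfun (sval z.1).2 ord0 == v0 then p0 n ((sval z.1).1, z.2) else p1 n ((sval z.1).1, z.2).

Lemma ends_nat m n (f : mor m n) (z : sprod cyl_ends (Delta 1) n) : ends_fun (act f z) = act f (ends_fun z).
Proof.
case: z => -[[x j] H] k; have [c /= jc] := H; rewrite /ends_fun /= jc.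
by case: ifP => _; rewrite -smap_nat.
Qed.

Definition ends_map : smap (sprod cyl_ends (Delta 1)) Y := @SMap (sprod cyl_ends (Delta 1)) Y ends_fun ends_nat.

Lemma ends0 n x H k : ends_map n (exist _ (x, mor_cst n v0 : Delta 1 n) H, k) = p0 n (x, k).
Proof. by []. Qed.
Lemma ends1 n x H k : ends_map n (exist _ (x, mor_cst n v1 : Delta 1 n) H, k) = p1 n (x, k).
Proof. by []. Qed.

(** A nonconstant simplex of Delta^1 starts at 0; so transport in the opposite direction needs
    special edges only over the end 0. *)
Lemma not_ends n (z : sprod X (Delta 1) n) : ~ smem cyl_ends z -> mfun z.2 ord0 = v0.
Proof.
move=> H; case: (I2P (mfun z.2 ord0)) => // E; case: H; exists v1; apply: mor_ext => i.
by case: (I2P (mfun z.2 i)) => // E2; have := mor_mono z.2 (leq0n i : ord0 <= i); rewrite E E2.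
Qed.

End Ends.

Lemma homotopic_end (X : sset) (qX : infty_category X) (f g e k : X 1) :
  edge_comp f (degen 1 (tgt f)) k -> edge_comp e g k -> edge_comp e g f.
Proof.
move=> H1 H2; apply: (homotopic_comp qX H2); exact: (homotopic_sym qX H1).
Qed.

(** * Transfer of Cartesian edges from a correspondence *)

Section Transfer.
Variables (X M : sset) (qX : infty_category X) (qM : infty_category M).
Variables (AA : ssub X) (Q1 : M 0 -> Prop) (QQ : ssub M).
Hypothesis QQP : forall n (x : M n), smem QQ x <-> forall i, Q1 (vert x i).
Variables (r : smap X AA) (h0 : smap AA M) (hq : smap X QQ) (G : smap QQ X).
Variables (al : smap (sprod X (Delta 1)) X) (be : smap (sprod QQ (Delta 1)) M).
Variables (ka : smap (sprod X (Delta 1)) M) (et : smap (sprod AA (Delta 1)) M).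
Let hc : smap X M := incl QQ \os hq.
Let rx : smap X X := incl AA \os r.
Hypothesis al0 : forall n x, al n (x, mor_cst n v0 : Delta 1 n) = x.
Hypothesis al1 : forall n x, al n (x, mor_cst n v1 : Delta 1 n) = G n (hq n x).
Hypothesis alE : forall x, edge_equiv (comp_at al x).
Hypothesis be0 : forall n y, be n (y, mor_cst n v0 : Delta 1 n) = hc n (G n y).
Hypothesis be1 : forall n y, be n (y, mor_cst n v1 : Delta 1 n) = sval y.
Hypothesis beE : forall y, edge_equiv (comp_at be y).
Hypothesis ka0 : forall n x, ka n (x, mor_cst n v0 : Delta 1 n) = h0 n (r n x).
Hypothesis ka1 : forall n x, ka n (x, mor_cst n v1 : Delta 1 n) = hc n x.
Hypothesis et0 : forall n a, et n (a, mor_cst n v0 : Delta 1 n) = h0 n a.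
Hypothesis et1 : forall n a, et n (a, mor_cst n v1 : Delta 1 n) = hc n (sval a).
Hypothesis etS : forall a, @special (osset v1 M) Q1 (comp_at et a).

Lemma hcQ x : Q1 (hc 0 x).
Proof. by have := (QQP _).1 (svalP (hq 0 x)) ord0; rewrite vert0. Qed.

(** The transformation [ka], seen as a map on X x Delta^1, is pushed forward along the edges [et] on
    the end 0 and along identities on the end 1. The result factors [ka x] through [et (r x)]. *)
Lemma transfer_nu : exists nu : smap (sprod X (Delta 1)) QQ,
  [/\ forall n x, nu n (x, mor_cst n v0 : Delta 1 n) = hq n (rx n x),
      forall n x, nu n (x, mor_cst n v1 : Delta 1 n) = hq n x
    & forall x, edge_comp (comp_at et (r 0 x)) (sval (comp_at nu x)) (comp_at ka x)].
Proof.
pose p0 : smap (sprod X (Delta 1)) M := et \os sprod_map r (sid _).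
pose p1 : smap (sprod X (Delta 1)) M := hc \os sfst X (Delta 1).
pose eps (z : sprod X (Delta 1) 0) : M 1 := if mfun z.2 ord0 == v0 then comp_at et (r 0 z.1) else degen 1 (hc 0 z.1).
have epsE c x : eps (x, mor_cst 0 c) = if c == v0 then comp_at et (r 0 x) else degen 1 (hc 0 x) by [].
have [||||H [H0 [HU _]]] := @transport_op M qM _ (cyl_ends X) ka (ends_map p0 p1) eps.
- move=> n z; have [x [c ->]] := cyl_endsP z; case: (I2P c) => ->.
    by rewrite ends0 [RHS]ka0 [LHS]et0.
  by rewrite ends1 [RHS]ka1.
- move=> z; have [x [c ->]] := cyl_endsP z; rewrite [sval _]/= epsE.
  have -> : degen 1 (exist _ _ (@cst_ends X 0 x c) : cyl_ends X 0) = exist _ (degen 1 x, mor_cst 1 c : Delta 1 1) (@cst_ends X 1 (degen 1 x) c).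
    by apply: sig_ext; congr pair; exact: mor_ext.
  case: (I2P c) => ->; first by rewrite ends0 [RHS]/= smap_nat.
  by rewrite ends1 [RHS]/= smap_nat.
- move=> [x j]; rewrite /eps; case: (I2P (mfun j ord0)) => E; rewrite E /=.
    rewrite comp_vert et0 -ka0; congr (ka 0 (_, _)); apply: mor_ext => t; by rewrite (ord1 t) E.
  rewrite vert_degen -[LHS]/(hc 0 x) -ka1; congr (ka 0 (_, _)); apply: mor_ext => t; by rewrite (ord1 t) E.
- move=> n [x j] /not_ends E; exists Q1; split=> [|i].
    by rewrite /eps -[mfun _ ord0]/(mfun j ord0) E; exact: etS.
  rewrite /eps; case: ifP => _; last by rewrite vert_degen; exact: hcQ.
  by rewrite comp_vert et1; exact: hcQ.
have HUc c n (x : X n) k : H n ((x, mor_cst n c : Delta 1 n), k) = (if c == v0 then p0 else p1) n (x, k).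
  by rewrite (HU n (exist _ _ (@cst_ends X n x c))); case: (I2P c) => ->.
pose nu0 : smap (sprod X (Delta 1)) M := H \os spair (sid _) (const_map (sprod X (Delta 1)) (mor_cst 0 v1 : Delta 1 0)).
have cs n z : const_map (sprod X (Delta 1)) (mor_cst 0 v1 : Delta 1 0) n z = mor_cst n v1 by exact: mor_ext.
have nu0E n z : nu0 n z = H n (z, mor_cst n v1) by rewrite -(cs n z).
have nuQ n (z : sprod X (Delta 1) n) : smem QQ (nu0 n z).
  apply/QQP => i; rewrite /vert -smap_nat nu0E.
  case E : (act (mor_cst 0 i) z) => [x j].
  have -> : j = mor_cst 0 (mfun j ord0) by apply: mor_ext => t; rewrite (ord1 t).
  rewrite HUc; case: ifP => _; last exact: hcQ.
  by rewrite [X in Q1 X]et1; exact: hcQ.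
exists (sub_corestr nuQ); split=> [n x|n x|x].
- by apply: sig_ext; rewrite [LHS]nu0E HUc [LHS]et1.
- by apply: sig_ext; rewrite [LHS]nu0E HUc.
(* The naturality square of H has an identity as one side, which [homotopic_end] removes. *)
have [T1 T2] := comp_natural H (degen 1 x, mor_id 1 : Delta 1 1).
rewrite H0 in T1.
have E c : comp_at H ((vert (degen 1 x) c, mor_cst 0 c) : sprod X (Delta 1) 0) = (if c == v0 then p0 else p1) 1 (degen 1 x, mor_id 1).
  rewrite /comp_at -HUc vert_degen; congr (H 1 ((_, _), _)); exact: mor_ext.
have s0 c : vert ((degen 1 x, mor_id 1 : Delta 1 1) : sprod X (Delta 1) 1) c = ((vert (degen 1 x) c, mor_cst 0 c) : sprod X (Delta 1) 0).
  by congr pair; exact: mor_ext.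
have p0E : p0 1 (degen 1 x, mor_id 1 : Delta 1 1) = comp_at et (r 0 x) by rewrite /p0 /= smap_nat.
have p1E : p1 1 (degen 1 x, mor_id 1 : Delta 1 1) = degen 1 (tgt (comp_at ka x)).
  by rewrite /tgt comp_vert ka1 /p1 [LHS]smap_nat.
rewrite /tgt s0 (etrans (E v1) p1E) in T1; rewrite /src s0 (etrans (E v0) p0E) in T2.
apply: (homotopic_end qM T1); rewrite -[sval _]/(nu0 1 (degen 1 x, mor_id 1)) nu0E; exact: T2.
Qed.

(** [G nu] is moved along the equivalences [al] to a transformation w of X. No triangle identity is
    needed for comparing [hc w] with [nu]: cancelling a component of [al] makes [G hq w] and [G nu]
    homotopic, and applying [hc] and cancelling a component of [be] gives the claim. *)
Lemma transfer_w : exists w : smap (sprod X (Delta 1)) X,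
  [/\ forall n x, w n (x, mor_cst n v1 : Delta 1 n) = x,
      forall n x, w n (x, mor_cst n v0 : Delta 1 n) = rx n x
    & forall x, edge_comp (comp_at et (r 0 x)) (hc 1 (comp_at w x)) (comp_at ka x)].
Proof.
have [nu [nu0 nu1 nuT]] := transfer_nu.
pose p0 : smap (sprod X (Delta 1)) X := al \os sprod_map rx (sid _).
pose eps (z : sprod X (Delta 1) 0) : X 1 := if mfun z.2 ord0 == v0 then comp_at al (rx 0 z.1) else comp_at al z.1.
have epsE c x : eps (x, mor_cst 0 c) = if c == v0 then comp_at al (rx 0 x) else comp_at al x by [].
have [||||H [H1 [HU _]]] := @transport X qX _ (cyl_ends X) (G \os nu) (ends_map p0 al) eps.
- move=> n z; have [x [c ->]] := cyl_endsP z; case: (I2P c) => ->.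
    by rewrite ends0 scompE nu0 [LHS]al1.
  by rewrite ends1 scompE nu1 [LHS]al1.
- move=> z; have [x [c ->]] := cyl_endsP z; rewrite [sval _]/= epsE.
  have -> : degen 1 (exist _ _ (@cst_ends X 0 x c) : cyl_ends X 0) = exist _ (degen 1 x, mor_cst 1 c : Delta 1 1) (@cst_ends X 1 (degen 1 x) c).
    by apply: sig_ext; congr pair; exact: mor_ext.
  case: (I2P c) => ->; first by rewrite ends0 [RHS]/= smap_nat.
  by rewrite ends1.
- move=> [x j]; rewrite /eps; case: (I2P (mfun j ord0)) => E; rewrite E /= comp_vert al1.
    by rewrite -nu0; congr (G 0 (nu 0 (_, _))); apply: mor_ext => t; rewrite (ord1 t) E.
  by rewrite -nu1; congr (G 0 (nu 0 (_, _))); apply: mor_ext => t; rewrite (ord1 t) E.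
- move=> n [x j] _; exists (fun=> True); split=> //; rewrite /eps; case: ifP => _; exact: joyal.
have HUc c n (x : X n) k : H n ((x, mor_cst n c : Delta 1 n), k) = (if c == v0 then p0 else al) n (x, k).
  by rewrite (HU n (exist _ _ (@cst_ends X n x c))); case: (I2P c) => ->.
have cs n z : const_map (sprod X (Delta 1)) (mor_cst 0 v0 : Delta 1 0) n z = mor_cst n v0 by exact: mor_ext.
pose w : smap (sprod X (Delta 1)) X := H \os spair (sid _) (const_map (sprod X (Delta 1)) (mor_cst 0 v0 : Delta 1 0)).
have wE n z : w n z = H n (z, mor_cst n v0) by rewrite -(cs n z).
have w1 n x : w n (x, mor_cst n v1 : Delta 1 n) = x by rewrite wE HUc al0.
have w0 n x : w n (x, mor_cst n v0 : Delta 1 n) = rx n x by rewrite wE HUc [LHS]al0.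
exists w; split=> // x.
have [T1 T2] := comp_natural H (degen 1 x, mor_id 1 : Delta 1 1).
have E c : comp_at H ((vert (degen 1 x) c, mor_cst 0 c) : sprod X (Delta 1) 0) = (if c == v0 then p0 else al) 1 (degen 1 x, mor_id 1).
  rewrite /comp_at -HUc vert_degen; congr (H 1 ((_, _), _)); exact: mor_ext.
have s0 c : vert ((degen 1 x, mor_id 1 : Delta 1 1) : sprod X (Delta 1) 1) c = ((vert (degen 1 x) c, mor_cst 0 c) : sprod X (Delta 1) 0).
  by congr pair; exact: mor_ext.
have p0E : p0 1 (degen 1 x, mor_id 1 : Delta 1 1) = comp_at al (rx 0 x) by rewrite /p0 [LHS]/= smap_nat.
have E1 : comp_at H ((vert (degen 1 x) v1, mor_cst 0 v1) : sprod X (Delta 1) 0) = comp_at al x := E v1.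
rewrite /tgt s0 E1 -wE -/(comp_at w x) in T1.
rewrite /src s0 (etrans (E v0) p0E) H1 scompE -/(comp_at nu x) in T2.
have ws : src (comp_at w x) = rx 0 x by rewrite /src comp_vert w0.
have wt : tgt (comp_at w x) = x by rewrite /tgt comp_vert w1.
have [T3 T4] := comp_natural al (comp_at w x).
rewrite al0 wt in T3; rewrite al1 ws in T4.
have T5 := homotopic_comp qX T4 (T_uniq qX T3 T1).
have T6 := T_lcancel qX (alE _) T2 T5.
have T7 := homotopic_map hc T6.
have [T8 T9] := comp_natural be (comp_at nu x).
have [T8' T9'] := comp_natural be (hq 1 (comp_at w x)).
have nus : src (comp_at nu x) = hq 0 (rx 0 x) by rewrite /src comp_vert nu0.
have nut : tgt (comp_at nu x) = hq 0 x by rewrite /tgt comp_vert nu1.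
have hs : src (hq 1 (comp_at w x)) = hq 0 (rx 0 x).
  by rewrite -ws; exact: esym (smap_nat hq _ _).
have ht : tgt (hq 1 (comp_at w x)) = hq 0 x.
  by rewrite -[in RHS]wt; exact: esym (smap_nat hq _ _).
rewrite be0 nut in T8; rewrite be0 ht in T8'; rewrite be1 nus in T9; rewrite be1 hs in T9'.
have T10 := homotopic_l qM T7 T8.
have T11 := homotopic_comp qM T9' (T_uniq qM T8' T10).
exact: (homotopic_r qM (T_lcancel qM (beE _) T9 T11) (nuT x)).
Qed.

End Transfer.

Section TransferSpecial.
Variables (X M : sset) (qX : infty_category X) (qM : infty_category M).
Variables (A : X 0 -> Prop) (Q0 Q1 : M 0 -> Prop) (AA : ssub X) (QQ : ssub M).
Hypothesis AAP : forall n (x : X n), (forall i, A (vert x i)) -> smem AA x.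
Hypothesis QQP : forall n (x : M n), smem QQ x <-> forall i, Q1 (vert x i).
Variables (h0 : smap AA M) (hq : smap X QQ) (G : smap QQ X).
Variables (al : smap (sprod X (Delta 1)) X) (et : smap (sprod AA (Delta 1)) M).
Let hc : smap X M := incl QQ \os hq.
Hypothesis al0 : forall n x, al n (x, mor_cst n v0 : Delta 1 n) = x.
Hypothesis al1 : forall n x, al n (x, mor_cst n v1 : Delta 1 n) = G n (hq n x).
Hypothesis alE : forall x, edge_equiv (comp_at al x).
Hypothesis et0 : forall n a, et n (a, mor_cst n v0 : Delta 1 n) = h0 n a.
Hypothesis et1 : forall n a, et n (a, mor_cst n v1 : Delta 1 n) = hc n (sval a).
Hypothesis etS : forall a, @special (osset v1 M) Q1 (comp_at et a).
Hypothesis h0Q : forall a, Q0 (h0 0 a).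
Variables (a : AA 0) (e : X 1) (k : M 1).
Hypothesis (es : src e = sval a) (kS : special Q0 k) (Tk : edge_comp (comp_at et a) (hc 1 e) k).

Lemma hcQ' x : Q1 (hc 0 x).
Proof. by have := (QQP _).1 (svalP (hq 0 x)) ord0; rewrite vert0. Qed.

Section Horn.
Variables (n : nat) (h : smap (horn (ord_max : 'I_n.+3)) X).
Hypothesis he : forall H, h 1 (exist _ (ledge_mor n.+1 : Delta n.+2 1) H) = e.
Hypothesis hA : forall (i : 'I_n.+3) H, i < n.+2 -> A (h 0 (exist _ (mor_cst 0 i : Delta n.+2 0) H)).
Let K : sset := horn (ord_max : 'I_n.+3).
Let zm l (z : K l) : mor l n.+2 := sval z.

Lemma ledge_horn : smem (horn (ord_max : 'I_n.+3)) (ledge_mor n.+1 : Delta n.+2 1).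
Proof. by exists ord0; split=> [/(congr1 val)//|t /(congr1 val) /=]; lia. Qed.

(** The homotopy of horns is prescribed in two places: on simplices avoiding the last vertex, whose
    images lie in A so that [et] is available, and on the last edge, where a square with sides
    [hc e] and k is used. *)
Definition low l (z : K l) := misses (zm z) ord_max.
Definition high l (z : K l) := forall t, n.+1 <= zm z t.
Let pe l (z : K l) : mor l 1 := mor_comp (jlb v0 n.+1 0) (zm z).

Lemma high_E l (z : K l) : high z -> h l z = act (pe z) e.
Proof.
move=> H; rewrite -(he ledge_horn) -smap_nat; congr (h l _); apply: sig_ext; apply: mor_eqP => t.
rewrite -[LHS]/(nat_of_ord (zm z t)) -[RHS]/((n.+1 < zm z t : nat) + n.+1).
by have := H t; have := ltn_ord (zm z t); move: (nat_of_ord (zm z t)) => i; case: ltnP => /=; lia.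
Qed.

Lemma lowA l (z : K l) : low z -> smem AA (h l z).
Proof.
move=> H; apply: AAP => i; rewrite /vert -smap_nat.
have E : act (mor_cst 0 i) z = exist (@smem _ (horn (ord_max : 'I_n.+3)) 0) (mor_cst 0 (zm z i) : Delta n.+2 0) (smem_act (mor_cst 0 i) (svalP z)).
  by apply: sig_ext; exact: mor_ext.
by rewrite E; apply: hA; exact: lt_max.
Qed.

Lemma hl_act m l (f : mor m l) (z : K l) : low z \/ high z -> low (act f z) \/ high (act f z).
Proof. by case=> H; [left|right] => t; exact: H. Qed.

Let U : ssub K := @SSub K (fun l z => low z \/ high z) hl_act.

(** The first coordinate runs along the last edge of the horn, the second along the homotopy. *)
Lemma horn_square : exists s : smap Sq M, [/\ forall n (j : mor n 1), s n (mor_cst n v0, j) = act j (comp_at et a),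
  forall n (j : mor n 1), s n (j, mor_cst n v1) = act j (hc 1 e),
  forall n (j : mor n 1), s n (mor_cst n v1, j) = degen n (hc 0 (tgt e)) & s 1 (mor_id 1, mor_cst 1 v0) = k].
Proof.
have [s [s1 s2 s3 s4]] := T_square Tk; exists s; split=> // l j.
by rewrite s3; congr degen; exact: esym (smap_nat hc _ _).
Qed.

(** The horn is carried to M by [hc], moved back along [et] so that its last edge becomes k, filled
    there, moved forward along [et], and brought back to X along [al]. *)
Lemma horn_fill : exists y : X n.+2, forall l g, h l g = act (sval g : mor l n.+2) y.
Proof.
have [s [s0 s1 sv sk]] := horn_square.
pose gf l (zj : sprod U (Delta 1) l) : M l := match pselect (low (sval zj.1)) with
  | left H => et l (exist _ (h l (sval zj.1)) (lowA H), zj.2)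
  | right _ => s l (pe (sval zj.1), zj.2) end.
have gl l (z : U l) (j : Delta 1 l) (H : low (sval z)) : gf l (z, j) = et l (exist _ (h l (sval z)) (lowA H), j).
  by rewrite /gf; case: pselect => // H'; congr (et l (_, _)); exact: sig_ext.
(* The two prescriptions overlap at the source of e, where the square restricts to the edge
   [et a]. *)
have gh l (z : U l) (j : Delta 1 l) : high (sval z) -> gf l (z, j) = s l (pe (sval z), j).
  move=> Hz; rewrite /gf; case: pselect => // H; rewrite [(_, _).2]/=.
  have E1 : pe (sval z) = mor_cst l v0.
    apply: mor_ext => t; apply: val_inj; rewrite -[LHS]/(n.+1 < zm (sval z) t : nat).
    by have := lt_max (H t); case: ltnP => //=; lia.
  rewrite E1 s0 -comp_act; congr (et l (_, _)); apply: sig_ext.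
  by rewrite [LHS]/= (high_E Hz) E1 [RHS]/= -es /src /vert /degen !act_comp; apply: act_eq; exact: mor_ext.
have gN m l (f : mor m l) (z : sprod U (Delta 1) l) : gf m (act f z) = act f (gf l z).
  case: z => z j; rewrite -[LHS]/(gf m (act f z, act f j)).
  case: (pselect (low (sval z))) => H.
    have H2 : low (sval (act f z)) by move=> t; exact: H.
    by rewrite (gl _ _ _ H) (gl _ _ _ H2) -smap_nat; congr (et m (_, _)); apply: sig_ext; rewrite [LHS]/= smap_nat.
  have H1 : high (sval z) by case: (svalP z).
  have H2 : high (sval (act f z)) by move=> t; exact: H1.
  by rewrite gh // gh // -smap_nat; congr (s m (_, _)); exact: mor_ext.
pose g := @SMap (sprod U (Delta 1)) M gf gN.
(* The homotopy is constant at the last vertex. *)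
pose eps (z : K 0) : M 1 := match pselect (low z) with
  | left H => comp_at et (exist _ (h 0 z) (lowA H)) | right _ => degen 1 (hc 0 (tgt e)) end.
have epsl (z : K 0) (H : low z) : eps z = comp_at et (exist _ (h 0 z) (lowA H)).
  by rewrite /eps; case: pselect => // H'; congr comp_at; exact: sig_ext.
have epsh (z : K 0) : ~ low z -> eps z = degen 1 (hc 0 (tgt e)) by rewrite /eps; case: pselect.
have nlow l (z : K l) : ~ low z -> exists t, zm z t = ord_max.
  by move=> H; apply: contrapT => H2; apply: H => t E; apply: H2; exists t.
have hmax (z : K 0) : ~ low z -> h 0 z = tgt e.
  move=> /nlow [t zt]; rewrite -(he ledge_horn) /tgt /vert -smap_nat; congr (h 0 _); apply: sig_ext.
  by apply: mor_eqP => i; rewrite (ord1 i) -(ord1 t) -[LHS]/(nat_of_ord (zm z t)) zt /=; lia.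
have eps1 v : vert (eps v) v1 = hc 0 (h 0 v).
  case: (pselect (low v)) => H; first by rewrite epsl comp_vert et1.
  by rewrite epsh // vert_degen hmax.
have eps0 v : low v -> Q0 (vert (eps v) v0) by move=> H; rewrite epsl comp_vert et0.
have [l z|z|v|l z nU|H1 [H1v1 [H1U H1e]]] := @transport M qM K U (hc \os h) g eps.
- have [H|H] := svalP z; first by rewrite [LHS](gl _ _ _ H) et1.
  by apply: etrans (gh _ _ _ H) _; rewrite s1; exact: etrans (esym (smap_nat hc _ _)) (congr1 (hc l) (esym (high_E H))).
- case: (pselect (low (sval z))) => H.
    have H2 : low (sval (degen 1 z)) by move=> t; exact: H.
    rewrite epsl [RHS](gl _ _ _ H2) /comp_at; congr (et 1 (_, _)); apply: sig_ext.
    by rewrite [LHS]/= -smap_nat.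
  have [//|Hh] := svalP z; have H2 : high (sval (degen 1 z)) by move=> t; exact: Hh.
  rewrite epsh // [RHS](gh _ _ _ H2); have -> : pe (sval (degen 1 z)) = mor_cst 1 v1; last by rewrite sv.
  have [t zt] := nlow _ _ H; apply: mor_ext => i; apply: val_inj; rewrite -[LHS]/(n.+1 < zm (sval z) ord0 : nat).
  by rewrite -(ord1 t) zt /= ltnSn.
- by rewrite eps1.
(* A simplex outside U ends at the last vertex, where the edge is an identity. *)
- exists (fun=> True); split=> //.
  have [t zt] : exists t, zm z t = ord_max by apply: nlow => H; apply: nU; left.
  rewrite epsh; first by apply: joyal => //; exact: edge_equiv_degen.
  move=> H; apply: (H ord0); apply: val_inj; apply/eqP; rewrite eqn_leq -ltnS ltn_ord /=.
  have := mor_mono (zm z) (leq_ord t : t <= ord_max); by rewrite zt.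
have H1c v c : H1 0 (v, mor_cst 0 c : Delta 1 0) = vert (eps v) c by rewrite -H1e comp_vert.
have cs n' z c : const_map K (mor_cst 0 c : Delta 1 0) n' z = mor_cst n' c by exact: mor_ext.
(* The start of the homotopy: a horn with last edge k whose other vertices satisfy [Q0]. *)
pose u1 : smap K M := H1 \os spair (sid K) (const_map K (mor_cst 0 v0 : Delta 1 0)).
have u1E l z : u1 l z = H1 l (z, mor_cst l v0) by rewrite -(cs l z).
have [H|i H Hi|S SE] := kS (h := u1).
- have Hh : high (exist _ (ledge_mor n.+1 : Delta n.+2 1) H : K 1) by move=> t; rewrite -[zm _ t]/(ledge_mor n.+1 t) /=; lia.
  have Hu : smem U (exist _ (ledge_mor n.+1 : Delta n.+2 1) H : K 1) by right.
  rewrite u1E (H1U 1 (exist _ _ Hu)) [LHS](gh 1 (exist _ _ Hu) (mor_cst 1 v0) Hh) -sk; congr (s 1 (_, _)).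
  by apply: mor_ext => t; apply: val_inj; rewrite -[LHS]/(n.+1 < t + n.+1 : nat) /=; have := ltn_ord t; case: ltnP => /=; lia.
- by rewrite u1E H1c; apply: eps0 => t E; have E2 : i = ord_max := E; by move: Hi; rewrite E2 ltnn.
have vH (v : Delta n.+2 0) : smem (horn (ord_max : 'I_n.+3)) v.
  exists (if nat_of_ord ((v : mor 0 n.+2) ord0) == 0 then inord 1 else ord0); split.
    by case: ifP => _ /(congr1 (@nat_of_ord _)) //=; rewrite inordK.
  by move=> t; rewrite (ord1 t) => E; move: E; case: eqP => [E0 /(congr1 (@nat_of_ord _))|E0 E]; [rewrite E0 inordK|apply: E0; rewrite E].
(* Pushes the filler S forward. A simplex outside the horn starts at the vertex 0, where the edge
   belongs to [et] and is special in the opposite direction. *)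
have [l z|z|v|l z nU|H3 [H3v0 [H3U _]]] := @transport_op M qM (Delta n.+2) (horn (ord_max : 'I_n.+3)) (yoneda S) H1 (fun v => eps (exist _ v (vH v))).
- by rewrite -u1E; exact: SE.
- by apply: etrans _ (esym (H1e z)); congr eps; exact: sig_ext.
- by rewrite -H1c -u1E; exact: SE.
- exists Q1; split=> [|i]; last by rewrite eps1; exact: hcQ'.
  have z0 : (z : mor l.+1 n.+2) ord0 = ord0.
    apply: contrapT => zn; apply: nU; exists ord0; split=> [/(congr1 val)//|t zt]; apply: zn; apply: val_inj.
    by apply/eqP; rewrite -leqn0; have := mor_mono (z : mor l.+1 n.+2) (leq0n t : ord0 <= t); rewrite zt.
  have H : low (exist _ (vert z ord0) (vH (vert z ord0)) : K 0).
    by move=> t; rewrite -[zm _ t]/((z : mor l.+1 n.+2) ord0) z0 => /(congr1 val).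
  by rewrite (epsl _ H); exact: etS.
pose S' : M n.+2 := H3 n.+2 (mor_id n.+2, mor_cst n.+2 v1).
have S'E l (g' : horn (ord_max : 'I_n.+3) l) : act (sval g' : mor l n.+2) S' = hc l (h l g').
  rewrite -smap_nat -[RHS]H1v1 -H3U; congr (H3 l (_, _)); exact: mor_ext.
have S'Q : smem QQ S'.
  by apply/QQP => i; rewrite /vert -[act _ _]/(act (sval (exist _ (mor_cst 0 i : Delta n.+2 0) (vH _))) S') S'E; exact: hcQ'.
pose Sq' : QQ n.+2 := exist _ S' S'Q.
have SqE l (g' : horn (ord_max : 'I_n.+3) l) : act (sval g' : mor l n.+2) Sq' = hq l (h l g') by apply: sig_ext; exact: S'E.
(* The filler of the horn [hq h] is brought back by G and the invertible edges [al]. *)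
have [l z|z|v|l z nU|H4 [_ [H4U _]]] := @transport X qX (Delta n.+2) (horn (ord_max : 'I_n.+3)) (yoneda (G _ Sq'))
  (al \os sprod_map h (sid _)) (fun v => comp_at al (h 0 (exist _ v (vH v)))).
- by rewrite [LHS]al1 [RHS]/= -smap_nat SqE.
- rewrite /comp_at [RHS]/=; congr (al 1 (_, _)); rewrite [RHS]smap_nat; congr (degen 1 (h 0 _)); exact: sig_ext.
- by rewrite comp_vert al1 [RHS]/= -smap_nat -SqE.
- by exists (fun=> True); split=> //; exact: joyal.
exists (H4 n.+2 (mor_id n.+2, mor_cst n.+2 v0)) => l g'.
rewrite -smap_nat -[LHS]al0 -[LHS](H4U l g'); congr (H4 l (_, _)); exact: mor_ext.
Qed.

End Horn.

Lemma transfer_special : special A e.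
Proof. by move=> n h he hA; exact: horn_fill he hA. Qed.

End TransferSpecial.

Lemma vop_vop b : vop (vop b) = b.
Proof. exact: vopK. Qed.

Lemma rvo_b0 b : rvo b v0 = b :> 'I_2. Proof. by case: (I2P b) => ->; exact: val_inj. Qed.
Lemma rvo_b1 b : rvo b v1 = vop b :> 'I_2. Proof. by case: (I2P b) => ->; exact: val_inj. Qed.

(** The simplex of Delta^1 that sends only the last vertex, in the orientation given by b, to vop b. *)
Definition last_lab b n : mor n.+2 1 := rv b (jlb v0 n.+1 0).

Lemma last_labE b n i : last_lab b n (rvo b i) = (if nat_of_ord i == n.+2 then vop b else b).
Proof.
rewrite -[LHS]/(rvo b (jlb v0 n.+1 0 (rvo b (rvo b i)))) rvoK.
have -> : jlb v0 n.+1 0 i = (if nat_of_ord i == n.+2 then v1 else v0).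
  by apply: val_inj; rewrite -[LHS]/(n.+1 < i : nat); have := ltn_ord i; case: eqP; case: ltnP => //=; lia.
by case: ifP => _; [exact: rvo_b1|exact: rvo_b0].
Qed.

Lemma horn_vert n (j : 'I_n.+1) (i : 'I_n.+1) : 1 < n -> smem (horn j) (mor_cst 0 i : Delta n 0).
Proof.
move=> n1; have [k [kj ki]] : exists k : 'I_n.+1, k <> j /\ k <> i.
  pose f (x : nat) (H : x < n.+1) := Ordinal H.
  have H0 : 0 < n.+1 by []. have H1 : 1 < n.+1 by lia. have H2 : 2 < n.+1 by lia.
  have D (x y : nat) (Hx : x < n.+1) (Hy : y < n.+1) : Ordinal Hx = Ordinal Hy -> x = y by move=> /(congr1 val).
  case: (pselect (j = Ordinal H0)) => [->|j0]; [case: (pselect (i = Ordinal H1)) => [->|i1]|case: (pselect (i = Ordinal H0)) => [->|i0]].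
  - by exists (Ordinal H2); split=> /D.
  - by exists (Ordinal H1); split=> [/D|/esym].
  - case: (pselect (j = Ordinal H1)) => [->|j1]; last by exists (Ordinal H1); split=> [/esym|/D].
    by exists (Ordinal H2); split=> /D.
  - by exists (Ordinal H0); split=> /esym.
by exists k; split=> // t /esym.
Qed.

(** * Cartesian edges over Delta^1 *)

Lemma ocart_special b (M : sset) (q : smap M (Delta 1)) (e : M 1) : ocartesian_edge b q e -> q 1 e = mor_id 1 ->
  @special (osset b M) (fun m => q 0 m = mor_cst 0 b) e.
Proof.
move=> /ocart_hcart H qe n h he hP.
have qv l (g : horn (ord_max : 'I_n.+3) l) i : (q l (h l g) : mor l 1) (rvo b i) = last_lab b n (rvo b ((sval g : mor l n.+2) i)).
  have E : q 0 (@act (osset b M) _ _ (mor_cst 0 i) (h l g)) = mor_cst 0 ((q l (h l g) : mor l 1) (rvo b i)).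
    by rewrite oactE smap_nat rv_cst; exact: mor_ext.
  rewrite -smap_nat in E; set j := (sval g : mor l n.+2) i in E *.
  have gE : act (mor_cst 0 i) g = exist _ (mor_cst 0 j : Delta n.+2 0) (smem_act (mor_cst 0 i) (svalP g)).
    by apply: sig_ext; exact: mor_ext.
  rewrite gE in E; move: (smem_act _ _) E => Hj E.
  apply: (@etrans _ _ ((q 0 (h 0 (exist _ (mor_cst 0 j : Delta n.+2 0) Hj)) : mor 0 1) ord0)); first by rewrite E.
  rewrite last_labE; case: eqP => Ej; last first.
    by rewrite hP //; have := ltn_ord j; lia.
  have lH : smem (horn (ord_max : 'I_n.+3)) (ledge_mor n.+1 : Delta n.+2 1).
    by exists ord0; split=> [/(congr1 val)//|t /(congr1 val) /=]; lia.
  have -> : exist _ (mor_cst 0 j : Delta n.+2 0) Hj = act (mor_cst 0 v1) (exist _ _ lH : horn (ord_max : 'I_n.+3) 1).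
    by apply: sig_ext; apply: mor_eqP => t /=; rewrite Ej; lia.
  rewrite smap_nat he oactE smap_nat qe rv_cst Delta_actE mor_id_comp rvo_b1; by [].
have [l g|y [_ y2]] := H n h (last_lab b n : Delta 1 n.+2) he.
  apply: mor_ext => i; rewrite -[i in LHS](rvoK b) -[i in RHS](rvoK b).
  rewrite [LHS](qv l g (rvo b i)) /= !rvoK; congr (rvo b _); congr (jlb _ _ _ _); by rewrite /= !rvoK.
by exists y.
Qed.

(** Reversing by [vop b] has the same effect as reversing by b and then once more, but the two
    simplicial sets carry different proofs of the same laws; hence the comparison field by field. *)
Lemma special_oo b (M : sset) P (e : M 1) : @special (osset (vop b) M) P e -> @special (osset v1 (osset b M)) P e.
Proof.
have aux (T : nat -> Type) (a1 a2 : forall m n, mor m n -> T n -> T m) i1 c1 i2 c2 (P' : T 0 -> Prop) (e' : T 1) :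
    a1 = a2 -> @special (@SSet T a1 i1 c1) P' e' -> @special (@SSet T a2 i2 c2) P' e'.
  move=> E; subst a2; by rewrite (Prop_irrelevance i1 i2) (Prop_irrelevance c1 c2).
apply: aux; apply: functional_extensionality_dep => m; apply: functional_extensionality_dep => n.
apply/funext => f; apply/funext => x; rewrite oactE; congr act.
by case: (I2P b) => ->; apply: mor_ext => i /=; rewrite /rvo /= ?rev_ordK.
Qed.

(** An inner horn contains all vertices and all edges between consecutive vertices, and these
    determine a monotone map. *)
Lemma Delta1_qcat : infty_category (Delta 1).
Proof.
apply: qcat_of_fill => n j Hj h; have n1 : 1 < n by lia.
pose c i := h 0 (exist _ _ (horn_vert j i n1)).
pose y (i : 'I_n.+1) : 'I_2 := (c i : mor 0 1) ord0.
have hv l (g : horn j l) i : (h l g : mor l 1) i = y ((sval g : mor l n) i).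
  rewrite /y /c; have -> : exist _ _ (horn_vert j ((sval g : mor l n) i) n1) = act (mor_cst 0 i) g by apply: sig_ext; exact: mor_ext.
  by rewrite smap_nat.
have step (i i' : 'I_n.+1) : nat_of_ord i' = (nat_of_ord i).+1 -> y i <= y i'.
  move=> E; have Hm : forall a b : 'I_2, a <= b -> (if a == v0 then i else i') <= (if b == v0 then i else i').
    by move=> a b; case: (I2P a) => ->; case: (I2P b) => -> //=; rewrite E.
  pose g : mor 1 n := @Mor 1 n (fun t => if t == v0 then i else i') Hm.
  have gH : smem (horn j) (g : Delta n 1).
    (* The edge avoids the last vertex if i = 0 and the first vertex otherwise; neither is j, which
       is inner. *)
    exists (if nat_of_ord i == 0 then ord_max else ord0); split.
      case: eqP => _ /(congr1 (@nat_of_ord _)) /=; move: Hj; lia.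
    move=> t; case: (nat_of_ord i =P 0) => E0; case: (I2P t) => -> /(congr1 (@nat_of_ord _)) /=; lia.
  by have := mor_mono (h 1 (exist _ _ gH) : mor 1 1) (isT : v0 <= v1); rewrite !hv.
have mono (i i' : 'I_n.+1) : i <= i' -> y i <= y i'.
  case: i' => i' Hi'; elim: i' Hi' => [|k IH] Hk /= ik.
    by have -> : i = Ordinal Hk by apply: val_inj => /=; lia.
  case: (ltngtP (nat_of_ord i) k.+1) => [lt|gt|E]; [|lia|by have -> : i = Ordinal Hk by exact: val_inj].
  exact: leq_trans (IH (ltnW Hk) lt) (step (Ordinal (ltnW Hk)) (Ordinal Hk) erefl).
by exists (@Mor n 1 y mono : Delta 1 n) => l g; apply: mor_ext => i; exact: hv.
Qed.

Lemma inner_qcat (M S : sset) (q : smap M S) : infty_category S -> inner_fibration q -> infty_category M.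
Proof.
move=> qS iq; apply: qcat_of_fill => n j Hj h; have [y yE] := qfill qS Hj (q \os h).
have [|w [wh _]] := iq n j Hj h (yoneda y); first by apply: smap_ext => l g; exact: yE.
exists (w n (mor_id n)) => l g; rewrite -wh /= -smap_nat; congr (w _ _); exact/esym/mor_id_comp.
Qed.

(** * The correspondence chi *)

Section Chi.
Variables (C : sset) (qC : infty_category C) (S : 'I_2 -> C 0 -> Prop).
Let Ch := chi (S v0) (S v1).
Let pr := chi_proj (S v0) (S v1).

(** Both subcategories are full, so membership in chi can be tested on vertices; S treats the two
    sides uniformly. *)
Definition chi_pred n (t : mor n 1) (y : C n) := forall i, S (t i) (vert y i).

Lemma chi_elim n (z : Ch n) : chi_pred ((sval z).1 : mor n 1) (sval z).2.
Proof.
case: z => -[t y] [zA zB] i /=.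
have E c : t i = c -> smem (fiber (@yoneda (Delta 1) n t) c) (mor_cst 0 i : Delta n 0).
  by move=> <-; exact: mor_ext.
case: (I2P (mfun t i)) => ti; rewrite ti.
  by have := zA 0 (exist _ _ (E v0 ti)) ord0; rewrite /= vert0.
by have := zB 0 (exist _ _ (E v1 ti)) ord0; rewrite /= vert0.
Qed.

Lemma chi_intro n (t : mor n 1) (y : C n) : chi_pred t y -> exists z : Ch n, sval z = (t, y).
Proof.
move=> H; have E c k (a : fiber (@yoneda (Delta 1) n t) c k) i : S c (vert (act (sval a : mor k n) y) i).
  rewrite vert_act; have E2 := mor_eqE i (svalP a : mor_comp t (sval a) = mor_cst k c).
  by have := H ((sval a : mor k n) i); rewrite -[t _]/(mor_comp t (sval a) i) E2.
have Hc : (forall k (a : fiber (yoneda (t : Delta 1 n)) v0 k), smem (full (S v0)) (act (sval a : mor k n) y)) /\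
    (forall k (a : fiber (yoneda (t : Delta 1 n)) v1 k), smem (full (S v1)) (act (sval a : mor k n) y)).
  by split=> k a i; exact: E.
by exists (exist _ (t : Delta 1 n, y) Hc).
Qed.

(** A horn of dimension at least 2 contains all vertices, so a filler in C of a horn in chi is
    automatically in chi. *)
Lemma chi_horn n (j : 'I_n.+1) (h : smap (horn j) Ch) (t : mor n 1) (y : C n) : 1 < n ->
  (forall l (g : horn j l), sval (h l g) = (mor_comp t (sval g), act (sval g : mor l n) y)) ->
  exists z : Ch n, sval z = (t, y) /\ forall l g, h l g = act (sval g : mor l n) z.
Proof.
move=> n1 H; have [z zE] : exists z : Ch n, sval z = (t, y).
  apply: chi_intro => i; have := chi_elim (h 0 (exist _ _ (horn_vert j i n1))) ord0.
  by rewrite H /= vert0.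
by exists z; split=> // l g; apply: sig_ext; rewrite H /= zE.
Qed.

Lemma chi_snd_nat m n (f : mor m n) (z : Ch n) : (sval (act f z)).2 = act f (sval z).2.
Proof. by []. Qed.

Definition chi_snd : smap Ch C := @SMap Ch C (fun n z => (sval z).2) chi_snd_nat.

Lemma chi_eta n (z : Ch n) : sval z = (pr n z, chi_snd n z).
Proof. by rewrite /=; case: (sval z). Qed.

Lemma chi_inner : inner_fibration pr.
Proof.
move=> n j Hj u v uv; have n1 : 1 < n by lia.
have [y yE] := qfill qC Hj (chi_snd \os u).
have pE l (g : horn j l) : pr l (u l g) = mor_comp (v n (mor_id n)) (sval g).
  rewrite -[LHS]/((pr \os u) l g) uv -[RHS]/(act (sval g : mor l n) (v n (mor_id n))) -smap_nat.
  by congr (v l _); exact/esym/mor_id_comp.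
have [|z [zE zu]] := @chi_horn n j u (v n (mor_id n)) y n1.
  by move=> l g; rewrite chi_eta pE -(yE l g).
exists (yoneda z); split; apply: smap_ext => l g; first by rewrite [RHS]zu.
rewrite -[LHS]/(mor_comp (sval z).1 g) zE -[LHS]/(act (g : mor l n) (v n (mor_id n))) -smap_nat.
by congr (v l _); exact: mor_id_comp.
Qed.

(** If the edge starts over b in the chosen orientation, so do all earlier vertices of a horn, and P
    is needed on S b only. If it starts over the other vertex, the labels say nothing about earlier
    vertices and P is required of every object; this case serves the degenerate edges. *)
Lemma chi_cart b (e : Ch 1) (P : C 0 -> Prop) : @special (osset b C) P (sval e).2 ->
  (mfun (sval e).1 b = b -> forall c, S b c -> P c) -> (mfun (sval e).1 b = vop b -> forall c, P c) ->
  ocartesian_edge b pr e.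
Proof.
move=> sp P1 P2; apply/ocart_hcart => n h t he ht.
pose t0 : mor n.+2 1 := t.
have lH : smem (horn (ord_max : 'I_n.+3)) (ledge_mor n.+1 : Delta n.+2 1).
  by exists ord0; split=> [/(congr1 val)//|k /(congr1 val) /=]; lia.
have teE : mor_comp t0 (rv b (ledge_mor n.+1)) = (sval e).1.
  by have := ht 1 (exist _ _ lH); rewrite he => E; exact: esym E.
have [H|i H Hi|y yE] := sp n (osmap b chi_snd \os h).
- by rewrite scompE he.
- have tE : (sval (h 0 (exist _ (mor_cst 0 i : Delta n.+2 0) H))).1 = mor_cst 0 (t0 (rvo b i)).
    by have := ht 0 (exist _ _ H) => E; apply: etrans E _; exact: mor_ext.
  have cE := chi_elim (h 0 (exist _ (mor_cst 0 i : Delta n.+2 0) H)) ord0; rewrite vert0 tE in cE.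
  have eb : mfun (sval e).1 b = t0 (rvo b (inord n.+1)).
    have rvbb : rvo b b = v0 by case: (I2P b) => ->; exact: val_inj.
    rewrite -teE -[LHS]/(t0 (rvo b (ledge_mor n.+1 (rvo b b)))) rvbb; congr (t0 (rvo b _)).
    by apply: ord_inj; rewrite inordK.
  case: (I2vP b (mfun (sval e).1 b)) => E; last exact: P2.
  apply: (P1 E); rewrite -[X in S X _](_ : t0 (rvo b i) = b); first exact: cE.
  rewrite E in eb.
  case: (I2P b) eb => -> eb.
  + apply: val_inj; have Hle : nat_of_ord i <= (inord n.+1 : 'I_n.+3) by rewrite inordK.
    have := mor_mono t0 Hle; rewrite -[inord n.+1]/(rvo v0 (inord n.+1)) -eb /= leqn0 => /eqP; exact.
  + have Hle : rvo v1 (inord n.+1 : 'I_n.+3) <= rvo v1 i by rewrite !rvo_max /= inordK //; lia.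
    have := mor_mono t0 Hle; rewrite -eb; case: (I2P (t0 (rvo v1 i))) => ->; by [].
pose yC : C n.+2 := y.
have zz : exists z : Ch n.+2, sval z = (t0, yC).
  apply: chi_intro => i; have Hi := horn_vert (ord_max : 'I_n.+3) (rvo b i) (isT : 1 < n.+2).
  have := chi_elim (h 0 (exist _ _ Hi)) ord0; rewrite vert0.
  have -> : (sval (h 0 (exist _ _ Hi))).2 = vert yC i.
    by have := yE 0 (exist _ _ Hi) => E; apply: etrans E _; rewrite oactE rv_cst /= rvoK.
  have -> : (sval (h 0 (exist _ _ Hi))).1 = mor_cst 0 (t0 i).
    by have := ht 0 (exist _ _ Hi) => E; apply: etrans E _; apply: mor_ext => k; rewrite /= rvoK.
  by [].
have [z zE] := zz; exists z; split; first by rewrite -[LHS]/((sval z).1) zE.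
move=> l g; apply: sig_ext; rewrite chi_eta -[RHS]/(act (rv b (sval g : mor l n.+2)) (sval z).1, act (rv b (sval g : mor l n.+2)) (sval z).2) zE.
by congr pair; [exact: (ht l g)|exact: (yE l g)].
Qed.

(** With the labels of [last_lab], a horn in C with the required vertices becomes a horn in chi,
    which is filled because e is Cartesian. *)
Lemma chi_cart_special b (e : Ch 1) : ocartesian_edge b pr e -> (sval e).1 = mor_id 1 ->
  @special (osset b C) (S b) (sval e).2.
Proof.
move=> ce ee; have eS i : S i (vert (sval e).2 i) by have := chi_elim e i; rewrite ee.
have sp := ocart_special ce ee; move=> n h he hP.
have lH : smem (horn (ord_max : 'I_n.+3)) (ledge_mor n.+1 : Delta n.+2 1).
  by exists ord0; split=> [/(congr1 val)//|k /(congr1 val) /=]; lia.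
have hpred l (g : horn (ord_max : 'I_n.+3) l) : chi_pred (mor_comp (last_lab b n) (rv b (sval g : mor l n.+2))) (h l g : C l).
  move=> i; rewrite -[i](rvoK b) -overt mor_compE -[rv b (sval g : mor l n.+2) _]/(rvo b ((sval g : mor l n.+2) (rvo b (rvo b (rvo b i))))) rvoK last_labE.
  set j := (sval g : mor l n.+2) (rvo b i).
  have gE : act (mor_cst 0 (rvo b i)) g = exist _ (mor_cst 0 j : Delta n.+2 0) (smem_act (mor_cst 0 (rvo b i)) (svalP g)).
    by apply: sig_ext; exact: mor_ext.
  rewrite /vert -smap_nat gE; move: (smem_act _ _) => Hj; case: eqP => Ej; last by apply: hP; have := ltn_ord j; lia.
  have -> : exist _ (mor_cst 0 j : Delta n.+2 0) Hj = act (mor_cst 0 v1) (exist _ _ lH : horn (ord_max : 'I_n.+3) 1).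
    by apply: sig_ext; apply: mor_eqP => k /=; rewrite Ej; lia.
  by rewrite smap_nat he oactE rv_cst rvo_b1; exact: eS.
pose hh l (g : horn (ord_max : 'I_n.+3) l) : Ch l := sval (cid (chi_intro (hpred l g))).
have hhE l g : sval (hh l g) = (mor_comp (last_lab b n) (rv b (sval g : mor l n.+2)), h l g : C l) by exact: svalP (cid (chi_intro (hpred l g))).
have hhN l k (f : mor l k) g : hh l (act f g) = @act (osset b Ch) _ _ f (hh k g).
  apply: sig_ext; rewrite hhE -[RHS]/(act (rv b f) (sval (hh k g)).1, act (rv b f) (sval (hh k g)).2) hhE.
  congr pair; last exact: (smap_nat h f g).
  by rewrite [LHS](congr1 (mor_comp _) (rv_comp b f (sval g : mor k n.+2))) -mor_compA.
have [H|i H Hi|y yE] := sp n (@SMap (horn (ord_max : 'I_n.+3)) (osset b Ch) hh hhN).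
- apply: sig_ext; rewrite [LHS]hhE -[RHS]/(sval e) (chi_eta e); congr pair; last by rewrite he.
  rewrite -[RHS]/((sval e).1) ee; apply: mor_ext => i; rewrite -[i](rvoK b) mor_compE.
  rewrite -[rv b _ _]/(rvo b (ledge_mor n.+1 (rvo b (rvo b (rvo b i))))) rvoK last_labE /=.
  case: (I2P (rvo b i)) => -> /=; first by rewrite rvo_b0; case: eqP => //; lia.
  by rewrite rvo_b1; case: eqP => //; lia.
- rewrite -[LHS]/((sval (hh 0 (exist _ _ H))).1) hhE; apply: mor_ext => k.
  rewrite mor_compE -[rv b _ _]/(rvo b i) last_labE; case: eqP => // E; lia.
exists ((sval y).2 : C n.+2) => l g; have := congr1 (fun z => (sval z).2) (yE l g).
by rewrite [X in X = _ -> _]/= hhE.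
Qed.

Lemma chi_cart_degen b (z : Ch 0) : ocartesian_edge b pr (degen 1 z).
Proof.
apply: (@chi_cart b (degen 1 z) (fun=> True)) => //.
apply: joyal; first exact: osset_qcat.
exact/edge_equiv_o/edge_equiv_degen.
Qed.

(** An edge of Delta^1 is degenerate or is 0 -> 1. Degenerate edges of chi are Cartesian, so only
    the second case calls on the hypothesis. *)
Lemma chi_fib b : (forall c, S (vop b) c -> exists e : C 1, [/\ S b (vert e b), vert e (vop b) = c & @special (osset b C) (S b) e]) ->
  ocartesian_fibration b pr.
Proof.
move=> H; split; first exact: chi_inner.
move=> e y ye; pose e0 : mor 1 1 := e.
case: (pselect (e0 v0 = e0 v1)) => E.
  have eE : e0 = mor_cst 1 (e0 v0) by apply: mor_ext => i; case: (I2P i) => ->.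
  exists (degen 1 y); split; [exact: chi_cart_degen| |exact: vert_degen].
  rewrite /degen smap_nat ye -[RHS]/e0 eE /vert act_comp -[LHS]/(mor_comp e0 _) eE; exact: mor_ext.
have eE : e0 = mor_id 1.
  apply: mor_ext => i; have := mor_mono e0 (isT : v0 <= v1).
  by case: (I2P i) => ->; case: (I2P (e0 v0)) E => ->; case: (I2P (e0 v1)) => ->.
have yS : S (vop b) (sval y).2.
  have := chi_elim y ord0; rewrite vert0 -[(sval y).1]/(pr 0 y) ye -/e0.
  by rewrite -[vert _ _]/(mor_comp e0 (mor_cst 0 (vop b))) eE.
have [f [f0 f1 fs]] := H _ yS.
have [z zE] : exists z : Ch 1, sval z = (mor_id 1, f).
  by apply: chi_intro => i; case: (I2vP b i) => ->; rewrite /= ?f1.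
exists z; split.
- apply: (@chi_cart b z (S b)); rewrite zE //= => E0; case: (vop_neq E0).
- by rewrite -[LHS]/((sval z).1) zE -[RHS]/e0 eE.
- apply: sig_ext; rewrite (chi_eta y) ye; rewrite -[LHS]/(act (mor_cst 0 (vop b)) (sval z).1, act (mor_cst 0 (vop b)) (sval z).2) zE.
  by congr pair; [rewrite -[RHS]/(mor_comp e0 (mor_cst 0 (vop b))) eE|].
Qed.

Definition in_chi c (h : smap (full (S c)) (fiber pr c)) := forall n x, sval (sval (h n x)) = (mor_cst n c, sval x).

Lemma chi_assoc b (hb : smap (full (S b)) (fiber pr b)) (hc : smap (full (S (vop b))) (fiber pr (vop b)))
    (g : smap (full (S (vop b))) (full (S b))) (w : smap (sprod (full (S (vop b))) (Delta 1)) C) (P : C 0 -> Prop) :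
  in_chi hb -> in_chi hc ->
  (forall n y, w n (y, mor_cst n (vop b) : Delta 1 n) = sval y) -> (forall n y, w n (y, mor_cst n b : Delta 1 n) = sval (g n y)) ->
  (forall c, S b c -> P c) -> (forall y, @special (osset b C) P (comp_at w y)) -> oassociated hb hc g.
Proof.
move=> hbE hcE w1 w0 SP ws.
have pred n (z : sprod (full (S (vop b))) (Delta 1) n) : chi_pred (z.2 : mor n 1) (w n z).
  case: z => y j i; rewrite /vert -smap_nat; set c := (_, j).2 i.
  have -> : @act (sprod (full (S (vop b))) (Delta 1)) _ _ (mor_cst 0 i) (y, j) = (act (mor_cst 0 i) y, mor_cst 0 c).
    by congr pair; exact: mor_ext.
  case: (I2vP b c) => ->.
    by rewrite w0; have := svalP (g 0 (act (mor_cst 0 i) y)) ord0; rewrite vert0.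
  by rewrite w1; have := svalP (act (mor_cst 0 i) y) ord0; rewrite vert0.
pose s n (z : sprod (full (S (vop b))) (Delta 1) n) : Ch n := sval (cid (chi_intro (pred n z))).
have sE n z : sval (s n z) = (z.2, w n z) by exact: svalP (cid (chi_intro (pred n z))).
have sN m n (f : mor m n) z : s m (act f z) = act f (s n z).
  by apply: sig_ext; rewrite sE -[RHS]/(act f (sval (s n z)).1, act f (sval (s n z)).2) sE smap_nat.
exists (@SMap (sprod (full (S (vop b))) (Delta 1)) Ch s sN); split.
- by apply: smap_ext => n z; rewrite -[LHS]/((sval (s n z)).1) sE.
- by move=> n y; apply: sig_ext; rewrite [LHS]sE [RHS]hcE w1.
- by move=> n y; apply: sig_ext; rewrite [LHS]sE [RHS]hbE w0.
move=> y; apply: (@chi_cart b _ P); rewrite ?sE //=; first exact: ws.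
by move=> E; case: (vop_neq E).
Qed.

End Chi.

(** * Homotopies in the opposite orientation *)

Section OppositeHomotopy.
Variables (b : 'I_2) (Y : sset).

Lemma ohom_nat (K : sset) (U : ssub K) (p : smap (sprod U (Delta 1)) Y) m n (f : mor m n) (z : sprod (osub b U) (Delta 1) n) :
  p m (exist (@smem _ U m) (sval (act f z).1) (svalP (act f z).1), rv b (act f z).2) =
  act (rv b f) (p n (exist (@smem _ U n) (sval z.1) (svalP z.1), rv b z.2)).
Proof.
rewrite -smap_nat; congr (p _ (_, _)); first exact: sig_ext.
exact: (rv_comp b f z.2).
Qed.

Definition ohom_sub (K : sset) (U : ssub K) (p : smap (sprod U (Delta 1)) Y) : smap (sprod (osub b U) (Delta 1)) (osset b Y) :=
  @SMap (sprod (osub b U) (Delta 1)) (osset b Y) _ (@ohom_nat K U p).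

Lemma ohom_subE (K : sset) (U : ssub K) (p : smap (sprod U (Delta 1)) Y) n x H c :
  ohom_sub p n (exist _ x H, mor_cst n c : Delta 1 n) = p n (exist _ x H, mor_cst n (rvo b c)).
Proof.
by apply: etrans _ (congr1 (fun j : Delta 1 n => p n (exist _ x H : U n, j)) (rv_cst b n c)); congr (p n (_, _)); exact: sig_ext.
Qed.

Lemma ohom_sub_at (K : sset) (U : ssub K) (p : smap (sprod U (Delta 1)) Y) x H : comp_at (ohom_sub p) (exist _ x H) = comp_at p (exist _ x H).
Proof.
rewrite /comp_at -[LHS]/(p 1 (exist _ _ _, rv b (mor_id 1))) rv_id; congr (p 1 (_, _)).
by apply: sig_ext; exact: (odegen b).
Qed.

Lemma ohom_nat1 (K : sset) (p : smap (sprod K (Delta 1)) Y) m n (f : mor m n) (z : sprod (osset b K) (Delta 1) n) :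
  p m ((act f z).1, rv b (act f z).2) = act (rv b f) (p n (z.1, rv b z.2)).
Proof. by rewrite -smap_nat; congr (p _ (_, _)); exact: (rv_comp b f z.2). Qed.

Definition ohom (K : sset) (p : smap (sprod K (Delta 1)) Y) : smap (sprod (osset b K) (Delta 1)) (osset b Y) :=
  @SMap (sprod (osset b K) (Delta 1)) (osset b Y) _ (@ohom_nat1 K p).

Lemma ohomE (K : sset) (p : smap (sprod K (Delta 1)) Y) n (x : K n) c : ohom p n (x, mor_cst n c : Delta 1 n) = p n (x, mor_cst n (rvo b c)).
Proof. exact: (congr1 (fun j : Delta 1 n => p n (x, j)) (rv_cst b n c)). Qed.

Lemma ohom_at (K : sset) (p : smap (sprod K (Delta 1)) Y) (x : K 0) : comp_at (ohom p) x = comp_at p x.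
Proof. by rewrite /comp_at -[LHS]/(p 1 (degen 1 (x : osset b K 0), rv b (mor_id 1))) rv_id odegen. Qed.

Lemma unohom_nat (K : sset) (p : smap (sprod (osset b K) (Delta 1)) (osset b Y)) m n (f : mor m n) (z : sprod K (Delta 1) n) :
  p m ((act f z).1 : osset b K m, rv b (act f z).2) = @act Y _ _ f (p n (z.1 : osset b K n, rv b z.2)).
Proof.
have E := smap_nat p (rv b f) (z.1 : osset b K n, rv b z.2 : Delta 1 n).
rewrite oactE rvK in E; rewrite -E; congr (p m (_, _)); last exact: (rv_comp b f z.2).
by rewrite [in RHS]oactE rvK.
Qed.

Definition unohom (K : sset) (p : smap (sprod (osset b K) (Delta 1)) (osset b Y)) : smap (sprod K (Delta 1)) Y :=
  @SMap (sprod K (Delta 1)) Y _ (@unohom_nat K p).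

Lemma unohomE (K : sset) (p : smap (sprod (osset b K) (Delta 1)) (osset b Y)) n (x : K n) c :
  unohom p n (x, mor_cst n c : Delta 1 n) = p n (x : osset b K n, mor_cst n (rvo b c)).
Proof. exact: (congr1 (fun j : Delta 1 n => p n (x : osset b K n, j)) (rv_cst b n c)). Qed.

Lemma unohom_at (K : sset) (p : smap (sprod (osset b K) (Delta 1)) (osset b Y)) (x : K 0) : comp_at (unohom p) x = comp_at p (x : osset b K 0).
Proof. by rewrite /comp_at -[LHS]/(p 1 (degen 1 x : osset b K 1, rv b (mor_id 1))) rv_id -(odegen b). Qed.

End OppositeHomotopy.

(** * Natural equivalences *)

Lemma functor_equiv_refl (X Y : sset) (F : smap X Y) : functor_equiv F F.
Proof.
exists (degen 1 (fun_vertex F)); split; [exact: edge_equiv_degen| |]; exact: vert_degen.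
Qed.

Lemma cat_equiv_iso (X Y : sset) (F : smap X Y) (G : smap Y X) :
  G \os F = sid X -> F \os G = sid Y -> cat_equiv F.
Proof. by move=> E1 E2; exists G; rewrite E1 E2; split; exact: functor_equiv_refl. Qed.

Lemma edge_equiv_inv (X : sset) (e : X 1) : edge_equiv e ->
  exists g, [/\ edge_equiv g, src g = tgt e & tgt g = src e].
Proof.
case=> g [H1 H2]; have [_ E1 _] := T_ends H1; have [_ E2 _] := T_ends H2.
by exists g; split=> //; exists e; rewrite -E1 E2.
Qed.

(** The direction is prescribed by b; for b = v1 an inverse edge in the functor category is used.
    Components are invertible because evaluation preserves invertible edges. *)
Lemma functor_equiv_hom b (X Y : sset) (F G : smap X Y) : functor_equiv F G ->
  exists p : smap (sprod X (Delta 1)) Y, [/\ forall n x, p n (x, mor_cst n b : Delta 1 n) = F n x,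
    forall n x, p n (x, mor_cst n (vop b) : Delta 1 n) = G n x & forall x, edge_equiv (comp_at p x)].
Proof.
have ev (e : Fun X Y 1) i (H : smap X Y) n (x : X n) : vert e i = fun_vertex H ->
    (e : smap (sprod X (Delta 1)) Y) n (x, mor_cst n i) = H n x.
  move=> E; have := congr1 (fun f : Fun X Y 0 => (f : smap (sprod X (Delta 0)) Y) n (x, mor_cst n ord0)) E.
  by rewrite /= => <-; congr (_ (_, _)); exact: mor_ext.
case=> e [ee es et]; case: (I2P b) => ->.
  exists e; split=> [n x|n x|x]; [exact: ev|exact: ev|].
  exact: (edge_equiv_map (fun_ev Y x) ee).
have [g [ge gs gt]] := edge_equiv_inv ee.
exists g; split=> [n x|n x|x].
- by apply: ev; rewrite -es -gt.
- by apply: ev; rewrite -et -gs.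
exact: (edge_equiv_map (fun_ev Y x) ge).
Qed.

(** * Adjunctions as families of coreflections *)

Section Adjunction.
Variables (b : 'I_2) (C : sset) (qC : infty_category C).

(** The data of an adjunction between C and a full subcategory, the inclusion being the left adjoint for b = v0
    and the right adjoint for b = v1. *)
Definition adj_data (A : C 0 -> Prop) (r : smap C (full A)) : Prop :=
  exists (M : sset) (q : smap M (Delta 1)) (hb : smap (full A) (fiber q b)) (hc : smap C (fiber q (vop b))),
  [/\ ocartesian_fibration b q, ocartesian_fibration (vop b) q, cat_equiv hb & cat_equiv hc] /\
  (exists s : smap (sprod (full A) (Delta 1)) M, [/\ q \os s = ssnd (full A) (Delta 1),
     forall n a, s n (a, mor_cst n (vop b) : Delta 1 n) = sval (hc n (sval a)),
     forall n a, s n (a, mor_cst n b : Delta 1 n) = sval (hb n a) & forall a, ocartesian_edge (vop b) q (comp_at s a)]) /\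
  oassociated hb hc r.

(** A natural transformation exhibiting r as the coreflection (b = v0) or the reflection (b = v1) onto A. *)
Definition corefl_trans (A : C 0 -> Prop) (r : smap C (full A)) (w : smap (sprod C (Delta 1)) C) : Prop :=
  [/\ forall n x, w n (x, mor_cst n (vop b) : Delta 1 n) = x, forall n x, w n (x, mor_cst n b : Delta 1 n) = sval (r n x)
    & forall x, @special (osset b C) A (comp_at w x)].

Lemma rvo_bb : rvo b b = v0. Proof. by case: (I2P b) => ->; exact: val_inj. Qed.
Lemma rvo_bvop : rvo b (vop b) = v1. Proof. by case: (I2P b) => ->; exact: val_inj. Qed.

(** The transfer applied in [osset b M]: [ka] consists of the edges defining r, and [et] of the
    edges of the other variance defining the inclusion. The homotopies of the equivalence [hc] are
    taken in opposite directions, [al] out of the identity and [be] into it. *)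
Lemma adj_trans (A : C 0 -> Prop) (r : smap C (full A)) : adj_data r -> exists w, corefl_trans r w.
Proof.
move=> [M [q [hb [hc [[fb fv _ [G [E1 E2]]] [[se [se1 se2 se3 se4]] [sk [sk1 sk2 sk3 sk4]]]]]]]].
have qM : infty_category M := inner_qcat Delta1_qcat fb.1.
have [p [p1 p0 pE]] := functor_equiv_hom (vop b) E1; rewrite vop_vop in p0.
(* Here [is_pullback] is a bound name for the homotopy from [hc G] to the identity of the fiber. *)
have [is_pullback [pb0 pb1 pbE]] := functor_equiv_hom b E2.
pose X := osset b C; pose Mo := osset b M.
pose AA : ssub X := osub b (full A); pose QQ : ssub Mo := osub b (fiber q (vop b)).
pose Q0 (m : Mo 0) := q 0 m = mor_cst 0 b; pose Q1 (m : Mo 0) := q 0 m = mor_cst 0 (vop b).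
have QQP n (x : Mo n) : smem QQ x <-> forall i, Q1 (vert x i).
  split=> [H i|H]; first by rewrite /Q1 overt /vert smap_nat (H : q n x = _); exact: mor_ext.
  apply: mor_ext => i; have := H (rvo b i); rewrite /Q1 overt rvoK /vert smap_nat => /(mor_eqE ord0) E.
  exact: E.
have AAP n (x : X n) : (forall i, A (vert x i)) -> smem AA x.
  by move=> H i; have := H (rvo b i); rewrite overt rvoK.
have rN m n (f : mor m n) (x : X n) : (r m (act f x) : AA m) = act f (r n x : AA n).
  by apply: sig_ext; exact: (congr1 sval (smap_nat r (rv b f) x)).
have hbN m n (f : mor m n) (x : AA n) : (sval (hb m (act f x)) : Mo m) = act f (sval (hb n x) : Mo n).
  have := congr1 sval (smap_nat hb (rv b f) (x : full A n)) => E; apply: etrans E.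
  by congr (sval (hb m _)); exact: sig_ext.
have hcN m n (f : mor m n) (x : X n) : (hc m (act f x) : QQ m) = act f (hc n x : QQ n).
  by apply: sig_ext; exact: (congr1 sval (smap_nat hc (rv b f) x)).
have GN m n (f : mor m n) (x : QQ n) : (G m (act f x) : X m) = act f (G n x : X n).
  by apply: etrans (smap_nat G (rv b f) (x : fiber q (vop b) n)); congr (G m _); exact: sig_ext.
pose r' : smap X AA := @SMap X AA (fun n x => r n x) rN.
pose h0' : smap AA Mo := @SMap AA Mo (fun n x => sval (hb n x)) hbN.
pose hq : smap X QQ := @SMap X QQ (fun n x => hc n x) hcN.
pose G' : smap QQ X := @SMap QQ X (fun n x => G n x) GN.
pose al := ohom b p.
pose be : smap (sprod QQ (Delta 1)) Mo := ohom_sub b (incl (fiber q (vop b)) \os is_pullback).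
pose ka := ohom b sk.
pose et : smap (sprod AA (Delta 1)) Mo := ohom_sub b se.
have al0 n x : al n (x, mor_cst n v0 : Delta 1 n) = x by rewrite ohomE rvo_b0 p0.
have al1 n x : al n (x, mor_cst n v1 : Delta 1 n) = G' n (hq n x) by rewrite ohomE rvo_b1 p1.
have alE x : edge_equiv (comp_at al x) by rewrite ohom_at; exact/edge_equiv_o/pE.
have be0 n y : be n (y, mor_cst n v0 : Delta 1 n) = (incl QQ \os hq) n (G' n y).
  by case: y => y Hy; rewrite ohom_subE rvo_b0 scompE pb0.
have be1 n y : be n (y, mor_cst n v1 : Delta 1 n) = sval y.
  by case: y => y Hy; rewrite ohom_subE rvo_b1 scompE pb1.
have beE y : edge_equiv (comp_at be y).
  case: y => y Hy; rewrite ohom_sub_at; apply: edge_equiv_o.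
  exact: (edge_equiv_map (incl (fiber q (vop b))) (pbE (exist _ y Hy))).
have ka0 n x : ka n (x, mor_cst n v0 : Delta 1 n) = h0' n (r' n x) by rewrite ohomE rvo_b0 sk3.
have ka1 n x : ka n (x, mor_cst n v1 : Delta 1 n) = (incl QQ \os hq) n x by rewrite ohomE rvo_b1 sk2.
have et0 n a : et n (a, mor_cst n v0 : Delta 1 n) = h0' n a.
  by case: a => a Ha; rewrite ohom_subE rvo_b0 se3.
have et1 n a : et n (a, mor_cst n v1 : Delta 1 n) = (incl QQ \os hq) n (sval a).
  by case: a => a Ha; rewrite ohom_subE rvo_b1 se2.
have etS a : @special (osset v1 Mo) Q1 (comp_at et a).
  case: a => a Ha; rewrite ohom_sub_at; apply: special_oo; apply: ocart_special; first exact: se4.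
  by rewrite /comp_at -[LHS]/((q \os se) 1 (degen 1 _, mor_id 1)) se1.
have kaS x : special Q0 (comp_at ka x).
  rewrite ohom_at; apply: ocart_special; first exact: sk4.
  by rewrite /comp_at -[LHS]/((q \os sk) 1 (degen 1 _, mor_id 1)) sk1.
have qX : infty_category X by exact: osset_qcat.
have qMo : infty_category Mo by exact: osset_qcat.
have [w [w1 w0 wT]] := @transfer_w X Mo qX qMo AA Q1 QQ QQP r' h0' hq G' al be ka et al0 al1 alE be0 be1 beE ka0 ka1 et0 et1 etS.
exists (unohom w); split=> [n x|n x|x].
- by rewrite unohomE rvo_bvop w1.
- by rewrite unohomE rvo_bb w0.
rewrite unohom_at; apply: (@transfer_special X Mo qX qMo A Q0 Q1 AA QQ AAP QQP h0' hq G' al et al0 al1 alE et0 et1 etS _ (r' 0 x) _ (comp_at ka x)) => //.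
- by move=> a; rewrite -[h0' 0 a]/(sval (hb 0 a)); exact: (svalP (hb 0 a)).
- by rewrite /src comp_vert w0.
Qed.

(** The identity of X is transported along the chosen coreflections, with nothing prescribed; the
    required special edge is the coreflection at the last vertex, for P = A. *)
Lemma corefl_trans_ex (A : C 0 -> Prop) : (forall c, @coreflected (osset b C) A c) -> exists r w, @corefl_trans A r w.
Proof.
move=> H; pose X := osset b C; have qX : infty_category X by exact: osset_qcat.
pose eps (c : X 0) : X 1 := sval (cid (H c)).
have epsP (c : X 0) : [/\ A (@src X (eps c)), @tgt X (eps c) = c & @special X A (eps c)] by rewrite /eps; case: cid.
have [||v|n x _|w [w1 [_ we]]] := @transport X qX X (empty X) (sid X)
  (@SMap (sprod (empty X) (Delta 1)) X (fun n z => False_rect _ (svalP z.1)) (fun _ _ _ z => False_ind _ (svalP z.1))) eps.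
- by move=> n [x []].
- by move=> [x []].
- by have [] := epsP v.
- by exists A; split=> [|i]; [have [] := epsP (vert x ord_max)|have [] := epsP (vert x i)].
have rA n (x : C n) : smem (full A) (unohom w n (x, mor_cst n b : Delta 1 n)).
  move=> i; rewrite /vert -smap_nat.
  have -> : act (mor_cst 0 i) ((x, mor_cst n b : Delta 1 n) : sprod C (Delta 1) n) = (act (mor_cst 0 i) x, mor_cst 0 b : Delta 1 0).
    by congr pair; exact: mor_ext.
  by rewrite unohomE rvo_bb -comp_vert /comp_at we; have [] := epsP (act (mor_cst 0 i) x).
have rN m n (f : mor m n) (x : C n) : exist (@smem _ (full A) m) _ (rA m (act f x)) = act f (exist (@smem _ (full A) n) _ (rA n x) : full A n).
  apply: sig_ext; apply: etrans (smap_nat (unohom w) f (x, mor_cst n b : Delta 1 n)); congr (unohom w m (_, _)); exact: mor_ext.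
exists (@SMap C (full A) _ rN), (unohom w); split=> [n x|n x|x] //.
- by rewrite unohomE rvo_bvop w1.
- by rewrite unohom_at /comp_at we; have [] := epsP x.
Qed.

End Adjunction.

(** * Adjunctions and gluing functors from chi *)

Section ChiTrans.
Variables (b : 'I_2) (C : sset) (qC : infty_category C) (S : 'I_2 -> C 0 -> Prop).
Let Ch := chi (S v0) (S v1).
Let pr := chi_proj (S v0) (S v1).

Lemma chi_map (K : sset) (w : smap (sprod K (Delta 1)) C) :
  (forall (x : K 0) c, S c (w 0 (x, mor_cst 0 c))) ->
  exists s : smap (sprod K (Delta 1)) Ch, forall n z, sval (s n z) = (z.2, w n z).
Proof.
move=> H; have pred n (z : sprod K (Delta 1) n) : chi_pred S (z.2 : mor n 1) (w n z).
  case: z => y j i; rewrite /vert -smap_nat; set c := (_, j).2 i.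
  have -> : @act (sprod K (Delta 1)) _ _ (mor_cst 0 i) (y, j) = (act (mor_cst 0 i) y, mor_cst 0 c); last exact: H.
  by congr pair; exact: mor_ext.
pose s n (z : sprod K (Delta 1) n) : Ch n := sval (cid (chi_intro (pred n z))).
have sE n z : sval (s n z) = (z.2, w n z) by exact: svalP (cid (chi_intro (pred n z))).
have sN m n (f : mor m n) z : s m (act f z) = act f (s n z).
  by apply: sig_ext; rewrite sE -[RHS]/(act f (sval (s n z)).1, act f (sval (s n z)).2) sE smap_nat.
by exists (@SMap (sprod K (Delta 1)) Ch s sN).
Qed.

Lemma in_chi_ex c : exists2 h : smap (full (S c)) (fiber pr c), in_chi h & exists g : smap (fiber pr c) (full (S c)), g \os h = sid _ /\ h \os g = sid _.
Proof.
have pred n (x : full (S c) n) : chi_pred S (mor_cst n c) (sval x) by move=> i; exact: (svalP x).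
pose s n (x : full (S c) n) : Ch n := sval (cid (chi_intro (pred n x))).
have sE n x : sval (s n x) = (mor_cst n c : Delta 1 n, sval x) by exact: svalP (cid (chi_intro (pred n x))).
have sF n x : smem (fiber pr c) (s n x) by exact: (congr1 fst (sE n x)).
have sN m n (f : mor m n) x : exist (@smem _ (fiber pr c) m) _ (sF m (act f x)) = act f (exist (@smem _ (fiber pr c) n) _ (sF n x) : fiber pr c n).
  apply: sig_ext; apply: sig_ext; rewrite [LHS]sE -[RHS]/(act f (sval (s n x)).1, act f (sval (s n x)).2) sE.
  by congr pair; exact: mor_ext.
exists (@SMap (full (S c)) (fiber pr c) _ sN); first by move=> n x; exact: sE.
have gS n (z : fiber pr c n) : smem (full (S c)) (sval (sval z)).2.
  move=> i; have := chi_elim (sval z) i; by rewrite -[(sval (sval z)).1]/(pr n (sval z)) (svalP z : pr n (sval z) = mor_cst n c).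
have gN m n (f : mor m n) z : exist (@smem _ (full (S c)) m) _ (gS m (act f z)) = act f (exist (@smem _ (full (S c)) n) _ (gS n z) : full (S c) n).
  exact: sig_ext.
exists (@SMap (fiber pr c) (full (S c)) _ gN); split; apply: smap_ext => n z; apply: sig_ext.
  by rewrite -[LHS]/((sval (s n z)).2) sE.
apply: sig_ext; rewrite [LHS]sE [RHS]chi_eta; congr pair; exact: esym (svalP z).
Qed.

Lemma trans_chi_fib (r : smap C (full (S b))) (w : smap (sprod C (Delta 1)) C) : corefl_trans b r w -> ocartesian_fibration b pr.
Proof.
case=> w1 w0 ws; apply: chi_fib => // c _; exists (comp_at w c); rewrite !comp_vert w0 w1; split=> //.
by have := svalP (r 0 c) ord0; rewrite vert0.
Qed.

Lemma trans_chi_assoc (r : smap C (full (S b))) (w : smap (sprod C (Delta 1)) C)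
    (hb : smap (full (S b)) (fiber pr b)) (hc : smap (full (S (vop b))) (fiber pr (vop b))) :
  corefl_trans b r w -> in_chi hb -> in_chi hc -> oassociated hb hc (r \os emb (S (vop b))).
Proof.
case=> w1 w0 ws hbE hcE.
apply: (@chi_assoc C S b hb hc _ (w \os sprod_map (emb (S (vop b))) (sid _)) (S b) hbE hcE) => //.
- by move=> n y; rewrite -[LHS]/(w n (sval y, mor_cst n (vop b))) w1.
- by move=> n y; rewrite -[LHS]/(w n (sval y, mor_cst n b)) w0.
- by move=> y; exact: (ws (sval y)).
Qed.

(** If the other subcategory is all of C, then chi itself is a correspondence for the adjunction: it
    is a fibration of one variance by the coreflections and of the other by identities, and the
    identities also classify the inclusion. *)
Lemma trans_adj (r : smap C (full (S b))) (w : smap (sprod C (Delta 1)) C) : (forall c, S (vop b) c) ->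
  corefl_trans b r w -> adj_data b r.
Proof.
move=> ST H; have [w1 w0 ws] := H.
have [hb hbE [gb [gb1 gb2]]] := in_chi_ex b; have [h hE [g [g1 g2]]] := in_chi_ex (vop b).
pose t : smap C (full (S (vop b))) := @sub_corestr _ _ (full (S (vop b))) (sid C) (fun n x i => ST _).
pose hc := h \os t.
have hcE n x : sval (sval (hc n x)) = (mor_cst n (vop b) : Delta 1 n, x) by exact: hE.
exists Ch, pr, hb, hc; split; [split|split].
- exact: trans_chi_fib H.
- apply: chi_fib => // c; rewrite vop_vop => Sc; exists (degen 1 c); rewrite !vert_degen; split=> //.
  have J : @special (osset (vop b) C) (fun=> True) (degen 1 c).
    apply: joyal; [exact: osset_qcat|exact/edge_equiv_o/edge_equiv_degen].
  exact: (@special_sub (osset (vop b) C) (fun=> True) (S (vop b)) (degen 1 c) (fun _ _ => I) J).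
- exact: cat_equiv_iso gb1 gb2.
- apply: (@cat_equiv_iso _ _ hc (emb (S (vop b)) \os g)).
    apply: smap_ext => n x; rewrite -[LHS]/(sval ((g \os h) n (t n x))) g1; by [].
  apply: smap_ext => n x; rewrite -[RHS]/(sid (fiber pr (vop b)) n x) -g2 -[LHS]/(h n (t n (sval (g n x)))).
  by congr (h n _); exact: sig_ext.
- have [|s sE] := @chi_map (full (S b)) (emb (S b) \os sfst _ _).
    move=> x c; case: (I2vP b c) => ->; last exact: ST.
    by have := svalP x ord0; rewrite vert0.
  exists s; split.
  + by apply: smap_ext => n z; rewrite -[LHS]/((sval (s n z)).1) sE.
  + by move=> n a; apply: sig_ext; rewrite sE hcE.
  + by move=> n a; apply: sig_ext; rewrite sE hbE.
  move=> a; apply: (@chi_cart C S (vop b) _ (fun=> True)) => //.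
  rewrite /comp_at sE; apply: joyal; first exact: osset_qcat.
  rewrite -[X in edge_equiv X]/(sval (degen 1 a)); apply: edge_equiv_o.
  exact: (edge_equiv_map (emb (S b)) (edge_equiv_degen a)).
have [|s sE] := @chi_map C w.
  move=> x c; case: (I2vP b c) => ->; last exact: ST.
  by rewrite w0; have := svalP (r 0 x) ord0; rewrite vert0.
exists s; split.
- by apply: smap_ext => n z; rewrite -[LHS]/((sval (s n z)).1) sE.
- by move=> n y; apply: sig_ext; rewrite sE [RHS]hcE w1.
- by move=> n y; apply: sig_ext; rewrite sE [RHS]hbE w0.
move=> y; apply: (@chi_cart C S b _ (S b)); rewrite ?sE //=; first exact: ws.
by move=> E; case: (vop_neq E).
Qed.

Lemma chi_fib_corefl : ocartesian_fibration b pr -> forall c, S (vop b) c -> @coreflected (osset b C) (S b) c.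
Proof.
case=> _ H c Sc; have [y yE] : exists y : Ch 0, sval y = (mor_cst 0 (vop b) : Delta 1 0, c).
  by apply: chi_intro => i; rewrite vert0.
have [|e [ce ee ey]] := H (mor_id 1) y.
  by rewrite -[LHS]/((sval y).1) yE; exact: mor_ext.
have eb i : S i (vert (sval e).2 i).
  by have := chi_elim e i; rewrite -[(sval e).1]/(pr 1 e) ee.
exists ((sval e).2 : osset b C 1); split.
- by rewrite /src overt rvo_b0; exact: eb.
- by rewrite /tgt overt rvo_b1 -[vert _ _]/((sval (vert e (vop b))).2) ey yE.
exact: (chi_cart_special ce ee).
Qed.

End ChiTrans.

(** * Zero objects and squares in the chosen orientation *)

Lemma edge_comp_flip b (C : sset) (f g h : C 1) : @edge_comp (osset (vop b) C) g f h -> @edge_comp (osset b C) f g h.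
Proof.
case=> s [s2 s0 s1]; exists s; rewrite /face !oactE in s2 s0 s1 *; split.
- by rewrite -s0; apply: (@act_eq C); case: (I2P b) => ->; mor_ord.
- by rewrite -s2; apply: (@act_eq C); case: (I2P b) => ->; mor_ord.
- by rewrite -s1; apply: (@act_eq C); case: (I2P b) => ->; mor_ord.
Qed.

Lemma overt_vop b (C : sset) (e : C 1) : @src (osset b C) e = @tgt (osset (vop b) C) e /\ @tgt (osset b C) e = @src (osset (vop b) C) e.
Proof. by rewrite /src /tgt !overt !rvo_b0 !rvo_b1 vop_vop. Qed.

(** Filling over Delta^0 gives an edge out of z, and filling the boundary of Delta^1 gives a
    triangle out of z. Both are cones with z behind, hence in the reversed orientation. *)
Lemma zero_zin b (C : sset) (z : C 0) : limit_cone (vop b) (empty (Delta 0)) (yoneda z) -> @initial_like (osset b C) z.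
Proof.
move=> H; pose Y := osset (vop b) C; split=> [x|f g h fz fg hz hg].
  have [||w [wb wf _]] := @final_fill (vop b) C z H 0 (from_bd0 _) (x : Y 0).
  - by move=> l g; have := bd0_empty g.
  - by move=> l g; have := bd0_empty g.
  pose e : Y 1 := w; have [E1 E2] := @overt_vop b C e; exists (e : osset b C 1); split.
    by apply: etrans E1 _; rewrite -wb /dback /tgt /vert; apply: (@act_eq Y); apply: mor_eqP => t; rewrite (ord1 t).
  by apply: etrans E2 _; rewrite -wf /dfront /src /vert; apply: (@act_eq Y); apply: mor_eqP => t; rewrite (ord1 t).
have [fs ft] := @overt_vop b C f; have [gs gt] := @overt_vop b C g; have [hs ht] := @overt_vop b C h.
have {}fz := etrans (esym fs) fz; have {}fg := etrans (etrans (esym ft) fg) gs.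
have {}hz := etrans (esym hs) hz; have {}hg := etrans (etrans (esym ht) hg) gt.
(* Reversal exchanges the ends of g, so h belongs to the vertex 0 of the front and f to the vertex
   1. *)
pose d (c : 'I_2) : dec 0 Y 0 := if c == v0 then h else f.
have bcst l (g' : boundary 1 l) : exists c, sval g' = mor_cst l c :> mor l 1.
  by case: g' => g' [i gi]; exists (vop i); apply: mor_ext => t; apply: I2_neq; exact: gi.
pose uf l (g' : boundary 1 l) : dec 0 Y l := act (mor_cst l ord0) (d ((sval g' : mor l 1) ord0)).
have uN k l (a : mor k l) (g' : boundary 1 l) : uf k (act a g') = act a (uf l g').
  have [c cE] := bcst l g'.
  have E : (sval (act a g') : mor k 1) ord0 = (sval g' : mor l 1) ord0 by rewrite -[sval (act a g')]/(mor_comp (sval g') a) cE.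
  by rewrite /uf E act_comp; apply: (@act_eq (dec 0 Y)); exact: mor_ext.
have dE (e : dec 0 Y 0) : dback e = @tgt Y e /\ dfront e = @src Y e.
  by split; rewrite /dback /dfront /tgt /src /vert; apply: (@act_eq Y); apply: mor_eqP => t; rewrite (ord1 t).
have [l g'|l g'|w [wb wf wu]] := @final_fill (vop b) C z H 1 (@SMap (boundary 1) (dec 0 Y) uf uN) (g : Y 1).
- rewrite [LHS]dback_act (dE _).1 /d; case: ifP => _; [exact: hz|exact: fz].
- have [c cE] := bcst l g'; rewrite [LHS]dfront_act (dE _).2 cE.
  have -> : @src Y (d (mor_cst l c ord0)) = vert (g : Y 1) c.
    by rewrite /d /=; case: (I2P c) => -> /=; [exact: hg|exact: fg].
  by rewrite /vert act_comp; apply: (@act_eq Y); exact: mor_ext.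
have wd c : @act (dec 0 Y) _ _ (mor_cst 0 c) w = d c.
  have gb : smem (boundary 1) (mor_cst 0 c : Delta 1 0) by exists (vop c) => t; exact: vop_neq.
  apply: etrans (esym (wu 0 (exist _ _ gb))) _; rewrite -[RHS]act_id; apply: (@act_eq (dec 0 Y)).
  by apply: mor_ext => t; exact: I1E.
apply: (@edge_comp_flip b C); exists (w : Y 2); split.
- rewrite -wf /dfront; apply: (@act_eq Y); mor_ord.
- by apply: etrans (wd v1); apply: (@act_eq Y); apply: (@jm_ext v0 0 0); mor_ord.
- by apply: etrans (wd v0); apply: (@act_eq Y); apply: (@jm_ext v0 0 0); mor_ord.
Qed.

Section Squares.
Variables (b : 'I_2) (C : sset) (s : smap Sq C).
Let X := osset b C.

(** The triangle for true passes through s01, the one for false through s10, the corner that is zero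
    in fiber and cofiber sequences. The apex is s00 for b = v0 and s11 for b = v1. *)
Definition halves (j : bool) : X 2 := s 2 (tri j).

Lemma halves_diag j : face (inord 1) (halves j) = s 1 (mor_id 1, mor_id 1).
Proof.
rewrite /face oactE -smap_nat; congr (s 1 _).
case: j; congr pair; apply: mor_eqP; move=> [[|[|//]] ?]; rewrite /= ?rvo_max /=;
  case: (I2P b) => -> /=; rewrite /bump ?inordK //.
Qed.

Lemma halves_vert j i : vert (halves j) i =
  s 0 (if j then corner (lo (rvo b i)) (hi (rvo b i)) else corner (hi (rvo b i)) (lo (rvo b i))).
Proof.
by rewrite overt /vert -smap_nat; congr (s 0 _); case: j; congr pair; exact: mor_ext.
Qed.

Lemma halves_apex : vert (halves true) ord0 = s 0 (corner b b).
Proof. by rewrite halves_vert; congr (s 0 _); congr corner; apply: val_inj; case: (I2P b) => ->. Qed.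

Lemma halves_mid j : src (face (inord 0) (halves j)) = s 0 (if j then corner v0 v1 else corner v1 v0).
Proof.
have -> : src (face (inord 0) (halves j)) = vert (halves j) (inord 1).
  by rewrite /src /vert /face act_comp; apply: act_eq; mor_ord.
rewrite halves_vert; have -> : rvo b (inord 1 : 'I_3) = inord 1 by apply: ord_inj; rewrite rvo_max inordK //; case: (I2P b) => ->.
by congr (s 0 _); case: j; congr corner; apply: ord_inj; rewrite /= inordK.
Qed.

Lemma halves_end j : tgt (face (inord 0) (halves j)) = s 0 (corner (vop b) (vop b)).
Proof.
have -> : tgt (face (inord 0) (halves j)) = vert (halves j) ord_max.
  by rewrite /tgt /vert /face act_comp; apply: act_eq; mor_ord.
by rewrite halves_vert; congr (s 0 _); case: j; congr corner; apply: val_inj; case: (I2P b) => ->.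
Qed.

Lemma pb_halves : limit_cone b (full (fun x : Sq 0 => x <> corner b b)) s -> is_pullback halves.
Proof.
move=> lim; split=> [|m u y ub yb uu yy uy]; first by rewrite !halves_diag.
have c0 : coface (ord0 : 'I_2) = mor_cst 0 v1 by rewrite -cface0 inord0.
have [||||j l g|w [w1 w2 w3 w4]] := pullback_lift lim (u := u) (y := y).
- exact: ub.
- by move=> j; rewrite yb inord0.
- exact: uu.
- by rewrite c0.
- by rewrite -uy inord0.
by exists w; split=> // j; rewrite inord0 w3.
Qed.

End Squares.

Lemma edge_of_square (C : sset) (s : smap Sq C) (d : smap (Delta 1) Sq) (e : C 1) : s \os d = yoneda e -> s 1 (d 1 (mor_id 1)) = e.
Proof. by move=> E; rewrite -[LHS]/((s \os d) 1 (mor_id 1)) E; exact: act_id. Qed.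

Lemma halves_right (C : sset) (s : smap Sq C) (e : C 1) : s \os right_edge = yoneda e -> face (inord 0) (halves v0 s true) = e.
Proof.
move=> /edge_of_square <-; rewrite /face oactE -smap_nat; congr (s 1 _); congr pair; first by mor_ord.
apply: mor_eqP; move=> [[|[|//]] ?]; rewrite /= /bump ?inordK //.
Qed.

Lemma halves_top (C : sset) (s : smap Sq C) (e : C 1) : s \os top_edge = yoneda e -> face (inord 0) (halves v1 s true) = e.
Proof.
move=> /edge_of_square <-; rewrite /face oactE -smap_nat; congr (s 1 _); congr pair; last by mor_ord.
apply: mor_eqP; move=> [[|[|//]] ?]; rewrite /= /bump ?inordK //.
Qed.

(** * Decompositions of stable categories *)

(** Essential surjectivity of [Fib]: the inverse functor assigns to c an arrow whose fiber is
    equivalent to c. *)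
Lemma SOD_fiber (C : sset) (A B : C 0 -> Prop) : SOD A B -> forall c, exists s : smap Sq C,
  [/\ fiber_sequence s, A (s 0 (corner v0 v1)), B (s 0 (corner v1 v1))
    & exists e : C 1, [/\ edge_equiv e, src e = s 0 (corner v0 v0) & tgt e = c]].
Proof.
case=> Phi [Psi [Pf Pr Pe]] [G [_ E]] c.
have [p [p0 p1 pE]] := functor_equiv_hom v0 E.
pose x := G 0 c; pose s := vertex_fun (Psi 0 x).
have sE (y : Sq 0) : s 0 y = fun_ev C y 0 (Psi 0 x).
  pose F : smap (sprod Sq (Delta 0)) C := Psi 0 x.
  rewrite -[LHS]/(F 0 (y, mor_cst 0 ord0)) -[RHS]/(F 0 (degen 0 y, mor_id 0)) degen0; congr (F 0 (_, _)).
  by apply: mor_ext => t; exact: I1E.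
have re (i : 'I_2) : s 0 (corner i v1) = fun_ev C (mor_cst 0 i : Delta 1 0) 0 (sval x).
  pose F : smap (sprod Sq (Delta 0)) C := Psi 0 x.
  rewrite -[sval x]/(incl (arrows A B) 0 x) -Pr -[LHS]/(F 0 (corner i v1, mor_cst 0 ord0)).
  rewrite -[RHS]/(F 0 (right_edge 0 (degen 0 (mor_cst 0 i : Delta 1 0)), mor_id 0)).
  have E1 : right_edge 0 (degen 0 (mor_cst 0 i : Delta 1 0)) = corner i v1.
    by rewrite degen0; apply: (congr1 (fun j : Delta 1 0 => (mor_cst 0 i : Delta 1 0, j))); exact: mor_ext.
  by rewrite E1; congr (F 0 (_, _)); apply: mor_ext => t; exact: I1E.
have [xA xB] := svalP x ord0; rewrite vert0 in xA xB.
exists s; split; [exact: Pf|by rewrite re|by rewrite re|].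
exists (comp_at p c); split; first exact: pE.
  by rewrite /src comp_vert p0 sE -Pe.
by rewrite /tgt comp_vert p1.
Qed.

Section Main.
Variables (C : sset) (hC : stable C).

Lemma st_qcat : infty_category C. Proof. by case: hC. Qed.

Lemma st_zero b (z : C 0) : zero_object z -> @initial_like (osset b C) z.
Proof. by case=> H1 H2; apply: zero_zin; case: (I2P b) => ->; [have -> : vop v0 = v1 by exact: val_inj|have -> : vop v1 = v0 by exact: val_inj]. Qed.

(** For b = v1 the edge is completed to a cofiber square, whose reversal is a pullback; closure
    under cofibers then plays the role of closure under fibers. *)
Lemma st_fib b (A : C 0 -> Prop) : stable_subcategory A -> forall h : osset b C 1, A (src h) -> A (tgt h) ->
  exists th, [/\ @is_pullback (osset b C) th, face (inord 0) (th true) = h, initial_like (src (face (inord 0) (th false))) & A (vert (th true) ord0)].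
Proof.
case=> _ Af Ac h; have [_ _ Ho Hs] := hC; case: (I2P b) h => -> h Ah Ah'.
  have [[s [[s1 s2] s3]] _] := Ho h; have E := halves_right s3.
  exists (halves v0 s); split=> //; first exact: pb_halves.
    by rewrite halves_mid; exact: st_zero.
  by rewrite halves_apex; apply: Af => //; [rewrite -(halves_mid v0 s true) E|rewrite -(halves_end v0 s true) E].
have [_ [s [[s1 s2] s3]]] := Ho h; have E := halves_top s3.
exists (halves v1 s); split=> //; first exact: pb_halves.
  by rewrite halves_mid; exact: st_zero.
by rewrite halves_apex; apply: Ac => //; [rewrite -(halves_end v1 s true) E|rewrite -(halves_mid v1 s true) E].
Qed.

Lemma st_Azero b (A : C 0 -> Prop) : stable_subcategory A -> exists2 z, A z & @initial_like (osset b C) z.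
Proof. by case=> -[z zz Az] _ _; exists z => //; exact: st_zero. Qed.

Lemma corefl_all_a (A B : C 0 -> Prop) : stable_subcategory A -> SOD A B ->
  (forall c, B c -> @coreflected (osset v0 C) A c) -> forall c, @coreflected (osset v0 C) A c.
Proof.
move=> hA hS HB c; have [s [[s1 s2] sA sB [e [ee es et]]]] := SOD_fiber hS c.
have qX : infty_category (osset v0 C) by exact/osset_qcat/st_qcat.
apply: hasfin_special.
have sp : @special (osset v0 C) (fun=> True) e by apply: joyal => //; exact: edge_equiv_o.
have := hasfin_equiv qX A sp.
have -> : @src (osset v0 C) e = vert (halves v0 s true) ord0 by rewrite halves_apex -es /src overt.
have -> : @tgt (osset v0 C) e = c by rewrite -et /tgt overt.
case=> H _; apply: H; apply: (corefl_fib qX (st_Azero v0 hA) (st_fib hA)).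
- exact: pb_halves.
- by rewrite halves_mid.
- by rewrite halves_mid; exact: st_zero.
- by rewrite halves_end; exact: HB.
Qed.

Lemma corefl_all_b (A B : C 0 -> Prop) : stable_subcategory B -> SOD A B ->
  (forall c, A c -> @coreflected (osset v1 C) B c) -> forall c, @coreflected (osset v1 C) B c.
Proof.
move=> hB hS HA c; have [_ [z zz] Ho Hs] := hC.
have qX : infty_category (osset v1 C) by exact/osset_qcat/st_qcat.
(* The fiber of an edge 0 -> c is a loop object of c, at the corner s00. *)
have [f [fz fc]] := (st_zero v0 zz).1 c.
have [[s [s1 s2]] _] := Ho f; have E := halves_right s2.
(* By stability the same square is a pushout and exhibits c as a suspension. *)
have [_ sP] := (Hs s s1.1).1 s1.
have s01 : s 0 (corner v0 v1) = z by rewrite -fz -E (halves_mid v0 s true).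
have s11 : s 0 (corner v1 v1) = c by rewrite -fc -E (halves_end v0 s true).
(* The loop object is the fiber of some a -> b; the square is also a pushout, so reversed it
   presents b as the fiber of an edge from a. *)
have [s' [s1' s'A s'B [e [ee es et]]]] := SOD_fiber hS (s 0 (corner v0 v0)).
have [_ sP'] := (Hs s' s1'.1).1 s1'.
(* The inverse is taken because passing to the opposite exchanges source and target. *)
have [g [ge gs gt]] := edge_equiv_inv ee.
have ap : vert (halves v1 s true) ord0 = c by rewrite halves_apex s11.
apply: hasfin_special; rewrite -ap.
apply: (corefl_loop qX (st_Azero v1 hB) (st_fib hB) (th := halves v1 s) (th' := halves v1 s') (e := (g : osset v1 C 1))).
- exact: pb_halves.
- exact: pb_halves.
- by rewrite halves_mid s01; exact: st_zero.
- by rewrite halves_mid; exact/st_zero/s1.1.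
- exact: edge_equiv_o.
- by rewrite halves_end /tgt overt -[rvo _ _]/(rvo v1 v1) rvo_v1 -/(src g) gs et.
- by rewrite halves_end /src overt rvo_v0 -/(tgt g) gt es.
- by rewrite halves_apex.
- by rewrite halves_mid; exact/st_zero/s1'.1.
- by rewrite halves_mid; exact: HA.
Qed.

End Main.

(** * The two equivalences and the gluing functors *)

Lemma adj_right (C : sset) (A : C 0 -> Prop) (r : smap C (full A)) : adjoint (emb A) r <-> @adj_data v0 C A r.
Proof.
split=> [[M [q [h0 [h1 [[f0 f1 e0 e1] [[s [s1 s2 s3 s4]] a0]]]]]]|[M [q [h0 [h1 [[f0 f1 e0 e1] [[s [s1 s2 s3 s4]] a0]]]]]]].
  exists M, q, h0, h1; split; [by split|split=> //]; exists s; split=> //.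
exists M, q, h0, h1; split; [by split|split=> //]; exists s; split=> //.
Qed.

Lemma adj_left (C : sset) (B : C 0 -> Prop) (l : smap C (full B)) : adjoint l (emb B) <-> @adj_data v1 C B l.
Proof.
split=> [[M [q [h0 [h1 [[f0 f1 e0 e1] [a0 [s [s1 s2 s3 s4]]]]]]]]|[M [q [h1 [h0 [[f0 f1 e0 e1] [[s [s1 s2 s3 s4]] a0]]]]]]].
  exists M, q, h1, h0; split; [by split|split=> //]; exists s; split=> //.
exists M, q, h0, h1; split; [by split|split=> //]; exists s; split=> //.
Qed.

Theorem proposition2p3p3 (C : sset) (hC : stable C) (A B : C 0 -> Prop)
    (hA : stable_subcategory A) (hB : stable_subcategory B)
    (hAB : SOD A B) :
  ((cartesian_SOD A B <-> right_admissible A) /\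
   (cartesian_SOD A B ->
    forall r : smap C (full A), adjoint (emb A) r ->
      cartesian_gluing_functor (r \os emb B)))
  /\
  ((cocartesian_SOD A B <-> left_admissible B) /\
   (cocartesian_SOD A B ->
    forall l : smap C (full B), adjoint l (emb B) ->
      cocartesian_gluing_functor (l \os emb A))).
Proof.
have qC := st_qcat hC.
(* [S] gives chi(A, B). In [S0] and [S1] the other subcategory is replaced by all of C, which turns
   chi into a correspondence for the adjunction. *)
pose S (c : 'I_2) := if c == v0 then A else B.
pose S0 (c : 'I_2) (x : C 0) := if c == v0 then A x else True.
pose S1 (c : 'I_2) (x : C 0) := if c == v0 then True else B x.
split; split.
- split=> [[_ fb]|[r /adj_right /(adj_trans qC) [w ww]]].
    have H := corefl_all_a hC hA hAB (@chi_fib_corefl v0 C S fb).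
    have [r [w ww]] := corefl_trans_ex qC H; exists r; apply/adj_right.
    exact: (@trans_adj v0 C qC S0 r w _ ww).
  by split=> //; exact: (@trans_chi_fib v0 C qC S r w ww).
- move=> ca r /adj_right /(adj_trans qC) [w ww]; split=> //.
  exact: (@trans_chi_assoc v0 C S r w (chi_in0 A B) (chi_in1 A B) ww (fun n x => erefl) (fun n x => erefl)).
- split=> [[_ fb]|[l /adj_left /(adj_trans qC) [w ww]]].
    have H := corefl_all_b hC hB hAB (@chi_fib_corefl v1 C S fb).
    have [l [w ww]] := corefl_trans_ex qC H; exists l; apply/adj_left.
    exact: (@trans_adj v1 C qC S1 l w _ ww).
  by split=> //; exact: (@trans_chi_fib v1 C qC S l w ww).
- move=> ca l /adj_left /(adj_trans qC) [w ww]; split=> //.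
  exact: (@trans_chi_assoc v1 C S l w (chi_in1 A B) (chi_in0 A B) ww (fun n x => erefl) (fun n x => erefl)).
Qed.
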